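(* Let $\nu\ge 0$ and consider the Navier-Stokes ($\nu>0$) or Euler ($\nu=0$) system on the unit sphere $\mathbb{S}^2\subset\mathbb{R}^3$. Let the (constant) controlled vector fields correspond to three linearly independent linear spherical harmonics $l^1,l^2,l^3$, one (nonzero) quadratic spherical harmonic $q$ and one (nonzero) cubic spherical harmonic $c$. Then this set of controlled vector fields is saturating, and, for every $T>0$, the Navier-Stokes/Euler system with forcing $v_1(t)l^1+v_2(t)l^2+v_3(t)l^3+v_4(t)q+v_5(t)c$ is time-$T$ globally controllable in projection onto every finite-dimensional subspace and time-$T$ $L_2$-approximately controllable.
   Context: The sphere $\mathbb{S}^2$ carries the Riemannian metric induced from $\mathbb{R}^3$ and the area form $\sigma$; $\Delta$ is the spherical Laplacian. A spherical harmonic of degree $s$ is the restriction to $\mathbb{S}^2$ of a harmonic homogeneous polynomial of degree $s$ on $\mathbb{R}^3$; it is an eigenfunction of $\Delta$ with eigenvalue $-s(s+1)$. Linear, quadratic, cubic mean $s=1,2,3$. Controlled system (vorticity form). All vorticities and stream functions have zero mean on $\mathbb{S}^2$, so that $\Delta^{-1}$ is well defined, and $H^2$, $L_2$ denote the corresponding spaces of zero-mean functions. With $\psi=\Delta^{-1}w$ the stream function, the velocity $u$ is the vector field determined by $\sigma(u,\cdot)=-d\psi$, and the Poisson bracket associated with $\sigma$ is normalized so that $L_uw=-\{\psi,w\}$. The system with controlled directions $f_1,\dots,f_r$ is $$\frac{\partial w}{\partial t}-\{\Delta^{-1}w,w\}-\nu\Delta w=\sum_{i=1}^r v_i(t)f_i(x),\qquad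 w|_{t=0}=\tilde\varphi\in H^2,$$ with controls $v_i$ arbitrary measurable essentially bounded real functions. The attainable set $\mathcal{A}^T_{\tilde\varphi}$ is the set of all values $w(T,\cdot)$ obtained with such controls on $[0,T]$. For a finite-dimensional subspace $\mathcal{L}\subset H^2$ let $\Pi^{\mathcal{L}}$ be the $L_2$-orthogonal projection onto $\mathcal{L}$. The system is time-$T$ globally controllable in projection onto $\mathcal{L}$ if $\Pi^{\mathcal{L}}(\mathcal{A}^T_{\tilde\varphi})=\mathcal{L}$ for each $\tilde\varphi\in H^2$. It is time-$T$ $L_2$-approximately controllable if $\mathcal{A}^T_{\tilde\varphi}$ is $L_2$-dense in $H^2$ for each $\tilde\varphi\in H^2$. Saturating. Put $\mathcal{B}(f,g)=\{g,\Delta^{-1}f\}+\{f,\Delta^{-1}g\}$. A function $f$ is a steady motion (of the Euler equation) if $\{f,\Delta^{-1}f\}=0$. For controlled directions $f_1,\dots,f_r$ that are steady motions, let $\mathcal{D}^1=\mathrm{span}\{f_1,\dots,f_r\}$ and $\mathcal{D}^{j+1}=\mathcal{D}^j+\mathrm{span}\,\mathcal{B}(\mathcal{S}^j,\mathcal{D}^j)$, where $\mathcal{S}^j\subseteq\mathcal{D}^j$ is the linear subspace spanned by the steady motions contained in $\mathcal{D}^j$. The set $\{f_1,\dots,f_r\}$ is saturating if $\bigcup_j\mathcal{D}^j$ is dense in $H^2$. *)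

(* Defs.v *)
From HB Require Import structures.
From mathcomp Require Import all_boot all_order all_algebra.
From mathcomp Require Import all_classical all_reals all_analysis.
From mathcomp Require Import measurable_realfun.
From mathcomp Require mpoly.

Set Implicit Arguments.
Unset Strict Implicit.
Unset Printing Implicit Defensive.
Import Order.TTheory GRing.Theory Num.Theory.
Import numFieldNormedType.Exports.

Local Open Scope classical_set_scope.
Local Open Scope ring_scope.

(** * The unit sphere and its area measure *)

Record S2 (R : realType) := MkS2 {
  s2val :> 'rV[R]_3 ;
  s2valP : \sum_i s2val 0 i ^+ 2 = 1 }.

(* Colatitude p.1, longitude p.2. *)
Definition sph_row (R : realType) (p : R * R) : 'rV[R]_3 :=
  \row_i nth 0 [:: sin p.1 * cos p.2; sin p.1 * sin p.2; cos p.1] i.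

Lemma sph_rowP (R : realType) (p : R * R) : \sum_i sph_row p 0 i ^+ 2 = 1.
Proof.
rewrite !big_ord_recl big_ord0 !mxE /= addr0 !exprMn addrA -mulrDr.
by rewrite cos2Dsin2 mulr1 addrC cos2Dsin2.
Qed.

Definition sph (R : realType) (p : R * R) : S2 R := MkS2 (sph_rowP p).

HB.instance Definition _ (R : realType) := gen_eqMixin (S2 R).
HB.instance Definition _ (R : realType) := gen_choiceMixin (S2 R).
HB.instance Definition _ (R : realType) :=
  isPointed.Build (S2 R) (sph (0, 0)).

(* Borel subsets of the sphere: the sigma-algebra generated by the three
   coordinate functions (same construction as for [n.-tuple R]). *)
Definition s2coord (R : realType) (i : 'I_3) (x : S2 R) : R :=
  s2val x 0 i.

Section s2_measurable.
Context (R : realType).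

Let s2_set0 : g_sigma_preimage (@s2coord R) set0.
Proof. exact: sigma_algebra0. Qed.

Let s2_setC A : g_sigma_preimage (@s2coord R) A ->
  g_sigma_preimage (@s2coord R) (~` A).
Proof. exact: sigma_algebraC. Qed.

Let s2_bigcup (F : _^nat) : (forall i, g_sigma_preimage (@s2coord R) (F i)) ->
  g_sigma_preimage (@s2coord R) (\bigcup_i (F i)).
Proof. exact: sigma_algebra_bigcup. Qed.

HB.instance Definition _ := @isMeasurable.Build default_measure_display
  (S2 R) (g_sigma_preimage (@s2coord R)) s2_set0 s2_setC s2_bigcup.

End s2_measurable.

Lemma measurable_sph (R : realType) :
  measurable_fun [set: R * R] (@sph R).
Proof.
apply: (@measurability _ _ _ _ setT (@sph R)
  (\big[setU/set0]_(i < 3) preimage_set_system setT (@s2coord R i) measurable)).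
  by [].
move=> _ [A + <-]; rewrite -bigcup_mkord_ord => -[i _ [B mB <-]].
rewrite setTI -comp_preimage setTI.
have ms : measurable_fun setT (@sin R).
  by apply: continuous_measurable_fun; exact: continuous_sin.
have mc : measurable_fun setT (@cos R).
  by apply: continuous_measurable_fun; exact: continuous_cos.
have ms1 : measurable_fun [set: R * R] (fun p => sin p.1) :=
  measurableT_comp ms measurable_fst.
have ms2 : measurable_fun [set: R * R] (fun p => sin p.2) :=
  measurableT_comp ms measurable_snd.
have mc1 : measurable_fun [set: R * R] (fun p => cos p.1) :=
  measurableT_comp mc measurable_fst.
have mc2 : measurable_fun [set: R * R] (fun p => cos p.2) :=
  measurableT_comp mc measurable_snd.
have m : measurable_fun [set: R * R]
    (s2coord (inord i) \o @sph R).
  move: (inord i) => {}i; case: i => -[|[|[|//]]] /= lti.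
  - rewrite [X in measurable_fun _ X](_ : _ = fun p => sin p.1 * cos p.2).
      exact: measurable_funM.
    by apply/funext => p; rewrite /s2coord /= mxE.
  - rewrite [X in measurable_fun _ X](_ : _ = fun p => sin p.1 * sin p.2).
      exact: measurable_funM.
    by apply/funext => p; rewrite /s2coord /= mxE.
  - rewrite [X in measurable_fun _ X](_ : _ = fun p => cos p.1) //.
    by apply/funext => p; rewrite /s2coord /= mxE.
by rewrite -[X in measurable X]setTI; exact: m.
Qed.

Section area.
Context (R : realType).
Local Open Scope ereal_scope.

Definition sph_rect : set (R * R) :=
  `[0%R, pi] `*` `[0%R, (2 * pi)%R].

Let lambda2 := (@lebesgue_measure R \x @lebesgue_measure R)%E.

(* The area form is sin(p.1) dp.1 /\ dp.2 in spherical coordinates. *)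
Definition area (A : set (S2 R)) : \bar R :=
  \int[lambda2]_(p in sph_rect `&` @sph R @^-1` A) (sin p.1)%:E.

Let area0 : area set0 = 0.
Proof. by rewrite /area preimage_set0 setI0 integral_set0. Qed.

Let area_ge0 A : 0 <= area A.
Proof.
apply: integral_ge0 => -[a b] [[/= + _] _].
rewrite in_itv /= => ab; rewrite lee_fin.
exact: sin_ge0_pi.
Qed.

Let m_rect : measurable sph_rect.
Proof. by apply: measurableX; exact: measurable_itv. Qed.

Let area_sigma_additive : semi_sigma_additive area.
Proof.
move=> F mF tF mUF; rewrite /area preimage_bigcup setI_bigcupr.
have mG n : measurable (sph_rect `&` @sph R @^-1` F n).
  apply: measurableI => //; rewrite -[X in measurable X]setTI.
  exact: measurable_sph.
rewrite ge0_integral_bigcup //.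
- by apply: is_cvg_nneseries => n _ _; exact: area_ge0.
- apply/measurable_EFinP; apply: measurable_funTS.
  apply: measurableT_comp; last exact: measurable_fst.
  by apply: continuous_measurable_fun; exact: continuous_sin.
- move=> -[a b] [n _ [[/= + _] _]].
  by rewrite in_itv /= lee_fin; exact: sin_ge0_pi.
- apply/trivIsetP => i j _ _ ij; rewrite setIACA -preimage_setI.
  by move/trivIsetP : tF => /(_ _ _ Logic.I Logic.I ij) ->; rewrite preimage_set0 setI0.
Qed.

HB.instance Definition _ := isMeasure.Build _ (S2 R) R
  area area0 area_ge0 area_sigma_additive.

End area.

(** * Function spaces and differential operators on the sphere

    Elements of the L_2 and Sobolev spaces are represented by measurable
    functions [S2 R -> R]; the operators and norms below depend only on their
    class modulo equality [area]-almost everywhere. *)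

Section spaces.
Context (R : realType).
Implicit Types (f g h psi w : S2 R -> R) (i j : 'I_3) (x : S2 R).

Definition L2 f : Prop := f \in Lfun (@area R) 2%:E.

Definition l2ip f g : R := \int[@area R]_x (f x * g x).

Definition l2norm f : R := Num.sqrt (l2ip f f).

Definition zero_mean f : Prop := \int[@area R]_x f x = 0.

Definition C1 (phi : 'rV[R]_3 -> R) : Prop :=
  (forall y, differentiable phi y) /\
  (forall i, continuous ('D_(delta_mx 0 i) phi)).

(* i-th component of the tangential part of the gradient of phi, that is, of
   the Riemannian gradient of its restriction to the sphere. *)
Definition tder i (phi : 'rV[R]_3 -> R) (x : S2 R) : R :=
  'D_(delta_mx 0 i) phi x -
  s2coord i x * \sum_j s2coord j x * 'D_(delta_mx 0 j) phi x.

(* Weak version of [tder]: the term with factor 2 is the curvature term in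
   the integration by parts formula on the sphere, whose mean curvature (the
   sum of the principal curvatures) is 2. *)
Definition is_wder i f g : Prop :=
  L2 g /\
  forall phi, C1 phi ->
    (\int[@area R]_x (f x * tder i phi x)) =
    2 * (\int[@area R]_x (s2coord i x * f x * phi x)) -
    (\int[@area R]_x (g x * phi x)).

Definition wder i f : S2 R -> R := xget 0 [set g | is_wder i f g].

Definition sobolev1 f : Prop := L2 f /\ forall i, exists g, is_wder i f g.

Definition sobolev2 f : Prop := sobolev1 f /\ forall i, sobolev1 (wder i f).

(* The space H^2 of zero-mean functions. *)
Definition H2 f : Prop := sobolev2 f /\ zero_mean f.

Definition H2norm f : R :=
  Num.sqrt (l2norm f ^+ 2 + \sum_i l2norm (wder i f) ^+ 2 +
            \sum_i \sum_j l2norm (wder j (wder i f)) ^+ 2).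

Definition grad f (x : S2 R) : 'rV[R]_3 := \row_i wder i f x.

(* Spherical Laplacian: surface divergence of the tangential gradient. *)
Definition lap f : S2 R -> R := \sum_i wder i (wder i f).

(* Delta^-1 w: the zero-mean solution psi of lap psi = w. *)
Definition invlap w : S2 R -> R :=
  xget 0 [set psi | H2 psi /\ lap psi = w %[ae @area R]].

(* With the outward orientation, sigma_x(a, b) = det(x, a, b) on tangent
   vectors; hence sigma(u, .) = - d f gives u = x \times grad f, and
   {f, g} = - L_u g = - det(x, grad f, grad g). *)
Definition poisson f g (x : S2 R) : R :=
  - \det (\matrix_(k < 3) nth 0 [:: s2val x; grad f x; grad g x] k).

(** * Spherical harmonics *)

Definition harmonic_poly (p : mpoly.mpoly 3 R) : Prop :=
  \sum_i mpoly.mderiv i (mpoly.mderiv i p) = 0.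

(* The first condition is [p \is s.-homog]; mpoly's notations cannot be
   imported together with those of mathcomp-analysis. *)
Definition spherical_harmonic (s : nat) f : Prop :=
  exists p : mpoly.mpoly 3 R,
    [/\ p \is mpoly.ishomog1 s (mpoly.mpoly_mdeg__canonical__mpoly_Measure 3),
        harmonic_poly p &
        forall x, f x = mpoly.meval (fun i => s2coord i x) p].

(** * Saturating sets *)

Definition lin_span (A : set (S2 R -> R)) : set (S2 R -> R) :=
  [set f | exists n (a : 'I_n -> R) (e : 'I_n -> S2 R -> R),
    (forall k, A (e k)) /\ f = \sum_k a k *: e k].

Definition steady f : Prop := poisson f (invlap f) = 0 %[ae @area R].

Definition Bform f g : S2 R -> R :=
  poisson g (invlap f) + poisson f (invlap g).

Definition steady_span (D : set (S2 R -> R)) : set (S2 R -> R) :=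
  lin_span (D `&` [set f | steady f]).

(* [saturation f j] is D^(j+1). *)
Fixpoint saturation (r : nat) (f : 'I_r -> S2 R -> R) (j : nat) :
    set (S2 R -> R) :=
  if j is j'.+1 then
    let D := saturation f j' in
    [set g + h | g in D &
      h in lin_span [set Bform a b | a in steady_span D & b in D]]
  else lin_span (range f).

Definition saturating (r : nat) (f : 'I_r -> S2 R -> R) : Prop :=
  [/\ forall k, steady (f k),
      forall j : nat, saturation f j `<=` [set g | H2 g] &
      forall g, H2 g -> forall eps : R, 0 < eps ->
        exists (j : nat) h, saturation f j h /\ H2norm (g - h) < eps].

(** * The controlled system *)

Definition admissible (T : R) (r : nat) (v : 'I_r -> R -> R) : Prop :=
  forall k, measurable_fun `[0, T] (v k) /\
    exists M : R, {ae @lebesgue_measure R, forall t : R, t \in `[0, T] ->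
      `|v k t| <= M}.

Definition rhs (nu : R) (r : nat) (f : 'I_r -> S2 R -> R) (v : 'I_r -> R -> R)
    (w : R -> S2 R -> R) (t : R) : S2 R -> R :=
  poisson (invlap (w t)) (w t) + nu *: lap (w t) + \sum_k v k t *: f k.

(* w belongs to C([0, T]; H^2), and the equation holds in integrated form
   w(t) = phi + \int_0^t rhs(s) ds as an identity between elements of L_2, the
   L_2-valued integral being expressed by duality. *)
Definition is_solution (nu T : R) (r : nat) (f : 'I_r -> S2 R -> R)
    (v : 'I_r -> R -> R) (phi : S2 R -> R) (w : R -> S2 R -> R) : Prop :=
  [/\ forall t : R, t \in `[0, T] -> H2 (w t),
      forall t : R, t \in `[0, T] ->
        H2norm (w s - w t) @[s --> within `[0, T] (nbhs t)] --> (0 : R),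
      w 0 = phi %[ae @area R] &
      forall t : R, t \in `[0, T] -> forall g, L2 g ->
        l2ip (w t) g =
        l2ip phi g + \int[@lebesgue_measure R]_(s in `[0, t])
                       l2ip (rhs nu f v w s) g].

Definition attainable (nu T : R) (r : nat) (f : 'I_r -> S2 R -> R)
    (phi : S2 R -> R) : set (S2 R -> R) :=
  [set h | exists (v : 'I_r -> R -> R) (w : R -> S2 R -> R),
    [/\ admissible T v, is_solution nu T f v phi w & h = w T]].

(* g is the L_2-orthogonal projection of h onto L. *)
Definition is_proj (L : set (S2 R -> R)) h g : Prop :=
  L g /\ forall e, L e -> l2ip (h - g) e = 0.

Definition controllable_in_projection (nu T : R) (r : nat)
    (f : 'I_r -> S2 R -> R) (L : set (S2 R -> R)) : Prop :=
  forall phi, H2 phi ->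
    [set g | exists2 h, attainable nu T f phi h & is_proj L h g] = L.

Definition approximately_controllable (nu T : R) (r : nat)
    (f : 'I_r -> S2 R -> R) : Prop :=
  forall phi, H2 phi ->
    forall g, H2 g -> forall eps : R, 0 < eps ->
      exists2 h, attainable nu T f phi h & l2norm (g - h) < eps.

Definition finite_dim_subspace (L : set (S2 R -> R)) : Prop :=
  (exists n (e : 'I_n -> S2 R -> R), L = lin_span (range e)) /\
  L `<=` [set g | H2 g].

Definition directions (l : 'I_3 -> S2 R -> R) (q c : S2 R -> R)
    (k : 'I_5) : S2 R -> R :=
  nth 0 (codom l ++ [:: q; c]) k.

End spaces.

(* Main.v *)
Require Import Defs.
From HB Require Import structures.
From mathcomp Require Import all_boot all_order all_algebra.
From mathcomp Require Import all_classical all_reals all_analysis.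
From mathcomp Require Import measurable_realfun.
From mathcomp Require Import ring lra zify.
From mathcomp Require Import -(notations) mpoly.

Set Implicit Arguments.
Unset Strict Implicit.
Unset Printing Implicit Defensive.
Import Order.TTheory GRing.Theory Num.Theory.
Import numFieldNormedType.Exports.

Local Open Scope classical_set_scope.
Local Open Scope ring_scope.

(** All estimates are made on Galerkin truncations to spherical polynomials,
 whose solutions converge in H^2 by the Bona-Smith argument. Jumping by [a h],
 [a] large, drifting for a time [a^-2] and jumping back by [-a h] adds
 {Delta^-1 h, h} up to a small error; for [h = f / s + s c g] with [f] steady
 and [s] small, this is a multiple of B(f, g). So the directions in which the
 system can be steered, approximately and in a Lipschitz way in a parameter,
 form a linear space stable under B(f, _) for each steady [f] in it. Bracketing
 with linear harmonics generates the rotations, under which harmonics of a given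
 degree form an irreducible space, and bracketing with q and c raises the
 degree: the space contains all harmonics. Exact controllability in
 projection follows from Lipschitz approximate steering by contraction. *)

(** The difference of two Euler flows loses a derivative, so H^2 offers no Lipschitz dependence on
    data or parameters. Lipschitz bounds are taken in the negative norm [N 1 (invl _)], in which the
    offending term cancels; this is enough, since a projection only pairs the endpoint with fixed
    functions of H^2. A steering error that is small and Lipschitz in the target coordinates makes
    the coordinate map a small Lipschitz perturbation of the identity, which a contraction can
    invert. The constants of a steering step do not depend on the truncation, and its amplification
    factor is fixed before its accuracy and duration, so that steps can be composed freely. Steps
    must act as translations also on smooth perturbations of the datum: this is what allows a step
    designed around 0 to be applied around any smooth state. The prescribed time is met exactly by
    waiting near 0 between two short phases. Polynomials are used modulo those vanishing on the
    sphere, with [pev p = pev q] as equality. *)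

Section area_integral.
Context (R : realType).
Notation leb := (@lebesgue_measure R).
Notation leb2 := (leb \x leb)%E.
Notation rect := (@sph_rect R).

(** * Integration over the sphere in spherical coordinates *)

Lemma measurable_sph_rect : measurable rect.
by apply: measurableX; exact: measurable_itv. Qed.
Lemma sin_rect_ge0 (p : R * R) : rect p -> 0 <= sin p.1.
by move=> [/= + _]; rewrite in_itv /= => ?; exact: sin_ge0_pi. Qed.
Lemma measurable_sin1 : measurable_fun setT (fun p : R * R => sin p.1).
apply: measurableT_comp; last exact: measurable_fst.
by apply: continuous_measurable_fun; exact: continuous_sin.
Qed.

Local Open Scope ereal_scope.

Lemma area_integral_indic A : measurable A ->
 \int[@area R]_x (\1_A x)%:E =
 \int[leb2]_(p in rect) ((\1_A (sph p))%:E * (sin p.1)%:E).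
move=> mA; rewrite integral_indic// setIT /=.
rewrite /area integral_mkcondr; apply: eq_integral => p _.
rewrite /= patchE indicE; case: ifPn => [|]; rewrite ?inE/= => hp.
 by rewrite mem_set// mul1e.
by rewrite memNset ?mul0e//; move: hp; rewrite notin_setE.
Qed.

Import HBNNSimple.

Lemma area_integral_nnsfun (f : {nnsfun S2 R >-> R}) :
 \int[@area R]_x (f x)%:E =
 \int[leb2]_(p in rect) ((f (sph p))%:E * (sin p.1)%:E).
have mr := measurable_sph_rect.
have ms : measurable_fun rect (fun p : R * R => (sin p.1)%:E).
 by apply/measurable_EFinP/measurable_funTS; exact: measurable_sin1.
under [LHS]eq_integral do rewrite fimfunE -fsumEFin//.
rewrite [LHS]ge0_integral_fsum//; last 2 first.
 - by move=> r; exact/measurable_EFinP/measurableT_comp.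
 - by move=> n x _; rewrite EFinM nnfun_muleindic_ge0.
have mi (r : R) : measurable_fun rect
  (fun p : R * R => (\1_(f @^-1` [set r]) (sph p))%:E).
 apply/measurable_EFinP/measurable_funTS.
 by apply: (measurableT_comp _ (@measurable_sph R)); exact: measurable_indic.
under [RHS]eq_integral.
 move=> p pD; rewrite fimfunE -fsumEFin// ge0_mule_fsuml; last first.
  by move=> r; rewrite EFinM nnfun_muleindic_ge0.
 over.
rewrite [RHS]ge0_integral_fsum//; last 2 first.
 - move=> r; apply: emeasurable_funM => //.
  by under eq_fun do rewrite EFinM; apply: emeasurable_funM => //; exact: mi.
 - move=> n p pD; rewrite EFinM mule_ge0// ?nnfun_muleindic_ge0//.
  by rewrite lee_fin; exact: sin_rect_ge0.
apply: eq_fsbigr => r _.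
under [LHS]eq_integral do rewrite EFinM.
rewrite integralZl_indic_nnsfun//= area_integral_indic//.
have [r0|r0] := leP 0%R r.
 rewrite -ge0_integralZl//=.
 - by apply: eq_integral => p _; rewrite EFinM muleA.
 - by apply: emeasurable_funM => //; exact: mi.
 - by move=> p rp; rewrite mule_ge0// lee_fin// sin_rect_ge0.
rewrite [in LHS]integral0_eq ?[in RHS]integral0_eq ?mule0//; move=> p _;
 rewrite preimage_nnfun0// indic0 ?mulr0 ?mul0e//.
Qed.

(** Monotone convergence is applied to the same increasing simple functions on both sides. *)
Lemma area_integral_ge0 (f : S2 R -> \bar R) :
 measurable_fun setT f -> (forall x, 0 <= f x) ->
 \int[@area R]_x f x = \int[leb2]_(p in rect) (f (sph p) * (sin p.1)%:E).
move=> mf f0.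
have mr := measurable_sph_rect.
have ms : measurable_fun rect (fun p : R * R => (sin p.1)%:E).
 by apply/measurable_EFinP/measurable_funTS; exact: measurable_sin1.
pose f_ := nnsfun_approx measurableT mf.
transitivity (limn (fun n => \int[@area R]_x (f_ n x)%:E)).
 rewrite -monotone_convergence//=.
 - apply: eq_integral => ? /[!inE] xD; apply/esym/cvg_lim => //=.
  exact: cvg_nnsfun_approx.
 - by move=> n; exact/measurable_EFinP/measurable_funTS.
 - by move=> n ? _; rewrite lee_fin.
 - by move=> ? _ ? ? mn; rewrite lee_fin; exact/lefP/nd_nnsfun_approx.
transitivity (limn (fun n =>
  \int[leb2]_(p in rect) ((f_ n (sph p))%:E * (sin p.1)%:E))).
 by congr (limn _); apply/funext => n; exact: area_integral_nnsfun.
rewrite -monotone_convergence//=.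
- apply: eq_integral => p; rewrite inE => pD; apply/cvg_lim => //=.
 apply: cvgeZr => //; apply: cvg_nnsfun_approx => //.
- move=> n; apply: emeasurable_funM => //.
 apply/measurable_EFinP/measurable_funTS.
 by apply: (measurableT_comp _ (@measurable_sph R)).
- by move=> n p pD; rewrite mule_ge0// lee_fin// sin_rect_ge0.
- move=> p pD m n mn; rewrite lee_wpmul2r// lee_fin ?sin_rect_ge0//.
 exact/lefP/nd_nnsfun_approx.
Qed.

Lemma area_integralE (f : S2 R -> R) : measurable_fun setT f ->
 \int[@area R]_x (f x)%:E =
 \int[leb2]_(p in rect) (f (sph p) * sin p.1)%:E.
move=> mf; rewrite integralE [RHS]integralE.
rewrite !area_integral_ge0//; last 2 first.
 by apply: measurable_funeneg; exact/measurable_EFinP.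
 by apply: measurable_funepos; exact/measurable_EFinP.
congr (_ - _); apply: eq_integral => p; rewrite inE => /sin_rect_ge0 s0.
- by rewrite !funeposE -!EFin_max -EFinM maxr_pMl// mul0r.
- by rewrite !funenegE -!EFinN -!EFin_max -EFinM maxr_pMl// mul0r mulNr.
Qed.

End area_integral.

(** * Measurability and boundedness of continuous functions on the sphere *)

Section measurable_coordinates.
Context (R : realType).

(** Only the coordinates of [g] are known to be measurable, so the open set [c < phi] is written as
    a countable union of rational boxes, whose preimages are measurable coordinate by coordinate. *)
Lemma measurable_continuous_row d (T : measurableType d) (g : T -> 'rV[R]_3)
  (phi : 'rV[R]_3 -> R) :
 (forall i, measurable_fun setT (fun x => g x 0 i)) -> continuous phi ->
 measurable_fun setT (phi \o g).
move=> mg cphi _; apply: (measurability _ (RGenOInfty.measurableE R)) => //.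
move=> _ [_ [c ->] <-]; rewrite setTI.
pose box (k : (rat * rat * rat) * nat) : set 'rV[R]_3 :=
 [set y | `|y 0 0 - ratr k.1.1.1| < k.2.+1%:R^-1 /\
      `|y 0 1 - ratr k.1.1.2| < k.2.+1%:R^-1 /\
      `|y 0 2 - ratr k.1.2| < k.2.+1%:R^-1].
pose U := [set y | c < phi y].
(* Boxes not contained in [U] contribute the empty set, which leaves a union over a countable
   type. *)
pose F k := if `[< box k `<=` U >] then g @^-1` box k else set0.
have -> : (phi \o g) @^-1` `]c, +oo[ = \bigcup_k F k.
 apply/seteqP; split=> x; last first.
  move=> [k _]; rewrite /F; case: asboolP => // bU /bU.
  by rewrite /U /= in_itv /= andbT.
 rewrite /= in_itv/= andbT => cx.
 have /cvgrPdist_lt /(_ (phi (g x) - c)) := cphi (g x).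
 rewrite subr_gt0 => /(_ cx) /nbhs_ballP[e /= e0 He].
 have [n ne] : exists n, n.+1%:R^-1 < e / 2.
  have e20 : 0 < e / 2 by rewrite divr_gt0.
  by have [n] := ltr_add_invr e20; rewrite add0r; exists n.
 have [q0 q1 q2] : [/\ exists q : rat, `|g x 0 0 - ratr q| < n.+1%:R^-1,
   exists q : rat, `|g x 0 1 - ratr q| < n.+1%:R^-1 &
   exists q : rat, `|g x 0 2 - ratr q| < n.+1%:R^-1].
  have H (t : R) : exists q : rat, `|t - ratr q| < n.+1%:R^-1.
   have : t - n.+1%:R^-1 < t + n.+1%:R^-1.
    by rewrite ltrBlDr -addrA ltrDl addr_gt0.
   move=> /rat_in_itvoo[q]; rewrite in_itv /= => /andP[q1 q2].
   by exists q; rewrite ltr_distlC q1 q2.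
  by split; exact: H.
 case: q0 q1 q2 => q0 h0 [q1 h1] [q2 h2].
 have close (t s q : R) : `|s - q| < n.+1%:R^-1 -> `|t - q| < n.+1%:R^-1 ->
   `|t - s| < e.
  move=> h1' h2'; rewrite -(subrKA q) (le_lt_trans (ler_normD _ _))//.
  rewrite (splitr e) ltrD//; first exact: lt_trans ne.
  by rewrite distrC; exact: lt_trans ne.
 exists (q0, q1, q2, n) => //; rewrite /F; case: asboolP; last first.
  move=> []; move=> y [/= k0 [k1 k2]].
  have := He y; rewrite /U /=.
  suff : ball (g x) e y.
   by move=> /[swap] /[apply]; rewrite /= ltr_distlC => /andP[]; lra.
  split=> // i j; rewrite ord1; case: j => -[|[|[|//]]] lj /=.
  - rewrite (_ : Ordinal lj = 0); last exact/val_inj.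
   exact: close k0 h0.
  - rewrite (_ : Ordinal lj = 1); last exact/val_inj.
   exact: close k1 h1.
  - rewrite (_ : Ordinal lj = 2); last exact/val_inj.
   exact: close k2 h2.
 by move=> _; split.
apply: countable_bigcupT_measurable => [|k]; first exact: countableP.
rewrite /F; case: asboolP => // _.
have mi (i : 'I_3) (q : R) (e : R) : measurable [set x | `|g x 0 i - q| < e].
 rewrite -[X in measurable X]setTI.
 have -> : [set x | `|g x 0 i - q| < e] = (fun x => `|g x 0 i - q|) @^-1` `]-oo, e[.
  by apply/seteqP; split=> x /=; rewrite in_itv.
 apply: (_ : measurable_fun setT (fun x => `|g x 0 i - q|)) => //.
 apply: measurableT_comp => //.
 apply: (measurable_funB (mg i)); exact: measurable_cst.
rewrite (_ : g @^-1` box k = [set x | `|g x 0 0 - ratr k.1.1.1| < k.2.+1%:R^-1] `&`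
  ([set x | `|g x 0 1 - ratr k.1.1.2| < k.2.+1%:R^-1] `&`
  [set x | `|g x 0 2 - ratr k.1.2| < k.2.+1%:R^-1])); last by [].
by do ! apply: measurableI.
Qed.

Lemma measurable_s2coord i : measurable_fun setT (@s2coord R i).
move=> _ B mB; rewrite setTI; apply: sub_sigma_algebra.
by rewrite -bigcup_mkord_ord; exists (nat_of_ord i) => //=;
 rewrite inord_val; exists B => //; rewrite setTI.
Qed.

Lemma measurable_continuous_S2 (phi : 'rV[R]_3 -> R) :
 continuous phi -> measurable_fun setT (fun x : S2 R => phi x).
by apply: measurable_continuous_row => i; exact: measurable_s2coord. Qed.

Lemma measurable_continuous_sph (phi : 'rV[R]_3 -> R) :
 continuous phi -> measurable_fun setT (fun p : R * R => phi (sph p)).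
move=> cphi; apply: (measurableT_comp (measurable_continuous_S2 cphi)).
exact: measurable_sph.
Qed.

Lemma s2coord_le1 (x : S2 R) i : `|s2coord i x| <= 1.
rewrite -(@ler_pXn2r _ 2)// ?nnegrE// expr1n real_normK ?num_real//.
have <- := Defs.s2valP x; rewrite (bigD1 i)//= lerDl.
by apply: sumr_ge0 => j _; exact: sqr_ge0.
Qed.

(** The sphere lies in the compact cube [A], on which [|phi|] attains a maximum. *)
Lemma continuous_bounded_S2 (phi : 'rV[R]_3 -> R) : continuous phi ->
 exists M, forall x : S2 R, `|phi x| <= M.
move=> cphi.
pose A := [set v : 'rV[R]_3 | forall i, `[-1, 1]%classic (v 0 i)].
have cA : compact A.
 have := @rV_compact R 3 (fun=> [set` `[-1 : R, 1]]) (fun=> @segment_compact R (-1) 1).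
 exact.
have SA (x : S2 R) : A x.
 by move=> i /=; have := s2coord_le1 x i; rewrite in_itv/= ler_norml.
have A0 : A !=set0 by exists (point : S2 R); exact: SA.
have cn : continuous (fun y => `|phi y|).
 by move=> y; apply: continuous_comp; [exact: cphi|exact: norm_continuous].
have [c _ hc] := EVT_max_rV A0 cA (fun y => @continuous_subspaceT _ _ A _ cn y).
by exists `|phi c| => x; apply: hc; rewrite inE; exact: SA.
Qed.

End measurable_coordinates.

(** * Fubini and the fundamental theorem of calculus in coordinates *)

Section divergence.
Context (R : realType).
Notation leb := (@lebesgue_measure R).
Notation leb2 := (leb \x leb)%E.
Notation rect := (@sph_rect R).

Lemma sph_rect_fin : (leb2 rect < +oo)%E.
rewrite product_measure1E; try exact: measurable_itv.
by rewrite lte_mul_pinfty//;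
 rewrite /= lebesgue_measure_itv/=; case: ifPn; rewrite ?ltry.
Qed.

Lemma area_fin : (@area R setT < +oo)%E.
rewrite /area setIT.
apply: (@le_lt_trans _ _ (\int[leb2]_(p in rect) 1%:E)%E).
 apply: ge0_le_integral => //=.
 - exact: measurable_sph_rect.
 - by move=> p /sin_rect_ge0.
 - by apply/measurable_EFinP/measurable_funTS; exact: measurable_sin1.
 - by move=> p; rewrite lee_fin.
rewrite integral_cst; last exact: measurable_sph_rect.
by rewrite mul1e; exact: sph_rect_fin.
Qed.

Lemma bounded_integrable_area (f : S2 R -> R) M : measurable_fun setT f ->
 (forall x, `|f x| <= M) -> (@area R).-integrable setT (EFin \o f).
move=> mf fM; apply: measurable_bounded_integrable => //; first exact: area_fin.
by exists M; split; [exact: num_real|move=> N MN x _; apply: le_trans (ltW MN)].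
Qed.

Lemma bounded_integrable_rect (G : R * R -> R) M : measurable_fun setT G ->
 (forall p, `|G p| <= M) -> leb2.-integrable rect (EFin \o G).
move=> mf fM; apply: measurable_bounded_integrable => //.
- exact: measurable_sph_rect.
- exact: sph_rect_fin.
- exact: measurable_funTS.
by exists M; split; [exact: num_real|move=> N MN x _; apply: le_trans (ltW MN)].
Qed.

(** Meant for integrands that are exact derivatives in the colatitude; the next lemma is the
    counterpart for the longitude. *)
Lemma integral_rect_fubini1 (G : R * R -> R) M : measurable_fun setT G ->
 (forall p, `|G p| <= M) ->
 (forall b, \int[leb]_(a in `[0%R, pi]) (G (a, b))%:E = 0)%E ->
 (\int[leb2]_(p in rect) (G p)%:E = 0)%E.
move=> mG GM G0.
have iG := bounded_integrable_rect mG GM.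
rewrite integral_mkcond /= -integral21_prod_meas1; last first.
 exact: (@integrable_mkcond _ _ _ leb2 rect (EFin \o G) (@measurable_sph_rect R)).1.
apply: integral0_eq => b _; rewrite /fubini_G.
have [hb|hb] := boolP (b \in `[0, 2 * pi]).
 rewrite -[RHS](G0 b) [RHS]integral_mkcond; apply: eq_integral => a _.
 congr (if _ then _ else _); apply/idP/idP; rewrite !inE/=.
  by case.
 by [].
apply: integral0_eq => a; rewrite patchE memNset// => -[_ /=].
by apply/negP.
Qed.

Lemma integral_rect_fubini2 (G : R * R -> R) M : measurable_fun setT G ->
 (forall p, `|G p| <= M) ->
 (forall a, \int[leb]_(b in `[0%R, (2 * pi)%R]) (G (a, b))%:E = 0)%E ->
 (\int[leb2]_(p in rect) (G p)%:E = 0)%E.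
move=> mG GM G0.
have iG := bounded_integrable_rect mG GM.
rewrite integral_mkcond /= -integral12_prod_meas1; last first.
 exact: (@integrable_mkcond _ _ _ leb2 rect (EFin \o G) (@measurable_sph_rect R)).1.
apply: integral0_eq => a _; rewrite /fubini_F.
have [ha|ha] := boolP (a \in `[0, pi]).
 rewrite -[RHS](G0 a) [RHS]integral_mkcond; apply: eq_integral => b _.
 congr (if _ then _ else _); apply/idP/idP; rewrite !inE/=.
  by case.
 by [].
apply: integral0_eq => b; rewrite patchE memNset// => -[/= + _].
by apply/negP.
Qed.

Lemma integral_is_derive (F f : R -> R) (a b : R) : a < b ->
 (forall t, is_derive t (1 : R) F (f t)) -> continuous f ->
 (\int[leb]_(x in `[a, b]) (f x)%:E = (F b - F a)%:E)%E.
move=> ab dF cf.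
have cF t : {for t, continuous F}.
 by apply: differentiable_continuous; apply/derivable1_diffP.
rewrite (@continuous_FTC2 _ f F)//.
- exact: continuous_subspaceT.
- split; first by [].
 + by apply: cvg_at_right_filter; exact: cF.
 + by apply: cvg_at_left_filter; exact: cF.
- by move=> t; rewrite derive1E; case: (dF t).
Qed.

Lemma is_derive_row (phi : 'rV[R]_3 -> R) (g : R -> 'rV[R]_3) (t : R)
  (dg : 'I_3 -> R) :
 differentiable phi (g t) ->
 (forall i, is_derive t (1 : R) (fun s => g s 0 i) (dg i)) ->
 is_derive t (1 : R) (phi \o g) (\sum_i dg i * 'D_(delta_mx 0 i) phi (g t)).
move=> dphi dgi.
have Dg : derivable g t 1.
 by apply/derivable_mxP => j; rewrite ord1.
have dif := Dg; move/derivable1_diffP in dif.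
have dc : differentiable (phi \o g) t by exact: differentiable_comp.
apply: DeriveDef; first exact/derivable1_diffP.
rewrite deriveE// diff_comp//= (_ : 'd g t 1 = 'D_1 g t); last by rewrite deriveE.
rewrite (derive_mx Dg).
set v := (X in 'd phi _ X); have -> : v = \sum_i dg i *: delta_mx 0 i; last first.
 by rewrite linear_sum; apply: eq_bigr => i; rewrite linearZ/= deriveE.
rewrite [LHS]row_sum_delta /v; apply: eq_bigr => i _; rewrite mxE.
by case: (dgi i) => _ ->.
Qed.

Lemma continuous_sph_row (T : topologicalType) (f1 f2 : T -> R) : continuous f1 -> continuous f2 ->
 continuous (fun t => sph_row (f1 t, f2 t)).
move=> c1 c2.
have c (g : R -> R) (f : T -> R) : continuous g -> continuous f -> continuous (g \o f).
 by move=> cg cf t; apply: continuous_comp; [exact: cf|exact: cg].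
have -> : (fun t => sph_row (f1 t, f2 t)) = fun t =>
  (sin (f1 t) * cos (f2 t)) *: delta_mx 0 0 +
  ((sin (f1 t) * sin (f2 t)) *: delta_mx 0 1 + cos (f1 t) *: delta_mx 0 2).
 apply/funext => t; apply/rowP => -[[|[|[|//]]] li]; rewrite !mxE/=;
 by rewrite !(mulr0, mulr1, addr0, add0r).
have cs1 := c _ _ (@continuous_sin R) c1; have cs2 := c _ _ (@continuous_sin R) c2.
have cc1 := c _ _ (@continuous_cos R) c1; have cc2 := c _ _ (@continuous_cos R) c2.
move=> t; apply: cvgD; [|apply: cvgD].
- by apply: cvgZr_tmp; apply: cvgM; [exact: cs1|exact: cc2].
- by apply: cvgZr_tmp; apply: cvgM; [exact: cs1|exact: cs2].
- by apply: cvgZr_tmp; exact: cc1.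
Qed.

End divergence.

(** * Polynomials in three variables *)

Definition e0 : 'I_3 := @Ordinal 3 0 isT.
Definition e1 : 'I_3 := @Ordinal 3 1 isT.
Definition e2 : 'I_3 := @Ordinal 3 2 isT.

Lemma ord3 (P : 'I_3 -> Prop) : P e0 -> P e1 -> P e2 -> forall i, P i.
move=> P0 P1 P2 [[|[|[|//]]] li].
- by rewrite (_ : Ordinal li = e0)//; exact/val_inj.
- by rewrite (_ : Ordinal li = e1)//; exact/val_inj.
- by rewrite (_ : Ordinal li = e2)//; exact/val_inj.
Qed.

Lemma sum3 (V : nmodType) (F : 'I_3 -> V) : \sum_i F i = F e0 + F e1 + F e2.
rewrite !big_ord_recl big_ord0 addr0 addrA.
by congr (F _ + F _ + F _); exact/val_inj.
Qed.

(* What is used of the algebra of polynomials in three variables. Working in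
  an opaque model keeps conversion from unfolding polynomial arithmetic. *)
Record poly_model (R : realType) := PolyModel {
 pcar :> comAlgType R ;
 mX : 'I_3 -> pcar ;
 mD : 'I_3 -> pcar -> pcar ;
 mev : pcar -> 'rV[R]_3 -> R ;
 mD_linear : forall i a p q, mD i (a *: p + q) = a *: mD i p + mD i q ;
 mD_mul : forall i p q, mD i (p * q) = mD i p * q + p * mD i q ;
 mD_comm : forall i j p, mD i (mD j p) = mD j (mD i p) ;
 mD_X : forall i j, mD i (mX j) = (i == j)%:R ;
 mev_linear : forall a p q y, mev (a *: p + q) y = a * mev p y + mev q y ;
 mev_mul : forall p q y, mev (p * q) y = mev p y * mev q y ;
 mev1 : forall y, mev 1 y = 1 ;
 mev_X : forall i y, mev (mX i) y = y 0 i ;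
 mev_diff : forall p y, differentiable (mev p) y ;
 mev_D : forall p i y, 'D_(delta_mx 0 i) (mev p) y = mev (mD i p) y ;
 m_ind : forall P : pcar -> Prop,
  (forall a b c, P (mX e0 ^+ a * mX e1 ^+ b * mX e2 ^+ c)) ->
  (forall a p q, P p -> P q -> P (a *: p + q)) -> forall p, P p ;
 m_harm : forall s f, spherical_harmonic s f ->
  exists p, [/\ forall x : S2 R, f x = mev p x,
   \sum_i mX i * mD i p = s%:R *: p & \sum_i mD i (mD i p) = 0] }.

Section mpoly_model.
Context (R : realType).
Notation mp := (mpoly 3 R).

Lemma mpoly_D_X (i j : 'I_3) : mderiv i (mpolyX R (mnm1 j)) = (i == j)%:R.
rewrite mderivX mnm1E eq_sym; case: eqP => [->|_]; last by rewrite scale0r.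
rewrite scale1r (_ : _ _ = mnm0) ?mpolyX0//.
by apply/mnmP => k; rewrite mnmBE subnn mnm0E.
Qed.

Definition mpoly_ev (p : mp) (y : 'rV[R]_3) : R := meval (fun i => y 0 i) p.

Lemma mpolyX_mon (m : multinom 3) : mpolyX R m =
 mpolyX R (mnm1 e0) ^+ m e0 * mpolyX R (mnm1 e1) ^+ m e1 *
 mpolyX R (mnm1 e2) ^+ m e2.
rewrite !mpolyXn -!mpolyXD; congr mpolyX; apply/mnmP.
by apply: ord3; rewrite !(mnmDE, mulmnE, mnm1E) !(mul0n, mul1n, addn0, add0n).
Qed.

Lemma mpoly_model_ind (P : mp -> Prop) :
 (forall a b c, P (mpolyX R (mnm1 e0) ^+ a * mpolyX R (mnm1 e1) ^+ b *
  mpolyX R (mnm1 e2) ^+ c)) ->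
 (forall a p q, P p -> P q -> P (a *: p + q)) -> forall p, P p.
move=> Pm Pl p.
have P1 m : P (mpolyX R m) by rewrite mpolyX_mon.
have P0 : P 0.
 by have := Pl (-1) _ _ (P1 mnm0) (P1 mnm0); rewrite scaleN1r addNr.
rewrite [p]mpolyE; elim: (msupp p) => [|m s IH]; first by rewrite big_nil.
by rewrite big_cons; exact: Pl.
Qed.

Lemma mpoly_ev_linear a (p q : mp) y :
 mpoly_ev (a *: p + q) y = a * mpoly_ev p y + mpoly_ev q y.
by rewrite /mpoly_ev mevalD mevalZ. Qed.

Lemma mpoly_ev_mul (p q : mp) y : mpoly_ev (p * q) y = mpoly_ev p y * mpoly_ev q y.
by rewrite /mpoly_ev mevalM. Qed.
Lemma mpoly_ev_X i y : mpoly_ev (mpolyX R (mnm1 i)) y = y 0 i.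
by rewrite /mpoly_ev mevalXU. Qed.
(** Differentiability and the value of the derivative are proved together, because the product rule
    uses both in the induction over monomials. *)
Lemma mpoly_ev_diff_D (p : mp) y : differentiable (mpoly_ev p) y /\
 forall i, 'D_(delta_mx 0 i) (mpoly_ev p) y = mpoly_ev (mderiv i p) y.
pose Q (p : mp) := forall y, differentiable (mpoly_ev p) y /\
 forall i, 'D_(delta_mx 0 i) (mpoly_ev p) y = mpoly_ev (mderiv i p) y.
have QM u v : Q u -> Q v -> Q (u * v).
 move=> Qu Qv z; have [du Du] := Qu z; have [dv Dv] := Qv z.
 have -> : mpoly_ev (u * v) = mpoly_ev u * mpoly_ev v.
  by apply/funext => w; rewrite mpoly_ev_mul.
 split=> [|i]; first exact: differentiableM.
 rewrite deriveM; [|exact: diff_derivable|exact: diff_derivable].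
 rewrite Du Dv mderivM /mpoly_ev mevalD !mevalM /GRing.scale /=.
 by rewrite addrC; rewrite mulrC.
have Q1 : Q 1.
 move=> z; have -> : mpoly_ev 1 = cst 1 by apply/funext => w; rewrite /mpoly_ev meval1.
 split=> [|i]//.
 by rewrite derive_cst mderivC /mpoly_ev meval0.
have QX i : Q (mpolyX R (mnm1 i)).
 move=> z; have -> : mpoly_ev (mpolyX R (mnm1 i)) = (fun w : 'rV[R]_3 => w 0 i).
  by apply/funext => w; rewrite mpoly_ev_X.
 split=> [|j]; first exact: differentiable_coord.
 rewrite mpoly_D_X /mpoly_ev.
 have cl : linear (fun w : 'rV[R]_3 => w 0 i) by move=> a u v; rewrite !mxE.
 pose L : {linear 'rV[R]_3 -> R} := HB.pack (fun w : 'rV[R]_3 => w 0 i)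
  (GRing.isLinear.Build _ _ _ _ _ cl).
 rewrite deriveE; last exact: differentiable_coord.
 rewrite (@diff_lin _ _ _ L); last exact: coord_continuous.
 rewrite /= mxE eqxx eq_sym; case: eqP => _; last by rewrite meval0.
 by rewrite meval1.
have QXn i n : Q (mpolyX R (mnm1 i) ^+ n).
 by elim: n => [|n IH]; [exact: Q1|rewrite exprS; exact: QM].
apply: (@mpoly_model_ind Q) => [a b c|a u v Qu Qv z].
 exact: (QM _ _ (QM _ _ (QXn _ _) (QXn _ _)) (QXn _ _)).
have [du Du] := Qu z; have [dv Dv] := Qv z.
have -> : mpoly_ev (a *: u + v) = a *: mpoly_ev u + mpoly_ev v.
 by apply/funext => w; rewrite mpoly_ev_linear.
have da : differentiable (a *: mpoly_ev u) z by exact: differentiableZ.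
split=> [|i]; first exact: differentiableD.
rewrite deriveD; [|exact: diff_derivable|exact: diff_derivable].
rewrite deriveZ; last exact: diff_derivable.
by rewrite Du Dv mderivD mderivZ /mpoly_ev mevalD mevalZ.
Qed.

(** Euler's identity for homogeneous polynomials, checked on each monomial of the support. *)
Lemma mpoly_harm s f : spherical_harmonic s f ->
 exists p : mp, [/\ forall x : S2 R, f x = mpoly_ev p x,
  \sum_i mpolyX R (mnm1 i) * mderiv i p = s%:R *: p &
  \sum_i mderiv i (mderiv i p) = 0].
move=> [p [hp harm fE]]; exists p; split=> //.
rewrite [p in RHS]mpolyE scaler_sumr.
under eq_bigr => i _.
 rewrite {1}[p]mpolyE raddf_sum mulr_sumr.
 under eq_bigr do rewrite /= mderivZ.
 over.
rewrite exchange_big /= big_seq [RHS]big_seq; apply: eq_bigr => m mp_.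
have dm : mdeg m = s by move/dhomogP: hp; exact.
under eq_bigr => i _.
 rewrite -scalerAr mderivX -scalerAr -mpolyXD.
 over.
rewrite -scaler_sumr [RHS]scalerA mulrC -scalerA; congr (_ _).
rewrite -dm mdegE natr_sum scaler_suml; apply: eq_bigr => i _.
(* Subtraction of exponents is truncated, so a zero exponent is treated apart. *)
have [->|mi0] := eqVneq (m i) 0%N; first by rewrite !scale0r.
rewrite addmC submK//.
by apply/mnm_lepP => j; rewrite mnm1E; case: eqP => // <-; rewrite lt0n.
Qed.

Lemma poly_model_exists : {M : poly_model R | True}.
exists (@PolyModel R mp (fun i => mpolyX R (mnm1 i)) (@mderiv 3 R) mpoly_ev
 (@mderiv_is_linear 3 R) (@mderivM 3 R)
 (fun i j p => mderiv_comm j i p) mpoly_D_X mpoly_ev_linear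
 mpoly_ev_mul (fun => meval1 _) mpoly_ev_X (fun p y => (mpoly_ev_diff_D p y).1)
 (fun p i y => (mpoly_ev_diff_D p y).2 i) mpoly_model_ind mpoly_harm).
by [].
Qed.

Definition pol : poly_model R := sval poly_model_exists.

End mpoly_model.

(** * Brackets, rotations and the Laplacian on polynomials *)

Section poly_algebra.
Context (R : realType).
Notation P := (pol R).

Definition px i : P := @mX R P i.
Notation D := (@mD R P).

Lemma mDD i p q : D i (p + q) = D i p + D i q.
by have := mD_linear i 1 p q; rewrite !scale1r. Qed.
Lemma mD0 i : D i 0 = 0.
by apply: (@addrI _ (D i 0)); rewrite -mDD !addr0. Qed.
Lemma mDZ i a p : D i (a *: p) = a *: D i p.
by have := mD_linear i a p 0; rewrite mD0 !addr0. Qed.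
Lemma mDN i p : D i (- p) = - D i p.
by rewrite -scaleN1r mDZ scaleN1r. Qed.
Lemma mDB i p q : D i (p - q) = D i p - D i q.
by rewrite mDD mDN. Qed.
Lemma mDM i p q : D i (p * q) = D i p * q + p * D i q.
exact: mD_mul. Qed.
Lemma pdx i j : D i (px j) = (i == j)%:R.
exact: mD_X. Qed.
(** A scalar as a constant polynomial: [scaleE] turns scaling into a product, which [ring] can
    handle. *)
Definition polC (a : R) : P := locked (a *: 1).
Lemma scaleE a p : a *: p = polC a * p.
by rewrite /polC -lock mulr_algl. Qed.

(** Minus the determinant of the position and the two Euclidean gradients. On the sphere the radial
    parts of the gradients drop out, which gives [poisson]. *)
Definition bk p q : P := locked
 (- (px e0 * (D e1 p * D e2 q - D e2 p * D e1 q)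
  + px e1 * (D e2 p * D e0 q - D e0 p * D e2 q)
  + px e2 * (D e0 p * D e1 q - D e1 p * D e0 q))).

(* The infinitesimal rotation about the i-th axis, [x \times grad]. *)
Definition rot i p : P := locked (bk (px i) p).

Lemma bkE p q : bk p q =
 - (px e0 * (D e1 p * D e2 q - D e2 p * D e1 q)
  + px e1 * (D e2 p * D e0 q - D e0 p * D e2 q)
  + px e2 * (D e0 p * D e1 q - D e1 p * D e0 q)).
by rewrite /bk -lock. Qed.

Lemma rotF i p : rot i p = bk (px i) p.
by rewrite /rot -lock. Qed.
Lemma rot0E p : rot e0 p = px e1 * D e2 p - px e2 * D e1 p.
by rewrite rotF bkE !pdx /=; ring. Qed.
Lemma rot1E p : rot e1 p = px e2 * D e0 p - px e0 * D e2 p.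
by rewrite rotF bkE !pdx /=; ring. Qed.
Lemma rot2E p : rot e2 p = px e0 * D e1 p - px e1 * D e0 p.
by rewrite rotF bkE !pdx /=; ring. Qed.
Definition rotE := (rot0E, rot1E, rot2E).

Lemma bkDr p q r : bk p (q + r) = bk p q + bk p r.
by rewrite !bkE !mDD; ring. Qed.
Lemma bkDl p q r : bk (q + r) p = bk q p + bk r p.
by rewrite !bkE !mDD; ring. Qed.
Lemma bkZr p a q : bk p (a *: q) = a *: bk p q.
by rewrite !bkE !mDZ !scaleE; ring. Qed.
Lemma bkZl p a q : bk (a *: q) p = a *: bk q p.
by rewrite !bkE !mDZ !scaleE; ring. Qed.
Lemma bkC p q : bk q p = - bk p q.
by rewrite !bkE; ring. Qed.
Lemma bkpp p : bk p p = 0.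
by rewrite !bkE; ring. Qed.
Lemma bkMr p q r : bk p (q * r) = bk p q * r + q * bk p r.
by rewrite !bkE !mDM; ring. Qed.
Lemma bkNr p q : bk p (- q) = - bk p q.
by rewrite -scaleN1r bkZr scaleN1r. Qed.
Lemma bkNl p q : bk (- q) p = - bk q p.
by rewrite -scaleN1r bkZl scaleN1r. Qed.
Lemma bkBr p q r : bk p (q - r) = bk p q - bk p r.
by rewrite bkDr bkNr. Qed.
Lemma bkBl p q r : bk (q - r) p = bk q p - bk r p.
by rewrite bkDl bkNl. Qed.
Lemma rot_linear i : linear (rot i).
by move=> a p q; rewrite !rotF bkDr bkZr. Qed.
HB.instance Definition _ i :=
 GRing.isLinear.Build R (P) (P) _ (rot i) (rot_linear i).
Lemma rotD i p q : rot i (p + q) = rot i p + rot i q.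
exact: linearD. Qed.
Lemma rotB i p q : rot i (p - q) = rot i p - rot i q.
exact: linearB. Qed.
Lemma rotZ i a p : rot i (a *: p) = a *: rot i p.
exact: linearZ. Qed.
Lemma rotM i p q : rot i (p * q) = rot i p * q + p * rot i q.
by rewrite !rotF bkMr. Qed.
Lemma mD_sort u : (D e1 (D e0 u) = D e0 (D e1 u)) *
 (D e2 (D e0 u) = D e0 (D e2 u)) * (D e2 (D e1 u) = D e1 (D e2 u)).
by do !split; exact: mD_comm. Qed.

(** Rotations preserve the metric and the area form, hence the bracket; here this is a polynomial
    identity. *)
Lemma rot_bk i p q : rot i (bk p q) = bk (rot i p) q + bk p (rot i q).
elim/ord3: i; rewrite !rotE !bkE.
- rewrite !(mDN, mDD, mDM, pdx) /=.
 rewrite !mD_sort.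
 ring.
- rewrite !(mDN, mDD, mDB, mDM, pdx) /= !mD_sort.
 ring.
- rewrite !(mDN, mDD, mDM, pdx) /= !mD_sort.
 ring.
Qed.

(** Together with [bk_rot], this writes a bracket as a sum of rotations of products, so that its
    integral vanishes. *)
Lemma sum_rotD p : rot e0 (D e0 p) + rot e1 (D e1 p) + rot e2 (D e2 p) = 0.
by rewrite !rotE !mD_sort; ring. Qed.
Lemma bk_rot p q :
 bk p q = D e0 p * rot e0 q + D e1 p * rot e1 q + D e2 p * rot e2 q.
by rewrite !rotE !bkE; ring. Qed.

(** The Casimir operator of the rotations. It acts on all polynomials and gives the spherical
    Laplacian on the sphere. *)
Definition lapp p : P :=
 rot e0 (rot e0 p) + rot e1 (rot e1 p) + rot e2 (rot e2 p).

Lemma lapp_linear : linear lapp.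
move=> a p q; rewrite /lapp.
by rewrite !rot_linear !scalerDr [RHS]addrACA [X in _ = X + _]addrACA.
Qed.
HB.instance Definition _ :=
 GRing.isLinear.Build R (P) (P) _ lapp lapp_linear.

Lemma rotC p : (rot e0 (rot e1 p) = rot e1 (rot e0 p) - rot e2 p) *
 (rot e1 (rot e2 p) = rot e2 (rot e1 p) - rot e0 p) *
 (rot e2 (rot e0 p) = rot e0 (rot e2 p) - rot e1 p).
by do !split; rewrite !rotE !(mDN, mDB, mDM, pdx)/=;
 rewrite !mD_sort; ring.
Qed.

(** The Casimir element of so(3) is central. One generator is enough: the commutation relations are
    cyclic, so the other two follow by permutation. *)
Lemma casimir_comm (V : zmodType) (A B C : {additive V -> V}) :
 (forall u, A (B u) = B (A u) - C u) -> (forall u, B (C u) = C (B u) - A u) ->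
 (forall u, C (A u) = A (C u) - B u) -> forall u : V,
 A (A (A u) + B (B u) + C (C u)) = A (A (A u)) + B (B (A u)) + C (C (A u)).
move=> AB BC CA u.
have AC v : A (C v) = C (A v) + B v by rewrite CA subrK.
have ABB : A (B (B u)) = B (B (A u)) - B (C u) - C (B u).
 by rewrite AB AB raddfB.
have ACC : A (C (C u)) = C (C (A u)) + C (B u) + B (C u).
 by rewrite AC AC raddfD.
rewrite !raddfD ABB ACC -!addrA; congr (_ (_ + _)).
by rewrite (addrCA _ (C (B u))) addKr addrC addrK.
Qed.

Lemma rot_lapp i p : rot i (lapp p) = lapp (rot i p).
have h0 u : rot e0 (rot e1 u) = rot e1 (rot e0 u) - rot e2 u by rewrite rotC.
have h1 u : rot e1 (rot e2 u) = rot e2 (rot e1 u) - rot e0 u by rewrite rotC.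
have h2 u : rot e2 (rot e0 u) = rot e0 (rot e2 u) - rot e1 u by rewrite rotC.
pose X i : {additive P -> P} := rot i.
have k0 := @casimir_comm P (X e0) (X e1) (X e2) h0 h1 h2 p.
have k1 := @casimir_comm P (X e1) (X e2) (X e0) h1 h2 h0 p.
have k2 := @casimir_comm P (X e2) (X e0) (X e1) h2 h0 h1 p.
rewrite /= in k0 k1 k2.
have s1 u : lapp u = rot e1 (rot e1 u) + rot e2 (rot e2 u) + rot e0 (rot e0 u).
 by rewrite /lapp -addrA addrC.
have s2 u : lapp u = rot e2 (rot e2 u) + rot e0 (rot e0 u) + rot e1 (rot e1 u).
 by rewrite -addrA addrC.
elim/ord3: i => //.
- by rewrite !s1.
- by rewrite !s2.
Qed.

Lemma lapp_bk p q : lapp (bk p q) = bk (lapp p) q + bk p (lapp q) +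
 2 * (bk (rot e0 p) (rot e0 q) + bk (rot e1 p) (rot e1 q) + bk (rot e2 p) (rot e2 q)).
by rewrite /lapp !bkDl !bkDr !rot_bk !rotD !rot_bk; ring.
Qed.

Definition r2 : P := px e0 ^+ 2 + px e1 ^+ 2 + px e2 ^+ 2.

(** The cross product of the two vectors of rotations is minus the bracket times the position
    vector, whose squared length is [r2]. *)
Lemma bk_sqr p q : r2 * bk p q ^+ 2 =
 (rot e1 p * rot e2 q - rot e2 p * rot e1 q) ^+ 2 +
 (rot e2 p * rot e0 q - rot e0 p * rot e2 q) ^+ 2 +
 (rot e0 p * rot e1 q - rot e1 p * rot e0 q) ^+ 2.
by rewrite /r2 bkE !rotE; ring. Qed.

Definition eul p : P := px e0 * D e0 p + px e1 * D e1 p + px e2 * D e2 p.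
(** The polynomial counterpart of [tder], with the radial derivative [eul] subtracted. *)
Definition tgr i p : P := D i p - px i * eul p.

Lemma tgr_linear i : linear (tgr i).
by move=> a p q; rewrite /tgr /eul !mDD !mDZ !scaleE; ring.
Qed.
HB.instance Definition _ i :=
 GRing.isLinear.Build R (P) (P) _ (tgr i) (tgr_linear i).

Lemma tgrM i p q : tgr i (p * q) = tgr i p * q + p * tgr i q.
by rewrite /tgr /eul !mDM; ring. Qed.
(** Reduces the integral of a rotation to integrals of tangential derivatives, whose curvature terms
    then cancel. *)
Lemma rot_tgr p : (rot e0 p = tgr e2 (px e1 * p) - tgr e1 (px e2 * p)) *
 (rot e1 p = tgr e0 (px e2 * p) - tgr e2 (px e0 * p)) *
 (rot e2 p = tgr e1 (px e0 * p) - tgr e0 (px e1 * p)).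
by do !split; rewrite !rotE /tgr /eul !mDM !pdx /=; ring.
Qed.

(** The factor [r2 - 1] vanishes on the sphere: there the tangential gradient and the vector of
    rotations have the same length. *)
Lemma sum_tgr_sqr p : r2 * (tgr e0 p ^+ 2 + tgr e1 p ^+ 2 + tgr e2 p ^+ 2) -
  (rot e0 p ^+ 2 + rot e1 p ^+ 2 + rot e2 p ^+ 2) =
  (r2 - 1) * (r2 * eul p ^+ 2 - eul p ^+ 2).
by rewrite /r2 !rotE /tgr /eul; ring. Qed.

End poly_algebra.

(** * Bounded measurable functions *)

Section bounded_measurable.
Context d (T : measurableType d) (R : realType).
Implicit Types f g : T -> R.

Definition bmeas f := measurable_fun setT f /\ exists M, forall x, `|f x| <= M.

Lemma bmeasD f g : bmeas f -> bmeas g -> bmeas (fun x => f x + g x).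
move=> [mf [M hM]] [mg [N hN]]; split; first exact: measurable_funD.
by exists (M + N) => x; rewrite (le_trans (ler_normD _ _))// lerD.
Qed.

Lemma bmeasM f g : bmeas f -> bmeas g -> bmeas (fun x => f x * g x).
move=> [mf [M hM]] [mg [N hN]]; split; first exact: measurable_funM.
by exists (M * N) => x; rewrite normrM ler_pM.
Qed.

Lemma bmeas_cst (k : R) : bmeas (fun=> k).
by split; [exact: measurable_cst|exists `|k|]. Qed.
Lemma bmeasN f : bmeas f -> bmeas (fun x => - f x).
move=> /(bmeasM (bmeas_cst (-1))).
by rewrite (_ : (fun x => -1 * f x) = (fun x => - f x))//; apply/funext => x; rewrite mulN1r.
Qed.

Lemma bmeasB f g : bmeas f -> bmeas g -> bmeas (fun x => f x - g x).
by move=> bf /bmeasN; exact: bmeasD. Qed.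
Lemma bmeasX f n : bmeas f -> bmeas (fun x => f x ^+ n).
move=> bf; elim: n => [|n IH]; first exact: bmeas_cst.
under eq_fun do rewrite exprS; exact: bmeasM.
Qed.

Lemma bmeas_sum (I : Type) (r : seq I) (F : I -> T -> R) :
 (forall i, bmeas (F i)) -> bmeas (fun x => \sum_(i <- r) F i x).
move=> bF; elim: r => [|a r IH].
 by under eq_fun do rewrite big_nil; exact: bmeas_cst.
by under eq_fun do rewrite big_cons; exact: bmeasD.
Qed.

End bounded_measurable.

(** * Integration by parts on the sphere *)

Section sphere_integration_by_parts.
Context (R : realType).
Notation leb := (@lebesgue_measure R).
Notation leb2 := (leb \x leb)%E.
Notation rect := (@sph_rect R).
Implicit Types phi : 'rV[R]_3 -> R.

Lemma bmeas_integrable (f : S2 R -> R) : bmeas f ->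
 (@area R).-integrable setT (EFin \o f).
by move=> [mf [M hM]]; exact: bounded_integrable_area. Qed.

Lemma bmeas_continuous_S2 phi : continuous phi -> bmeas (fun x : S2 R => phi x).
by split; [exact: measurable_continuous_S2|exact: continuous_bounded_S2].
Qed.

Lemma bmeas_s2coord i : bmeas (@s2coord R i).
by split; [exact: measurable_s2coord|exists 1 => x; exact: s2coord_le1]. Qed.
Lemma bmeas_sph phi : continuous phi -> bmeas (fun p : R * R => phi (sph p)).
move=> c; split; first exact: measurable_continuous_sph.
by have [M hM] := continuous_bounded_S2 c; exists M => p.
Qed.

Lemma bmeas_trig (f : R -> R) : f = sin \/ f = cos ->
 bmeas (fun p : R * R => f p.1) /\ bmeas (fun p : R * R => f p.2).
move=> h.
have cf : continuous f by case: h => ->; [exact: continuous_sin|exact: continuous_cos].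
have bf t : `|f t| <= 1.
 by case: h => ->; rewrite ler_norml ?sin_geN1 ?sin_le1 ?cos_geN1 ?cos_le1.
have mf : measurable_fun setT f := continuous_measurable_fun cf.
split; (split; last by (exists 1 => p; exact: bf)).
- have : measurable_fun [set: R * R] (fun p => f p.1) :=
  measurableT_comp mf measurable_fst.
 exact.
- have : measurable_fun [set: R * R] (fun p => f p.2) :=
  measurableT_comp mf measurable_snd.
 exact.
Qed.

Lemma C1_continuous phi : C1 phi -> continuous phi.
by move=> [d _] y; exact: differentiable_continuous. Qed.
Lemma bmeas_tder phi i : C1 phi -> bmeas (tder i phi).
move=> [_ c]; apply: bmeasB; first exact: (bmeas_continuous_S2 (c i)).
apply: bmeasM; first exact: bmeas_s2coord.
apply: bmeas_sum => j; apply: bmeasM; first exact: bmeas_s2coord.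
exact: (bmeas_continuous_S2 (c j)).
Qed.

Section fixed_phi.
Variable phi : 'rV[R]_3 -> R.
Hypothesis C1phi : C1 phi.
Let g j (p : R * R) := 'D_(delta_mx 0 j) phi (sph_row p).
Let f (p : R * R) := phi (sph_row p).

Let fa p := cos p.1 * cos p.2 * g e0 p + cos p.1 * sin p.2 * g e1 p
      - sin p.1 * g e2 p.
Let fb p := - (sin p.1 * sin p.2) * g e0 p + sin p.1 * cos p.2 * g e1 p.

Let dfa a b : is_derive a (1 : R) (fun a => f (a, b)) (fa (a, b)).
pose dg (i : 'I_3) := nth 0 [:: cos a * cos b; cos a * sin b; - sin a] i.
have h := @is_derive_row R phi (fun a => sph_row (a, b)) a dg (C1phi.1 _).
rewrite (_ : fa (a, b) = \sum_i dg i * 'D_(delta_mx 0 i) phi (sph_row (a, b))).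
 apply: h; elim/ord3.
 - by under eq_fun do rewrite mxE /=; apply: is_derive_eq;
   rewrite /dg /GRing.scale /=; ring.
 - by under eq_fun do rewrite mxE /=; apply: is_derive_eq;
   rewrite /dg /GRing.scale /=; ring.
 - by under eq_fun do rewrite mxE /=; apply: is_derive_eq.
by rewrite sum3 mulNr.
Qed.

Let dfb a b : is_derive b (1 : R) (fun b => f (a, b)) (fb (a, b)).
pose dg (i : 'I_3) := nth 0 [:: - (sin a * sin b); sin a * cos b; 0] i.
have h := @is_derive_row R phi (fun b => sph_row (a, b)) b dg (C1phi.1 _).
rewrite (_ : fb (a, b) = \sum_i dg i * 'D_(delta_mx 0 i) phi (sph_row (a, b))).
 apply: h; elim/ord3.
 - by under eq_fun do rewrite mxE /=; apply: is_derive_eq;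
   rewrite /dg /GRing.scale /=; ring.
 - by under eq_fun do rewrite mxE /=; apply: is_derive_eq.
 - by under eq_fun do rewrite mxE /=; apply: is_derive_eq.
by rewrite sum3 mul0r addr0.
Qed.

(** [G1 i] and [G2 i] are the derivatives, in colatitude and longitude, of the functions [A] of
    [iG1] and [iG2]. Their sum is the integrand: this is the divergence theorem in spherical
    coordinates. *)
Let G1 (i : 'I_3) (p : R * R) : R := nth 0 [::
 (cos p.1 ^+ 2 - sin p.1 ^+ 2) * cos p.2 * f p + sin p.1 * cos p.1 * cos p.2 * fa p;
 (cos p.1 ^+ 2 - sin p.1 ^+ 2) * sin p.2 * f p + sin p.1 * cos p.1 * sin p.2 * fa p;
 - (2 * sin p.1 * cos p.1 * f p + sin p.1 ^+ 2 * fa p)] i.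
Let G2 (i : 'I_3) (p : R * R) : R := nth 0 [::
 - (cos p.2 * f p) - sin p.2 * fb p;
 - (sin p.2 * f p) + cos p.2 * fb p; 0] i.

Let tder_G i (p : R * R) :
 (tder i phi (sph p) - 2 * (s2coord i (sph p) * phi (sph p))) * sin p.1 =
 G1 i p + G2 i p.
have h1 : cos p.1 ^+ 2 + sin p.1 ^+ 2 - 1 = 0 by rewrite cos2Dsin2 subrr.
have h2 : cos p.2 ^+ 2 + sin p.2 ^+ 2 - 1 = 0 by rewrite cos2Dsin2 subrr.
elim/ord3: i; rewrite /tder sum3 /s2coord !mxE /= /G1 /G2 /fa /fb /=
 -!/(g _ _) -!/(f _); move: h1 h2;
 move: (sin p.1) (cos p.1) (sin p.2) (cos p.2) (f p) (g e0 p) (g e1 p) (g e2 p)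
  => s c v u f0 g0 g1 g2 h1 h2.
- apply/eqP; rewrite -subr_eq0; apply/eqP.
 (* The difference of the two sides is an explicit combination of the Pythagorean relations [h1] and
    [h2]. *)
 transitivity (- ((c ^+ 2 + s ^+ 2 - 1) * (u * f0 + s * u ^+ 2 * g0 +
  s * u * v * g1) +
  (u ^+ 2 + v ^+ 2 - 1) * (s * g0))); first by ring.
 by rewrite h1 h2 !mul0r addr0 oppr0.
- apply/eqP; rewrite -subr_eq0; apply/eqP.
 transitivity (- ((c ^+ 2 + s ^+ 2 - 1) * (v * f0 + s * u * v * g0 +
  s * v ^+ 2 * g1) +
  (u ^+ 2 + v ^+ 2 - 1) * (s * g1))); first by ring.
 by rewrite h1 h2 !mul0r addr0 oppr0.
- apply/eqP; rewrite -subr_eq0; apply/eqP.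
 transitivity (- ((c ^+ 2 + s ^+ 2 - 1) * (s * g2) +
  (u ^+ 2 + v ^+ 2 - 1) * 0)); first by ring.
 by rewrite h1 h2 !mul0r addr0 oppr0.
Qed.

Let bs1 := (bmeas_trig (or_introl erefl)).1.
Let bs2 := (bmeas_trig (or_introl erefl)).2.
Let bc1 := (bmeas_trig (or_intror erefl)).1.
Let bc2 := (bmeas_trig (or_intror erefl)).2.
Let bf : bmeas f. by apply: bmeas_sph; exact: C1_continuous. Qed.
Let bg j : bmeas (g j). by apply: (bmeas_sph (C1phi.2 j)). Qed.
Let bfa : bmeas fa.
by apply: bmeasB; [apply: bmeasD|]; repeat (apply: bmeasM) => //.
Qed.
Let bfb : bmeas fb.
apply: bmeasD; repeat (apply: bmeasM) => //.
by apply: bmeasN; exact: bmeasM.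
Qed.
Let bG1 i : bmeas (G1 i).
elim/ord3: i.
- by apply: bmeasD; repeat (apply: bmeasM) => //; apply: bmeasB; exact: bmeasX.
- by apply: bmeasD; repeat (apply: bmeasM) => //; apply: bmeasB; exact: bmeasX.
- apply: bmeasN; apply: bmeasD; repeat (apply: bmeasM) => //; exact: bmeas_cst.
Qed.
Let bG2 i : bmeas (G2 i).
elim/ord3: i.
- by apply: bmeasB; [apply: bmeasN|]; exact: bmeasM.
- by apply: bmeasD; [apply: bmeasN|]; exact: bmeasM.
- exact: bmeas_cst.
Qed.

Let cg j (f1 f2 : R -> R) : continuous f1 -> continuous f2 ->
 continuous (fun t => g j (f1 t, f2 t)).
move=> c1 c2 t; have h1 := continuous_sph_row c1 c2 (x := t).
exact: (@continuous_comp _ _ _ (fun t => sph_row (f1 t, f2 t))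
 ('D_(delta_mx 0 j) phi) t h1 (C1phi.2 j _)).
Qed.
Let cid : continuous (@idfun R). by move=> t. Qed.
Let ccst (k : R) : continuous (fun _ : R => k). by move=> t; exact: cvg_cst. Qed.
Let cadd (f1 f2 : R -> R) : continuous f1 -> continuous f2 ->
 continuous (fun t => f1 t + f2 t).
by move=> c1 c2 t; apply: cvgD; [exact: c1|exact: c2]. Qed.
Let cmul (f1 f2 : R -> R) : continuous f1 -> continuous f2 ->
 continuous (fun t => f1 t * f2 t).
by move=> c1 c2 t; apply: cvgM; [exact: c1|exact: c2]. Qed.
Let copp (f1 : R -> R) : continuous f1 -> continuous (fun t => - f1 t).
by move=> c1 t; apply: cvgN; exact: c1. Qed.
Let cs := @continuous_sin R.
Let cc := @continuous_cos R.
Let cfA b : continuous (fun a => f (a, b)).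
by move=> a; apply: differentiable_continuous; apply/derivable1_diffP; case: (dfa a b).
Qed.
Let cfB a : continuous (fun b => f (a, b)).
by move=> b; apply: differentiable_continuous; apply/derivable1_diffP; case: (dfb a b).
Qed.
(** Continuity by recursion on the syntax of the function; whatever matches no pattern is taken to
    be constant. *)
Ltac ct := lazymatch goal with
 | |- continuous (fun x => @?u x + @?v x) => refine (@cadd u v _ _); ct
 | |- continuous (fun x => @?u x * @?v x) => refine (@cmul u v _ _); ct
 | |- continuous (fun x => - @?u x) => refine (@copp u _); ct
 | |- continuous (fun x => sin x) => exact: cs
 | |- continuous (fun x => cos x) => exact: cc
 | |- continuous (fun x => f (x, _)) => exact: cfA
 | |- continuous (fun x => f (_, x)) => exact: cfB
 | |- continuous (fun x => g ?j (@?u x, @?v x)) => refine (@cg j u v _ _); ct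
 | |- continuous (fun x => x) => exact: cid
 | |- continuous (fun x => fa (x, _)) => assumption
 | |- continuous (fun x => fb (_, x)) => assumption
 | |- continuous (fun x => @?u x ^+ 2) => refine (@cmul u u _ _); ct
 | |- _ => exact: ccst end.

Let iG1 i : (\int[leb2]_(p in rect) (G1 i p)%:E = 0)%E.
have [m [M hM]] := bG1 i.
apply: (integral_rect_fubini1 m hM) => b.
have ppi : 0 < pi :> R by exact: pi_gt0.
have cfa1 : continuous (fun a => fa (a, b)) by rewrite /fa /=; ct.
pose A (i : 'I_3) (a : R) : R := nth 0 [:: sin a * cos a * cos b * f (a, b);
 sin a * cos a * sin b * f (a, b); - (sin a ^+ 2 * f (a, b))] i.
have dA a : is_derive a (1 : R) (A i) (G1 i (a, b)).
 have := dfa a b => da; clear -da.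
 by elim/ord3: i => /=; rewrite /G1 /=; apply: is_derive_eq;
  rewrite /GRing.scale /= ?expr1; ring.
rewrite (integral_is_derive ppi dA); last first.
 by elim/ord3: i {m hM dA} => /=; rewrite /G1 /=; ct.
(* Each primitive carries a factor [sin a], which vanishes at both poles. *)
elim/ord3: i {m hM dA} => /=;
 by rewrite /A /= sin0 sinpi ?expr2 !(mul0r, oppr0, addr0).
Qed.

Let iG2 i : (\int[leb2]_(p in rect) (G2 i p)%:E = 0)%E.
have [m [M hM]] := bG2 i.
apply: (integral_rect_fubini2 m hM) => a.
have ppi : 0 < 2 * pi :> R by rewrite mulr_gt0// pi_gt0.
have cfb1 : continuous (fun b => fb (a, b)) by rewrite /fb /=; ct.
pose A (i : 'I_3) (b : R) : R := nth 0 [:: - (sin b * f (a, b)); cos b * f (a, b); 0] i.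
have dA b : is_derive b (1 : R) (A i) (G2 i (a, b)).
 have := dfb a b => da; clear -da.
 by elim/ord3: i => /=; rewrite /A /G2 /=; apply: is_derive_eq;
  rewrite /GRing.scale /= ?expr1; ring.
rewrite (integral_is_derive ppi dA); last first.
 by elim/ord3: i {m hM dA} => /=; rewrite /G2 /=; ct.
(* The boundary values in longitude agree by periodicity. *)
have c2 : cos (2 * pi) = 1 :> R by rewrite mulr_natl -[_ 2]add0r cosD2pi cos0.
have s2 : sin (2 * pi) = 0 :> R by rewrite mulr_natl -[_ 2]add0r sinD2pi sin0.
have fE : f (a, 2 * pi) = f (a, 0).
 by rewrite /f /sph_row c2 s2 sin0 cos0.
by rewrite /A ?fE ?c2 ?s2 ?sin0 ?cos0 subrr.
Qed.

Lemma integral_tder i : \int[@area R]_x tder i phi x =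
 2 * \int[@area R]_x (s2coord i x * phi x).
have b1 := bmeas_tder i C1phi.
have b2 : bmeas (fun x => s2coord i x * phi x).
 by apply: bmeasM; [exact: bmeas_s2coord|apply: bmeas_continuous_S2; exact: C1_continuous].
have b3 := bmeasM (bmeas_cst _ 2) b2.
apply/eqP; rewrite -subr_eq0 -RintegralZl//; last exact: bmeas_integrable.
rewrite -RintegralB//; [|exact: bmeas_integrable|exact: bmeas_integrable].
rewrite /Rintegral area_integralE; last exact: (bmeasB b1 b3).1.
under eq_integral do rewrite tder_G EFinD.
rewrite integralD//=; [|exact: measurable_sph_rect| |].
- by rewrite iG1 iG2 adde0.
- by have [m [M hM]] := bG1 i; exact: bounded_integrable_rect.
- by have [m [M hM]] := bG2 i; exact: bounded_integrable_rect.
Qed.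

End fixed_phi.

End sphere_integration_by_parts.

(** * Polynomials as functions on the sphere *)

Section polynomial_functions.
Context (R : realType).
Notation P := (pol R).
Notation leb := (@lebesgue_measure R).
Notation leb2 := (leb \x leb)%E.
Notation rect := (@sph_rect R).
Implicit Types (p q r : P) (x : S2 R) (i j : 'I_3).

Definition pev p x : R := @mev R P p x.

Lemma pevD p q x : pev (p + q) x = pev p x + pev q x.
by have := mev_linear 1 p q x; rewrite scale1r mul1r. Qed.
Lemma pev0 x : pev 0 x = 0.
by apply: (@addrI _ (pev 0 x)); rewrite -pevD !addr0. Qed.
Lemma pevZ a p x : pev (a *: p) x = a * pev p x.
by rewrite -[a *: p]addr0 /pev mev_linear -!/(pev _ _) pev0 addr0. Qed.
Lemma pevN p x : pev (- p) x = - pev p x.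
by rewrite -scaleN1r pevZ mulN1r. Qed.
Lemma pevB p q x : pev (p - q) x = pev p x - pev q x.
by rewrite pevD pevN. Qed.
Lemma pevM p q x : pev (p * q) x = pev p x * pev q x.
exact: mev_mul. Qed.
Lemma pev1 x : pev 1 x = 1.
exact: mev1. Qed.
Lemma pevX p n x : pev (p ^+ n) x = pev p x ^+ n.
by elim: n => [|n IH]; rewrite ?pev1// !exprS pevM IH. Qed.
Lemma pev_px i x : pev (px R i) x = s2coord i x.
exact: mev_X. Qed.
Lemma pev_sum (I : Type) (s : seq I) (c : pred I) (F : I -> P) x :
 pev (\sum_(i <- s | c i) F i) x = \sum_(i <- s | c i) pev (F i) x.
elim: s => [|i s IH]; first by rewrite !big_nil pev0.
by rewrite !big_cons; case: (c i) => //; rewrite pevD IH.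
Qed.

Lemma pev_r2 x : pev (r2 R) x = 1.
have <- := Defs.s2valP x; rewrite sum3 !pevD !pevX.
by rewrite !pev_px.
Qed.

Lemma mev_C1 p : C1 (@mev R P p).
split=> [y|i]; first exact: mev_diff.
rewrite (_ : 'D_(delta_mx 0 i) (@mev R P p) = @mev R P (mD i p)).
 by move=> y; apply: differentiable_continuous; exact: mev_diff.
by apply/funext => y; exact: mev_D.
Qed.

Lemma mev_continuous p : continuous (@mev R P p).
exact: C1_continuous (mev_C1 p). Qed.

Lemma bmeas_pev p : bmeas (pev p).
by apply: bmeas_continuous_S2; exact: mev_continuous. Qed.
Lemma tder_mev i p x : tder i (@mev R P p) x = pev (tgr i p) x.
rewrite /tder pevB pevM !pevD !pevM !pev_px sum3.
by rewrite !mev_D.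
Qed.

Definition Ip p : R := \int[@area R]_x pev p x.

Lemma Ip_linear a p q : Ip (a *: p + q) = a * Ip p + Ip q.
rewrite /Ip; under eq_Rintegral do rewrite pevD pevZ.
rewrite RintegralD//; last exact: bmeas_integrable (bmeas_pev _).
 rewrite RintegralZl//; exact: bmeas_integrable (bmeas_pev _).
apply: (@bmeas_integrable _ (fun x => a * pev p x)).
by apply: bmeasM; [exact: bmeas_cst|exact: bmeas_pev].
Qed.

Lemma eq_Ip p q : pev p = pev q -> Ip p = Ip q.
by rewrite /Ip => ->. Qed.
Lemma Ip_tgr i p : Ip (tgr i p) = 2 * Ip (px R i * p).
have := integral_tder (mev_C1 p) i.
under eq_Rintegral do rewrite tder_mev.
by rewrite /Ip => ->; congr (2 * _); apply: eq_Rintegral => x; rewrite pevM pev_px.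
Qed.

Lemma Ip_sqr_ge0 p : 0 <= Ip (p * p).
by apply: Rintegral_ge0 => x; rewrite pevM sqr_ge0.
Qed.

Lemma sph_surj x : exists2 p, rect p & sph_row p = x.
have x1 := Defs.s2valP x; rewrite sum3 in x1.
pose z := s2coord e2 x; pose X := s2coord e0 x; pose Y := s2coord e1 x.
have xyz : X ^+ 2 + Y ^+ 2 + z ^+ 2 = 1 by [].
have z1 : -1 <= z <= 1 by rewrite -ler_norml; exact: s2coord_le1.
pose a := acos z.
have ca : cos a = z by rewrite acosK.
have sa2 : sin a ^+ 2 = X ^+ 2 + Y ^+ 2.
 by rewrite sin2cos2 ca -xyz addrK.
have a0 : 0 <= a <= pi by rewrite acos_ge0 ?acos_lepi.
have mk b : 0 <= b <= 2 * pi -> sin a * cos b = X -> sin a * sin b = Y ->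
  exists2 p, rect p & sph_row p = x.
 move=> hb hX hY; exists (a, b) => //.
 by apply/rowP; apply: ord3; rewrite mxE.
have pi0 := pi_ge0 R.
have [s0|s0] := eqVneq (sin a) 0.
 have : X ^+ 2 + Y ^+ 2 = 0 by rewrite -sa2 s0 expr0n.
 move/eqP; rewrite paddr_eq0 ?sqr_ge0// !sqrf_eq0 => /andP[/eqP X0 /eqP Y0].
 by apply: (mk 0); rewrite ?s0 ?mul0r// lexx mulr_ge0.
pose u := X / sin a; pose v := Y / sin a.
have uv : u ^+ 2 + v ^+ 2 = 1.
 by rewrite !expr_div_n -mulrDl -sa2 divff// sqrf_eq0.
have u1 : -1 <= u <= 1.
 rewrite -ler_norml -(@ler_pXn2r _ 2) ?nnegrE// expr1n real_normK ?num_real//.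
 by rewrite -uv lerDl sqr_ge0.
have cu : cos (acos u) = u by rewrite acosK.
have su : sin (acos u) = `|v|.
 by rewrite sin_acos// -uv addrC addKr sqrtr_sqr.
have au := acos_ge0 u1; have aup := acos_lepi u1.
have [v0|v0] := leP 0 v.
 apply: (mk (acos u)); first by lra.
  by rewrite cu mulrC divfK.
 by rewrite su ger0_norm// mulrC divfK.
(* [acos] reaches only half of the circle; for negative [v] the longitude is reflected. *)
have cN t : cos (2 * pi - t) = cos t.
 by rewrite mulr_natl addrC cosD2pi cosN.
have sN t : sin (2 * pi - t) = - sin t.
 by rewrite mulr_natl addrC sinD2pi sinN.
apply: (mk (2 * pi - acos u)); first by lra.
 by rewrite cN cu mulrC divfK.
by rewrite sN su ltr0_norm// opprK mulrC divfK.
Qed.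

Lemma leb2_box (a b c d : R) : a < b -> c < d ->
 (0 < leb2 (`]a, b[%classic `*` `]c, d[%classic))%E.
move=> ab cd; rewrite product_measure1E; try exact: measurable_itv.
have len (u v : R) : u < v -> (0 < leb (`]u, v[%classic : set R))%E.
 by move=> uv; rewrite lebesgue_measure_itv/= lte_fin uv lte_fin subr_gt0.
by rewrite mule_gt0// len.
Qed.

(** The interval stays close to [t] without having to contain it, as [t] may be an end of the
    range. *)
Lemma open_itv_near (t l u : R) e : 0 < e -> l < u -> l <= t <= u ->
 exists a b, [/\ a < b, l <= a, b <= u & forall s, a < s < b -> `|t - s| < e].
move=> e_gt0 lu /andP[lt tu].
exists (Num.max l (t - e)), (Num.min u (t + e)); split.
- by rewrite lt_min !gt_max lu; lra.
- by rewrite le_max lexx.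
- by rewrite ge_min lexx.
- by move=> s /andP[]; rewrite gt_max lt_min => /andP[_ ?]; rewrite ltr_distlC; lra.
Qed.

(** If [phi] were nonzero at a point, then by continuity it would be nonzero on an open coordinate
    box inside the rectangle, where [sin] is positive and the measure too. *)
Lemma continuous_sqr_eq0 (phi : 'rV[R]_3 -> R) : continuous phi ->
 \int[@area R]_x (phi x ^+ 2) = 0 -> forall x : S2 R, phi x = 0.
move=> cphi I0 x; apply/eqP; apply: contraT => phix.
have [p0 rp0 p0x] := sph_surj x.
have bphi := bmeasX 2 (bmeas_continuous_S2 cphi).
pose h (p : R * R) : R := phi (sph p) ^+ 2 * sin p.1.
have mh : measurable_fun rect (EFin \o h).
 apply/measurable_EFinP/measurable_funTS/measurable_funM.
  exact: (bmeasX 2 (bmeas_sph cphi)).1.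
 exact: measurable_sin1.
have ih : (\int[leb2]_(p in rect) (h p)%:E = 0)%E.
 rewrite -[LHS](area_integralE bphi.1) -[LHS]fineK; first by congr EFin.
 by apply: integrable_fin_num => //; exact: bmeas_integrable.
have : ae_eq leb2 rect (EFin \o h) (cst 0%E).
 apply/(ae_eq_integral_abs leb2 (@measurable_sph_rect R) mh).
 rewrite -[RHS]ih; apply: eq_integral => p; rewrite inE => rp /=.
 by rewrite ger0_norm// mulr_ge0 ?sqr_ge0 ?sin_rect_ge0.
move=> [N [mN N0 hN]].
have cp : {for p0, continuous (fun t : R * R => phi (sph_row t))}.
 have cs : continuous (@sph_row R).
  have := @continuous_sph_row R (R * R)%type fst snd.
  rewrite (_ : (fun => _) = @sph_row R)//.
  by apply; move=> t; [exact: cvg_fst|exact: cvg_snd].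
 by apply: continuous_comp; [exact: cs|exact: cphi].
have /cvgrPdist_lt /(_ `|phi x|) := cp; rewrite normr_gt0 phix => /(_ isT).
move=> /nbhs_ballP[e /= e_gt0 He].
have ppi := pi_gt0 R.
case: rp0 => /= /[!in_itv]/= r1 r2.
have [a [b [ab la bu hab]]] := open_itv_near e_gt0 ppi r1.
have [|c [d [cd lc du hcd]]] := open_itv_near e_gt0 (_ : 0 < 2 * pi) r2.
 by rewrite mulr_gt0.
have sub : `]a, b[%classic `*` `]c, d[%classic `<=` N.
 move=> [s t] [/= /[!in_itv]/= hs ht]; apply: hN => /= /(_ _).
 have rst : rect (s, t).
  by split; rewrite /= in_itv /=; apply/andP; split; lra.
 move=> /(_ rst) [] /eqP; rewrite mulf_eq0 sqrf_eq0 => /orP[/eqP f0|/eqP s0].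
  have := He (s, t); rewrite p0x f0 subr0 ltxx => H.
  suff : false by [].
  by apply: H; split; [exact: hab|exact: hcd].
 have := @sin_gt0_pi R s; rewrite s0 ltxx => H.
 suff : false by [].
 by apply: H; apply/andP; split; lra.
have := leb2_box ab cd; rewrite ltNge -N0 le_measure// inE//.
by apply: measurableX.
Qed.

Lemma Ip_sqr_eq0 p : Ip (p * p) = 0 -> pev p = (fun=> 0).
move=> h; apply/funext => x.
apply: (continuous_sqr_eq0 (@mev_continuous p) _ x).
by rewrite -[RHS]h; apply: eq_Rintegral => y; rewrite pevM.
Qed.

End polynomial_functions.

(** * The inner product, adjoints and degree *)

Section inner_product.
Context (R : realType).
Notation P := (pol R).
Implicit Types (p q r : P) (x : S2 R) (i j : 'I_3).
Notation D := (@mD R P).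
Notation Ip := (@Ip R).

Lemma IpD p q : Ip (p + q) = Ip p + Ip q.
by have := Ip_linear 1 p q; rewrite scale1r mul1r. Qed.
Lemma Ip0 : Ip 0 = 0.
by apply: (@addrI _ (Ip 0)); rewrite -IpD !addr0. Qed.
Lemma IpZ a p : Ip (a *: p) = a * Ip p.
by have := Ip_linear a p 0; rewrite Ip0 !addr0. Qed.
Lemma IpN p : Ip (- p) = - Ip p.
by rewrite -scaleN1r IpZ mulN1r. Qed.
Lemma IpB p q : Ip (p - q) = Ip p - Ip q.
by rewrite IpD IpN. Qed.

Definition ip p q : R := Ip (p * q).

Lemma ipC p q : ip p q = ip q p. by rewrite /ip mulrC. Qed.
Lemma ipDl p q r : ip (p + q) r = ip p r + ip q r.
by rewrite /ip mulrDl IpD. Qed.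
Lemma ipDr p q r : ip r (p + q) = ip r p + ip r q.
by rewrite !(ipC r) ipDl. Qed.
Lemma ipZl a p q : ip (a *: p) q = a * ip p q.
by rewrite /ip -scalerAl IpZ. Qed.
Lemma ipZr a p q : ip p (a *: q) = a * ip p q.
by rewrite !(ipC p) ipZl. Qed.
Lemma ipNl p q : ip (- p) q = - ip p q.
by rewrite /ip mulNr IpN. Qed.
Lemma ipNr p q : ip p (- q) = - ip p q.
by rewrite !(ipC p) ipNl. Qed.
Lemma ipBl p q r : ip (p - q) r = ip p r - ip q r.
by rewrite ipDl ipNl. Qed.
Lemma ipBr p q r : ip r (p - q) = ip r p - ip r q.
by rewrite ipDr ipNr. Qed.
Lemma ip0l p : ip 0 p = 0. by rewrite /ip mul0r Ip0. Qed.
Lemma ip0r p : ip p 0 = 0. by rewrite ipC ip0l. Qed.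
Lemma ip_suml (T : Type) (s : seq T) (c : pred T) (F : T -> P) q :
 ip (\sum_(i <- s | c i) F i) q = \sum_(i <- s | c i) ip (F i) q.
elim: s => [|i s IH]; first by rewrite !big_nil ip0l.
by rewrite !big_cons; case: (c i) => //; rewrite ipDl IH.
Qed.
Lemma ip_sumr (T : Type) (s : seq T) (c : pred T) (F : T -> P) q :
 ip q (\sum_(i <- s | c i) F i) = \sum_(i <- s | c i) ip q (F i).
by rewrite ipC ip_suml; apply: eq_bigr => i; rewrite ipC. Qed.

Lemma ip_ge0 p : 0 <= ip p p. exact: Ip_sqr_ge0. Qed.
Lemma ip_eq0 p : ip p p = 0 -> pev p = (fun=> 0).
exact: Ip_sqr_eq0. Qed.

Lemma ip_extl p p' q : pev p = pev p' -> ip p q = ip p' q.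
by move=> e; apply: eq_Ip; apply/funext => x; rewrite !pevM e. Qed.
Lemma ip_extr p p' q : pev p = pev p' -> ip q p = ip q p'.
by move=> e; rewrite !(ipC q) (ip_extl _ e). Qed.
Lemma ip_0ext p q : pev p = (fun=> 0) -> ip p q = 0.
move=> e; rewrite (@ip_extl _ 0) ?ip0l// e.
by apply/funext => x; rewrite pev0.
Qed.
Lemma pev_eqP p q : pev p = pev q <-> ip (p - q) (p - q) = 0.
split=> [e|/ip_eq0 e].
 by apply: ip_0ext; apply/funext => x; rewrite pevB e subrr.
apply/funext => x; apply/eqP; rewrite -subr_eq0 -pevB; apply/eqP.
by rewrite e.
Qed.

Lemma Ip_rot i p : Ip (rot i p) = 0.
elim/ord3: i; rewrite ?(rot_tgr p) IpB !Ip_tgr !mulrA -mulrBr.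
- by rewrite (mulrC (px R e2)) subrr mulr0.
- by rewrite (mulrC (px R e0)) subrr mulr0.
- by rewrite (mulrC (px R e1)) subrr mulr0.
Qed.

Lemma ip_rot i p q : ip (rot i p) q = - ip p (rot i q).
by apply/eqP; rewrite -subr_eq0 opprK -IpD -rotM Ip_rot.
Qed.

Lemma Ip_bk p q : Ip (bk p q) = 0.
have -> : bk p q = rot e0 (D e0 p * q) + rot e1 (D e1 p * q) +
  rot e2 (D e2 p * q) - (rot e0 (D e0 p) + rot e1 (D e1 p) + rot e2 (D e2 p)) * q.
 by rewrite !rotM bk_rot; ring.
by rewrite sum_rotD mul0r subr0 !IpD !Ip_rot !addr0.
Qed.

Lemma ip_bk p q r : ip (bk p q) r = - ip q (bk p r).
by apply/eqP; rewrite -subr_eq0 opprK -IpD -bkMr Ip_bk.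
Qed.

Lemma ip_bk_self p q : ip (bk p q) q = 0.
by have := ip_bk p q q; rewrite (ipC q) => /eqP; rewrite -addr_eq0 -mulr2n mulrn_eq0 => /eqP. Qed.
Lemma ip_lapp p q : ip (lapp p) q =
 - (ip (rot e0 p) (rot e0 q) + ip (rot e1 p) (rot e1 q) + ip (rot e2 p) (rot e2 q)).
by rewrite !ipDl !ip_rot !opprD. Qed.

Lemma ip_lappC p q : ip (lapp p) q = ip p (lapp q).
by rewrite ip_lapp (ipC p) ip_lapp (ipC (rot e0 q)) (ipC (rot e1 q)) (ipC (rot e2 q)).
Qed.

(** By skew-symmetry, the squared norm of the rotation of [p - q] is a pairing with [p - q], which
    vanishes on the sphere. The same device serves for every operator having an adjoint. *)
Lemma pev_rot i p q : pev p = pev q -> pev (rot i p) = pev (rot i q).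
move=> e; apply/pev_eqP; rewrite -rotB ip_rot.
by rewrite ip_0ext ?oppr0//; apply/funext => x; rewrite pevB e subrr.
Qed.

Lemma pev_lapp p q : pev p = pev q -> pev (lapp p) = pev (lapp q).
by move=> e; apply/funext => x; rewrite !pevD; do !congr (_ + _);
 congr (_ x); do 2 apply: pev_rot.
Qed.

Lemma pev_bkr p q r : pev p = pev q -> pev (bk r p) = pev (bk r q).
move=> e; apply/pev_eqP; rewrite -bkBr ip_bk.
by rewrite ip_0ext ?oppr0//; apply/funext => x; rewrite pevB e subrr.
Qed.
Lemma pev_bkl p q r : pev p = pev q -> pev (bk p r) = pev (bk q r).
move=> e; have h := pev_bkr r e; rewrite (bkC p r) (bkC q r) in h.
apply/funext => x; apply: oppr_inj; rewrite -!pevN.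
exact: (congr1 (fun f => f x) h).
Qed.

(** Splits the Euclidean Laplacian into a radial and an angular part. As [eul] multiplies degree [s]
    by [s], harmonic polynomials get the eigenvalue [- s (s + 1)]. *)
Lemma lapp_eul p : lapp p = r2 R * (D e0 (D e0 p) + D e1 (D e1 p) + D e2 (D e2 p))
 - (eul (eul p) + eul p).
rewrite /lapp !rotE /eul !(mDN, mDD, mDM, pdx) /=.
by rewrite /r2; ring.
Qed.

Definition mono (a b c : nat) : P := px R e0 ^+ a * px R e1 ^+ b * px R e2 ^+ c.

Lemma DXn i j n : D i (px R j ^+ n) = (n * (i == j))%:R *: px R j ^+ n.-1.
elim: n => [|n IH].
 rewrite scale0r expr0; apply: (@addrI _ (D i 1)).
 by rewrite addr0 -{3}[1](mulr1 (1 : P)) mDM mulr1 mul1r.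
rewrite exprS mDM IH pdx; case: eqP => _; rewrite ?muln0 ?muln1 ?scale0r ?mul0r ?mulr0 ?addr0// mul1r.
case: n {IH} => [|n] /=; first by rewrite !scale0r mulr0 addr0 scale1r.
by rewrite -scalerAr -exprS -{1}[_ n.+1]scale1r -scalerDl.
Qed.

Lemma D_mono a b c : (D e0 (mono a b c) = a%:R *: mono a.-1 b c) *
 (D e1 (mono a b c) = b%:R *: mono a b.-1 c) *
 (D e2 (mono a b c) = c%:R *: mono a b c.-1).
do !split; rewrite /mono !mDM !DXn !muln1 !muln0 !scale0r !(mul0r, mulr0, addr0, add0r).
- by rewrite -!scalerAl.
- by rewrite -scalerAr -scalerAl.
- by rewrite -scalerAr.
Qed.

Lemma px_mono a b c : (px R e0 * mono a b c = mono a.+1 b c) *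
 (px R e1 * mono a b c = mono a b.+1 c) * (px R e2 * mono a b c = mono a b c.+1).
by rewrite /mono; do !split; rewrite !exprS; ring. Qed.

Lemma eul_mono a b c : eul (mono a b c) = (a + b + c)%:R *: mono a b c.
rewrite /eul !D_mono -!scalerAr !px_mono.
have H k (u v : P) : ((0 < k)%N -> u = v) -> k%:R *: u = k%:R *: v.
 by case: k => [_|k ->//]; rewrite !scale0r.
by rewrite !natrD !scalerDl; congr (_ + _ + _); apply: H => /prednK ->.
Qed.

(** Polynomials of degree at most [s], modulo those vanishing on the sphere, encoded as the least
    class closed under combinations and equality on the sphere that contains the monomials. The
    encoding is its own induction principle. *)
Definition Sp (s : nat) p := forall Q : P -> Prop,
 (forall a p q, Q p -> Q q -> Q (a *: p + q)) ->
 (forall p q, pev p = pev q -> Q p -> Q q) ->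
 (forall a b c, (a + b + c <= s)%N -> Q (mono a b c)) -> Q p.

Lemma Sp_lin s a p q : Sp s p -> Sp s q -> Sp s (a *: p + q).
by move=> hp hq Q Ql Qe Qm; apply: (Ql); [exact: hp|exact: hq]. Qed.
Lemma Sp_ext s p q : pev p = pev q -> Sp s p -> Sp s q.
by move=> e hp Q Ql Qe Qm; apply: (Qe _ _ e); exact: hp. Qed.
Lemma Sp_mono s a b c : (a + b + c <= s)%N -> Sp s (mono a b c).
by move=> h Q Ql Qe Qm; exact: Qm. Qed.
Lemma Sp_le s t p : (s <= t)%N -> Sp s p -> Sp t p.
move=> st; apply=> [a v|u v|a b c abc]; first exact: Sp_lin.
 exact: Sp_ext.
by apply: Sp_mono; exact: leq_trans st.
Qed.
Lemma Sp0 s : Sp s 0.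
by have := @Sp_lin s (-1) _ _ (Sp_mono (leq0n s : 0 + 0 + 0 <= s)%N)
 (Sp_mono (leq0n s : 0 + 0 + 0 <= s)%N); rewrite scaleN1r addNr.
Qed.
Lemma SpZ s a p : Sp s p -> Sp s (a *: p).
by move=> h; rewrite -[_ *: _]addr0; apply: Sp_lin => //; exact: Sp0. Qed.
Lemma SpD s p q : Sp s p -> Sp s q -> Sp s (p + q).
by move=> h; rewrite -[p]scale1r; exact: Sp_lin. Qed.
Lemma SpN s p : Sp s p -> Sp s (- p).
by rewrite -scaleN1r; exact: SpZ. Qed.
Lemma SpB s p q : Sp s p -> Sp s q -> Sp s (p - q).
by move=> ? /SpN; exact: SpD. Qed.
Lemma Sp_sum s (T : Type) (l : seq T) (c : pred T) (F : T -> P) :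
 (forall t : T, c t -> Sp s (F t)) -> Sp s (\sum_(t <- l | c t) F t).
by move=> h; elim/big_ind: _ => //; [exact: Sp0|exact: SpD]. Qed.

Lemma Sp_exists p : exists s, Sp s p.
apply: (@m_ind R P (fun p => exists s, Sp s p)) => [a b c|a u v [s hs] [t ht]].
 by exists (a + b + c)%N; exact: Sp_mono.
exists (maxn s t); apply: Sp_lin; first exact: Sp_le (leq_maxl _ _) hs.
exact: Sp_le (leq_maxr _ _) ht.
Qed.

Lemma Sp_rot s i p : Sp s p -> Sp s (rot i p).
move=> h; apply: (h (fun u => Sp s (rot i u))) => {h} [a u v hu hv|u v e hu|a b c abc].
- by rewrite rotD rotZ; exact: Sp_lin.
- by apply: Sp_ext hu; exact: pev_rot.
have H k (u : P) : (0 < k -> Sp s u)%N -> Sp s (k%:R *: u).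
 by case: k => [|k] h; [rewrite scale0r; exact: Sp0|apply: SpZ; exact: h].
elim/ord3: i; rewrite rotE !D_mono -!scalerAr !px_mono; apply: SpB; apply: H => k0;
 by apply: Sp_mono; lia.
Qed.

Lemma Sp_lapp s p : Sp s p -> Sp s (lapp p).
by move=> h; apply: SpD; [apply: SpD|]; do 2 apply: Sp_rot. Qed.
(** In top degree [lapp] is the expected eigenvalue up to [r2] times a Euclidean Laplacian, and
    [r2 = 1] on the sphere leaves there a polynomial of lower degree. *)
Lemma Sp_lapp_top s p : Sp s.+1 p ->
 Sp s (lapp p + (s.+1 * s.+2)%:R *: p).
move=> h; apply: (h (fun u => Sp s (lapp u + (s.+1 * s.+2)%:R *: u))) => {h} [a u v hu hv|u v e hu|a b c].
- rewrite [lapp _]linearP scalerDr addrACA scalerA mulrC -scalerA -scalerDr.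
 exact: Sp_lin.
- apply: Sp_ext hu; apply/funext => x.
 by rewrite (pevD (lapp u)) (pevD (lapp v)) !pevZ e (pev_lapp e).
rewrite leq_eqVlt => /orP[/eqP abc|abc]; last first.
 by apply: SpD; [apply: Sp_lapp|apply: SpZ]; exact: Sp_mono.
have eZ k (u : P) : eul (k *: u) = k *: eul u.
 by rewrite /eul !mDZ -!scalerAr !scalerDr.
rewrite lapp_eul (eul_mono a) eZ (eul_mono a) abc -addrA.
have -> : - (s.+1%:R *: (s.+1%:R *: mono a b c) + s.+1%:R *: mono a b c) +
  (s.+1 * s.+2)%:R *: mono a b c = 0.
 rewrite scalerA -scalerDl -scaleNr -scalerDl -[RHS](scale0r (mono a b c)).
 congr (_ *: _); ring.
rewrite addr0.
apply: (@Sp_ext _ (D e0 (D e0 (mono a b c)) + D e1 (D e1 (mono a b c)) +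
  D e2 (D e2 (mono a b c)))).
 by apply/funext => x; rewrite pevM pev_r2 mul1r.
rewrite !D_mono !mDZ !D_mono.
have H k l (u : P) : (1 < k -> Sp s u)%N -> l = k.-1 -> Sp s (k%:R *: (l%:R *: u)).
 case: k => [|[|k]] h ->; rewrite ?scale0r ?scaler0; try exact: Sp0.
 by do 2 apply: SpZ; exact: h.
by apply: SpD; [apply: SpD|]; apply: H => // k1; apply: Sp_mono; lia.
Qed.

Lemma pev_tgr p : (pev (tgr e0 p) = pev (px R e2 * rot e1 p - px R e1 * rot e2 p)) *
 (pev (tgr e1 p) = pev (px R e0 * rot e2 p - px R e2 * rot e0 p)) *
 (pev (tgr e2 p) = pev (px R e1 * rot e0 p - px R e0 * rot e1 p)).
have H (u v w : P) : u = v + (1 - r2 R) * w -> pev u = pev v.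
 by move=> ->; apply/funext => x; rewrite pevD pevM pevB pev1 pev_r2 subrr mul0r addr0.
do !split.
- by apply: (H _ _ (D e0 p)); rewrite !rotE /tgr /eul /r2; ring.
- by apply: (H _ _ (D e1 p)); rewrite !rotE /tgr /eul /r2; ring.
- by apply: (H _ _ (D e2 p)); rewrite !rotE /tgr /eul /r2; ring.
Qed.

End inner_product.

(** * The Cauchy-Schwarz inequality for finite sums *)

Section real_sums.
Context (R : realFieldType).

Lemma sum_CS (I : Type) (s : seq I) (a b : I -> R) :
 (\sum_(i <- s) a i * b i) ^+ 2 <=
 (\sum_(i <- s) a i ^+ 2) * (\sum_(i <- s) b i ^+ 2).
set C := \sum_(i <- s) a i * b i; set A := \sum_(i <- s) a i ^+ 2.
set B := \sum_(i <- s) b i ^+ 2.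
have A0 : 0 <= A by apply: sumr_ge0 => i _; exact: sqr_ge0.
have B0 : 0 <= B by apply: sumr_ge0 => i _; exact: sqr_ge0.
have H u v : 0 <= u ^+ 2 * A + 2 * (u * v) * C + v ^+ 2 * B.
 rewrite !mulr_sumr -!big_split /=; apply: sumr_ge0 => i _.
 by have := sqr_ge0 (u * a i + v * b i); lra.
have [B00|BN0] := eqVneq B 0.
 have := H (- C) (A + 1); rewrite B00 mulr0 addr0 !mulr0.
 nra.
have Bp : 0 < B by rewrite lt_neqAle eq_sym BN0.
rewrite -subr_ge0 -(pmulr_rge0 _ Bp); have := H B (- C); lra.
Qed.

End real_sums.

(** * An orthonormal basis of eigenfunctions and the Sobolev embedding *)

Section spectral_basis.
Context (R : realType).
Notation P := (pol R).
Implicit Types (p q r : P) (x : S2 R).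
Notation D := (@mD R P).

(** On the sphere [z ^ 2 = 1 - x ^ 2 - y ^ 2], so monomials with [z] to the power 0 or 1 suffice. In
    degree [s] there are [s + 1] of the first kind and [s] of the second: they fill the indices from
    [s ^ 2] to [(s + 1) ^ 2 - 1]. *)
Definition mon_enum (k : nat) : P :=
 let s := Nat.sqrt k in let i := (k - s ^ 2)%N in
 if (i <= s)%N then mono R i (s - i) 0 else mono R (i - s.+1) (s.*2 - i) 1.

Lemma sqrt_spec k : (Nat.sqrt k ^ 2 <= k < (Nat.sqrt k).+1 ^ 2)%N.
have [h1 h2] := PeanoNat.Nat.sqrt_spec k (PeanoNat.Nat.le_0_l k).
by apply/andP; split; [exact/ssrnat.leP|exact/ssrnat.ltP].
Qed.

Lemma sqrt_uniq s k : (s ^ 2 <= k < s.+1 ^ 2)%N -> Nat.sqrt k = s.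
move=> /andP[h1 h2]; apply: PeanoNat.Nat.sqrt_unique; split.
 by apply/ssrnat.leP.
by apply/ssrnat.ltP.
Qed.

Lemma sqrt_le j k : (j <= k)%N -> (Nat.sqrt j <= Nat.sqrt k)%N.
by move=> /ssrnat.leP jk; apply/ssrnat.leP; exact: PeanoNat.Nat.sqrt_le_mono. Qed.

(* Vanishing remainders are kept as (null) basis elements, so that no linear
  independence has to be proved: [0^-1 = 0]. *)
Fixpoint gram_schmidt (n : nat) : seq P :=
 if n is n'.+1 then
  let s := gram_schmidt n' in
  let r := mon_enum n' - \sum_(y <- s) ip (mon_enum n') y *: y in
  rcons s ((Num.sqrt (ip r r))^-1 *: r)
 else [::].

Definition Y (k : nat) : P := nth 0 (gram_schmidt k.+1) k.

Lemma size_gram_schmidt n : size (gram_schmidt n) = n.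
by elim: n => //= n IH; rewrite size_rcons IH. Qed.
Lemma gram_schmidtE n : gram_schmidt n = [seq Y j | j <- iota 0 n].
elim: n => // n IH; rewrite -{2}addn1 iotaD map_cat -IH /= add0n cats1.
by rewrite /Y nth_rcons size_gram_schmidt ltnn eqxx.
Qed.

Definition gs_rem k : P := mon_enum k - \sum_(j < k) ip (mon_enum k) (Y j) *: Y j.

Lemma YE k : Y k = (Num.sqrt (ip (gs_rem k) (gs_rem k)))^-1 *: gs_rem k.
rewrite /Y /= nth_rcons size_gram_schmidt ltnn eqxx gram_schmidtE big_map.
by rewrite (_ : iota 0 k = index_iota 0 k) ?big_mkord// /index_iota subn0.
Qed.

Definition nY k := ip (Y k) (Y k).

Lemma nY01 k : nY k = 0 \/ nY k = 1.
rewrite /nY YE ipZl ipZr; have := ip_ge0 (gs_rem k).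
set c := ip _ _; rewrite le_eqVlt => /orP[/eqP <-|c0]; first by left; rewrite !mulr0.
right; rewrite mulrA -invfM -expr2 sqr_sqrtr ?ltW// mulVf// gt_eqF//.
Qed.

Lemma ip_Y_nY p k : ip p (Y k) * nY k = ip p (Y k).
case: (nY01 k) => h; rewrite h ?mulr1// mulr0.
by rewrite ipC (ip_0ext _ (ip_eq0 h)).
Qed.

Lemma Y_orth_lt i j : (i < j)%N -> ip (Y i) (Y j) = 0.
elim/ltn_ind: j i => j IH i ij.
rewrite (YE j) ipZr; suff -> : ip (Y i) (gs_rem j) = 0 by rewrite mulr0.
rewrite ipBr ip_sumr (bigD1 (Ordinal ij))//= big1 ?addr0.
 by rewrite ipZr ip_Y_nY (ipC (Y i)) subrr.
move=> l li; rewrite ipZr; case: (ltngtP i l) => [il|li'|il].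
- by rewrite (IH l (ltn_ord l) i il) mulr0.
- by rewrite (ipC (Y i)) (IH i ij l li') mulr0.
- by move: li; rewrite -val_eqE/= il eqxx.
Qed.

Lemma Y_orth i j : i != j -> ip (Y i) (Y j) = 0.
by rewrite neq_ltn => /orP[|] h; [|rewrite ipC]; exact: Y_orth_lt.
Qed.

Lemma Y_rem k j : (j < k)%N -> ip (gs_rem k) (Y j) = 0.
move=> jk; have [h|h] := eqVneq (ip (gs_rem k) (gs_rem k)) 0.
 by rewrite (ip_0ext _ (ip_eq0 h)).
have := Y_orth_lt jk; rewrite (YE k) ipZr ipC => /eqP.
rewrite mulf_eq0 => /orP[|/eqP//]; rewrite invr_eq0 sqrtr_eq0 le_eqVlt (negbTE h) /=.
by rewrite ltNge ip_ge0.
Qed.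

Lemma mon_enum_span k :
 pev (mon_enum k) = pev (\sum_(j < k.+1) ip (mon_enum k) (Y j) *: Y j).
have rE : ip (mon_enum k) (gs_rem k) = ip (gs_rem k) (gs_rem k).
 rewrite ipBl ip_suml big1 ?subr0// => j _.
 by rewrite ipZl (ipC (Y j)) Y_rem ?mulr0.
have h : pev (gs_rem k) = pev (ip (mon_enum k) (Y k) *: Y k).
 have [r0|rN] := eqVneq (ip (gs_rem k) (gs_rem k)) 0.
  apply/funext => x; rewrite pevZ YE pevZ (ip_eq0 r0) !mulr0//.
 rewrite (YE k) ipZr rE scalerA mulrAC -invfM -expr2 sqr_sqrtr ?ip_ge0//.
 by rewrite mulVf// scale1r.
apply/funext => x; rewrite big_ord_recr /= pevD -h -pevD addrC.
by rewrite subrK.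
Qed.

Definition cf p k := ip p (Y k).
Definition proj n p : P := \sum_(k < n) cf p k *: Y k.

Lemma cf_sum n (a : nat -> R) k :
 cf (\sum_(j < n) a j *: Y j) k = if (k < n)%N then a k * nY k else 0.
rewrite /cf ip_suml; case: ifPn => [kn|kn].
 rewrite (bigD1 (Ordinal kn))//= big1 ?addr0 ?ipZl// => j jk.
 by rewrite ipZl Y_orth ?mulr0.
rewrite big1// => j; rewrite ipZl Y_orth ?mulr0//.
by apply: contra kn => /eqP <-.
Qed.

Lemma cf_proj n p k : cf (proj n p) k = if (k < n)%N then cf p k else 0.
by rewrite cf_sum; rewrite ip_Y_nY. Qed.
Lemma cf_lin a p q k : cf (a *: p + q) k = a * cf p k + cf q k.
by rewrite /cf ipDl ipZl. Qed.
Lemma pev_proj n p x : pev (proj n p) x = \sum_(k < n) cf p k * pev (Y k) x.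
by rewrite pev_sum; apply: eq_bigr => k; rewrite pevZ. Qed.

Definition inV n p := pev p = pev (proj n p).

Lemma inV_lin n a p q : inV n p -> inV n q -> inV n (a *: p + q).
move=> hp hq; apply/funext => x.
rewrite pevD pevZ hp hq !pev_proj mulr_sumr -big_split/=.
by apply: eq_bigr => k; rewrite cf_lin mulrDl mulrA.
Qed.

Lemma cf_ext p q : pev p = pev q -> cf p = cf q.
by move=> e; apply/funext => k; exact: ip_extl. Qed.
Lemma inV_ext n p q : pev p = pev q -> inV n p -> inV n q.
by rewrite /inV /proj => e; rewrite (cf_ext e) e. Qed.
Lemma cf_eq0 n p k : inV n p -> (n <= k)%N -> cf p k = 0.
by move=> h nk; rewrite (cf_ext h) cf_proj ltnNge nk. Qed.
Lemma inV_le n m p : (n <= m)%N -> inV n p -> inV m p.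
move=> nm h; rewrite /inV h; apply/funext => x; rewrite !pev_proj.
rewrite (big_ord_widen _ (fun k => cf p k * pev (Y k) x) nm).
rewrite big_mkcond /=; apply: eq_bigr => k _.
by case: ltnP => // nk; rewrite (cf_eq0 h nk) mul0r.
Qed.

Lemma inV_Y n k : (k < n)%N -> inV n (Y k).
move=> kn; apply/funext => x; rewrite pev_proj (bigD1 (Ordinal kn))//= big1 ?addr0.
 rewrite /cf -/(nY k); case: (nY01 k) => h; rewrite h ?mul1r// mul0r.
 by rewrite (ip_eq0 h).
by move=> j; rewrite eq_sym => jk; rewrite /cf Y_orth ?mul0r.
Qed.

Lemma inV0 n : inV n 0.
apply/funext => x; rewrite pev_proj pev0 big1// => k _.
by rewrite /cf ip0l mul0r.
Qed.

Lemma inV_sum n (m : nat) (F : nat -> P) :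
 (forall k, (k < m)%N -> inV n (F k)) -> inV n (\sum_(k < m) F k).
elim: m => [|m IH] h; first by rewrite big_ord0; exact: inV0.
rewrite big_ord_recr /= addrC -[F m]scale1r; apply: inV_lin; first exact: h.
by apply: IH => k km; apply: h; rewrite ltnW.
Qed.

Lemma inVZ n a p : inV n p -> inV n (a *: p).
by move=> h; rewrite -[_ *: _]addr0; apply: inV_lin => //; exact: inV0. Qed.
Lemma inV_proj n p : inV n (proj n p).
by apply: (@inV_sum _ _ (fun k => cf p k *: Y k)) => k kn; exact/inVZ/inV_Y. Qed.
Lemma inV_mon_enum n k : (k < n)%N -> inV n (mon_enum k).
move=> kn; apply: (inV_ext (esym (mon_enum_span k))).
apply: (@inV_sum _ _ (fun j => ip (mon_enum k) (Y j) *: Y j)) => j jk.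
by apply/inVZ/inV_Y; lia.
Qed.

Lemma Sp_inV s p : Sp s p -> inV (s.+1 ^ 2) p.
move=> h; apply: (h (inV (s.+1 ^ 2))) => {p h} [a p q|p q|a b c].
- exact: inV_lin.
- exact: inV_ext.
elim/ltn_ind: c a b => -[|[|c]] IH a b abc.
- have [e1 e2] : Nat.sqrt ((a + b) ^ 2 + a) = (a + b)%N /\ ((a + b) ^ 2 + a < s.+1 ^ 2)%N.
  by split; [apply: sqrt_uniq|]; nia.
 have := inV_mon_enum e2; rewrite /mon_enum e1.
 by rewrite addKn leq_addr addKn.
- have [e1 e2] : Nat.sqrt ((a + b).+1 ^ 2 + ((a + b).+2 + a)) = (a + b).+1 /\
   ((a + b).+1 ^ 2 + ((a + b).+2 + a) < s.+1 ^ 2)%N.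
  by split; [apply: sqrt_uniq|]; nia.
 have := inV_mon_enum e2; rewrite /mon_enum e1.
 have E2 : ((a + b).+1.*2 - ((a + b).+2 + a) = b)%N by lia.
 by rewrite ifN ?addKn ?E2//; lia.
(* The relation [r2 = 1] trades two powers of [z] for monomials with a smaller exponent of [z]. *)
have zE : pev (1 *: mono R a b c + (- 1 *: mono R a.+2 b c + - 1 *: mono R a b.+2 c)) =
  pev (mono R a b c.+2).
 have -> : 1 *: mono R a b c + (- 1 *: mono R a.+2 b c + - 1 *: mono R a b.+2 c)
   = mono R a b c.+2 + (1 - r2 R) * mono R a b c.
  by rewrite !scaleN1r scale1r /mono /r2 !exprS; ring.
 by apply/funext => x; rewrite pevD (pevM (1 - r2 R)) pevB pev1 pev_r2 subrr mul0r addr0.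
by apply: (inV_ext zE); apply: inV_lin; [|apply: inV_lin; [|apply: inVZ]]; apply: IH; lia.
Qed.

Lemma inV_exists p : exists n, inV n p.
by have [s /Sp_inV h] := Sp_exists p; exists (s.+1 ^ 2)%N. Qed.
Lemma Sp_Y k : Sp (Nat.sqrt k) (Y k).
elim/ltn_ind: k => k IH; rewrite YE; apply: SpZ; apply: SpB.
 have /andP[h1 h2] := sqrt_spec k.
 by rewrite /mon_enum; case: ifPn => h; apply: Sp_mono; nia.
apply: Sp_sum => j _; apply: SpZ; apply: Sp_le (IH _ (ltn_ord j)).
exact: sqrt_le (ltnW (ltn_ord j)).
Qed.

Lemma ip_Y_low k s q : Sp s q -> (s.+1 ^ 2 <= k)%N -> ip (Y k) q = 0.
by move=> /Sp_inV sk; rewrite ipC; exact: cf_eq0. Qed.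
Lemma ip_parseval n p q : inV n p -> ip p q = \sum_(k < n) cf p k * cf q k.
move=> h; rewrite (ip_extl q h) ip_suml; apply: eq_bigr => k _.
by rewrite ipZl (ipC (Y k)).
Qed.

(** The index [k] belongs to the block of degree [s = Nat.sqrt k], where minus the Laplacian is
    [s (s + 1)]. *)
Definition lam k : R := (Nat.sqrt k * (Nat.sqrt k).+1)%:R.

Lemma lam_ge0 k : 0 <= lam k. by []. Qed.
Lemma lam0 : lam 0 = 0. by []. Qed.
Lemma lam_gt0 k : (0 < k)%N -> 2 <= lam k.
move=> k0; rewrite ler_nat.
have h : (1 <= Nat.sqrt k)%N := sqrt_le k0.
by nia.
Qed.
Lemma lam_le j k : (j <= k)%N -> lam j <= lam k.
by move=> /sqrt_le h; rewrite ler_nat; nia. Qed.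
(** The defect [u] has lower degree, by [Sp_lapp_top], while [Y k] and its Laplacian are orthogonal
    to lower degrees; so [u] is orthogonal to itself. *)
Lemma lapp_Y k : pev (lapp (Y k)) = pev (- lam k *: Y k).
have := sqrt_spec k; have := @Sp_Y k; rewrite /lam.
case: (Nat.sqrt k) => [|s] hk /andP[sk ks].
 rewrite oppr0 scale0r; apply: (hk (fun u => pev (lapp u) = pev 0)) => [a p q hp hq|p q e hp|a b c].
 - rewrite [lapp _]linearP; apply/funext => x; rewrite pevD pevZ hp hq.
  by rewrite pev0 mulr0 addr0.
 - by rewrite -(pev_lapp e).
 rewrite leqn0 !addn_eq0 => /andP[/andP[/eqP-> /eqP->] /eqP->].
 have -> : lapp (mono R 0 0 0) = 0 => //.
 rewrite lapp_eul eul_mono !D_mono !scale0r.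
 have D0 j : D j 0 = 0 by exact: mD0.
 by rewrite /eul !D0 !mulr0 !addr0 mulr0 subr0.
set u := lapp (Y k) + (s.+1 * s.+2)%:R *: Y k.
have Su : Sp s u by exact: Sp_lapp_top.
have u0 : pev u = (fun=> 0).
 apply: ip_eq0; rewrite ipDl ipZl ip_lappC !(@ip_Y_low _ s) ?mulr0 ?addr0//.
 exact: Sp_lapp.
apply/funext => x; apply/eqP; rewrite -subr_eq0 pevZ mulNr opprK -pevZ -pevD.
by rewrite u0.
Qed.

Lemma cf_lapp p k : cf (lapp p) k = - lam k * cf p k.
by rewrite /cf ip_lappC (ip_extr _ (lapp_Y k)) ipZr. Qed.
Lemma inV_lapp n p : inV n p -> inV n (lapp p).
move=> h; apply: (inV_ext (esym (pev_lapp h))); rewrite linear_sum /=.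
apply: (@inV_sum _ _ (fun k => lapp (cf p k *: Y k))) => k kn.
rewrite linearZ /=; apply/inVZ/(inV_ext (esym (lapp_Y k))).
by apply/inVZ/inV_Y.
Qed.

Lemma cf_rot_block i k j : Nat.sqrt j != Nat.sqrt k -> cf (rot i (Y k)) j = 0.
rewrite neq_ltn => /orP[h|h]; rewrite /cf.
 rewrite ip_rot (ip_Y_low (Sp_rot i (@Sp_Y j))) ?oppr0//.
 by have := sqrt_spec k; nia.
rewrite ipC (ip_Y_low (Sp_rot i (@Sp_Y k)))//.
by have := sqrt_spec j; nia.
Qed.

(** The diagonal of the reproducing kernel of degree [s]. Its rotation invariance replaces the
    addition theorem in bounding harmonics pointwise. *)
Definition kern s : P := \sum_(s ^ 2 <= k < s.+1 ^ 2) Y k * Y k.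

Lemma kern_rot s i : pev (rot i (kern s)) = (fun=> 0).
apply/funext => x; rewrite /kern.
have -> : rot i (\sum_(s ^ 2 <= k < s.+1 ^ 2) Y k * Y k) =
  \sum_(s ^ 2 <= k < s.+1 ^ 2) (rot i (Y k) * Y k + Y k * rot i (Y k)).
 by rewrite linear_sum; apply: eq_bigr => k _; exact: rotM.
rewrite pev_sum.
under eq_bigr do rewrite pevD !pevM (mulrC (pev (rot i _) _)) -mulr2n.
rewrite sumrMnl; apply/eqP; rewrite mulrn_eq0 /=; apply/eqP.
have rE k : (s ^ 2 <= k < s.+1 ^ 2)%N -> pev (Y k) x * pev (rot i (Y k)) x =
  \sum_(s ^ 2 <= j < s.+1 ^ 2) cf (rot i (Y k)) j * pev (Y j) x * pev (Y k) x.
 move=> hk; have sk := sqrt_uniq hk.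
 have h : inV (s.+1 ^ 2) (rot i (Y k)).
  by apply: Sp_inV; rewrite -sk; exact: (Sp_rot i (@Sp_Y k)).
 rewrite h pev_proj -(big_mkord xpredT (fun j => cf (rot i (Y k)) j * pev (Y j) x)).
 rewrite (@big_cat_nat _ _ _ (s ^ 2)) //=; last by nia.
 rewrite [X in X + _]big_nat big1 ?add0r => [|j js].
  by rewrite mulrC mulr_suml.
 rewrite cf_rot_block ?mul0r// sk neq_ltn.
 by have := sqrt_spec j; nia.
rewrite big_nat; under eq_bigr => k hk do rewrite (rE k hk).
rewrite -big_nat; set S := LHS.
(* The coefficients [cf (rot i (Y k)) j] are skew-symmetric in [j] and [k], so exchanging the sums
   changes the sign. *)
suff : S = - S by move=> /eqP; rewrite -addr_eq0 -mulr2n mulrn_eq0 => /eqP.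
rewrite {1}/S exchange_big /= -sumrN; apply: eq_bigr => j _.
rewrite -sumrN; apply: eq_bigr => k _.
by rewrite {1}/cf ip_rot (ipC (Y k)) -/(cf _ _); ring.
Qed.

Definition totarea : R := Ip (1 : P).

Lemma totarea_gt0 : 0 < totarea.
have h : totarea = ip 1 1 by rewrite /ip mulr1.
rewrite lt_neqAle h ip_ge0 andbT eq_sym; apply/eqP => /ip_eq0 e.
have := congr1 (fun f => f point) e; rewrite pev1 => /eqP.
by rewrite oner_eq0.
Qed.

Lemma pev_Y0 x : exists c, Y 0 = c *: 1.
rewrite YE /gs_rem big_ord0 subr0 /mon_enum /=.
by rewrite /mono !mulr1; eexists.
Qed.

(** [lapp (kern s)] vanishes on the sphere, so only the constant mode is left; its value times the
    area is a sum of [2 s + 1] squared norms, each at most one. *)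
Lemma kern_le s x : pev (kern s) x <= s.*2.+1%:R / totarea.
have [c Y0E] := pev_Y0 x.
have l0 : pev (lapp (kern s)) = (fun=> 0).
 apply/funext => y; rewrite !pevD.
 have h i : pev (rot i (rot i (kern s))) y = 0.
  have e : pev (rot i (kern s)) = pev 0.
   by rewrite kern_rot; apply/funext => z; rewrite pev0.
  by rewrite (pev_rot i e) (_ : rot i 0 = 0) ?pev0//; exact: linear0.
 by rewrite !h !addr0.
have [n hn] := inV_exists (kern s).
have kE y : pev (kern s) y = cf (kern s) 0 * c.
 rewrite (inV_le (leqnSn n) hn) pev_proj big_ord_recl /= big1 ?addr0.
  by rewrite Y0E pevZ pev1 mulr1.
 move=> k; rewrite [X in X * _](_ : _ = 0) ?mul0r//.
 have := cf_lapp (kern s) (bump 0 k); rewrite {1}/cf (ip_0ext _ l0) => /esym/eqP.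
 rewrite mulf_eq0 oppr_eq0 => /orP[|/eqP//].
 by have := @lam_gt0 (bump 0 k) isT; lra.
rewrite ler_pdivlMr ?totarea_gt0//.
have -> : pev (kern s) x * totarea = Ip (kern s).
 rewrite kE -IpZ; apply: eq_Ip; apply/funext => y.
 by rewrite pevZ pev1 mulr1.
have -> : Ip (\sum_(s ^ 2 <= k < s.+1 ^ 2) Y k * Y k) =
  \sum_(s ^ 2 <= k < s.+1 ^ 2) nY k.
 elim: index_iota => [|k l IH]; first by rewrite !big_nil Ip0.
 by rewrite !big_cons IpD IH.
apply: (@le_trans _ _ (\sum_(s ^ 2 <= k < s.+1 ^ 2) 1)).
 by apply: ler_sum => k; case: (nY01 k) => ->.
rewrite sumr_const_nat ler_nat; lia.
Qed.

(** The bound telescopes: [(2 s + 1) / (s (s + 1)) ^ 2] is the difference of [1 / s ^ 2] and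
    [1 / (s + 1) ^ 2]. *)
Lemma kern_sum_le N x :
 \sum_(1 <= k < N.+1 ^ 2) (pev (Y k) x / lam k) ^+ 2 <=
 totarea^-1 * (1 - (N.+1 ^ 2)%:R^-1).
elim: N => [|N IH]; first by rewrite big_geq// invr1 subrr mulr0.
rewrite (@big_cat_nat _ _ _ (N.+1 ^ 2)) //=; try by nia.
apply: (le_trans (lerD IH (lexx _))).
have -> : \sum_(N.+1 ^ 2 <= k < N.+2 ^ 2) (pev (Y k) x / lam k) ^+ 2 =
  pev (kern N.+1) x / (N.+1 * N.+2)%:R ^+ 2.
 rewrite pev_sum mulr_suml big_nat [RHS]big_nat; apply: eq_bigr => k hk.
 by rewrite /lam (sqrt_uniq hk) expr_div_n pevM.
have := kern_le N.+1 x; set t := pev _ _ => ht.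
have A0 := totarea_gt0.
have n1 : 0 < N.+1%:R :> R by [].
have n2 : N.+2%:R = N.+1%:R + 1 :> R by rewrite natr1.
have n3 : N.+1.*2.+1%:R = 2 * N.+1%:R + 1 :> R by rewrite -natr1 -mul2n natrM.
rewrite n3 in ht; rewrite natrM !natrX n2.
move: (N.+1%:R : R) n1 ht => m n1 ht {n2 n3 IH}.
have m1 : 0 < m + 1 by lra.
apply: (@le_trans _ _ (totarea^-1 * (1 - (m ^+ 2)^-1) +
  (2 * m + 1) / totarea / (m * (m + 1)) ^+ 2)).
 by rewrite lerD2l ler_pM2r// invr_gt0 exprn_gt0// mulr_gt0.
rewrite le_eqVlt; apply/orP; left; apply/eqP.
by field; rewrite !gt_eqF.
Qed.

(** The Sobolev embedding of H^2 into the continuous functions: Cauchy-Schwarz between the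
    coefficients of [lapp p] and the square-summable sequence [Y k x / lam k]. *)
Lemma sup_lapp p x : Ip p = 0 ->
 pev p x ^+ 2 <= totarea^-1 * ip (lapp p) (lapp p).
move=> p0; have [s hs] := Sp_exists p; have hV := Sp_inV hs.
have [c Y0E] := pev_Y0 x.
have c0 : cf p 0 = 0 by rewrite /cf Y0E ipZr /ip mulr1 p0 mulr0.
rewrite (ip_parseval _ (inV_lapp hV)) hV pev_proj.
rewrite -(big_mkord xpredT (fun k => cf p k * pev (Y k) x)).
rewrite -(big_mkord xpredT (fun k => cf (lapp p) k * cf (lapp p) k)).
rewrite [X in X ^+ 2]big_ltn//.
rewrite [X in _ <= _ X]big_ltn//.
rewrite cf_lapp c0 mulr0 !mul0r !add0r.
rewrite (_ : \sum_(1 <= k < _) _ = \sum_(1 <= k < s.+1 ^ 2)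
  (cf (lapp p) k * - (pev (Y k) x / lam k))); last first.
 rewrite big_nat [RHS]big_nat; apply: eq_bigr => k /andP[k1 _]; rewrite cf_lapp.
 have := lam_gt0 k1 => l2; have l0 : lam k != 0 by lra.
 move: (lam k) (cf p k) (pev (Y k) x) l0 => l u v l0.
 by field.
apply: (le_trans (sum_CS _ _ _)).
under [X in _ X <= _]eq_bigr do rewrite sqrrN.
under [X in _ <= _ X]eq_bigr do rewrite -expr2.
rewrite mulrC ler_wpM2r//; first by apply: sumr_ge0 => k _; exact: sqr_ge0.
apply: (le_trans (kern_sum_le s x)).
by rewrite ler_piMr ?invr_ge0 ?(ltW totarea_gt0).
Qed.

End spectral_basis.

(** * Differential inequalities and antiderivatives *)

Section calculus.
Context (R : realType).
Notation leb := (@lebesgue_measure R).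

Lemma is_derive_continuous (f : R -> R) t d : is_derive t (1 : R) f d ->
 {for t, continuous f}.
by move=> [h _]; apply: differentiable_continuous; exact/derivable1_diffP.
Qed.

Lemma is_derive_nincr (f df : R -> R) (a b : R) : a <= b ->
 (forall t, a <= t <= b -> is_derive t (1 : R) f (df t)) ->
 (forall t, a <= t <= b -> df t <= 0) -> f b <= f a.
move=> ab fd df0.
apply: (@ler0_derive1_nincr _ f a b) => //.
- move=> t; rewrite in_itv/= => /andP[at_ tb].
 by case: (fd t) => //; rewrite !ltW.
- move=> t; rewrite in_itv/= => /andP[at_ tb]; have h : a <= t <= b by rewrite !ltW.
 by rewrite derive1E; have [_ ->] := fd t h; exact: df0.
- apply: continuous_in_subspaceT => t; rewrite inE/= in_itv/= => h.
 exact: is_derive_continuous (fd t h).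
Qed.

Lemma is_derive_le (f g df dg : R -> R) (a b : R) : a <= b ->
 (forall t, a <= t <= b -> is_derive t (1 : R) f (df t)) ->
 (forall t, a <= t <= b -> is_derive t (1 : R) g (dg t)) ->
 (forall t, a <= t <= b -> df t <= dg t) -> f b - f a <= g b - g a.
move=> ab fd gd fg.
have h : f b - g b <= f a - g a.
 apply: (@is_derive_nincr (fun t => f t - g t) (fun t => df t - dg t)) => // t ht.
  by apply: is_deriveB; [exact: fd|exact: gd].
 by rewrite subr_le0 fg.
by lra.
Qed.

(** From [exp (- 1 / 2) >= 1 / 2]. All Gronwall estimates below are run with an exponent at most
    one, and this is their factor. *)
Lemma expR1_le4 : expR 1 <= 4 :> R.
have h : 1 + (- (1 / 2)) <= expR (- (1 / 2)) :> R by exact: expR_ge1Dx.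
have e0 := @expR_gt0 R (- (1 / 2)).
have e1 : expR 1 * (expR (- (1 / 2)) ^+ 2) = 1 :> R.
 by rewrite expr2 -!expRD [X in expR X](_ : _ = 0) ?expR0; lra.
move: h e0 e1; move: (expR 1) (expR _) => u v h v0 uv.
have h4 : 4^-1 <= v ^+ 2 by nra.
have u0 : 0 <= u by rewrite -(@pmulr_lge0 _ (v ^+ 2)) ?uv ?exprn_gt0.
by have := ler_wpM2l u0 h4; lra.
Qed.

Lemma gronwall (E dE : R -> R) (K A a b : R) : a <= b ->
 (forall t, a <= t <= b -> is_derive t (1 : R) E (dE t)) ->
 (forall t, a <= t <= b -> dE t <= K * (E t + A)) ->
 E b + A <= (E a + A) * expR (K * (b - a)).
move=> ab Ed dEK.
pose f t := (E t + A) * expR (- (K * (t - a))).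
have fd t : a <= t <= b ->
  is_derive t (1 : R) f ((dE t - K * (E t + A)) * expR (- (K * (t - a)))).
 move=> ht; have Et := Ed t ht; rewrite /f.
 have hd : is_derive t (1 : R) (fun s => expR (- (K * (s - a))))
   (- K * expR (- (K * (t - a)))).
  have h1 : is_derive t (1 : R) (fun s => - (K * (s - a))) (- K).
   by apply: is_derive_eq; rewrite /GRing.scale /=; ring.
  have := @is_derive1_comp R expR (fun s => - (K * (s - a))) t _ _ _ h1.
  by move=> /(_ _ (is_derive_expR _)); rewrite mulrC.
 by apply: is_derive_eq; rewrite /GRing.scale /=; ring.
have := @is_derive_nincr f (fun t => (dE t - K * (E t + A)) * expR (- (K * (t - a)))) a b ab fd.
have h : forall t, a <= t <= b -> (dE t - K * (E t + A)) * expR (- (K * (t - a))) <= 0.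
 by move=> t ht; rewrite mulr_le0_ge0 // subr_le0 dEK.
move=> /(_ h); rewrite /f subrr mulr0 oppr0 expR0 mulr1 => fb.
rewrite -(@ler_pM2r _ (expR (- (K * (b - a)))) ) ?expR_gt0// -mulrA -expRD.
by rewrite addrN expR0 mulr1.
Qed.

Lemma gronwall4 (E dE : R -> R) (K A a b : R) : a <= b ->
 K * (b - a) <= 1 -> 0 <= E a + A ->
 (forall t, a <= t <= b -> is_derive t (1 : R) E (dE t)) ->
 (forall t, a <= t <= b -> dE t <= K * (E t + A)) ->
 E b + A <= 4 * (E a + A).
move=> ab K1 EA Ed dEK; apply: (le_trans (gronwall ab Ed dEK)).
rewrite mulrC ler_wpM2r// (le_trans _ expR1_le4)// ler_expR//.
Qed.

Lemma antiderivative (f : R -> R) (T : R) : 0 < T -> continuous f ->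
 exists G : R -> R, G 0 = 0 /\
  forall t, 0 <= t <= T -> is_derive t (1 : R) G (f t).
move=> T0 cf.
(* The integral starts at -1, which makes 0 an interior point, where the derivative is two-sided. *)
pose H x := (\int[leb]_(t in `[-1, x]) f t).
have ih : leb.-integrable `[-1, T + 1] (EFin \o f).
 apply: continuous_compact_integrable; first exact: segment_compact.
 exact: continuous_subspaceT.
have Hd t : 0 <= t <= T -> is_derive t (1 : R) H (f t).
 move=> /andP[t0 tT].
 have [||h1 h2] := @continuous_FTC1_closed R f (-1) t (T + 1) _ ih _ (cf t).
 - by lra.
 - by lra.
 by apply: DeriveDef; [exact: h1|rewrite -derive1E; exact: h2].
exists (fun t => H t - H 0); split; first by rewrite subrr.
move=> t ht; have ht' := Hd t ht.
by rewrite -[f t]subr0; apply: is_deriveB.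
Qed.

End calculus.

(** * Limits of sequences with geometric increments *)

Section geometric_limit.
Context (R : realType).

(** The intervals of radius [2 * C / 2 ^ m] around [a m] are nested, and the supremum of their left
    ends lies in all of them. *)
Lemma geometric_limit (a : nat -> R) (C : R) : 0 <= C ->
 (forall m, `|a m.+1 - a m| <= C / 2 ^+ m) ->
 exists l, forall m, `|l - a m| <= 2 * C / 2 ^+ m.
move=> C0 ha.
have h2 m : 2 * C / 2 ^+ m.+1 = C / 2 ^+ m :> R.
 by rewrite exprS invfM mulrA [2 * C]mulrC mulfK.
have p2 m : 0 <= C / 2 ^+ m by rewrite divr_ge0.
pose b m := a m - 2 * C / 2 ^+ m; pose c m := a m + 2 * C / 2 ^+ m.
have bS m : b m <= b m.+1.
 have := ha m; rewrite /b h2 ler_norml => /andP[h _].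
 have : 2 * C / 2 ^+ m = C / 2 ^+ m + C / 2 ^+ m :> R by lra.
 lra.
have cS m : c m.+1 <= c m.
 have := ha m; rewrite /c h2 ler_norml => /andP[_ h].
 have : 2 * C / 2 ^+ m = C / 2 ^+ m + C / 2 ^+ m :> R by lra.
 lra.
have bm i j : (i <= j)%N -> b i <= b j.
 elim: j => [|j IH]; first by rewrite leqn0 => /eqP->.
 by rewrite leq_eqVlt => /orP[/eqP->//|]; rewrite ltnS => /IH /le_trans; exact.
have cm i j : (i <= j)%N -> c j <= c i.
 elim: j => [|j IH]; first by rewrite leqn0 => /eqP->.
 rewrite leq_eqVlt => /orP[/eqP->//|]; rewrite ltnS => /IH h.
 exact: le_trans.
have bc i j : b i <= c j.
 apply: (@le_trans _ _ (b (maxn i j))); first by rewrite bm// leq_maxl.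
 apply: (@le_trans _ _ (c (maxn i j))); last by rewrite cm// leq_maxr.
 have := p2 (maxn i j); rewrite /b /c -!mulrA.
 by lra.
have ubb : has_ubound (range b) by exists (c 0%N) => _ [i _ <-].
exists (sup (range b)) => m; rewrite ler_norml.
have h1 : b m <= sup (range b) by apply: ub_le_sup => //.
have h2' : sup (range b) <= c m.
 by apply: ge_sup; [exists (b 0%N); exists 0%N|move=> _ [i _ <-]].
move: h1 h2'; rewrite /b /c; move: (2 * C / 2 ^+ m) (a m) (sup _) => u v w.
by lra.
Qed.

Lemma half_exp_small (C e : R) : 0 <= C -> 0 < e -> exists m, C / 2 ^+ m <= e.
move=> C0 e0; exists (Num.Def.truncn (C / e)).+1.
set m := (Num.Def.truncn _).+1.
have h1 : C / e < m%:R by rewrite truncnS_gt.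
have h2 : m%:R <= 2 ^+ m :> R by rewrite -natrX ler_nat ltnW// ltn_expl.
rewrite ler_pdivrMr //; move: h1; rewrite ltr_pdivrMr// => h1.
apply: (le_trans (ltW h1)); rewrite mulrC; rewrite ler_wpM2l// ltW//.
Qed.

End geometric_limit.

(** * Picard iteration for a globally Lipschitz field *)

Section picard.
Context (R : realType).
Variables (n : nat) (F : (nat -> R) -> nat -> R) (L T : R) (x0 : nat -> R).
Hypotheses (T_gt0 : 0 < T) (L_ge0 : 0 <= L).
Hypothesis F_lip : forall x y k, (k < n)%N ->
 `|F x k - F y k| <= L * \sum_(j < n) `|x j - y j|.

(** Clamping the time to [[0, T]] makes every curve continuous on the whole line, as antiderivatives
    require. *)
Let cl (t : R) : R := Num.max 0 (Num.min t T).
Let cl_itv t : 0 <= cl t <= T.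
by rewrite le_max lexx ge_max (ltW T_gt0) ge_min lexx orbT. Qed.
Let cl_id t : 0 <= t <= T -> cl t = t.
by move=> /andP[t0 tT]; rewrite /cl min_l// max_r. Qed.
Let cl_cont : continuous cl.
move=> t; apply: (@continuous_comp _ _ _ (fun t => Num.min t T) (Num.max 0)).
 by apply: continuous_min => //; exact: cvg_cst.
by apply: continuous_max => //; exact: cvg_cst.
Qed.

Let curve := R -> nat -> R.
Let ccurve (u : curve) := forall k, (k < n)%N -> continuous (fun t => u (cl t) k).

Let F_lipd x y d k : (k < n)%N -> (forall j, (j < n)%N -> `|x j - y j| <= d) ->
 `|F x k - F y k| <= L * n%:R * d.
move=> kn h; apply: (le_trans (F_lip _ _ kn)); rewrite -mulrA ler_wpM2l//.
rewrite mulr_natl -[n in _ *+ n]card_ord -sumr_const.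
by apply: ler_sum => j _; exact: h.
Qed.

Let F_cont (u : curve) k : (k < n)%N -> ccurve u ->
 continuous (fun t => F (u (cl t)) k).
move=> kn cu t; apply/cvgrPdist_le => /= e e0.
pose d := e / (L * n%:R + 1).
have Ln0 : 0 <= L * n%:R by rewrite mulr_ge0.
have Ln : 0 < L * n%:R + 1 by rewrite ltr_wpDl.
have d0 : 0 < d by rewrite divr_gt0.
have h : \forall s \near t, forall j : 'I_n, `|u (cl t) j - u (cl s) j| <= d.
 apply: (@filter_forall _ 'I_n (fun j => [set s | `|u (cl t) j - u (cl s) j| <= d]) (nbhs t)) => j.
 by have /cvgrPdist_le := cu j (ltn_ord j) t; exact.
near=> s.
have hs : forall j : 'I_n, `|u (cl t) j - u (cl s) j| <= d by near: s.
have hs' j : (j < n)%N -> `|u (cl t) j - u (cl s) j| <= d.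
 by move=> jn; exact: (hs (Ordinal jn)).
apply: (le_trans (F_lipd kn hs')).
rewrite mulrA ler_pdivrMr// mulrC ler_wpM2l ?ltW//.
by rewrite ltrDl.
Unshelve. all: by end_near. Qed.

Let anti (f : R -> R) : R -> R := xget (fun=> 0) [set G | G 0 = 0 /\
 forall t, 0 <= t <= T -> is_derive t (1 : R) G (f t)].

Let antiP f : continuous f -> anti f 0 = 0 /\
 forall t, 0 <= t <= T -> is_derive t (1 : R) (anti f) (f t).
move=> /(antiderivative T_gt0)[G hG]; rewrite /anti.
by case: xgetP => [y //|/(_ G)].
Qed.

Let nxt (u : curve) : curve := fun t k => x0 k + anti (fun s => F (u (cl s)) k) t.

Let nxt_derive u k t : (k < n)%N -> ccurve u -> 0 <= t <= T ->
 is_derive t (1 : R) (fun t => nxt u t k) (F (u t) k).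
move=> kn cu ht; have [_ /(_ t ht) h] := antiP (F_cont kn cu).
rewrite (cl_id ht) in h.
by have := @is_deriveD _ _ _ (fun=> x0 k) _ t 1 _ _ (is_derive_cst _ _ _) h; rewrite add0r.
Qed.

Let nxt0 u k : (k < n)%N -> ccurve u -> nxt u 0 k = x0 k.
by move=> kn cu; rewrite /nxt (antiP (F_cont kn cu)).1 addr0. Qed.
Let nxt_ccurve u : ccurve u -> ccurve (nxt u).
move=> cu k kn t.
apply: (@continuous_comp _ _ _ cl (fun t => nxt u t k)); first exact: cl_cont.
exact: is_derive_continuous (nxt_derive kn cu (cl_itv t)).
Qed.

Let X m : curve := iter m nxt (fun=> x0).

Let X_ccurve m : ccurve (X m).
by elim: m => [k _ t|m IH]; [exact: cvg_cst|exact: nxt_ccurve]. Qed.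
Let nxt_sub u v (g dg : R -> R) k : (k < n)%N -> ccurve u -> ccurve v ->
 (forall t, is_derive t (1 : R) g (dg t)) -> 0 <= g 0 ->
 (forall t, 0 <= t <= T -> `|F (u t) k - F (v t) k| <= dg t) ->
 forall t, 0 <= t <= T -> `|nxt u t k - nxt v t k| <= g t.
move=> kn cu cv hg g0 huv t /[dup] ht /andP[t0 tT].
have sub s : 0 <= s <= t -> 0 <= s <= T.
 by move=> /andP[-> st]; rewrite (le_trans st).
have hd w w' : ccurve w -> ccurve w' ->
  forall s, 0 <= s <= t -> is_derive s (1 : R) (fun t => nxt w t k - nxt w' t k)
   (F (w s) k - F (w' s) k).
 by move=> cw cw' s /sub hs; apply: is_deriveB; exact: nxt_derive.
have key w w' : ccurve w -> ccurve w' ->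
  (forall t, 0 <= t <= T -> `|F (w t) k - F (w' t) k| <= dg t) ->
  nxt w t k - nxt w' t k <= g t.
 move=> cw cw' hw.
 have := @is_derive_le R _ g _ dg 0 t t0 (hd _ _ cw cw') (fun s _ => hg s).
 rewrite !nxt0// subrr subr0 => /(_ _)/le_trans; apply.
  by move=> s /sub hs; exact: le_trans (ler_norm _) (hw s hs).
 by rewrite lerBlDr lerDl.
rewrite ler_norml key// lerNl opprB key// => s hs.
by rewrite distrC huv.
Qed.

(** Increments are weighted by [exp (K t)], with [K] above twice the Lipschitz constant, so that
    each iteration halves them whatever the length [T]. *)
Let K := 2 * (L * n%:R) + 1.
Let Ln0 : 0 <= L * n%:R. by rewrite mulr_ge0. Qed.
Let K1 : 1 <= K. by rewrite lerDr mulr_ge0. Qed.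
Let A := \sum_(k < n) `|F x0 k|.

Let ge_derive (c t : R) : is_derive t (1 : R) (fun t => c * expR (K * t)) (c * (K * expR (K * t))).
have h1 : is_derive t (1 : R) (fun s => K * s) K.
 by apply: is_derive_eq; rewrite /GRing.scale /=; ring.
by apply: is_derive_eq; rewrite /GRing.scale /=; ring.
Qed.

Let X_geo m t k : (k < n)%N -> 0 <= t <= T ->
 `|X m.+1 t k - X m t k| <= A / 2 ^+ m * expR (K * t).
have A0 : 0 <= A by rewrite sumr_ge0.
elim: m t k => [|m IH] t k kn ht.
 have FA : `|F x0 k| <= A.
  by rewrite /A (bigD1 (Ordinal kn))// lerDl sumr_ge0.
 have hd s : 0 <= s <= T -> is_derive s (1 : R) (fun t => X 1 t k) (F x0 k).
  by move=> hs; exact: (nxt_derive kn (@X_ccurve 0%N) hs).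
 have x0E : X 1 0 k = x0 k by exact (nxt0 kn (@X_ccurve 0%N)).
 pose f t := X 1 t k; have f0 : f 0 = x0 k := x0E.
 have fd s : 0 <= s <= T -> is_derive s (1 : R) f (F x0 k) := hd s.
 have t0 : 0 <= t by case/andP: ht.
 have sub s : 0 <= s <= t -> 0 <= s <= T.
  by move=> /andP[-> st]; rewrite (le_trans st); case/andP: ht.
 have hK s : 0 <= s -> A <= A * (K * expR (K * s)).
  move=> s0; rewrite ler_peMr// mulr_ege1// -expR0 ler_expR mulr_ge0//.
  exact: le_trans.
 have hdn s : 0 <= s <= t -> is_derive s (1 : R) (fun t => - f t) (- F x0 k).
  by move=> /sub hs; apply: is_deriveN; exact: fd.
 have u1 := @is_derive_le R f _ _ _ 0 t t0 (fun s hs => fd s (sub s hs)) (fun s _ => ge_derive A s).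
 have u2 := @is_derive_le R _ _ _ _ 0 t t0 hdn (fun s _ => ge_derive A s).
 have v1 := u1 (fun s hs => le_trans (le_trans (ler_norm _) FA) (hK s (proj1 (andP hs)))).
 have v2 := u2 (fun s hs => le_trans (le_trans (ler_norm (- _)) (eq_ind_r (fun z => z <= A) FA (normrN _))) (hK s (proj1 (andP hs)))).
 move: v1 v2; rewrite f0 mulr0 expR0 mulr1 divr1 => v1 v2.
 rewrite -[X 1 t k]/(f t) -[X 0 t k]/(x0 k) ler_norml.
 by lra.
have := @nxt_sub (X m.+1) (X m) _ _ k kn (@X_ccurve _) (@X_ccurve _) (ge_derive (A / 2 ^+ m.+1)).
apply => //.
 by rewrite mulr_ge0 // divr_ge0.
move=> s hs; apply: (le_trans (F_lipd kn (fun j jn => IH s j jn hs))).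
rewrite exprS invfM.
have e0 := @expR_ge0 R (K * s).
have q0 : 0 <= A / 2 ^+ m by rewrite divr_ge0.
rewrite (_ : A * (2^-1 / 2 ^+ m) = A / 2 ^+ m * 2^-1); last by ring.
move: (A / 2 ^+ m) (expR _) q0 e0 => q e q0 e0.
have -> : q / 2 * (K * e) = (K / 2) * (q * e) by ring.
by rewrite ler_wpM2r ?mulr_ge0// /K; lra.
Qed.

Let C := A * expR (K * T).
Let C0 : 0 <= C. by rewrite mulr_ge0 ?sumr_ge0. Qed.

Let X_geo' m t k : (k < n)%N -> 0 <= t <= T ->
 `|X m.+1 t k - X m t k| <= C / 2 ^+ m.
move=> kn ht; apply: (le_trans (X_geo m kn ht)); rewrite /C mulrAC.
rewrite ler_wpM2r // ler_wpM2l ?sumr_ge0// ler_expR.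
by rewrite ler_wpM2l ?(le_trans ler01 K1); case/andP: ht.
Qed.

Lemma picard : exists W : R -> nat -> R,
 (forall k, (k < n)%N -> W 0 k = x0 k) /\
 forall t k, 0 <= t <= T -> (k < n)%N ->
  is_derive t (1 : R) (fun t => W t k) (F (W t) k).
have lims t k : exists l, (k < n)%N -> forall m, `|l - X m (cl t) k| <= 2 * C / 2 ^+ m.
 case: (ltnP k n) => kn; last by exists 0.
 by have [l hl] := geometric_limit C0 (fun m => X_geo' m kn (cl_itv t)); exists l.
pose u t k := sval (cid (lims t k)).
have hu t k m : (k < n)%N -> `|u t k - X m (cl t) k| <= 2 * C / 2 ^+ m.
 by move=> kn; exact: (svalP (cid (lims t k)) kn m).
have C20 : 0 <= 2 * C by rewrite mulr_ge0.
have cu' k : (k < n)%N -> continuous (fun t => u t k).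
 move=> kn t; apply/cvgrPdist_le => /= e e0.
 have [m hm] := half_exp_small C20 (divr_gt0 e0 (ltr0n R 3)).
 have e3 : 0 < e / 3 by rewrite divr_gt0.
 have /cvgrPdist_le hX := @X_ccurve m k kn t.
 have := hX _ e3; apply: filterS => s hs.
 have h1 := le_trans (hu t k m kn) hm; have h2 := le_trans (hu s k m kn) hm.
 move: h1 h2 hs; rewrite !ler_norml => /andP[? ?] /andP[? ?] /andP[? ?].
 by lra.
have cu : ccurve u.
 move=> k kn t; apply: (@continuous_comp _ _ _ cl (fun t => u t k)); first exact: cl_cont.
 exact: cu'.
have Wu t k : (k < n)%N -> 0 <= t <= T -> nxt u t k = u t k.
 move=> kn ht; apply/eqP; rewrite -subr_eq0 -normr_le0; apply/ler_addgt0Pr => e e0.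
 rewrite add0r.
 have B0 : 0 <= (L * n%:R * T + 1) * (2 * C).
  by rewrite mulr_ge0// addr_ge0// mulr_ge0// ltW.
 have [m hm] := half_exp_small B0 e0.
 apply: le_trans hm.
 have h1 := hu t k m.+1 kn; rewrite cl_id// in h1.
 have h1' : 2 * C / 2 ^+ m.+1 <= 2 * C / 2 ^+ m.
  rewrite ler_wpM2l// lef_pV2 ?posrE // exprS ler_peMl //.
  by rewrite ler1n.
 pose d := L * n%:R * (2 * C / 2 ^+ m).
 have gd s : is_derive s (1 : R) (fun s => d * s) d.
  by apply: is_derive_eq; rewrite /GRing.scale /=; ring.
 have h2 : `|nxt u t k - X m.+1 t k| <= d * t.
  have := @nxt_sub u (X m) (fun s => d * s) (fun=> d) k kn cu (@X_ccurve m) gd.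
  apply => //.
   by rewrite mulr0.
  move=> s hs; apply: F_lipd => // j jn.
  by have := hu s j m jn; rewrite cl_id.
 have h3 : d * t <= L * n%:R * T * (2 * C / 2 ^+ m).
  rewrite [leLHS]mulrAC ler_wpM2r ?divr_ge0 // ler_wpM2l//.
  by case/andP: ht.
 have -> : (L * n%:R * T + 1) * (2 * C) / 2 ^+ m =
  L * n%:R * T * (2 * C / 2 ^+ m) + 2 * C / 2 ^+ m by ring.
 have -> : nxt u t k - u t k = (nxt u t k - X m.+1 t k) - (u t k - X m.+1 t k) by lra.
 apply: (le_trans (ler_normB _ _)).
 exact: (lerD (le_trans h2 h3) (le_trans h1 h1')).
(* The limit [u] is only known to be continuous, but [nxt u] is an antiderivative and agrees with
   [u] on [[0, T]]. *)
exists (nxt u); split; first by move=> k kn; exact: nxt0.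
move=> t k ht kn.
have -> : F (nxt u t) k = F (u t) k.
 apply/eqP; rewrite -subr_eq0 -normr_le0.
 apply: (le_trans (F_lipd (d := 0) kn _)); last by rewrite mulr0.
 by move=> j jn; rewrite Wu// subrr normr0.
exact: nxt_derive.
Qed.

End picard.

(** These equations give access to definitions that are made opaque later. *)
Lemma ipE (R : realType) (p q : pol R) : ip p q = Ip (p * q).
by []. Qed.
Lemma cfE (R : realType) (p : pol R) k : cf p k = ip p (Y R k).
by []. Qed.

(** * Sobolev norms and the inverse Laplacian on polynomials *)

Section poly_sobolev.
Context (R : realType).
Notation P := (pol R).
Implicit Types (p q f g w : P) (r s n k : nat).
Notation lam := (@lam R).
Notation cf := (@cf R).
Notation Y := (@Y R).

Lemma inV_cf n p q : inV n p -> inV n q ->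
 (forall k, (k < n)%N -> cf p k = cf q k) -> pev p = pev q.
move=> hp hq h; rewrite hp hq; apply/funext => x; rewrite !pev_proj.
by apply: eq_bigr => k; rewrite h.
Qed.

Lemma cf_inj p q : cf p = cf q -> pev p = pev q.
move=> h; have [n hn] := inV_exists p; have [m hm] := inV_exists q.
apply: (@inV_cf (maxn n m)) => [||k]; last by rewrite h.
 exact: inV_le (leq_maxl _ _) hn.
exact: inV_le (leq_maxr _ _) hm.
Qed.

Lemma cf0 k : cf 0 k = 0. exact: ip0l. Qed.
Lemma cfD p q k : cf (p + q) k = cf p k + cf q k. exact: ipDl. Qed.
Lemma cfB p q k : cf (p - q) k = cf p k - cf q k. exact: ipBl. Qed.
Lemma cfN p k : cf (- p) k = - cf p k. exact: ipNl. Qed.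
Lemma cfZ a p k : cf (a *: p) k = a * cf p k. exact: ipZl. Qed.

Definition zm p := Ip p = 0.

Lemma zm_cf0 p : zm p <-> cf p 0 = 0.
rewrite /zm; split => h.
 have [c hc] := @pev_Y0 R point.
 by rewrite cfE hc ipZr ipE mulr1 h mulr0.
have h1 : inV 1 (1 : P).
 apply: (@Sp_inV R 0); have := @Sp_mono R 0 0 0 0 isT.
 by rewrite /mono !mulr1.
have : ip 1 p = 0 by rewrite (ip_parseval _ h1) big_ord1 h mulr0.
by rewrite ipE mul1r.
Qed.

Lemma zm_ext p q : pev p = pev q -> zm p -> zm q.
by move=> /eq_Ip; rewrite /zm => ->. Qed.
Lemma zm0 : zm 0. exact: Ip0. Qed.
Lemma zmD p q : zm p -> zm q -> zm (p + q).
by rewrite /zm IpD => -> ->; rewrite addr0. Qed.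
Lemma zmZ a p : zm p -> zm (a *: p).
by rewrite /zm IpZ => ->; rewrite mulr0. Qed.
Lemma zmN p : zm p -> zm (- p).
by rewrite /zm IpN => ->; rewrite oppr0. Qed.
Lemma zmB p q : zm p -> zm q -> zm (p - q).
by move=> hp hq; apply: zmD => //; exact: zmN. Qed.
Lemma zm_rot i p : zm (rot i p). exact: Ip_rot. Qed.
Lemma zm_bk p q : zm (bk p q). exact: Ip_bk. Qed.
Lemma zm_lapp p : zm (lapp p).
by apply: zmD; [apply: zmD|]; exact: zm_rot. Qed.
Lemma zm_proj n p : zm p -> zm (proj n p).
by move=> /zm_cf0 h; apply/zm_cf0; rewrite cf_proj h if_same. Qed.

Definition nlap p : P := - lapp p.

Lemma nlap_ext p q : pev p = pev q -> pev (nlap p) = pev (nlap q).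
by move=> /pev_lapp h; apply/funext => x; rewrite !pevN h. Qed.
Lemma iter_nlap_ext r p q : pev p = pev q ->
 pev (iter r nlap p) = pev (iter r nlap q).
by move=> h; elim: r => // IH; exact: nlap_ext. Qed.

Lemma cf_nlap r p k : cf (iter r nlap p) k = lam k ^+ r * cf p k.
elim: r => [|r IH]; first by rewrite mul1r.
by rewrite cfN cf_lapp IH exprS -mulrA mulNr opprK.
Qed.

(* Homogeneous Sobolev inner product of order [r] on zero-mean functions. *)
Definition sip r p q : R := ip (iter r nlap p) q.
Definition S r p : R := sip r p p.
Definition N r p : R := Num.sqrt (S r p).

Lemma sip_sum n r p q : inV n q ->
 sip r p q = \sum_(k < n) lam k ^+ r * (cf p k * cf q k).
move=> h; rewrite /sip ipC (ip_parseval _ h); apply: eq_bigr => k _.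
by rewrite cf_nlap mulrC mulrA.
Qed.

Lemma S_sum n r p : inV n p -> S r p = \sum_(k < n) lam k ^+ r * cf p k ^+ 2.
by move=> h; rewrite /S (sip_sum _ _ h). Qed.
Lemma S_ge0 r p : 0 <= S r p.
have [n h] := inV_exists p; rewrite (S_sum _ h) sumr_ge0// => k _.
by rewrite mulr_ge0 ?sqr_ge0// exprn_ge0.
Qed.

Lemma NE r p : N r p = Num.sqrt (S r p). by []. Qed.
Lemma N_ge0 r p : 0 <= N r p. exact: sqrtr_ge0. Qed.
Lemma N_sq r p : N r p ^+ 2 = S r p. by rewrite sqr_sqrtr ?S_ge0. Qed.
Hint Resolve N_ge0 S_ge0 : core.

Lemma sip_ext r p p' q q' : pev p = pev p' -> pev q = pev q' ->
 sip r p q = sip r p' q'.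
by move=> h h'; rewrite /sip (ip_extl _ (iter_nlap_ext r h)) (ip_extr _ h').
Qed.

Lemma S_ext r p q : pev p = pev q -> S r p = S r q.
by move=> h; exact: sip_ext. Qed.
Lemma N_ext r p q : pev p = pev q -> N r p = N r q.
by move=> h; rewrite /N (S_ext r h). Qed.
Lemma sip_le r p q : `|sip r p q| <= N r p * N r q.
have [n hp] := inV_exists p; have [m hq] := inV_exists q.
have {}hp := inV_le (leq_maxl n m) hp; have {}hq := inV_le (leq_maxr n m) hq.
rewrite -ler_sqr ?nnegrE ?mulr_ge0// real_normK ?num_real// exprMn !N_sq.
rewrite (sip_sum _ _ hq) (S_sum _ hp) (S_sum _ hq).
have := @sum_CS R _ (index_enum 'I_(maxn n m))
 (fun k : 'I__ => Num.sqrt (lam k ^+ r) * cf p k)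
 (fun k : 'I__ => Num.sqrt (lam k ^+ r) * cf q k).
have sq k : Num.sqrt (lam k ^+ r) ^+ 2 = lam k ^+ r.
 by rewrite sqr_sqrtr// exprn_ge0.
congr (_ ^+ 2 <= _ * _); apply: eq_bigr => k _.
- by rewrite mulrACA -expr2 sq.
- by rewrite exprMn sq.
- by rewrite exprMn sq.
Qed.

Lemma ip_le p q : `|ip p q| <= N 0 p * N 0 q. exact: (@sip_le 0). Qed.

Lemma sipDl r p q f : sip r (p + q) f = sip r p f + sip r q f.
have [n h] := inV_exists f; rewrite !(sip_sum _ _ h) -big_split/=.
by apply: eq_bigr => k _; rewrite cfD; ring.
Qed.
Lemma sipC r p q : sip r p q = sip r q p.
have [n hp] := inV_exists p; have [m hq] := inV_exists q.
have {}hp := inV_le (leq_maxl n m) hp; have {}hq := inV_le (leq_maxr n m) hq.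
by rewrite (sip_sum _ _ hp) (sip_sum _ _ hq); apply: eq_bigr => k _; ring.
Qed.
Lemma SD r p q : S r (p + q) = S r p + 2 * sip r p q + S r q.
by rewrite /S sipDl ![sip r _ (p + q)]sipC !sipDl (sipC r p); ring.
Qed.
Lemma SZ r a p : S r (a *: p) = a ^+ 2 * S r p.
have [n h] := inV_exists p; rewrite (S_sum _ h) (S_sum _ (inVZ a h)) mulr_sumr.
by apply: eq_bigr => k _; rewrite cfZ; ring.
Qed.
Lemma NZ r a p : N r (a *: p) = `|a| * N r p.
by rewrite /N SZ sqrtrM ?sqr_ge0// sqrtr_sqr. Qed.
Lemma NN r p : N r (- p) = N r p.
by rewrite -scaleN1r NZ normrN1 mul1r. Qed.
Lemma N0 r : N r 0 = 0.
by rewrite -(scale0r (0 : P)) NZ normr0 mul0r. Qed.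
Lemma ND r p q : N r (p + q) <= N r p + N r q.
rewrite -ler_sqr ?nnegrE ?addr_ge0// sqrrD !N_sq SD.
have := le_trans (ler_norm _) (sip_le r p q); rewrite mulr2n.
by lra.
Qed.
Lemma ND_le r p q a : N r p + N r q <= a -> N r (p + q) <= a.
exact: le_trans (ND _ _ _). Qed.
Lemma NB r p q : N r (p - q) <= N r p + N r q.
by apply: (le_trans (ND _ _ _)); rewrite NN. Qed.
Lemma NBC r p q : N r (p - q) = N r (q - p).
by rewrite -NN opprB. Qed.
Lemma N_dist r p q : `|N r p - N r q| <= N r (p - q).
have h p' q' : N r p' <= N r (p' - q') + N r q'.
 by apply: (le_trans _ (ND _ _ _)); rewrite subrK.
have h1 := h p q; have h2 := h q p; rewrite NBC in h2.
by rewrite ler_norml; apply/andP; split; lra.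
Qed.

Lemma N_sum r (I : Type) (l : seq I) (F : I -> P) :
 N r (\sum_(i <- l) F i) <= \sum_(i <- l) N r (F i).
elim: l => [|a l IH]; first by rewrite !big_nil N0.
rewrite !big_cons; apply: (le_trans (ND _ _ _)); exact: lerD.
Qed.

Lemma N_S_le r n p q : S r p <= S n q -> N r p <= N n q.
by move=> h; rewrite ler_wsqrtr. Qed.
Lemma S_lapp r p : S r (lapp p) = S r.+2 p.
have [n h] := inV_exists p; rewrite (S_sum _ h) (S_sum _ (inV_lapp h)).
by apply: eq_bigr => k _; rewrite cf_lapp !exprS; ring.
Qed.
Lemma N_lapp r p : N r (lapp p) = N r.+2 p. by rewrite /N S_lapp. Qed.

Lemma sip2E p q : sip 2 p q = ip (lapp p) (lapp q).
have [n h] := inV_exists q; rewrite (sip_sum _ _ h) ipC (ip_parseval _ (inV_lapp h)).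
by apply: eq_bigr => k _; rewrite !cf_lapp; ring.
Qed.

(** A zero mean removes the mode [k = 0]; all other eigenvalues are at least 2. *)
Lemma S_zm_le r s p : zm p -> (r <= s)%N -> S r p <= S s p.
move=> /zm_cf0 h0 rs; have [n h] := inV_exists p; rewrite !(S_sum _ h).
apply: ler_sum => k _; have [k0|k0] := posnP k; first by rewrite k0 h0 expr2 !mulr0.
by rewrite ler_wpM2r ?sqr_ge0// ler_weXn2l// (le_trans _ (lam_gt0 R k0))// ler1n.
Qed.
Lemma N_zm_le r s p : zm p -> (r <= s)%N -> N r p <= N s p.
by move=> h rs; rewrite ler_wsqrtr// S_zm_le. Qed.
Lemma iter_nlap_rot r i p : rot i (iter r nlap p) = iter r nlap (rot i p).
elim: r => // r IH; rewrite !iterS -IH /nlap -scaleN1r rotZ scaleN1r.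
by rewrite rot_lapp.
Qed.

Lemma S_rot r p : S r (rot e0 p) + S r (rot e1 p) + S r (rot e2 p) = S r.+1 p.
by rewrite /S /sip ipNl ip_lapp opprK !iter_nlap_rot.
Qed.

Lemma CS3 (a b c a' b' c' : R) : 0 <= a -> 0 <= b -> 0 <= c -> 0 <= a' ->
 0 <= b' -> 0 <= c' -> a * a' + b * b' + c * c' <=
 Num.sqrt (a ^+ 2 + b ^+ 2 + c ^+ 2) * Num.sqrt (a' ^+ 2 + b' ^+ 2 + c' ^+ 2).
move=> *; rewrite -sqrtrM; last by rewrite !addr_ge0// sqr_ge0.
rewrite -[leLHS]ger0_norm; last by rewrite !addr_ge0// mulr_ge0.
rewrite -sqrtr_sqr ler_wsqrtr// -subr_ge0.
have -> : (a ^+ 2 + b ^+ 2 + c ^+ 2) * (a' ^+ 2 + b' ^+ 2 + c' ^+ 2) -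
 (a * a' + b * b' + c * c') ^+ 2 =
 (a * b' - b * a') ^+ 2 + (a * c' - c * a') ^+ 2 + (b * c' - c * b') ^+ 2 by ring.
by rewrite !addr_ge0// sqr_ge0.
Qed.

Lemma N_rot r s f g :
 N r (rot e0 f) * N s (rot e0 g) + N r (rot e1 f) * N s (rot e1 g) +
 N r (rot e2 f) * N s (rot e2 g) <= N r.+1 f * N s.+1 g.
by apply: (le_trans (CS3 _ _ _ _ _ _)) => //; rewrite !N_sq !S_rot. Qed.

Lemma N_rot_le r i f : N r (rot i f) <= N r.+1 f.
rewrite ler_wsqrtr// -S_rot; move: (S_ge0 r (rot e0 f)) (S_ge0 r (rot e1 f)) (S_ge0 r (rot e2 f)).
by elim/ord3: i; lra.
Qed.

(** The sum runs over enough modes to capture [p]; the convention [0^-1 = 0] discards the constant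
    mode. *)
Definition invl p : P :=
 \sum_(k < sval (cid (inV_exists p))) (- ((lam k)^-1 * cf p k)) *: Y k.

Lemma cf_invl p k : cf (invl p) k = - ((lam k)^-1 * cf p k).
rewrite /invl; case: cid => n h /=.
rewrite (cf_sum n (fun k => - ((lam k)^-1 * cf p k))).
case: ltnP => kn; first by rewrite mulNr -mulrA ip_Y_nY.
by rewrite (cf_eq0 h kn) mulr0 oppr0.
Qed.

Lemma inV_invl n p : inV n p -> inV n (invl p).
move=> h; apply: (@inV_ext _ _ (proj n (invl p))); last exact: inV_proj.
apply: cf_inj; apply/funext => k; rewrite cf_proj cf_invl; case: ltnP => // kn.
by rewrite (cf_eq0 h kn) mulr0 oppr0.
Qed.

Lemma zm_invl p : zm (invl p).
by apply/zm_cf0; rewrite cf_invl invr0 mul0r oppr0. Qed.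
Lemma invl_ext p q : pev p = pev q -> pev (invl p) = pev (invl q).
by move=> /cf_ext h; apply: cf_inj; apply/funext => k; rewrite !cf_invl h. Qed.
Lemma invlD p q : pev (invl (p + q)) = pev (invl p + invl q).
by apply: cf_inj; apply/funext => k; rewrite cfD !cf_invl cfD; ring. Qed.
Lemma invlB p q : pev (invl (p - q)) = pev (invl p - invl q).
by apply: cf_inj; apply/funext => k; rewrite cfB !cf_invl cfB; ring. Qed.
Lemma invlZ a p : pev (invl (a *: p)) = pev (a *: invl p).
by apply: cf_inj; apply/funext => k; rewrite cfZ !cf_invl cfZ; ring. Qed.
Lemma lam_neq0 k : (0 < k)%N -> lam k != 0.
by move=> /(lam_gt0 R) h; rewrite gt_eqF// (lt_le_trans _ h). Qed.
Lemma lapp_invl p : zm p -> pev (lapp (invl p)) = pev p.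
move=> /zm_cf0 h; apply: cf_inj; apply/funext => k.
rewrite cf_lapp cf_invl; have [->|k0] := posnP k; first by rewrite h !mulr0 oppr0 mulr0.
by rewrite mulrNN mulrA divff ?mul1r// lam_neq0.
Qed.

Lemma S_invl r p : zm p -> S r.+2 (invl p) = S r p.
by move=> h; rewrite -S_lapp (S_ext _ (lapp_invl h)). Qed.
Lemma N_invl r p : zm p -> N r.+2 (invl p) = N r p.
by move=> h; rewrite /N S_invl. Qed.
Lemma ip_proj n p q : inV n q -> ip (proj n p) q = ip p q.
move=> h; rewrite ipC (ip_parseval _ h) [RHS]ipC (ip_parseval _ h).
by apply: eq_bigr => k; rewrite cf_proj ltn_ord.
Qed.

Lemma S_proj r n p : S r (proj n p) <= S r p.
have [m h] := inV_exists p.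
have h1 := inV_le (leq_maxr n m) h.
have h2 : inV (maxn n m) (proj n p) by apply: inV_le (leq_maxl _ _) (inV_proj _ _).
rewrite (S_sum _ h1) (S_sum _ h2); apply: ler_sum => k _.
rewrite ler_wpM2l ?exprn_ge0 // cf_proj; case: ifP => // _.
by rewrite expr0n sqr_ge0.
Qed.
Lemma N_proj r n p : N r (proj n p) <= N r p.
by rewrite ler_wsqrtr// S_proj. Qed.
(** High modes gain powers of [lam n]; [S_head] is the reverse inequality for low modes, which lose
    them. *)
Lemma S_tail r s n p : S r (p - proj n p) * lam n ^+ s <= S (r + s) (p - proj n p).
have [m h] := inV_exists (p - proj n p).
rewrite !(S_sum _ h) mulr_suml; apply: ler_sum => k _.
rewrite cfB cf_proj; case: ltnP => kn; first by rewrite subrr expr0n !mulr0 mul0r.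
rewrite mulrAC ler_wpM2r ?sqr_ge0// exprD ler_wpM2l ?exprn_ge0 //.
by rewrite lerXn2r ?nnegrE // lam_le.
Qed.

Lemma S_head r s n p : inV n p -> S (r + s) p <= lam n ^+ s * S r p.
move=> h; rewrite !(S_sum _ h) mulr_sumr; apply: ler_sum => k _.
rewrite mulrA ler_wpM2r ?sqr_ge0// exprD mulrC ler_wpM2r ?exprn_ge0 //.
by rewrite lerXn2r ?nnegrE // lam_le// ltnW.
Qed.

Lemma S_subproj r n p : S r (p - proj n p) <= S r p.
have [m h] := inV_exists p.
have h1 := inV_le (leq_maxr n m) h.
have h2 : inV (maxn n m) (p - proj n p).
 rewrite -scaleN1r addrC; apply: inV_lin h1.
 by apply: inV_le (leq_maxl _ _) (inV_proj _ _).
rewrite (S_sum _ h1) (S_sum _ h2); apply: ler_sum => k _.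
rewrite ler_wpM2l ?exprn_ge0 // cfB cf_proj; case: ifP => _.
 by rewrite subrr expr0n sqr_ge0.
by rewrite subr0.
Qed.

End poly_sobolev.
#[global] Hint Extern 0 (is_true (@Order.le _ _ _ (@N _ _ _))) =>
 solve [apply: N_ge0] : core.
#[global] Hint Extern 0 (is_true (@Order.le _ _ _ (@S _ _ _))) =>
 solve [apply: S_ge0] : core.

(** * Energy estimates for the bracket *)

Section bracket_estimates.
Context (R : realType).
Notation P := (pol R).
Implicit Types (p q f g w e z : P) (r s n k : nat).

(** The constant of the Sobolev embedding [sup_lapp]. *)
Definition csup : R := Num.sqrt (totarea R)^-1.

Lemma csup_ge0 : 0 <= csup. exact: sqrtr_ge0. Qed.
Lemma csup_sq : csup ^+ 2 = (totarea R)^-1.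
by rewrite sqr_sqrtr// invr_ge0 ltW// totarea_gt0. Qed.
Local Hint Extern 0 (is_true (@Order.le _ _ _ (csup))) => solve [apply: csup_ge0] : core.

Lemma Ip_ge0 p : (forall x, 0 <= pev p x) -> 0 <= Ip p.
by move=> h; rewrite fine_ge0// integral_ge0// => x; rewrite lee_fin.
Qed.

Lemma Ip_le p q : (forall x, pev p x <= pev q x) -> Ip p <= Ip q.
by move=> h; rewrite -subr_ge0 -IpB Ip_ge0// => x; rewrite pevB subr_ge0.
Qed.

Lemma rot_sup f x : pev (rot e0 f) x ^+ 2 + pev (rot e1 f) x ^+ 2 +
 pev (rot e2 f) x ^+ 2 <= csup ^+ 2 * S 3 f.
rewrite csup_sq -S_rot !mulrDr.
have h i : pev (rot i f) x ^+ 2 <= (totarea R)^-1 * S 2 (rot i f).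
 have := sup_lapp x (zm_rot i f); rewrite (_ : ip _ _ = S 2 (rot i f))//.
 by rewrite -(S_lapp 0).
by rewrite !lerD.
Qed.

Lemma bk_pointwise f g x : pev (bk f g) x ^+ 2 <=
 (pev (rot e0 f) x ^+ 2 + pev (rot e1 f) x ^+ 2 + pev (rot e2 f) x ^+ 2) *
 (pev (rot e0 g) x ^+ 2 + pev (rot e1 g) x ^+ 2 + pev (rot e2 g) x ^+ 2).
have := congr1 (fun p => pev p x) (bk_sqr f g).
rewrite pevM pev_r2 mul1r !pevD !pevX !pevB !pevM => ->.
move: (pev (rot e0 f) x) (pev (rot e1 f) x) (pev (rot e2 f) x)
 (pev (rot e0 g) x) (pev (rot e1 g) x) (pev (rot e2 g) x) => a b c u v w.
(* By Lagrange's identity the defect is the square of a scalar product. *)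
rewrite -subr_ge0 (_ : _ _ = (a * u + b * v + c * w) ^+ 2) ?sqr_ge0//.
by ring.
Qed.

Lemma S_bk f g : S 0 (bk f g) <= csup ^+ 2 * S 3 f * S 1 g.
pose G := rot e0 g * rot e0 g + rot e1 g * rot e1 g + rot e2 g * rot e2 g.
have -> : S 1 g = Ip G by rewrite -(S_rot 0) !IpD.
rewrite -IpZ; apply: Ip_le => x; rewrite pevZ pevM -expr2.
apply: (le_trans (bk_pointwise f g x)).
rewrite !pevD !pevM ler_wpM2r ?rot_sup//.
by rewrite !addr_ge0// sqr_ge0.
Qed.

Lemma N_bk31 f g : N 0 (bk f g) <= csup * N 3 f * N 1 g.
have h : 0 <= csup * N 3 f * N 1 g by rewrite !mulr_ge0.
rewrite -ler_sqr ?nnegrE// !exprMn !N_sq; exact: S_bk.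
Qed.

Lemma N_bk13 f g : N 0 (bk f g) <= csup * N 1 f * N 3 g.
by rewrite bkC NN mulrAC; exact: N_bk31. Qed.

(** The mixed term in the Leibniz rule for the Laplacian of a bracket. *)
Definition rotbk f g : P := bk (rot e0 f) (rot e0 g) + bk (rot e1 f) (rot e1 g) +
 bk (rot e2 f) (rot e2 g).

Lemma N_rotbk f g : N 0 (rotbk f g) <= csup * N 4 f * N 2 g.
apply: ND_le.
apply: (le_trans (lerD (ND _ _ _) (lexx _))).
have h i : N 0 (bk (rot i f) (rot i g)) <= csup * (N 3 (rot i f) * N 1 (rot i g)).
 by rewrite mulrA; exact: N_bk31.
apply: (le_trans (lerD (lerD (h _) (h _)) (h _))).
by rewrite -!mulrDr -mulrA ler_wpM2l// N_rot.
Qed.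

Lemma lapp_bkE f g : lapp (bk f g) = bk (lapp f) g + bk f (lapp g) + 2 *: rotbk f g.
by rewrite lapp_bk scaler_nat mulr_natl. Qed.
Lemma lapp_bk_le f g : N 2 (bk f g) <=
 N 0 (bk (lapp f) g) + N 0 (bk f (lapp g)) + 2 * csup * N 4 f * N 2 g.
rewrite -(N_lapp 0) lapp_bkE; apply: ND_le.
apply: lerD; first exact: ND.
by rewrite NZ ger0_norm// -!mulrA ler_wpM2l// mulrA N_rotbk.
Qed.

(** The term [bk f (lapp g)] has three derivatives on [g], but the bracket is skew, so it is
    orthogonal to [lapp g]. *)
Lemma sip2_bk_self f g : `|sip 2 (bk f g) g| <=
 N 2 g * (N 0 (bk (lapp f) g) + 2 * csup * N 4 f * N 2 g).
rewrite sip2E lapp_bkE 2!ipDl ip_bk_self addr0 -ipDl.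
apply: (le_trans (ip_le _ _)); rewrite (N_lapp 0) mulrC ler_wpM2l//.
apply: ND_le; rewrite lerD2l.
by rewrite NZ ger0_norm// -!mulrA ler_wpM2l// mulrA N_rotbk.
Qed.

(* The derivative of the difference [e = y - z] of two vorticities along the
  Euler flow is [bk (invl z) e + bk (invl e) z + bk (invl e) e]. *)
Lemma sip2_euler z e : zm z -> zm e ->
 `|sip 2 (bk (invl z) e + bk (invl e) z + bk (invl e) e) e| <=
 csup * N 2 e * (3 * N 3 z * N 1 e + 4 * N 2 z * N 2 e + 2 * N 2 e ^+ 2).
move=> hz he.
have n0 (p q : P) : pev p = pev q -> N 0 p = N 0 q by exact: N_ext.
have A1 : `|sip 2 (bk (invl z) e) e| <=
  N 2 e * (csup * N 3 z * N 1 e + 2 * csup * N 2 z * N 2 e).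
 apply: (le_trans (sip2_bk_self _ _)); rewrite ler_wpM2l// N_invl// lerD2r.
 rewrite (n0 _ (bk z e)); last exact/pev_bkl/lapp_invl.
 exact: N_bk31.
have A2 : `|sip 2 (bk (invl e) e) e| <= N 2 e * (2 * csup * N 2 e * N 2 e).
 apply: (le_trans (sip2_bk_self _ _)); rewrite ler_wpM2l// N_invl//.
 rewrite (n0 _ (bk e e)); last exact/pev_bkl/lapp_invl.
 by rewrite bkpp N0 add0r.
have A3 : `|sip 2 (bk (invl e) z) e| <=
  N 2 e * (csup * N 1 e * N 3 z + csup * N 1 e * N 3 z + 2 * csup * N 2 e * N 2 z).
 apply: (le_trans (sip_le _ _ _)); rewrite mulrC ler_wpM2l//.
 apply: (le_trans (lapp_bk_le _ _)); rewrite N_invl// lerD2r lerD//.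
  rewrite (n0 _ (bk e z)); last exact/pev_bkl/lapp_invl.
  exact: N_bk13.
 apply: (le_trans (N_bk31 _ _)).
 by rewrite N_invl// (N_lapp 1).
rewrite 2!sipDl; apply: (le_trans (ler_normD _ _)).
apply: (le_trans (lerD (ler_normD _ _) (lexx _))).
apply: (le_trans (lerD (lerD A1 A3) A2)).
rewrite le_eqVlt; apply/orP; left; apply/eqP.
by move: csup (N 2 e) (N 1 e) (N 3 z) (N 2 z) => a b c d u; ring.
Qed.

(** Linear in [N 2 z] and quadratic in [N 3 z]: control of the lower norm propagates the higher one.
    Summing over the three rotations reduces level 3 to level 2. *)
Lemma sip3_euler z : zm z ->
 `|sip 3 (bk (invl z) z) z| <= 7 * csup * N 2 z * N 3 z ^+ 2.
move=> hz; set f := invl z.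
have n0 (p q : P) : pev p = pev q -> N 0 p = N 0 q by exact: N_ext.
have key i : `|sip 2 (rot i (bk f z)) (rot i z)| <= csup * N 2 (rot i z) *
  (2 * N 3 z * N 1 (rot i z) + 4 * N 2 z * N 2 (rot i z) +
   (N 3 (rot i f) * N 3 z)) + 0 + csup * N 2 (rot i z) * (2 * N 4 (rot i f) * N 2 z)
   - csup * N 2 (rot i z) * (2 * N 2 z * N 2 (rot i z)).
 have B1 : `|sip 2 (bk f (rot i z)) (rot i z)| <= N 2 (rot i z) *
   (csup * N 3 z * N 1 (rot i z) + 2 * csup * N 2 z * N 2 (rot i z)).
  apply: (le_trans (sip2_bk_self _ _)); rewrite ler_wpM2l// /f N_invl// lerD2r.
  rewrite (n0 _ (bk z (rot i z))); last exact/pev_bkl/lapp_invl.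
  exact: N_bk31.
 have B2 : `|sip 2 (bk (rot i f) z) (rot i z)| <= N 2 (rot i z) *
   (csup * N 1 (rot i z) * N 3 z + csup * N 3 (rot i f) * N 3 z
   + 2 * csup * N 4 (rot i f) * N 2 z).
  apply: (le_trans (sip_le _ _ _)); rewrite mulrC ler_wpM2l//.
  apply: (le_trans (lapp_bk_le _ _)); rewrite lerD2r lerD//.
   rewrite (n0 _ (bk (rot i z) z)); first exact: N_bk13.
   by apply: pev_bkl; rewrite -rot_lapp; apply: pev_rot; exact: lapp_invl.
  by apply: (le_trans (N_bk31 _ _)); rewrite (N_lapp 1).
 rewrite rot_bk sipDl; apply: (le_trans (ler_normD _ _)).
 apply: (le_trans (lerD B2 B1)).
 rewrite le_eqVlt; apply/orP; left; apply/eqP.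
 move: csup (N 2 _) (N 1 _) (N 3 z) (N 2 z) (N 3 _) (N 4 _) => a b c d u v w.
 by ring.
have -> : sip 3 (bk f z) z = sip 2 (rot e0 (bk f z)) (rot e0 z) +
  sip 2 (rot e1 (bk f z)) (rot e1 z) + sip 2 (rot e2 (bk f z)) (rot e2 z).
 rewrite /sip -!iter_nlap_rot (_ : iter 3 _ _ = nlap (iter 2 (@nlap R) (bk f z)))//.
 by rewrite ipNl ip_lapp opprK.
apply: (le_trans (ler_normD _ _)).
apply: (le_trans (lerD (ler_normD _ _) (lexx _))).
apply: (le_trans (lerD (lerD (key _) (key _)) (key _))).
have h1 := N_rot 2 1 z z; have h2 := N_rot 2 2 z z.
have h3 := N_rot 2 3 z f; have h4 := N_rot 2 4 z f.
have n4 : N 4 f = N 2 z by rewrite N_invl.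
have n5 : N 5 f = N 3 z by rewrite N_invl.
rewrite n4 in h3; rewrite n5 in h4.
have a0 := csup_ge0; have c0 := N_ge0 3 z; have d0 := N_ge0 2 z.
have g1 := ler_wpM2l (mulr_ge0 a0 c0) h1.
have g2 := ler_wpM2l (mulr_ge0 a0 d0) h2.
have g3 := ler_wpM2l (mulr_ge0 a0 c0) h3.
have g4 := ler_wpM2l (mulr_ge0 a0 d0) h4.
move: g1 g2 g3 g4 {h1 h2 h3 h4 key n4 n5}.
move: (N 2 (rot e0 z)) (N 1 (rot e0 z)) (N 3 (rot e0 f)) (N 4 (rot e0 f)) => b0 x0 y0 w0.
move: (N 2 (rot e1 z)) (N 1 (rot e1 z)) (N 3 (rot e1 f)) (N 4 (rot e1 f)) => b1 x1 y1 w1.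
move: (N 2 (rot e2 z)) (N 1 (rot e2 z)) (N 3 (rot e2 f)) (N 4 (rot e2 f)) => b2 x2 y2 w2.
move: csup (N 3 z) (N 2 z) => a c d g1 g2 g3 g4.
rewrite -subr_ge0.
set u1 := _ - _ in g1 *.
have := lerD (lerD (lerD (lerD g1 g1) (lerD g2 g2)) g3) (lerD g4 g4).
rewrite -subr_ge0 => h; apply: (le_trans h); rewrite le_eqVlt; apply/orP; left.
by apply/eqP; rewrite /u1; ring.
Qed.

(* Stability in the negative norm [N 1 (invl e)]; testing with [invl e] kills
  the term in which [invl e] is the transporting stream function. *)
Lemma ip_bk_invl f e : zm e ->
 `|ip (bk f e) (invl e)| <= csup * N 4 f * N 1 (invl e) ^+ 2.
move=> he; set x := invl e.
have -> : ip (bk f e) x = - (ip (rot e0 x) (bk (rot e0 f) x) +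
  ip (rot e1 x) (bk (rot e1 f) x) + ip (rot e2 x) (bk (rot e2 f) x)) * -1.
 rewrite ip_bk -(ip_extl _ (lapp_invl he)) ip_lapp opprK mulrN1 opprK.
 have h i : ip (rot i x) (rot i (bk f x)) = ip (rot i x) (bk (rot i f) x).
  by rewrite rot_bk ipDr [X in _ + X]ipC ip_bk_self addr0.
 by rewrite !h.
rewrite mulrN1 opprK.
have key i : `|ip (rot i x) (bk (rot i f) x)| <=
  csup * N 1 x * (N 0 (rot i x) * N 3 (rot i f)).
 apply: (le_trans (ip_le _ _)).
 apply: (le_trans (ler_wpM2l (N_ge0 _ _) (N_bk31 _ _))).
 rewrite le_eqVlt; apply/orP; left; apply/eqP; ring.
apply: (le_trans (ler_normD _ _)).
apply: (le_trans (lerD (ler_normD _ _) (lexx _))).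
apply: (le_trans (lerD (lerD (key _) (key _)) (key _))).
rewrite -!mulrDr; apply: (le_trans (ler_wpM2l (mulr_ge0 csup_ge0 (N_ge0 1 x)) (N_rot 0 3 x f))).
rewrite le_eqVlt; apply/orP; left; apply/eqP; ring.
Qed.

End bracket_estimates.

Ltac nneg := by repeat first
 [ match goal with
  | H : is_true (@Order.le _ _ _ ?x) |- is_true (@Order.le _ _ _ ?x) => exact H
  | H : is_true (@Order.lt _ _ _ ?x) |- is_true (@Order.lt _ _ _ ?x) => exact H
  | H : is_true (@Order.lt _ _ _ ?x) |- is_true (@Order.le _ _ _ ?x) => exact (ltW H)
  end
 | exact: ler0n | exact: ler01 | exact: ltr0Sn | exact: ltr01 | exact: normr_ge0 | exact: N_ge0 | exact: csup_ge0 | exact: lam_ge0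
 | apply: mulr_ge0 | apply: addr_ge0 | apply: sqr_ge0 | apply: exprn_ge0 | rewrite invr_ge0
 | apply: mulr_gt0 | apply: divr_gt0 | apply: ltr_wpDl | apply: exprn_gt0 ].

(** * Differentiable curves of polynomials and the truncated field *)

Section galerkin_curves.
Context (R : realType).
Notation P := (pol R).
Notation sip := (@sip R).
Notation lam := (@lam R).
Notation csup := (csup R).

(** Differentiability is asked of the coefficients only, so that curves matter modulo polynomials
    vanishing on the sphere. *)
Definition dcurve n (X dX : R -> P) (T : R) := (forall t, inV n (X t) /\ zm (X t)) /\
 forall t, 0 <= t <= T -> forall k,
  is_derive t (1 : R) (fun s => cf (X s) k) (cf (dX t) k).

Lemma dcurve_S r n X dX T t : dcurve n X dX T -> 0 <= t <= T ->
 is_derive t (1 : R) (fun s => S r (X s)) (2 * sip r (dX t) (X t)).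
move=> [hX hd] ht.
have -> : (fun s => S r (X s)) =
  \sum_(k < n) (fun s => lam k ^+ r * (cf (X s) k * cf (X s) k)).
 by apply/funext => s; rewrite (S_sum _ (hX s).1) fct_sumE.
have -> : 2 * sip r (dX t) (X t) =
  \sum_(k < n) lam k ^+ r * (cf (X t) k * cf (dX t) k + cf (X t) k * cf (dX t) k).
 by rewrite (sip_sum _ _ (hX t).1) mulr_sumr; apply: eq_bigr => k _; ring.
apply: is_derive_sum => k; have h := hd t ht k.
have h2 := @is_deriveM _ _ _ _ t 1 _ _ h h.
by have := @is_deriveZ _ _ _ _ (lam k ^+ r) t 1 _ h2.
Qed.

Lemma dcurve_invl n X dX T : dcurve n X dX T ->
 dcurve n (fun t => invl (X t)) (fun t => invl (dX t)) T.
move=> [hX hd]; split; first by split; [exact: inV_invl (hX t).1|exact: zm_invl].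
move=> t ht k.
have -> : (fun s => cf (invl (X s)) k) = (fun s => - (lam k)^-1 * cf (X s) k).
 by apply/funext => s; rewrite cf_invl mulNr.
rewrite cf_invl -mulNr.
by have := @is_deriveZ _ _ _ _ (- (lam k)^-1) t 1 _ (hd t ht k).
Qed.

Lemma sip1_invl p q : zm p -> sip 1 (invl p) q = - ip p q.
by move=> h; rewrite /sip ipNl (ip_extl _ (lapp_invl h)). Qed.
Lemma dcurve_B n X dX X' dX' T : dcurve n X dX T -> dcurve n X' dX' T ->
 dcurve n (fun t => X t - X' t) (fun t => dX t - dX' t) T.
move=> [hX hd] [hX' hd']; split.
 split; last by apply: zmB; [exact: (hX t).2|exact: (hX' t).2].
 rewrite -scaleN1r addrC; apply: inV_lin; [exact: (hX' t).1|exact: (hX t).1].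
move=> t ht k; rewrite cfB.
have -> : (fun s => cf (X s - X' s) k) = (fun s => cf (X s) k - cf (X' s) k).
 by apply/funext => s; rewrite cfB.
exact: (@is_deriveB _ _ _ _ _ t 1 _ _ (hd t ht k) (hd' t ht k)).
Qed.

Definition affine p q (t : R) : P := p + t *: q.

Lemma dcurve_affine n p q T : inV n p -> inV n q -> zm p -> zm q ->
 dcurve n (affine p q) (fun=> q) T.
move=> hp hq zp zq; split.
 split; last by apply: zmD => //; exact: zmZ.
 by rewrite /affine addrC; exact: inV_lin.
move=> t _ k.
have -> : (fun s => cf (affine p q s) k) = (fun s => cf p k + s * cf q k).
 by apply/funext => s; rewrite cfD cfZ.
by apply: is_derive_eq; rewrite /GRing.scale /=; ring.
Qed.

Lemma dcurve_le n m X dX T T' : (n <= m)%N -> T' <= T -> dcurve n X dX T ->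
 dcurve m X dX T'.
move=> nm TT [hX hd]; split.
 by split; [exact: inV_le (hX t).1|exact: (hX t).2].
by move=> t /andP[t0 tT] k; apply: hd; rewrite t0 (le_trans tT).
Qed.

(* Gronwall's inequality in the form in which all energy estimates use it:
  the growth of the energy splits as [K E] plus a forcing of size [rho]. *)
Lemma energy_gronwall (E dE : R -> R) (K rho T : R) : 0 < T -> 0 <= K ->
 0 <= E 0 -> 2 * K * T <= 1 ->
 (forall t, 0 <= t <= T -> is_derive t (1 : R) E (dE t)) ->
 (forall t, 0 <= t <= T -> 0 <= E t) ->
 (forall t, 0 <= t <= T -> dE t <= K * E t + 2 * rho * Num.sqrt (E t)) ->
 forall t, 0 <= t <= T -> E t <= 4 * E 0 + 12 * (T * rho) ^+ 2.
move=> T0 K0 E00 KT Ed Ege dEK t /andP[t0 tT].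
have T2 : 0 < 2 * T by nneg.
have sub s : 0 <= s <= t -> 0 <= s <= T.
 by move=> /andP[-> st]; rewrite (le_trans st).
(* The forcing is absorbed by [2 * rho * u <= (u ^ 2 + 4 * (T * rho) ^ 2) / (2 * T)]. This adds
   [1 / 2] to the exponent, which stays at most one, and the factor 4 turns the shift
   [4 * (T * rho) ^ 2] into [12 * (T * rho) ^ 2]. *)
have := @gronwall4 R E dE (K + (2 * T)^-1) (4 * (T * rho) ^+ 2) 0 t t0.
rewrite subr0 => h.
have : E t + 4 * (T * rho) ^+ 2 <= 4 * (E 0 + 4 * (T * rho) ^+ 2).
 apply: h.
 - apply: (@le_trans _ _ ((K + (2 * T)^-1) * T)).
   by rewrite ler_wpM2l// addr_ge0// invr_ge0 ltW.
  rewrite mulrDl invfM -mulrA mulVf ?gt_eqF// mulr1.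
  by lra.
 - by rewrite addr_ge0// mulr_ge0// sqr_ge0.
 - by move=> s /sub; exact: Ed.
 move=> s /sub hs; apply: (le_trans (dEK s hs)).
 rewrite [leRHS]mulrDl; apply: lerD.
  by rewrite ler_wpM2l// lerDl mulr_ge0// sqr_ge0.
 have := sqr_sqrtr (Ege s hs); move: (Num.sqrt (E s)) => u uE.
 rewrite -uE [leRHS]mulrC ler_pdivlMr// -subr_ge0.
 have -> : u ^+ 2 + 4 * (T * rho) ^+ 2 - 2 * rho * u * (2 * T) =
  (u - 2 * (T * rho)) ^+ 2 by ring.
 exact: sqr_ge0.
lra.
Qed.

Definition euler w : P := bk (invl w) w.

Definition gfield n (mu : R) v w : P := proj n (euler w) + mu *: lapp w + v.

Lemma sip_proj r n p q : inV n q -> sip r (proj n p) q = sip r p q.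
move=> h; rewrite !(sip_sum _ _ h); apply: eq_bigr => k _.
by rewrite cf_proj ltn_ord.
Qed.

Lemma sip_lapp_le0 r p : sip r (lapp p) p <= 0.
have [n h] := inV_exists p; rewrite (sip_sum _ _ h) sumr_le0// => k _.
rewrite mulr_ge0_le0 ?exprn_ge0 // cf_lapp -mulrA mulNr oppr_le0.
by rewrite mulr_ge0 // sqr_ge0.
Qed.

Lemma sipZl r a p q : sip r (a *: p) q = a * sip r p q.
have [n h] := inV_exists q; rewrite !(sip_sum _ _ h) mulr_sumr.
by apply: eq_bigr => k _; rewrite cfZ; ring.
Qed.

Lemma sip2_euler0 e : zm e -> `|sip 2 (euler e) e| <= 2 * csup * N 2 e ^+ 3.
move=> he; apply: (le_trans (sip2_bk_self _ _)).
rewrite (@N_ext _ 0 _ (bk e e)); last exact/pev_bkl/lapp_invl.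
rewrite bkpp N0 N_invl// le_eqVlt; apply/orP; left; apply/eqP; ring.
Qed.

Lemma N_euler e : zm e -> N 0 (euler e) <= csup * N 1 e ^+ 2.
by move=> he; apply: (le_trans (N_bk31 _ _)); rewrite N_invl// mulrA.
Qed.

Lemma N_eulerB p q : zm p -> zm q -> N 0 (euler p - euler q) <=
 csup * (N 1 p + N 1 q) * N 1 (p - q).
move=> hp hq.
have h : pev (euler p - euler q) = pev (bk (invl (p - q)) p + bk (invl q) (p - q)).
 apply/funext => x; rewrite [RHS]pevD (pev_bkl p (invlB p q)) bkBl bkBr.
 by rewrite !pevB /euler; ring.
rewrite (N_ext 0 h); apply: ND_le.
apply: (le_trans (lerD (N_bk31 _ _) (N_bk31 _ _))).
rewrite !N_invl ?le_eqVlt//; last exact: zmB.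
apply/orP; left; apply/eqP; ring.
Qed.

End galerkin_curves.

(** * Existence of truncated solutions *)

Section galerkin_existence.
Context (R : realType).
Notation P := (pol R).
Notation N := (@N R).
Notation lam := (@lam R).
Notation csup := (csup R).
Notation Y := (@Y R).

Lemma nY_le1 k : nY R k <= 1.
by have [->|->] := nY01 R k. Qed.
Lemma cf_Y j k : cf (Y j) k = if j == k then nY R k else 0.
by case: eqP => [->|/eqP /(Y_orth R)]. Qed.
Lemma cf_le p k : `|cf p k| <= N 0 p.
apply: (le_trans (ip_le p (Y k))); rewrite ler_piMr//.
by rewrite -[leRHS]sqrtr1 ler_wsqrtr// nY_le1.
Qed.

Lemma N2_Y k : N 2 (Y k) <= lam k.
have h : S 2 (Y k) <= lam k ^+ 2.
 rewrite (S_sum _ (inV_Y R (ltnSn k))) big_ord_recr/= big1 ?add0r.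
  rewrite cf_Y eqxx ler_piMr ?sqr_ge0//.
  by have [->|->] := nY01 R k; rewrite ?expr0n.
 move=> j _; rewrite cf_Y; case: eqP => [h|_]; last by rewrite expr0n mulr0.
 by move: (ltn_ord j) h; lia.
by rewrite -[leRHS]ger0_norm // -sqrtr_sqr ler_wsqrtr.
Qed.

Section cutoff.
Variables (n : nat) (mu M : R) (v : P).
Hypotheses (M0 : 0 < M) (mu0 : 0 <= mu) (zv : zm v) (hv : inV n v).

(** Coefficient 0 is discarded, which forces a zero mean. *)
Let pl (x : nat -> R) : P := \sum_(k < n) (if k == 0%N :> nat then 0 else x k) *: Y k.

Let inV_pl x : inV n (pl x).
exact: (@inV_sum _ n n (fun k => (if k == 0%N then 0 else x k) *: Y k)
 (fun k kn => inVZ _ (inV_Y R kn))).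
Qed.

Let cf_pl x k : cf (pl x) k =
 if (k < n)%N then (if k == 0%N then 0 else x k) * nY R k else 0.
exact: (cf_sum n (fun k => if k == 0%N then 0 else x k)). Qed.

Let zm_pl x : zm (pl x).
by apply/zm_cf0; rewrite cf_pl mul0r if_same. Qed.
(** The Euler term is quadratic, while Picard iteration requires a global Lipschitz bound. It is
    multiplied by a cut-off equal to 1 for [N 2 p <= M] and to 0 beyond [2 * M]; the a priori bound
    shows that the cut-off never acts. *)
Let rho (p : P) : R := Num.max 0 (Num.min 1 (2 - N 2 p / M)).

Let rho_itv p : 0 <= rho p <= 1.
by rewrite le_max lexx ge_max ler01 ge_min lexx. Qed.
Let rho_lip p q : `|rho p - rho q| <= N 2 (p - q) / M.
have h : `|N 2 p / M - N 2 q / M| <= N 2 (p - q) / M.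
 rewrite -mulrBl normrM (gtr0_norm (_ : 0 < M^-1)) ?invr_gt0//.
 by apply: ler_wpM2r; [rewrite invr_ge0 ltW|exact: N_dist].
apply: le_trans h; rewrite /rho.
move: (N 2 p / M) (N 2 q / M) => a b.
wlog ab : a b / a <= b.
 move=> H; have [ab|ab] : a <= b \/ b <= a by apply/orP; exact: le_total.
  exact: H.
 by rewrite distrC [leRHS]distrC; exact: H.
rewrite [leRHS]distrC [leRHS]ger0_norm ?subr_ge0// ler_norml.
have hm (z : R) : [\/ z <= 1 /\ Num.max 0 (Num.min 1 (2 - z)) = 1,
  1 <= z <= 2 /\ Num.max 0 (Num.min 1 (2 - z)) = 2 - z |
  2 <= z /\ Num.max 0 (Num.min 1 (2 - z)) = 0].
 have [z1|z1] := lerP z 1; first by apply: Or31; rewrite min_l; [rewrite max_r|lra].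
 have [z2|z2] := lerP z.
  by apply: Or32; split; [lra|rewrite min_r; [rewrite max_r; lra|lra]].
 by apply: Or33; split; [lra|rewrite min_r; [rewrite max_l; lra|lra]].
case: (hm a) => -[ha ->]; case: (hm b) => -[hb ->]; lra.
Qed.

Let rho_out p : 2 * M <= N 2 p -> rho p = 0.
move=> h; rewrite /rho max_l// ge_min; apply/orP; right.
by rewrite subr_le0 ler_pdivlMr.
Qed.

Let rho_in p : N 2 p <= M -> rho p = 1.
move=> h; have h1 : N 2 p / M <= 1 by rewrite ler_pdivrMr// mul1r.
by rewrite /rho min_l; [rewrite max_r|lra].
Qed.

Let c0 := csup_ge0 R.

Let b_le p : zm p -> N 2 p <= 2 * M -> N 0 (euler p) <= csup * (4 * M ^+ 2).
move=> zp h; apply: (le_trans (N_euler zp)); rewrite ler_wpM2l//.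
have h1 : N 1 p <= 2 * M by apply: le_trans h; exact: N_zm_le.
have -> : 4 * M ^+ 2 = (2 * M) ^+ 2 by ring.
by rewrite lerXn2r ?nnegrE// mulr_ge0// ltW.
Qed.

Let b_lip p q : zm p -> zm q -> N 2 p <= 2 * M ->
 N 0 (rho p *: euler p - rho q *: euler q) <= 8 * csup * M * N 2 (p - q).
move=> zp zq hp.
have -> : rho p *: euler p - rho q *: euler q =
  (rho p - rho q) *: euler p + rho q *: (euler p - euler q).
 by rewrite scalerBl scalerBr addrA subrK.
apply: ND_le; rewrite !NZ.
have h1 : `|rho p - rho q| * N 0 (euler p) <= 4 * csup * M * N 2 (p - q).
 apply: (le_trans (ler_pM _ _ (rho_lip p q) (b_le zp hp))) => //.
 rewrite le_eqVlt; apply/orP; left; apply/eqP.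
 have Mn0 : M != 0 by rewrite gt_eqF.
 by field.
have h2 : `|rho q| * N 0 (euler p - euler q) <= 4 * csup * M * N 2 (p - q).
 case: (lerP (2 * M) (N 2 q)) => hq.
  by rewrite rho_out// normr0 mul0r !mulr_ge0// ltW.
 have hr : `|rho q| <= 1 by rewrite ger0_norm; case/andP: (rho_itv q).
 apply: (@le_trans _ _ (1 * N 0 (euler p - euler q))); first by rewrite ler_wpM2r.
 rewrite mul1r; apply: (le_trans (N_eulerB zp zq)).
 have -> : 4 * csup * M * N 2 (p - q) = csup * (2 * M + 2 * M) * N 2 (p - q) by ring.
 apply: ler_pM => //; first by nneg.
  rewrite ler_wpM2l// lerD//; first by apply: le_trans hp; exact: N_zm_le.
  by apply: le_trans (ltW hq); exact: N_zm_le.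
 by apply: N_zm_le => //; exact: zmB.
apply: (le_trans (lerD h1 h2)); rewrite le_eqVlt; apply/orP; left; apply/eqP.
by ring.
Qed.

Let b_lip' p q : zm p -> zm q ->
 N 0 (rho p *: euler p - rho q *: euler q) <= 8 * csup * M * N 2 (p - q).
move=> zp zq; case: (lerP (N 2 p) (2 * M)) => hp; first exact: b_lip.
case: (lerP (N 2 q) (2 * M)) => hq; first by rewrite (NBC 0) (NBC 2); exact: b_lip.
by rewrite (rho_out (ltW hp)) (rho_out (ltW hq)) !scale0r subrr N0 !mulr_ge0// ltW.
Qed.

Let fld (p : P) : P := proj n (rho p *: euler p) + mu *: lapp p + v.

Let F (x : nat -> R) (k : nat) : R := cf (fld (pl x)) k.

Let pl_lip (x y : nat -> R) : N 2 (pl x - pl y) <= lam n * \sum_(j < n) `|x j - y j|.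
have -> : pl x - pl y =
  \sum_(k < n) (if k == 0%N :> nat then 0 else x k - y k) *: Y k.
 rewrite -sumrB; apply: eq_bigr => k _; rewrite -scalerBl.
 by case: ifP => //; rewrite subrr.
apply: (le_trans (N_sum _ _ _)); rewrite mulr_sumr; apply: ler_sum => k _.
rewrite NZ mulrC; apply: ler_pM => //.
 by apply: (le_trans (N2_Y k)); rewrite lam_le// ltnW.
by case: ifP => //; rewrite normr0.
Qed.

Let F_lip (x y : nat -> R) k : (k < n)%N -> `|F x k - F y k| <=
 (8 * csup * M + mu * lam n) * lam n * \sum_(j < n) `|x j - y j|.
move=> kn; set d := \sum_(j < n) _.
have hd : N 2 (pl x - pl y) <= lam n * d := pl_lip x y.
have -> : F x k - F y k =
 cf (rho (pl x) *: euler (pl x) - rho (pl y) *: euler (pl y)) k -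
 mu * lam k * cf (pl x - pl y) k.
 by rewrite /F !cfD !cfZ !cf_lapp !cf_proj kn !cfN !cfZ; ring.
apply: (le_trans (ler_normB _ _)).
have -> : (8 * csup * M + mu * lam n) * lam n * d =
 8 * csup * M * (lam n * d) + mu * lam n * (lam n * d) by ring.
apply: lerD.
 apply: (le_trans (cf_le _ _)); apply: (le_trans (b_lip' _ _)) => //.
 by rewrite ler_wpM2l// !mulr_ge0// ltW.
rewrite !normrM (ger0_norm mu0) (ger0_norm (lam_ge0 _ k)); apply: ler_pM => //.
- nneg.
- by rewrite ler_wpM2l// lam_le// ltnW.
apply: (le_trans (cf_le _ _)); apply: le_trans hd; apply: N_zm_le => //.
exact: zmB.
Qed.

Lemma cutoff_exists (T : R) y : 0 < T -> inV n y -> zm y ->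
 4 * (N 2 y + T * N 2 v) <= M -> 16 * csup * M * T <= 1 ->
 exists X : R -> P, [/\ dcurve n X (fun t => gfield n mu v (X t)) T,
  pev (X 0) = pev y & forall t, 0 <= t <= T -> N 2 (X t) <= 4 * (N 2 y + T * N 2 v)].
move=> T0 hy zy HM HT.
have L0 : 0 <= (8 * csup * M + mu * lam n) * lam n.
 nneg.
have [W [W0 Wd]] := @picard R n F _ T (cf y) T0 L0 F_lip.
pose X t := pl (W t).
have cfX t k : (k < n)%N -> k != 0%N -> cf (X t) k = W t k * nY R k.
 by move=> kn k0; rewrite /X cf_pl kn (negbTE k0).
have X0 : pev (X 0) = pev y.
 apply: (inV_cf (inV_pl _) hy) => k kn; have [k0|k0] := eqVneq k 0%N.
  by rewrite k0 ((zm_cf0 (pl (W 0))).1 (zm_pl _)) ((zm_cf0 y).1 zy).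
 by rewrite cfX// W0// ip_Y_nY.
have zf p : zm p -> cf (fld p) 0 = 0.
 move=> zp; apply: (zm_cf0 _).1.
 have h1 : zm (proj n (rho p *: euler p)) by apply: zm_proj; apply: zmZ; exact: zm_bk.
 have h2 : zm (mu *: lapp p) by apply: zmZ; exact: zm_lapp.
 exact: (zmD (zmD h1 h2) zv).
have inVf p : inV n p -> inV n (fld p).
 move=> hp; rewrite /fld addrC -[v]scale1r; apply: inV_lin => //.
 by rewrite addrC; apply: inV_lin; [exact: inV_lapp|exact: inV_proj].
have Xd : dcurve n X (fun t => fld (X t)) T.
 split=> [t|t ht k]; first by split; [exact: inV_pl|exact: zm_pl].
 case: (ltnP k n) => kn; last first.
  rewrite (cf_eq0 (inVf _ (inV_pl _)) kn).
  have -> : (fun s => cf (X s) k) = cst 0; last exact: is_derive_cst.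
  by apply/funext => s; rewrite /= (cf_eq0 (inV_pl _) kn).
 have [k0|k0] := eqVneq k 0%N.
  rewrite k0 (zf _ (zm_pl (W t))).
  have -> : (fun s => cf (X s) 0) = cst 0; last exact: is_derive_cst.
  by apply/funext => s; rewrite /= ((zm_cf0 (X s)).1 (zm_pl _)).
 have -> : (fun s => cf (X s) k) = (fun s => nY R k * W s k).
  by apply/funext => s; rewrite cfX// mulrC.
 have -> : cf (fld (X t)) k = nY R k * F (W t) k.
  by rewrite mulrC /F cfE ip_Y_nY.
 by have := @is_deriveZ _ _ _ _ (nY R k) t 1 _ (Wd t k ht kn).
pose B := N 2 y + T * N 2 v.
have bound t : 0 <= t <= T -> N 2 (X t) <= 4 * B.
 move=> ht.
 have := @energy_gronwall R (fun s => S 2 (X s)) (fun t => 2 * sip 2 (fld (X t)) (X t))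
  (8 * csup * M) (N 2 v) T T0.
 have K0 : 0 <= 8 * csup * M by nneg.
 move=> /(_ K0 (S_ge0 _ _)) H.
 have {H} := H _ (fun s hs => dcurve_S 2 Xd hs) (fun s _ => S_ge0 2 (X s)) _ t ht.
 rewrite (S_ext 2 X0) => h.
 have {h} : S 2 (X t) <= 4 * S 2 y + 12 * (T * N 2 v) ^+ 2.
  apply: h; first by rewrite !mulrA -natrM.
  move=> s hs; set x := X s.
  have E1 : sip 2 (proj n (rho x *: euler x)) x <= 4 * csup * M * S 2 x.
   rewrite sip_proj; last exact: inV_pl.
   rewrite sipZl; case: (lerP (2 * M) (N 2 x)) => hx.
    by rewrite rho_out// mul0r !mulr_ge0// ltW.
   have [r0 r1] := andP (rho_itv x).
   apply: (le_trans (ler_norm _)); rewrite normrM (ger0_norm r0).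
   apply: (@le_trans _ _ (1 * (2 * csup * N 2 x ^+ 3))).
    by apply: ler_pM => //; apply: sip2_euler0; exact: zm_pl.
   have -> : 1 * (2 * csup * N 2 x ^+ 3) = 2 * csup * S 2 x * N 2 x.
    by rewrite -N_sq; ring.
   have -> : 4 * csup * M * S 2 x = 2 * csup * S 2 x * (2 * M) by ring.
   by rewrite ler_wpM2l ?mulr_ge0// ltW.
  have E2 : sip 2 (mu *: lapp x) x <= 0.
   by rewrite sipZl mulr_ge0_le0// sip_lapp_le0.
  have E3 : sip 2 v x <= N 2 v * Num.sqrt (S 2 x).
   by apply: (le_trans (ler_norm _)); exact: sip_le.
  rewrite /fld !sipDl; move: E1 E2 E3; rewrite -/x.
  move: (sip 2 _ x) (sip 2 _ x) (sip 2 v x) => a b c.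
  have -> : 8 * csup * M * S 2 x = 2 * (4 * csup * M * S 2 x) by ring.
  have -> : 2 * N 2 v * Num.sqrt (S 2 x) = 2 * (N 2 v * Num.sqrt (S 2 x)) by ring.
  move: (4 * csup * M * S 2 x) (N 2 v * _) => u w; lra.
 move=> h; have B0 : 0 <= B by nneg.
 rewrite -ler_sqr ?nnegrE ?mulr_ge0// N_sq; apply: (le_trans h).
 rewrite /B -N_sq; have := N_ge0 2 y; have : 0 <= T * N 2 v by nneg.
 move: (N 2 y) (T * N 2 v) => a b a0 b0; have := mulr_ge0 a0 b0.
 by rewrite -subr_ge0 => h1; rewrite -subr_ge0; nra.
(* The bound keeps the curve where the cut-off is 1, so it solves the original truncated
   equation. *)
exists X; split; [split; [exact: Xd.1|]|exact: X0|exact: bound].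
move=> t ht k; have := Xd.2 t ht k.
by rewrite /gfield /fld rho_in ?scale1r//; exact: le_trans (bound t ht) HM.
Qed.

End cutoff.

(** The lifespan condition: [b] bounds the datum plus the accumulated forcing. The constant 512
    leaves room in the Gronwall exponents of the estimates that follow. *)
Definition small (T b : R) := 512 * csup * T * b <= 1.

(* A Galerkin solution of dimension [n] with constant forcing [v] on a time
  interval short enough for the [N 2] norm to remain controlled. *)
Definition gsol n mu v (T : R) y (X : R -> P) : Prop :=
 [/\ 0 < T, small T (N 2 y + T * N 2 v),
  dcurve n X (fun t => gfield n mu v (X t)) T,
  pev (X 0) = pev y & forall t, 0 <= t <= T -> N 2 (X t) <= 4 * (N 2 y + T * N 2 v)].

Lemma gsol_exists n mu v T y : 0 <= mu -> 0 < T -> inV n v -> zm v -> inV n y -> zm y ->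
 small T (N 2 y + T * N 2 v) -> exists X, gsol n mu v T y X.
move=> mu0 T0 hv zv hy zy hs; set B := N 2 y + T * N 2 v.
have B0 : 0 <= B by nneg.
have c0 := csup_ge0 R.
have cT : 0 <= 32 * csup * T by nneg.
(* [M] has to be positive even if [B] vanishes; [d] is a margin small enough for the lifespan
   condition. *)
pose d := (32 * csup * T + 1)^-1.
have d0 : 0 < d by rewrite invr_gt0 ltr_wpDl.
have hd : 32 * csup * T * d <= 1.
 by rewrite ler_pdivrMr ?mul1r ?lerDl// ltr_wpDl.
have [|||X [h1 h2 h3]] := @cutoff_exists n mu (4 * B + d) v _ mu0 zv hv T y T0 hy zy.
- nneg.
- by rewrite lerDl ltW.
- move: hs hd; rewrite /small -/B.
 have -> : 512 * csup * T * B = 8 * (64 * (csup * T * B)) by ring.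
 have -> : 32 * csup * T * d = 2 * (16 * (csup * T * d)) by ring.
 have -> : 16 * csup * (4 * B + d) * T = 64 * (csup * T * B) + 16 * (csup * T * d) by ring.
 have : 0 <= csup * T * B by nneg.
 lra.
by exists X.
Qed.

End galerkin_existence.

Lemma projE (R : realType) n (p : pol R) :
 proj n p = \sum_(k < n) cf p k *: Y R k.
by []. Qed.

(** * Stability of truncated solutions, uniform in the dimension *)

Section galerkin_estimates.
Context (R : realType).
Local Opaque ip cf sip S N lapp bk rot invl proj pev Ip.
Notation P := (pol R).
Implicit Types (p q f g w e z v y A D : P) (r n m k : nat) (mu T : R).
Notation lam := (@lam R).
Notation csup := (csup R).
Let c0 : 0 <= csup := csup_ge0 R.

Lemma sqr_le_norm (a b : R) : 0 <= b -> a ^+ 2 <= b ^+ 2 -> a <= b.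
move=> b0 h; apply: (le_trans (ler_norm a)).
by rewrite -ler_sqr // real_normK ?num_real.
Qed.

Lemma energy_root (x a b : R) : 0 <= a -> 0 <= b ->
 x ^+ 2 <= 4 * a ^+ 2 + 12 * b ^+ 2 -> x <= 2 * a + 4 * b.
move=> a0 b0 h; apply: sqr_le_norm; first by nneg.
apply: (le_trans h); rewrite -subr_ge0.
have -> : (2 * a + 4 * b) ^+ 2 - (4 * a ^+ 2 + 12 * b ^+ 2) = 16 * (a * b) + 4 * b ^+ 2 by ring.
by rewrite addr_ge0 ?mulr_ge0.
Qed.

Lemma eulerB p q : pev (euler p - euler q) =
 pev (bk (invl q) (p - q) + bk (invl (p - q)) q + bk (invl (p - q)) (p - q)).
have hp : pev (euler p) = pev (bk (invl q + invl (p - q)) (q + (p - q))).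
 rewrite /euler; set e := p - q; have -> : p = q + e by rewrite addrC subrK.
 exact/pev_bkl/invlD.
apply/funext => x; rewrite pevB hp bkDl !bkDr !pevD /euler.
by lra.
Qed.

Lemma sipNl r p q : sip r (- p) q = - sip r p q.
by rewrite -scaleN1r sipZl mulN1r. Qed.

Section one_solution.
Variables (n : nat) (mu : R) (v : P) (T : R) (y : P) (X : R -> P).
Hypotheses (mu0 : 0 <= mu) (HX : gsol n mu v T y X).

Let B := N 2 y + T * N 2 v.
Let T0 : 0 < T. by case: HX. Qed.
Let B0 : 0 <= B. Proof. nneg. Qed.
Let cTB : 512 * (csup * T * B) <= 1. by rewrite !mulrA; case: HX. Qed.
Let cTB0 : 0 <= csup * T * B. Proof. nneg. Qed.
Let zX t : zm (X t). by case: HX => _ _ [h _] _ _; exact: (h t).2. Qed.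
Let vX t : inV n (X t). by case: HX => _ _ [h _] _ _; exact: (h t).1. Qed.
Let bX t : 0 <= t <= T -> N 2 (X t) <= 4 * B. by case: HX => _ _ _ _; exact. Qed.

(** Stability around an explicit smooth path whose residual in the equation is at most [r]. The
    derivative lost by the Euler term falls on the path, where [G] controls it. *)
Lemma gsol_close (A D : P) (G r : R) : inV n A -> inV n D -> zm A -> zm D ->
 (forall t, 0 <= t <= T -> N 3 (affine A D t) <= G) ->
 (forall t, 0 <= t <= T -> N 2 (euler (affine A D t) + mu *: lapp (affine A D t)
   + v - D) <= r) ->
 64 * csup * G * T <= 1 ->
 forall t, 0 <= t <= T -> N 2 (X t - affine A D t) <= 2 * N 2 (y - A) + 4 * (T * r).
move=> hA hD zA zD hG hr cGT t ht.
have G0 : 0 <= G by apply: le_trans (hG t ht).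
have r0 : 0 <= r by apply: le_trans (hr t ht).
have dA := dcurve_affine T hA hD zA zD.
case: HX => _ _ dX X0 _.
have dE := dcurve_B dX dA.
set th := affine A D in hG hr dA dE *.
have zth s : zm (th s) := (dA.1 s).2.
have zE s : zm (X s - th s) := (dE.1 s).2.
have K0 : 0 <= 2 * csup * (9 * G + 8 * B) by nneg.
have main := @energy_gronwall R _ _ _ r T T0 K0 (S_ge0 2 _) _
 (fun s hs => dcurve_S 2 dE hs) (fun s _ => S_ge0 2 _).
have {main} main : S 2 (X t - th t) <= 4 * S 2 (X 0 - th 0) + 12 * (T * r) ^+ 2.
 apply: main ht.
  rewrite (_ : 2 * _ * _ = 36 * (csup * G * T) + 32 * (csup * T * B)); last by ring.
  have : 64 * (csup * G * T) <= 1 by rewrite !mulrA.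
  have : 0 <= csup * G * T by nneg.
  by move: cTB cTB0; lra.
 move=> s hs; set e := X s - th s.
 have ve : inV n e := (dE.1 s).1.
 have ze : zm e := zE s.
 have -> : sip 2 (gfield n mu v (X s) - D) e = sip 2 (euler (X s) - euler (th s)) e
   + mu * sip 2 (lapp e) e + sip 2 (euler (th s) + mu *: lapp (th s) + v - D) e.
  have hl : sip 2 (lapp (X s)) e = sip 2 (lapp (th s)) e + sip 2 (lapp e) e.
   rewrite -sipDl; apply: sip_ext => //; apply/funext => x.
   have -> : X s = th s + e by rewrite addrC subrK.
   have : pev (lapp (th s + e)) = pev (lapp (th s) + lapp e).
    by apply: cf_inj; apply/funext => k; rewrite !(cf_lapp,cfD); ring.
   by move=> /(congr1 (fun u => u x)).
  rewrite /gfield; move: hl; move: (lapp (X s)) (lapp (th s)) (lapp e) => a1 a2 a3 hl.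
  by rewrite !sipDl !sipNl !sipZl hl (sip_proj 2 _ ve); ring.
 have E1 : sip 2 (euler (X s) - euler (th s)) e <= csup * (9 * G + 8 * B) * S 2 e.
  rewrite (sip_ext 2 (eulerB _ _) (erefl (pev e))); apply: (le_trans (ler_norm _)).
  apply: (le_trans (sip2_euler (zth s) ze)).
  have n1 : N 1 e <= N 2 e by exact: N_zm_le.
  have n23 : N 2 (th s) <= G by apply: le_trans (hG s hs); exact: N_zm_le.
  have ne : N 2 e <= 4 * B + G by apply: (le_trans (NB _ _ _)); rewrite lerD// bX.
  rewrite -N_sq.
  have -> : csup * (9 * G + 8 * B) * N 2 e ^+ 2 = csup * N 2 e *
   (3 * (G * N 2 e) + 4 * (G * N 2 e) + 2 * (N 2 e * (4 * B + G))) by ring.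
  rewrite ler_wpM2l ?mulr_ge0// !lerD//.
  - by rewrite -mulrA ler_wpM2l// ler_pM// hG.
  - by rewrite -mulrA ler_wpM2l// ler_wpM2r.
  - by rewrite ler_wpM2l// ler_wpM2l.
 have E2 : mu * sip 2 (lapp e) e <= 0 by rewrite mulr_ge0_le0// sip_lapp_le0.
 have E3 : sip 2 (euler (th s) + mu *: lapp (th s) + v - D) e <= r * Num.sqrt (S 2 e).
  apply: (le_trans (ler_norm _)); apply: (le_trans (sip_le _ _ _)).
  by rewrite ler_wpM2r// hr.
 move: E1 E2 E3; move: (sip 2 _ e) (mu * _) (sip 2 _ e) => a b c.
 have -> : 2 * csup * (9 * G + 8 * B) * S 2 e = 2 * (csup * (9 * G + 8 * B) * S 2 e) by ring.
 rewrite -(mulrA 2 r).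
 by lra.
have h0 : S 2 (X 0 - th 0) = N 2 (y - A) ^+ 2.
 rewrite N_sq; apply: S_ext; apply/funext => x; rewrite !pevB X0.
 by rewrite /th /affine scale0r addr0.
rewrite h0 -N_sq in main.
exact: (energy_root (N_ge0 _ _) (mulr_ge0 (ltW T0) r0) main).
Qed.

(** By [sip3_euler], the bound on [N 2 (X t)] is all that governs the growth of the next norm. *)
Lemma gsol_N3 t : 0 <= t <= T -> N 3 (X t) <= 2 * N 3 y + 4 * (T * N 3 v).
move=> ht; case: HX => _ _ dX X0 _.
have K0 : 0 <= 56 * csup * B by nneg.
have main := @energy_gronwall R _ _ _ (N 3 v) T T0 K0 (S_ge0 3 _) _
 (fun s hs => dcurve_S 3 dX hs) (fun s _ => S_ge0 3 _).
have {main} main : S 3 (X t) <= 4 * S 3 (X 0) + 12 * (T * N 3 v) ^+ 2.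
 apply: main ht.
  rewrite (_ : 2 * _ * _ = 112 * (csup * T * B)); last by ring.
  by move: cTB cTB0; lra.
 move=> s hs; set e := X s; have ve : inV n e := vX s; have ze : zm e := zX s.
 have E1 : sip 3 (proj n (euler e)) e <= 28 * csup * B * S 3 e.
  rewrite (sip_proj 3 _ ve); apply: (le_trans (ler_norm _)).
  apply: (le_trans (sip3_euler ze)); rewrite N_sq ler_wpM2r//.
  have -> : 28 * csup * B = 7 * csup * (4 * B) by ring.
  by rewrite ler_wpM2l ?mulr_ge0// bX.
 have E2 : mu * sip 3 (lapp e) e <= 0 by rewrite mulr_ge0_le0// sip_lapp_le0.
 have E3 : sip 3 v e <= N 3 v * Num.sqrt (S 3 e).
  by apply: (le_trans (ler_norm _)); exact: sip_le.
 rewrite !sipDl sipZl; move: E1 E2 E3.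
 move: (sip 3 _ e) (mu * _) (sip 3 _ e) => a b c.
 have -> : 56 * csup * B * S 3 e = 2 * (28 * csup * B * S 3 e) by ring.
 rewrite -(mulrA 2 (N 3 v)).
 by lra.
rewrite (S_ext 3 X0) -!N_sq in main.
exact: (energy_root (N_ge0 _ _) (mulr_ge0 (ltW T0) (N_ge0 _ _)) main).
Qed.

End one_solution.

Lemma ip_proj_sym n p q : ip (proj n p) q = ip p (proj n q).
rewrite !projE ip_suml ip_sumr; apply: eq_bigr => k _.
by rewrite ipZl ipZr -!cfE (ipC _ q) -cfE mulrC.
Qed.

Lemma proj_err n p q : (0 < n)%N ->
 `|ip p q - ip (proj n p) q| <= N 0 p / Num.sqrt (lam n) * N 1 q.
move=> n0; rewrite ip_proj_sym -ipBr; apply: (le_trans (ip_le _ _)).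
rewrite -mulrA ler_wpM2l// mulrC.
have l0 : 0 < lam n by apply: lt_le_trans (lam_gt0 R n0).
rewrite ler_pdivlMr ?sqrtr_gt0// !NE -sqrtrM// ler_wsqrtr//.
by apply: (le_trans (S_tail 0 1 n q)); exact: S_subproj.
Qed.

Section two_solutions.
Variables (n m : nat) (mu : R) (v v' : P) (T : R) (y y' : P) (X X' : R -> P).
Hypotheses (mu0 : 0 <= mu) (nm : (n <= m)%N).
Hypotheses (HX : gsol n mu v T y X) (HX' : gsol m mu v' T y' X').
Hypotheses (zv : zm v) (zv' : zm v').

(** In the negative norm [ip_bk_invl] costs no derivative of the difference, so the growth depends
    only on the [N 2] bound of [X']. [kap] measures the discrepancy between the two truncations and
    [r] the residual of the affine path. *)
Lemma gsol_diff (A D : P) (kap r : R) : inV m A -> inV m D -> zm A -> zm D ->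
 0 <= r -> 0 <= kap ->
 (forall t g, 0 <= t <= T -> inV m g ->
  `|ip (euler (X t)) g - ip (proj n (euler (X t))) g| <= kap * N 1 g) ->
 (forall t g, 0 <= t <= T -> inV m g ->
  `|ip (bk (invl (affine A D t)) (X t) + bk (invl (X' t)) (affine A D t)
   + mu *: lapp (affine A D t) + v - v' - D) g| <= r * N 1 g) ->
 forall t, 0 <= t <= T -> N 1 (invl (X t - X' t - affine A D t)) <=
  2 * N 1 (invl (y - y' - A)) + 4 * (T * (r + kap)).
move=> hA hD zA zD r0 k0 hk hr t ht.
case: HX => T0 _ dX X0 _; case: HX' => _ sm' dX' X0' bX'.
have dA := dcurve_affine T hA hD zA zD.
have dE := dcurve_B (dcurve_B (dcurve_le nm (lexx T) dX) dX') dA.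
set th := affine A D in hr dA dE *.
have dI := dcurve_invl dE.
set B := N 2 y' + T * N 2 v' in sm' bX'.
have B0 : 0 <= B by nneg.
have K0 : 0 <= 8 * csup * B by nneg.
have main := @energy_gronwall R _ _ _ (r + kap) T T0 K0 (S_ge0 1 _) _
 (fun s hs => dcurve_S 1 dI hs) (fun s _ => S_ge0 1 _).
have {main} main : S 1 (invl (X t - X' t - th t)) <=
  4 * S 1 (invl (X 0 - X' 0 - th 0)) + 12 * (T * (r + kap)) ^+ 2.
 apply: main ht.
  move: sm'; rewrite /small.
  rewrite (_ : 2 * _ * _ = 16 * (csup * T * B)); last by ring.
  have : 0 <= csup * T * B by nneg.
  by lra.
 move=> s hs; set e := X s - X' s - th s.
 have ve : inV m e := (dE.1 s).1.
 have ze : zm e := (dE.1 s).2.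
 set x := invl e; have vx : inV m x := inV_invl ve.
 have zf (k : nat) w u : zm u -> zm (gfield k mu u w).
  move=> zu; apply: zmD => //; apply: zmD; first by apply: zm_proj; exact: zm_bk.
  by apply: zmZ; exact: zm_lapp.
 rewrite sip1_invl; last by apply: zmB => //; apply: zmB; exact: zf.
 have main : ip (gfield n mu v (X s) - gfield m mu v' (X' s) - D) x =
   - (ip (euler (X s)) x - ip (proj n (euler (X s))) x) + ip (bk (invl (X' s)) e) x
   + mu * ip e e + ip (bk (invl (th s)) (X s) + bk (invl (X' s)) (th s)
   + mu *: lapp (th s) + v - v' - D) x.
  have Xe : X s = X' s + (e + th s) by rewrite /e subrK addrC subrK.
  have h1 : ip (euler (X s)) x - ip (euler (X' s)) x =
    ip (bk (invl (th s)) (X s)) x + ip (bk (invl (X' s)) e) x +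
    ip (bk (invl (X' s)) (th s)) x.
   have -> : ip (euler (X s)) x = ip (bk (invl (X' s) + (invl e + invl (th s))) (X s)) x.
    rewrite /euler {1}Xe; apply: ip_extl; apply: pev_bkl.
    apply/funext => z; rewrite invlD !pevD; congr (_ + _).
    by rewrite invlD pevD.
   rewrite !bkDl !ipDl.
   (* The field transported by the stream function of the error is orthogonal to that stream
      function. This is the cancellation that the negative norm is chosen for. *)
   have -> : ip (bk (invl e) (X s)) x = 0 by rewrite ip_bk bkpp ip0r oppr0.
   rewrite {1}Xe !bkDr !ipDl /euler.
   by move: (ip _ x) (ip _ x) (ip _ x) (ip _ x) => *; ring.
  have h2 : ip (lapp (X s)) x - ip (lapp (X' s)) x = ip e e + ip (lapp (th s)) x.
   rewrite !ip_lappC -ipBl {1}Xe [X' s + _]addrC addrK ipDl; congr (_ + _).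
   by rewrite -(ip_extr _ (lapp_invl ze)).
  rewrite /gfield; move: h1 h2.
  move: (lapp (X s)) (lapp (X' s)) (lapp (th s)) (ip e e) => a1 a2 a3 ee h1 h2.
  rewrite !(ipDl,ipNl,ipZl) (ip_proj (euler (X' s)) vx).
  have -> : ip (euler (X s)) x = ip (euler (X' s)) x +
   (ip (bk (invl (th s)) (X s)) x + ip (bk (invl (X' s)) e) x +
    ip (bk (invl (X' s)) (th s)) x) by rewrite -h1 addrC subrK.
  have -> : ip a1 x = ip a2 x + (ee + ip a3 x) by rewrite -h2 addrC subrK.
  by ring.
 rewrite main.
 have E1 := hk s x hs vx; have E2 := hr s x hs vx.
 have E3 := ip_bk_invl (invl (X' s)) ze.
 have E4 : 0 <= mu * ip e e by rewrite mulr_ge0// ip_ge0.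
 have E5 : csup * N 4 (invl (X' s)) * N 1 x ^+ 2 <= 4 * csup * B * S 1 x.
  rewrite N_invl; last exact: (dX'.1 s).2.
  rewrite N_sq ler_wpM2r//.
  have -> : 4 * csup * B = csup * (4 * B) by ring.
  by rewrite ler_wpM2l// bX'.
 have E3' := le_trans E3 E5.
 move: E1 E2 E3' E4 {E3 E5 main}; rewrite -/x.
 have -> : 8 * csup * B * S 1 x = 2 * (4 * csup * B * S 1 x) by ring.
 have -> : 2 * (r + kap) * Num.sqrt (S 1 x) = 2 * (r * N 1 x + kap * N 1 x).
  by rewrite -NE; ring.
 have G (u1 u2 u3 u4 w1 w2 w3 : R) : `|u1| <= w1 -> `|u2| <= w2 -> `|u3| <= w3 ->
   0 <= u4 -> 2 * - (- u1 + u3 + u4 + u2) <= 2 * w3 + 2 * (w2 + w1).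
  by rewrite !ler_norml => /andP[? ?] /andP[? ?] /andP[? ?] ?; lra.
 exact: G.
have h0 : S 1 (invl (X 0 - X' 0 - th 0)) = N 1 (invl (y - y' - A)) ^+ 2.
 rewrite N_sq; apply: S_ext; apply: invl_ext; apply/funext => x; rewrite !pevB X0 X0'.
 by rewrite /th /affine scale0r addr0.
have rk0 : 0 <= r + kap by nneg.
rewrite h0 -N_sq in main.
exact: (energy_root (N_ge0 _ _) (mulr_ge0 (ltW T0) rk0) main).
Qed.

End two_solutions.

End galerkin_estimates.

(** * Convergence of truncated solutions in H^2 *)

Section galerkin_limit.
Context (R : realType).
Local Opaque ip cf sip S N lapp bk rot invl proj pev Ip.
Notation P := (pol R).
Implicit Types (p q f g w e z v : P) (r n m k : nat) (mu T : R).
Notation lam := (@lam R).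
Notation csup := (csup R).
Let c0 : 0 <= csup := csup_ge0 R.

(** Mode by mode, with [u = s * lam k], this is [u ^ 2 <= u ^ 3 + 1]. *)
Lemma interpolation (s : R) e : 0 < s -> zm e ->
 S 1 e <= s * S 2 e + s ^- 2 * S 1 (invl e).
move=> s0 /zm_cf0 h0; have [n h] := inV_exists e.
rewrite !(S_sum _ h) (S_sum _ (inV_invl h)) !mulr_sumr -big_split/=.
apply: ler_sum => k _; rewrite cf_invl sqrrN exprMn.
have [k0|k0] := posnP k; first by rewrite k0 h0 expr2 !mulr0.
rewrite expr1 (_ : _ + _ = (s * lam k ^+ 2 + s ^- 2 * lam k * (lam k)^-1 ^+ 2) * cf e k ^+ 2); last by ring.
rewrite ler_wpM2r ?sqr_ge0//.
have l0 : 0 < lam k by apply: lt_le_trans (lam_gt0 R k0).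
move: (lam k) l0 => l l0.
have -> : s ^- 2 * l * l^-1 ^+ 2 = (s ^+ 2 * l)^-1.
 by field; rewrite !gt_eqF.
rewrite -(@ler_pM2r _ (s ^+ 2 * l)) ?mulr_gt0 //.
rewrite mulrDl mulVf ?gt_eqF ?mulr_gt0 //.
have -> : l * (s ^+ 2 * l) = (s * l) ^+ 2 by ring.
have -> : s * l ^+ 2 * (s ^+ 2 * l) = (s * l) ^+ 3 by ring.
have u0 : 0 < s * l by nneg.
move: (s * l) u0 => u u0; have [u1|u1] := lerP u 1.
 have h1 : u ^+ 2 <= 1 by rewrite exprn_ile1// ltW.
 have h2 : 0 <= u ^+ 3 by nneg.
 by lra.
have h1 : u ^+ 2 <= u ^+ 3 by rewrite ler_weXn2l// ltW.
by lra.
Qed.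

Lemma invl_proj m p : pev (invl p - proj m (invl p)) = pev (invl (p - proj m p)).
apply: cf_inj; apply/funext => k; rewrite cfB cf_proj !cf_invl cfB cf_proj.
by case: ifP => _; ring.
Qed.

Lemma S1_invl_tail m p : zm p ->
 S 1 (invl (p - proj m p)) * lam m ^+ 3 <= S 2 (p - proj m p).
move=> hp; have := S_tail 1 3 m (invl p).
rewrite !(S_ext _ (invl_proj m p)) S_invl//.
by apply: zmB => //; exact: zm_proj.
Qed.

Lemma lapp0 : lapp (0 : P) = 0.
by have := @lapp_linear R (-1) 0 0; rewrite scaler0 addr0 scaleN1r addNr. Qed.
Lemma bk0l p : bk (0 : P) p = 0. by have := bkZl p 0 0; rewrite !scale0r. Qed.
Lemma bk0r p : bk p (0 : P) = 0. by have := bkZr p 0 0; rewrite !scale0r. Qed.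
Lemma pev_invl0 : pev (invl (0 : P)) = pev (0 : P).
by apply: cf_inj; apply/funext => k; rewrite cf_invl cf0 mulr0 oppr0. Qed.
Lemma gsol_diff0 n m mu v T (y y' : P) (X X' : R -> P) (kap : R) : 0 <= mu ->
 (n <= m)%N -> gsol n mu v T y X -> gsol m mu v T y' X' -> zm v -> 0 <= kap ->
 (forall t g, 0 <= t <= T -> inV m g ->
  `|ip (euler (X t)) g - ip (proj n (euler (X t))) g| <= kap * N 1 g) ->
 forall t, 0 <= t <= T ->
 N 1 (invl (X t - X' t)) <= 2 * N 1 (invl (y - y')) + 4 * (T * kap).
move=> mu0 nm HX HX' zv k0 hk t ht.
have ii : inV m (0 : P) := inV0 _ _.
have zz : zm (0 : P) := @zm0 R.
have aE (u : R) : affine (0 : P) 0 u = 0 by rewrite /affine scaler0 addr0.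
have h := @gsol_diff R n m mu v v T y y' X X' mu0 nm HX HX' zv zv 0 0 kap 0
 ii ii zz zz (lexx 0) k0 hk _ t ht.
rewrite aE !subr0 add0r in h; apply: h => u g hu hg.
rewrite mul0r aE subr0 addrK lapp0 scaler0 addr0 bk0r addr0.
by rewrite (ip_extl _ (pev_bkl _ pev_invl0)) bk0l ip0l normr0.
Qed.

(** [N 3] of the solution with smoothed datum grows like the square root of [lam m], whereas in the
    negative norm the difference decays like [lam m] to the power -3/2. Interpolation makes their
    product harmless, uniformly in [m] and [n]. *)
Lemma bona_smith n m mu v T (y : P) (X Z : R -> P) (a : R) : 0 <= mu -> (0 < m)%N -> zm y ->
 gsol n mu v T y X -> gsol n mu v T (proj m y) Z -> zm v ->
 N 2 y <= a ->
 let q := 2 * a + 4 * (T * N 3 v) in let kap := (24 * csup * q * T + 1)^-1 in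
 forall t, 0 <= t <= T ->
 S 2 (X t - Z t) <= (4 + 432 * (T * csup * q) ^+ 2 / kap ^+ 4) * S 2 (y - proj m y).
move=> mu0 m0 zy HX HZ zv ya q kap t ht.
case: (HX) => T0 smX dX X0 bX; case: (HZ) => _ smZ dZ Z0 bZ.
have dE := dcurve_B dX dZ.
set B := N 2 y + T * N 2 v in smX bX.
have B0 : 0 <= B by nneg.
have a0 : 0 <= a by apply: le_trans ya.
have q0 : 0 <= q by nneg.
have kd0 : 0 < 24 * csup * q * T + 1 by nneg.
have k0 : 0 < kap by rewrite invr_gt0.
have l1 : 1 <= lam m by apply: le_trans (lam_gt0 R m0); rewrite ler1n.
have l0 : 0 < lam m by apply: lt_le_trans l1.
set eta := N 2 (y - proj m y).
have bZ' s : 0 <= s <= T -> N 2 (Z s) <= 4 * B.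
 by move=> hs; apply: (le_trans (bZ s hs)); rewrite ler_wpM2l// lerD2r N_proj.
have hd s : 0 <= s <= T -> S 1 (invl (X s - Z s)) <= 4 * eta ^+ 2 / lam m ^+ 3.
 move=> hs.
 have h := @gsol_diff0 n n mu v T y (proj m y) X Z 0 mu0 (leqnn n) HX HZ zv (lexx 0) _ s hs.
 have {h} : N 1 (invl (X s - Z s)) <= 2 * N 1 (invl (y - proj m y)) + 4 * (T * 0).
  by apply: h => u g hu hg; rewrite mul0r (ip_proj _ hg) subrr normr0.
 rewrite !mulr0 addr0 => h.
 have h2 : S 1 (invl (X s - Z s)) <= 4 * S 1 (invl (y - proj m y)).
  have -> : 4 * S 1 (invl (y - proj m y)) = (2 * N 1 (invl (y - proj m y))) ^+ 2.
   by rewrite exprMn N_sq; ring.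
  by rewrite -N_sq lerXn2r ?nnegrE// mulr_ge0.
 apply: (le_trans h2); rewrite -mulrA ler_wpM2l// ler_pdivlMr ?exprn_gt0//.
 by rewrite /eta N_sq; exact: S1_invl_tail.
have nZ3 s : 0 <= s <= T -> N 3 (Z s) ^+ 2 <= lam m * q ^+ 2.
 move=> hs; rewrite -[lam m](sqr_sqrtr (ltW l0)) -exprMn.
 rewrite lerXn2r ?nnegrE ?mulr_ge0 ?sqrtr_ge0//.
 apply: (le_trans (gsol_N3 mu0 HZ hs)); rewrite /q mulrDr; apply: lerD.
  rewrite mulrCA ler_wpM2l// (@le_trans _ _ (Num.sqrt (lam m) * N 2 (proj m y)))//.
   have := S_head 2 1 (inV_proj m y); rewrite expr1 => h.
   by rewrite !NE -(sqrtrM _ (ltW l0)) ler_wsqrtr.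
  by rewrite ler_wpM2l ?sqrtr_ge0// (le_trans (N_proj _ _ _)).
 have sl1 : 1 <= Num.sqrt (lam m) by rewrite -[leLHS]sqrtr1 ler_wsqrtr.
 exact: (ler_peMl (mulr_ge0 (ler0n _ 4) (mulr_ge0 (ltW T0) (N_ge0 _ _))) sl1).
have e0 : 0 <= eta by nneg.
have K0 : 0 <= 64 * csup * B + 6 * csup * q * kap by nneg.
pose rho := 6 * csup * q * eta / kap ^+ 2.
have main := @energy_gronwall R _ _ _ rho T T0 K0 (S_ge0 2 _) _
 (fun s hs => dcurve_S 2 dE hs) (fun s _ => S_ge0 2 _).
have {main} main : S 2 (X t - Z t) <= 4 * S 2 (X 0 - Z 0) + 12 * (T * rho) ^+ 2.
 apply: main ht.
  (* [kap] is chosen so that its share of the exponent is at most one half. *)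
  have h1 : 12 * csup * q * T * kap <= 2^-1.
   rewrite /kap ler_pdivrMr//.
   have -> : 12 * csup * q * T = 12 * (csup * q * T) by ring.
   have -> : 24 * csup * q * T = 24 * (csup * q * T) by ring.
   by move: (csup * q * T) => u; lra.
  rewrite (_ : 2 * _ * _ = 128 * csup * T * B + 12 * csup * q * T * kap); last by ring.
  move: smX; rewrite /small => smX.
  have : 128 * csup * T * B = (512 * csup * T * B) / 4 by field.
  move: (128 * _ * _ * _) => u ->; move: (512 * _ * _ * _) smX => w; lra.
 move=> s hs; set e := X s - Z s.
 have ve : inV n e := (dE.1 s).1.
 have ze : zm e := (dE.1 s).2.
 have zZ : zm (Z s) := (dZ.1 s).2.
 have -> : sip 2 (gfield n mu v (X s) - gfield n mu v (Z s)) e =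
   sip 2 (euler (X s) - euler (Z s)) e + mu * sip 2 (lapp e) e.
  have hl : sip 2 (lapp (X s)) e = sip 2 (lapp (Z s)) e + sip 2 (lapp e) e.
   rewrite -sipDl; apply: sip_ext => //; apply/funext => x.
   have -> : X s = Z s + e by rewrite /e addrC subrK.
   have : pev (lapp (Z s + e)) = pev (lapp (Z s) + lapp e).
    by apply: cf_inj; apply/funext => k; rewrite !(cf_lapp,cfD); ring.
   by move=> /(congr1 (fun u => u x)).
  rewrite /gfield; move: hl; move: (lapp (X s)) (lapp (Z s)) (lapp e) => a1 a2 a3 hl.
  by rewrite !sipDl !sipNl !sipDl !sipZl hl !(sip_proj 2 _ ve); ring.
 have E2 : mu * sip 2 (lapp e) e <= 0 by rewrite mulr_ge0_le0// sip_lapp_le0.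
 have n3n1 : N 3 (Z s) * N 1 e <= q * kap * N 2 e + 2 * q * eta / kap ^+ 2.
  apply: sqr_le_norm.
   exact: (addr_ge0 (mulr_ge0 (mulr_ge0 q0 (ltW k0)) (N_ge0 _ _))
    (divr_ge0 (mulr_ge0 (mulr_ge0 (ler0n _ 2) q0) e0) (exprn_ge0 2 (ltW k0)))).
  rewrite (exprMn 2 (N 3 (Z s))) (N_sq 1).
  (* At the interpolation scale [kap ^ 2 / lam m] all powers of [lam m] cancel. *)
  apply: (@le_trans _ _ (lam m * q ^+ 2 * (kap ^+ 2 / lam m * S 2 e +
    (kap ^+ 2 / lam m) ^- 2 * (4 * eta ^+ 2 / lam m ^+ 3)))).
   apply: ler_pM; [exact: sqr_ge0|exact: S_ge0|exact: nZ3|].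
   apply: (le_trans (interpolation (_ : 0 < kap ^+ 2 / lam m) ze)).
    by rewrite divr_gt0// exprn_gt0.
   by rewrite lerD2l ler_wpM2l ?hd// invr_ge0 exprn_ge0// divr_ge0 ?exprn_ge0// ltW.
  have -> : lam m * q ^+ 2 * (kap ^+ 2 / lam m * S 2 e +
    (kap ^+ 2 / lam m) ^- 2 * (4 * eta ^+ 2 / lam m ^+ 3)) =
   (q * kap * N 2 e) ^+ 2 + (2 * q * eta / kap ^+ 2) ^+ 2.
   have G (b l u q1 et : R) : 0 < l -> 0 < u -> l * q1 ^+ 2 * (u ^+ 2 / l * b ^+ 2 +
     (u ^+ 2 / l) ^- 2 * (4 * et ^+ 2 / l ^+ 3)) =
     (q1 * u * b) ^+ 2 + (2 * q1 * et / u ^+ 2) ^+ 2.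
    by move=> l1' u1'; field; rewrite !gt_eqF.
   by rewrite -N_sq; exact: G.
  have u1 := mulr_ge0 (mulr_ge0 q0 (ltW k0)) (N_ge0 2 e).
  have u2 := divr_ge0 (mulr_ge0 (mulr_ge0 (ler0n _ 2) q0) e0) (exprn_ge0 2 (ltW k0)).
  by rewrite sqrrD -addrA lerD2l lerDr; apply: mulrn_wge0; nneg.
 have E1 : 2 * sip 2 (euler (X s) - euler (Z s)) e <=
   (64 * csup * B + 6 * csup * q * kap) * S 2 e + 2 * rho * N 2 e.
  rewrite (sip_ext 2 (eulerB _ _) (erefl (pev e))).
  apply: (@le_trans _ _ (2 * (csup * N 2 e *
   (3 * N 3 (Z s) * N 1 e + 4 * N 2 (Z s) * N 2 e + 2 * N 2 e ^+ 2)))).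
   rewrite ler_wpM2l//; apply: (le_trans (ler_norm _)); exact: sip2_euler.
  have ne : N 2 e <= 8 * B.
   apply: (le_trans (NB _ _ _)); have := bX s hs; have := bZ' s hs.
   by move: (N 2 (X s)) (N 2 (Z s)) => u w; lra.
  have -> : (64 * csup * B + 6 * csup * q * kap) * S 2 e + 2 * rho * N 2 e =
    2 * (csup * N 2 e * (3 * (q * kap * N 2 e + 2 * q * eta / kap ^+ 2)
     + 4 * (4 * B) * N 2 e + 2 * ((8 * B) * N 2 e))).
   have G (c1 b u q1 et B1 : R) : 0 < u -> (64 * c1 * B1 + 6 * c1 * q1 * u) * b ^+ 2 +
     2 * (6 * c1 * q1 * et / u ^+ 2) * b =
     2 * (c1 * b * (3 * (q1 * u * b + 2 * q1 * et / u ^+ 2)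
     + 4 * (4 * B1) * b + 2 * ((8 * B1) * b))).
    by move=> u1'; field; rewrite gt_eqF.
   by rewrite -N_sq; exact: G.
  rewrite ler_wpM2l// ler_wpM2l ?mulr_ge0// !lerD//.
  - by rewrite -mulrA ler_wpM2l.
  - by rewrite ler_wpM2r// ler_wpM2l// bZ'.
  - by rewrite expr2 ler_wpM2l// ler_wpM2r.
 rewrite -NE.
 move: E1 E2; move: (sip 2 _ e) (mu * _) => u w.
 by rewrite mulrDr; move: (_ * S 2 e) (_ * N 2 e) => ? ?; lra.
apply: (le_trans main).
have -> : S 2 (X 0 - Z 0) = eta ^+ 2.
 by rewrite /eta N_sq; apply: S_ext; apply/funext => x; rewrite !pevB X0 Z0.
have G (c1 u q1 et T1 : R) : 0 < u -> 4 * et ^+ 2 + 12 * (T1 * (6 * c1 * q1 * et / u ^+ 2)) ^+ 2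
  = (4 + 432 * (T1 * c1 * q1) ^+ 2 / u ^+ 4) * et ^+ 2.
 by move=> u1'; field; rewrite gt_eqF.
by rewrite -(N_sq 2 (y - _)) -/eta -G.
Qed.

Definition hcauchy (y : nat -> P) := forall e : R, 0 < e -> exists n0, forall n m,
 (n0 <= n)%N -> (n0 <= m)%N -> N 2 (y n - y m) <= e.

Definition ucauchy (X : nat -> R -> P) T := forall e : R, 0 < e -> exists n0,
 forall n m (t : R), (n0 <= n)%N -> (n0 <= m)%N -> 0 <= t <= T ->
 N 2 (X n t - X m t) <= e.

Lemma projB m p q : pev (proj m (p - q)) = pev (proj m p - proj m q).
apply: cf_inj; apply/funext => k; rewrite cfB !cf_proj cfB.
by case: ifP => //; rewrite subrr.
Qed.

Lemma N_subprojB r m p q : N r (p - proj m p) <= N r (p - q) + N r (q - proj m q).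
have -> : N r (p - proj m p) = N r ((p - q - proj m (p - q)) + (q - proj m q)).
 apply: N_ext; apply: cf_inj; apply/funext => k.
 by rewrite cfB cfD !cfB !cf_proj !cfB; case: ifP => _; ring.
apply: ND_le; rewrite lerD2r N_S_le//; exact: S_subproj.
Qed.

Lemma hcauchy_bounded y : hcauchy y -> exists (a : R) n0, 0 <= a /\
 forall n, (n0 <= n)%N -> N 2 (y n) <= a.
move=> /(_ 1 ltr01)[n0 h]; exists (N 2 (y n0) + 1), n0; split; first by rewrite addr_ge0.
move=> n hn; have := ND 2 (y n0) (y n - y n0).
rewrite addrC subrK => /le_trans; apply; rewrite lerD2l; exact: h.
Qed.

(** All late terms are compared with the single term [y m], whose own tail beyond [m] is null. *)
Lemma hcauchy_tails y n1 : (forall n, (n1 <= n)%N -> inV n (y n)) -> hcauchy y ->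
 forall e : R, 0 < e -> exists m n0, [/\ (0 < m)%N, (m <= n0)%N &
  forall n, (n0 <= n)%N -> N 2 (y n - proj m (y n)) <= e].
move=> hy hc e e0; have [n0 h] := hc e e0.
pose m := maxn (maxn n0 n1) 1.
have m1 : (n1 <= m)%N by lia.
have m0 : (n0 <= m)%N by lia.
exists m, m; split=> // [|n hn]; first by lia.
apply: (le_trans (N_subprojB 2 m (y n) (y m))).
have -> : N 2 (y m - proj m (y m)) = 0.
 rewrite -(N0 _ 2); apply: N_ext; apply/funext => x; rewrite pevB -(hy m m1).
 by rewrite subrr pev0.
by rewrite addr0 h// (leq_trans m0).
Qed.

Lemma lam_unbounded (a : R) : exists n0, forall n, (n0 <= n)%N -> a <= lam n.
exists ((Num.Def.truncn a).+1 ^ 2)%N => n hn.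
have h1 : a <= (Num.Def.truncn a).+1%:R by rewrite ltW// truncnS_gt.
apply: (le_trans h1); apply: le_trans (lam_le R hn).
rewrite /lam (sqrt_uniq (s := (Num.Def.truncn a).+1)) ?ltn_exp2r ?ltnSn//.
by rewrite ler_nat leq_pmulr.
Qed.

(** High modes are uniformly small by comparison with the solution [Z] of smoothed datum, which is
    bounded in [N 3]. On finitely many low modes all norms are equivalent, and there the negative
    norm converges by [gsol_diff0]. *)
Lemma galerkin_cauchy mu v T (y : nat -> P) (X : nat -> R -> P) n1 : 0 <= mu ->
 zm v -> inV n1 v -> hcauchy y ->
 (forall n, (n1 <= n)%N -> [/\ inV n (y n), zm (y n) & gsol n mu v T (y n) (X n)]) ->
 ucauchy X T.
move=> mu0 zv vv hc hX e e0.
have [a [n2 [a0 ha]]] := hcauchy_bounded hc.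
have T0 : 0 < T by have [_ _ []] := hX n1 (leqnn _).
pose q := 2 * a + 4 * (T * N 3 v); pose kap := (24 * csup * q * T + 1)^-1.
pose C := 4 + 432 * (T * csup * q) ^+ 2 / kap ^+ 4.
have q0 : 0 <= q by nneg.
have k0 : 0 < kap by rewrite invr_gt0 ltr_wpDl// !mulr_ge0// ltW.
have C0 : 0 <= C.
 exact: (addr_ge0 (ler0n _ 4) (divr_ge0 (mulr_ge0 (ler0n _ 432) (sqr_ge0 _))
  (exprn_ge0 4 (ltW k0)))).
have C1 : 0 < C + 1.
 by rewrite ltr_wpDl.
pose e1 := e / (8 * (C + 1)).
have e10 : 0 < e1 by rewrite divr_gt0// mulr_gt0.
have [m [n3 [m0 mn3 hm]]] := hcauchy_tails (fun n hn => let: And3 h _ _ := hX n hn in h) hc e10.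
pose G := 2 * (Num.sqrt (lam m) * a) + 4 * (T * N 3 v).
have G0 : 0 <= G by rewrite addr_ge0// !mulr_ge0 // ltW.
have [K hK] := lam_unbounded ((8 * G / e + 1) ^+ 2).
have tail n t : (n1 <= n)%N -> (n2 <= n)%N -> (n3 <= n)%N -> 0 <= t <= T ->
  N 2 (X n t - proj K (X n t)) <= e / 4.
 move=> hn1 hn2 hn3 ht; have [iy zy sX] := hX n hn1.
 have mn : (m <= n)%N := leq_trans mn3 hn3.
 have vn : inV n v := inV_le hn1 vv.
 have [Z sZ] : exists Z, gsol n mu v T (proj m (y n)) Z.
  apply: gsol_exists => //; first exact: inV_le (inV_proj _ _).
   exact: zm_proj.
  case: sX => _ sX _ _ _; apply: le_trans sX.
  have cT0 : 0 <= 512 * csup * T by nneg.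
  exact: (ler_wpM2l cT0 (lerD (N_proj _ _ _) (lexx _))).
 have hS := bona_smith mu0 m0 zy sX sZ zv (ha n hn2) ht.
 have hE : N 2 (X n t - Z t) <= e / 8.
  apply: sqr_le_norm; first by nneg.
  rewrite N_sq; apply: (le_trans hS).
  have hy2 : S 2 (y n - proj m (y n)) <= e1 ^+ 2.
   by rewrite -N_sq ler_sqr ?nnegrE ?(ltW e10)// hm.
  apply: (@le_trans _ _ ((C + 1) * e1 ^+ 2)).
   by apply: ler_pM => //; rewrite lerDl.
  rewrite /e1 -subr_ge0.
  have -> : (e / 8) ^+ 2 - (C + 1) * (e / (8 * (C + 1))) ^+ 2 =
    (e / 8) ^+ 2 * (C / (C + 1)) by field; rewrite gt_eqF.
  by rewrite mulr_ge0 ?sqr_ge0// divr_ge0// ltW.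
 have hZ : N 2 (Z t - proj K (Z t)) <= e / 8.
  have z3 : N 3 (Z t) <= G.
   apply: (le_trans (gsol_N3 mu0 sZ ht)); rewrite lerD2r ler_wpM2l//.
   apply: (@le_trans _ _ (Num.sqrt (lam m) * N 2 (proj m (y n)))).
    have := S_head 2 1 (inV_proj m (y n)); rewrite expr1 => h.
    by rewrite -sqrtrM // ler_wsqrtr.
   by rewrite ler_wpM2l // (le_trans (N_proj _ _ _))// ha.
  have h8 : 0 <= 8 * G / e + 1 by nneg.
  have h81 : 0 < 8 * G / e + 1 by nneg.
  have t1 := S_tail 2 1 K (Z t); rewrite expr1 in t1.
  have t2 : S 2 (Z t - proj K (Z t)) * (8 * G / e + 1) ^+ 2 <= G ^+ 2.
   apply: (le_trans (ler_wpM2l (S_ge0 _ _) (hK K (leqnn K)))).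
   apply: (le_trans t1); apply: (le_trans (S_subproj _ _ _)).
   by rewrite -N_sq lerXn2r ?nnegrE.
  apply: (@le_trans _ _ (G / (8 * G / e + 1))).
   rewrite ler_pdivlMr//; apply: sqr_le_norm => //.
   by rewrite exprMn N_sq.
  rewrite ler_pdivrMr// mulrDr mulr1.
  have -> : e / 8 * (8 * G / e) = G by field; rewrite gt_eqF.
  by rewrite lerDl divr_ge0// ltW.
 apply: (le_trans (N_subprojB 2 K (X n t) (Z t))).
 by lra.
(* The price of passing from the negative norm to [N 2] on the modes below [K]. *)
pose L := Num.sqrt (lam K ^+ 3).
have L0 : 0 <= L by exact: sqrtr_ge0.
pose d := e / (16 * (L + 1)).
have d0 : 0 < d by rewrite divr_gt0// mulr_gt0// ltr_wpDl.
have [n4 hn4] := hc d d0.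
pose Q := T * (csup * (16 * (a + T * N 2 v) ^+ 2)).
have Q0 : 0 <= Q by nneg.
have [n5 hn5] := lam_unbounded ((Q / d + 1) ^+ 2).
pose n0 := maxn (maxn (maxn n1 n2) (maxn n3 n4)) (maxn n5 1).
have n0P k : (n0 <= k)%N -> [/\ (n1 <= k)%N, (n2 <= k)%N, (n3 <= k)%N, (n4 <= k)%N &
  (n5 <= k)%N && (0 < k)%N].
 by rewrite !geq_max => /andP[/andP[/andP[-> ->] /andP[-> ->]] ->].
suff key n m' t : (n0 <= n)%N -> (n <= m')%N -> 0 <= t <= T ->
  N 2 (X n t - X m' t) <= e.
 exists n0 => n m' t hn hm' ht; have [nm|/ltnW nm] := leqP n m'; first exact: key.
 by rewrite NBC key.
move=> hn nm ht.
have hm' : (n0 <= m')%N := leq_trans hn nm.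
have [g1 g2 g3 g4 /andP[g5 g6]] := n0P _ hn.
have [f1 f2 f3 f4 /andP[f5 f6]] := n0P _ hm'.
have [i1 z1 s1] : [/\ inV n (y n), zm (y n) & gsol n mu v T (y n) (X n)].
 exact: hX.
have [i2 z2 s2] : [/\ inV m' (y m'), zm (y m') & gsol m' mu v T (y m') (X m')].
 exact: hX.
have neg : N 1 (invl (X n t - X m' t)) <= 2 * d + 4 * d.
 have n50 : 0 < Q / d + 1 by nneg.
 have sl : Q / d + 1 <= Num.sqrt (lam n).
  rewrite -[leLHS](gtr0_norm n50) -sqrtr_sqr ler_wsqrtr//.
  exact: hn5.
 have sl0 : 0 < Num.sqrt (lam n) by apply: lt_le_trans sl.
 pose kp := csup * (16 * (a + T * N 2 v) ^+ 2) / Num.sqrt (lam n).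
 have kp0 : 0 <= kp := divr_ge0 (mulr_ge0 c0 (mulr_ge0 (ler0n _ 16) (sqr_ge0 _)))
  (sqrtr_ge0 _).
 have h := @gsol_diff0 n m' mu v T (y n) (y m') (X n) (X m') kp mu0 nm s1 s2 zv kp0 _ t ht.
 have : N 1 (invl (X n t - X m' t)) <= 2 * N 1 (invl (y n - y m')) + 4 * (T * kp).
  apply: h => u g hu hg.
   apply: (le_trans (proj_err _ _ g6)).
   rewrite ler_wpM2r// ler_wpM2r //.
   case: (s1) => _ _ dX _ bX.
   apply: (le_trans (N_euler (dX.1 u).2)); rewrite ler_wpM2l//.
   have -> : 16 * (a + T * N 2 v) ^+ 2 = (4 * (a + T * N 2 v)) ^+ 2 by ring.
   have aT : 0 <= a + T * N 2 v by nneg.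
   rewrite lerXn2r ?nnegrE ?mulr_ge0//.
   apply: (@le_trans _ _ (N 2 (X n u))); first by apply: N_zm_le => //; exact: (dX.1 u).2.
   apply: (le_trans (bX u hu)); rewrite ler_wpM2l// lerD2r.
   exact: ha.
 move=> /le_trans; apply; apply: lerD.
  rewrite ler_wpM2l//; apply: (@le_trans _ _ (N 2 (y n - y m'))).
   rewrite -(N_invl 2); last exact: zmB.
   by apply: N_zm_le => //; exact: zm_invl.
  exact: hn4.
 rewrite ler_wpM2l// mulrA -/Q ler_pdivrMr//.
 apply: (@le_trans _ _ (d * (Q / d + 1))); last by rewrite ler_wpM2l// ltW.
 rewrite mulrDr mulr1 mulrC mulfVK ?gt_eqF//.
 by rewrite lerDl ltW.
set D := X n t - X m' t in neg *.
have zD : zm D.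
 by case: s1 => _ _ [h1 _] _ _; case: s2 => _ _ [h2 _] _ _;
  apply: zmB; [exact: (h1 t).2|exact: (h2 t).2].
have low : N 2 (proj K D) <= e / 2.
 have wE : pev (proj K (invl D)) = pev (invl (proj K D)).
  apply: cf_inj; apply/funext => k; rewrite cf_proj !cf_invl cf_proj.
  by case: ifP => //; rewrite mulr0 oppr0.
 have h1 : S 2 (proj K D) <= lam K ^+ 3 * S 1 (invl D).
  rewrite -S_invl; last exact: zm_proj.
  rewrite -(S_ext _ wE); apply: (le_trans (S_head 1 3 (inV_proj K (invl D)))).
  by rewrite ler_wpM2l ?exprn_ge0 // S_proj.
 apply: (@le_trans _ _ (L * N 1 (invl D))).
  by rewrite -sqrtrM ?exprn_ge0 // ler_wsqrtr.
 apply: (le_trans (ler_wpM2l L0 neg)).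
 have -> : 2 * d + 4 * d = 6 * d by ring.
 rewrite /d; have L1 : 0 < L + 1 by rewrite ltr_wpDl.
 have -> : L * (6 * (e / (16 * (L + 1)))) = (6 / 16 * e) * (L / (L + 1)).
  by field; rewrite gt_eqF.
 have h : L / (L + 1) <= 1 by rewrite ler_pdivrMr// mul1r lerDl.
 apply: (@le_trans _ _ (6 / 16 * e * 1)).
  by rewrite ler_wpM2l// mulr_ge0// ltW.
 by move: e0; lra.
have tD : N 2 (D - proj K D) <= e / 4 + e / 4.
 have -> : N 2 (D - proj K D) =
   N 2 ((X n t - proj K (X n t)) - (X m' t - proj K (X m' t))).
  by apply: N_ext; apply: cf_inj; apply/funext => k;
    rewrite !cfB !cf_proj !cfB; case: ifP => _; ring.
 apply: (le_trans (NB _ _ _)); apply: lerD; exact: tail.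
have -> : D = (D - proj K D) + proj K D by rewrite subrK.
apply: ND_le; apply: (le_trans (lerD tD low)); lra.
Qed.

End galerkin_limit.

(** * Square-integrable functions and their inner product *)

Section square_integrable.
Context (R : realType).
Notation P := (pol R).
Notation area := (@area R).
Implicit Types (f g h b : S2 R -> R) (p q : P).

Lemma L2_meas f : L2 f -> measurable_fun setT f.
by rewrite /Defs.L2 => /andP[]; rewrite inE. Qed.
Lemma L2_sqr f : L2 f -> area.-integrable setT (EFin \o (fun x => f x ^+ 2)).
exact: Lfun2_integrable_sqr. Qed.

Lemma L2_intro f : measurable_fun setT f ->
 area.-integrable setT (EFin \o (fun x => f x ^+ 2)) -> L2 f.
move=> mf /integrableP[_ h]; apply/andP; split; rewrite inE//=.
rewrite /finite_norm unlock; apply: poweR_lty; apply: le_lt_trans h.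
rewrite le_eqVlt; apply/orP; left; apply/eqP; apply: eq_integral => x _ /=.
by rewrite powR_mulrn// normrX.
Qed.

Lemma L2_mul f g : L2 f -> L2 g -> area.-integrable setT (EFin \o (fun x => f x * g x)).
by move=> hf hg; apply/Lfun1_integrable; exact: Lfun2_mul_Lfun1. Qed.
Lemma integrable_eqf (f g : S2 R -> R) : f =1 g ->
 area.-integrable setT (EFin \o f) -> area.-integrable setT (EFin \o g).
by move=> h; rewrite (_ : f = g)//; exact/funext. Qed.

Lemma integrableDR f g : area.-integrable setT (EFin \o f) ->
 area.-integrable setT (EFin \o g) ->
 area.-integrable setT (EFin \o (fun x => f x + g x)).
by move=> hf hg; have := integrableD measurableT hf hg. Qed.

Lemma integrableZR (a : R) f : area.-integrable setT (EFin \o f) ->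
 area.-integrable setT (EFin \o (fun x => a * f x)).
by move=> hf; have := integrableZl measurableT a hf. Qed.

Lemma L2_lin (a : R) f g : L2 f -> L2 g -> L2 (fun x => a * f x + g x).
move=> hf hg; apply: L2_intro.
 apply: measurable_funD; last exact: L2_meas.
 by apply: measurable_funM => //; exact: L2_meas.
apply: (@integrable_eqf (fun x => (a ^+ 2 * f x ^+ 2 + (2 * a) * (f x * g x)) + g x ^+ 2)).
 by move=> x /=; ring.
apply: integrableDR; last exact: L2_sqr.
by apply: integrableDR; apply: integrableZR; [exact: L2_sqr|exact: L2_mul].
Qed.

Lemma L2_bmeas b : bmeas b -> L2 b.
move=> hb; apply: L2_intro; first exact: hb.1.
by apply: bmeas_integrable; exact: bmeasX.
Qed.

Lemma L2_pev p : L2 (pev p). exact: L2_bmeas (bmeas_pev p). Qed.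

Lemma L2_0 : L2 (0 : S2 R -> R).
by apply: L2_bmeas; exact: (@bmeas_cst _ (S2 R) R 0). Qed.
Lemma L2D f g : L2 f -> L2 g -> L2 (f + g).
move=> hf hg; have := L2_lin 1 hf hg.
by congr Defs.L2; apply/funext => x /=; rewrite mul1r.
Qed.
Lemma L2Z (a : R) f : L2 f -> L2 (a *: f).
move=> hf; have := L2_lin a hf L2_0.
by congr Defs.L2; apply/funext => x /=; rewrite addr0.
Qed.
Lemma L2N f : L2 f -> L2 (- f).
by move=> /(L2Z (-1)); rewrite scaleN1r. Qed.
Lemma L2B f g : L2 f -> L2 g -> L2 (f - g).
by move=> hf /L2N; exact: L2D. Qed.
Lemma L2_sum (I : Type) (s : seq I) (F : I -> S2 R -> R) :
 (forall i, L2 (F i)) -> L2 (\sum_(i <- s) F i).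
by move=> h; elim/big_ind : _ => //; [exact: L2_0|exact: L2D]. Qed.

Lemma L2_bM b f : bmeas b -> L2 f -> L2 (fun x => b x * f x).
move=> [mb [M hM]] hf; have mf := L2_meas hf.
apply: L2_intro; first exact: measurable_funM.
apply: (@le_integrable _ _ _ area setT measurableT _ (EFin \o (fun x => M ^+ 2 * f x ^+ 2))).
- by apply/measurable_EFinP; apply: measurable_funX; exact: measurable_funM.
- move=> x _ /=; rewrite lee_fin [leRHS]ger0_norm; last exact: mulr_ge0 (sqr_ge0 _) (sqr_ge0 _).
 rewrite [leLHS]ger0_norm ?sqr_ge0// exprMn.
 by rewrite ler_wpM2r ?sqr_ge0// -(real_normK (num_real (b x))) lerXn2r ?nnegrE// (le_trans _ (hM x)).
by apply: integrableZR; exact: L2_sqr.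
Qed.

Lemma l2ipC f g : l2ip f g = l2ip g f.
by apply: eq_Rintegral => x; rewrite mulrC. Qed.
Lemma l2ip_lin (a : R) f g h : L2 f -> L2 g -> L2 h ->
 l2ip (a *: f + g) h = a * l2ip f h + l2ip g h.
move=> hf hg hh; rewrite /Defs.l2ip -RintegralZl//; last exact: L2_mul.
rewrite -RintegralD; [|exact: measurableT|apply: integrableZR; exact: L2_mul|exact: L2_mul].
by apply: eq_Rintegral => x /=; rewrite mulrDl -mulrA.
Qed.

Lemma l2ipDl f g h : L2 f -> L2 g -> L2 h -> l2ip (f + g) h = l2ip f h + l2ip g h.
by move=> hf hg hh; rewrite -{1}(scale1r f) l2ip_lin// mul1r. Qed.
Lemma l2ip0l h : l2ip 0 h = 0.
rewrite /Defs.l2ip /Rintegral (_ : (fun x => (_ * h x)%:E) = cst 0%E).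
 by rewrite integral0.
by apply/funext => x /=; rewrite mul0r.
Qed.
Lemma l2ipZl (a : R) f h : L2 f -> L2 h -> l2ip (a *: f) h = a * l2ip f h.
by move=> hf hh; rewrite -[a *: f]addr0 l2ip_lin ?l2ip0l ?addr0//; exact: L2_0.
Qed.
Lemma l2ipBl f g h : L2 f -> L2 g -> L2 h -> l2ip (f - g) h = l2ip f h - l2ip g h.
move=> hf hg hh; rewrite l2ipDl//; last exact: L2N.
by rewrite -scaleN1r l2ipZl// mulN1r.
Qed.
Lemma l2ipDr f g h : L2 f -> L2 g -> L2 h -> l2ip h (f + g) = l2ip h f + l2ip h g.
by move=> *; rewrite l2ipC l2ipDl// ![l2ip h _]l2ipC. Qed.
Lemma l2ipZr (a : R) f h : L2 f -> L2 h -> l2ip h (a *: f) = a * l2ip h f.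
by move=> *; rewrite l2ipC l2ipZl// l2ipC. Qed.
Lemma l2ipBr f g h : L2 f -> L2 g -> L2 h -> l2ip h (f - g) = l2ip h f - l2ip h g.
by move=> *; rewrite l2ipC l2ipBl// ![l2ip h _]l2ipC. Qed.
Lemma l2ip_suml (I : Type) (s : seq I) (F : I -> S2 R -> R) h : (forall i, L2 (F i)) ->
 L2 h -> l2ip (\sum_(i <- s) F i) h = \sum_(i <- s) l2ip (F i) h.
move=> hF hh; elim: s => [|i s IH]; first by rewrite !big_nil l2ip0l.
by rewrite !big_cons l2ipDl ?IH//; exact: L2_sum.
Qed.

Lemma l2ip_ge0 f : 0 <= l2ip f f.
by apply: Rintegral_ge0 => x; rewrite sqr_ge0. Qed.
Lemma l2norm_ge0 f : 0 <= l2norm f. exact: sqrtr_ge0. Qed.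
Lemma l2norm_sq f : l2norm f ^+ 2 = l2ip f f.
by rewrite sqr_sqrtr// l2ip_ge0. Qed.
Lemma l2ip_le f g : L2 f -> L2 g -> `|l2ip f g| <= l2norm f * l2norm g.
move=> hf hg.
rewrite -ler_sqr ?nnegrE ?mulr_ge0 ?l2norm_ge0// real_normK ?num_real// exprMn !l2norm_sq.
have key (s t : R) : 0 <= s ^+ 2 * l2ip f f + 2 * s * t * l2ip f g + t ^+ 2 * l2ip g g.
 have := l2ip_ge0 (s *: f + t *: g).
 have hs := L2Z s hf; have ht := L2Z t hg; have hst := L2D hs ht.
 rewrite l2ipDl// !l2ipDr// !l2ipZl// !l2ipZr// (l2ipC g f).
 by congr (0 <= _); ring.
have a0 := l2ip_ge0 f; have c0 := l2ip_ge0 g.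
move: (l2ip f f) (l2ip f g) (l2ip g g) key a0 c0 => a b c key a0 c0.
have [c1|c1] := eqVneq c 0.
 (* For nonzero [b] this argument would give the quadratic form the value -1. *)
 have := key 1 (- (a + 1) * b / (2 * b ^+ 2)); rewrite c1 mulr0.
 have [->|b0] := eqVneq b 0; first by move=> _; rewrite expr2 !mulr0.
 have -> : 1 ^+ 2 * a + 2 * 1 * (- (a + 1) * b / (2 * b ^+ 2)) * b + 0 = -1 by field.
 by rewrite ler0N1.
have c2 : 0 < c by rewrite lt_neqAle eq_sym c1.
have := key c (- b).
have -> : c ^+ 2 * a + 2 * c * - b * b + (- b) ^+ 2 * c = c * (a * c - b ^+ 2) by ring.
by rewrite pmulr_rge0// subr_ge0.
Qed.

Lemma l2normD f g : L2 f -> L2 g -> l2norm (f + g) <= l2norm f + l2norm g.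
move=> hf hg; rewrite -ler_sqr ?nnegrE ?addr_ge0 ?l2norm_ge0//.
rewrite sqrrD !l2norm_sq l2ipDl ?l2ipDr//; last exact: L2D.
rewrite (l2ipC g f) mulr2n.
have := le_trans (ler_norm _) (l2ip_le hf hg).
by lra.
Qed.

Lemma l2normZ (a : R) f : L2 f -> l2norm (a *: f) = `|a| * l2norm f.
move=> hf; rewrite /Defs.l2norm l2ipZl ?l2ipZr ?mulrA -?expr2//; last exact: L2Z.
by rewrite sqrtrM ?sqr_ge0// sqrtr_sqr.
Qed.
Lemma l2normN f : L2 f -> l2norm (- f) = l2norm f.
by move=> hf; rewrite -scaleN1r l2normZ// normrN1 mul1r. Qed.
Lemma l2normB f g : L2 f -> L2 g -> l2norm (f - g) <= l2norm f + l2norm g.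
by move=> hf hg; rewrite -[in leRHS](l2normN hg); apply: l2normD => //; exact: L2N. Qed.
Lemma l2normBC f g : L2 f -> L2 g -> l2norm (f - g) = l2norm (g - f).
by move=> hf hg; rewrite -opprB l2normN//; exact: L2B. Qed.
Lemma l2ip_pev p q : l2ip (pev p) (pev q) = ip p q.
by apply: eq_Rintegral => x; rewrite pevM. Qed.
Lemma l2norm_pev p : l2norm (pev p) = N 0 p.
by rewrite /Defs.l2norm l2ip_pev. Qed.
Lemma pevBf p q : pev p - pev q = pev (p - q).
by apply/funext => x; rewrite pevB. Qed.
Lemma pevDf p q : pev p + pev q = pev (p + q).
by apply/funext => x; rewrite pevD. Qed.
Lemma pevZf (a : R) p : a *: pev p = pev (a *: p).
by apply/funext => x; rewrite pevZ. Qed.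
Lemma ae_l2ip f f' g : L2 f -> L2 f' -> L2 g -> f = f' %[ae area] -> l2ip f g = l2ip f' g.
move=> hf hf' hg h; congr fine; apply: ae_eq_integral => //.
- by apply/measurable_EFinP; apply: measurable_funM; exact: L2_meas.
- by apply/measurable_EFinP; apply: measurable_funM; exact: L2_meas.
by apply: filterS h => x hx; rewrite hx.
Qed.

Lemma l2norm_eq0 f : L2 f -> l2norm f = 0 -> f = 0 %[ae area].
move=> hf h0; have h1 : l2ip f f = 0 by rewrite -l2norm_sq h0 expr0n.
have mf := L2_meas hf.
have iF := L2_sqr hf.
have h2 : (\int[area]_(x in setT) `|(EFin \o (fun x => (f x ^+ 2)%R)) x| = 0)%E.
 have e : (\int[area]_(x in setT) `|(EFin \o (fun x => (f x ^+ 2)%R)) x| =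
   \int[area]_x (f x * f x)%:E)%E.
  by apply: eq_integral => x /=; rewrite ger0_norm ?sqr_ge0.
 rewrite e -[LHS]fineK ?[fine _]h1//.
 by rewrite -e; apply: (integrable_fin_num measurableT); exact: integrable_abse.
have m2 : measurable_fun setT (EFin \o (fun x => f x ^+ 2)).
 by apply/measurable_EFinP; exact: measurable_funX.
have /(_ h2) := (ae_eq_integral_abs area measurableT m2).1.
apply: filterS => x /= /(_ Logic.I) [] /eqP.
by rewrite expf_eq0/= => /eqP.
Qed.

Lemma ae_l2norm0 f g : L2 f -> L2 g -> f = g %[ae area] -> l2norm (f - g) = 0.
move=> hf hg h; have hfg := L2B hf hg; apply/eqP; rewrite -sqrf_eq0 l2norm_sq; apply/eqP.
rewrite (@ae_l2ip _ 0) ?l2ip0l//; first exact: L2_0.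
apply: filterS h => x /= hx _.
by rewrite [LHS](_ : _ = f x - g x)// hx// subrr.
Qed.

Lemma L2_ae f g : L2 f -> measurable_fun setT g -> f = g %[ae area] -> L2 g.
move=> hf mg h; apply: L2_intro => //.
have mf := L2_meas hf.
apply/integrableP; split; first by apply/measurable_EFinP; exact: measurable_funX.
have /integrableP[_] := L2_sqr hf.
rewrite (_ : (\int[area]_x `|(EFin \o (fun x => (f x ^+ 2)%R)) x|)%E =
 (\int[area]_x `|(EFin \o (fun x => (g x ^+ 2)%R)) x|)%E)//.
apply: ae_eq_integral => //.
- by apply: measurableT_comp => //; apply/measurable_EFinP; exact: measurable_funX.
- by apply: measurableT_comp => //; apply/measurable_EFinP; exact: measurable_funX.
by apply: filterS h => x /= hx; rewrite hx.
Qed.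

Definition l2lim (p : nat -> P) f := L2 f /\ forall e : R, 0 < e ->
 exists n0, forall n, (n0 <= n)%N -> l2norm (f - pev (p n)) <= e.

Lemma l2lim_cst p : l2lim (fun=> p) (pev p).
split; first exact: L2_pev.
by exists 0%N => n; rewrite subrr /Defs.l2norm l2ip0l sqrtr0 ltW.
Qed.

End square_integrable.

(** * Density of polynomials in L_2 of the sphere *)

Section density.
Context (R : realType).
Notation P := (pol R).
Notation area := (@area R).

Lemma bernoulli_le (u : R) n : 0 <= u <= 1 -> (1 - u) ^+ n * (1 + n%:R * u) <= 1.
move=> /andP[u0 u1]; elim: n => [|n IH]; first by rewrite mul0r addr0 mulr1.
apply: le_trans IH; rewrite exprSr -mulrA.
have h : 0 <= (1 - u) ^+ n by rewrite exprn_ge0// subr_ge0.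
rewrite ler_wpM2l// -subr_ge0.
have -> : 1 + n%:R * u - (1 - u) * (1 + n.+1%:R * u) = n.+1%:R * u ^+ 2.
 by ring.
by rewrite mulr_ge0// sqr_ge0.
Qed.

Lemma bernoulli_ge (u : R) n : 0 <= u <= 1 -> 1 - n%:R * u <= (1 - u) ^+ n.
move=> /andP[u0 u1]; elim: n => [|n IH]; first by rewrite mul0r subr0.
have h : 0 <= 1 - u by rewrite subr_ge0.
rewrite exprS; apply: (@le_trans _ _ ((1 - u) * (1 - n%:R * u))); last by rewrite ler_wpM2l.
rewrite -subr_ge0.
have -> : (1 - u) * (1 - n%:R * u) - (1 - n.+1%:R * u) = n%:R * u ^+ 2.
 by ring.
by rewrite mulr_ge0// sqr_ge0.
Qed.

(** On [[0, 1]] these polynomials tend to the indicator of [1 / 2 < s]; the additional factor [n] in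
    the exponent forces the limit 0 at [1 / 2] itself. *)
Definition step_poly n (s : R) := (1 - (1 - s) ^+ n) ^+ (n * 2 ^ n).

Lemma step_poly_itv n s : 0 <= s <= 1 -> 0 <= step_poly n s <= 1.
move=> /andP[s0 s1]; have h0 : 0 <= 1 - s by rewrite subr_ge0.
have h1 : (1 - s) ^+ n <= 1 by rewrite exprn_ile1// lerBlDr lerDl.
have h2 : 0 <= (1 - s) ^+ n by rewrite exprn_ge0.
rewrite exprn_ge0 ?subr_ge0// exprn_ile1 ?subr_ge0//.
by rewrite lerBlDr lerDl.
Qed.

Lemma step_poly_low s : 0 <= s <= 1 / 2 -> step_poly n s @[n --> \oo] --> (0 : R).
move=> /andP[s0 s1].
apply: (@squeeze_cvgr _ _ _ _ (fun=> 0) (fun n => n%:R^-1 : R)).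
- exists 1%N => // n /= n1.
 have s01 : 0 <= s <= 1 by lra.
 have /andP[-> _] := step_poly_itv n s01.
 have h : (2^-1) ^+ n <= (1 - s) ^+ n by rewrite lerXn2r ?nnegrE; lra.
 have u1 : (2^-1 : R) ^+ n <= 1 by rewrite exprn_ile1; lra.
 have u0 : 0 < (2^-1 : R) ^+ n by [].
 apply: (@le_trans _ _ ((1 - 2^-1 ^+ n) ^+ (n * 2 ^ n))).
  have h3 : (1 - s) ^+ n <= 1 by rewrite exprn_ile1; lra.
  by rewrite lerXn2r ?nnegrE ?subr_ge0// lerD2l lerN2.
 have := @bernoulli_le (2^-1 ^+ n) (n * 2 ^ n)%N (_ : _); rewrite (ltW u0) u1 => /(_ isT).
 rewrite natrM natrX exprVn mulfK // => hb.
 have n0 : 0 < n%:R :> R by rewrite ltr0n.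
 rewrite -[leRHS]mul1r ler_pdivlMr// (le_trans _ hb)// ler_wpM2l//.
  by rewrite exprn_ge0// subr_ge0 -exprVn.
 by rewrite lerDr.
- exact: cvg_cst.
- by rewrite -cvg_shiftS; exact: cvg_harmonic.
Qed.

Lemma step_poly_high s : 1 / 2 < s <= 1 -> step_poly n s @[n --> \oo] --> (1 : R).
move=> /andP[s0 s1].
pose r := 2 * (1 - s).
have r0 : 0 <= r by rewrite /r; lra.
have r1 : r < 1 by rewrite /r; lra.
have cvr : n%:R * r ^+ n @[n --> \oo] --> (0 : R).
 have [->|rn0] := eqVneq r 0.
  apply: cvg_near_cst; exists 1%N => // n /= n1.
  by rewrite expr0n gtn_eqF// mulr0.
 have rp : 0 < r by rewrite lt_neqAle eq_sym rn0.
 (* with r = (1+a)^-2, Bernoulli gives n r^n <= (n (1+a)^-n) (1+a)^-n <= a^-1 (1+a)^-n *)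
 pose q := Num.sqrt r.
 have q0 : 0 < q by rewrite sqrtr_gt0.
 have q1 : q < 1 by rewrite -[ltRHS]sqrtr1 ltr_sqrt.
 have qq : q ^+ 2 = r by rewrite sqr_sqrtr.
 have b n : n%:R * q ^+ n <= (1 - q)^-1.
  have e : 1 - (1 - q) = q by ring.
  have hb := @bernoulli_le (1 - q) n; rewrite e in hb.
  have : q ^+ n * (1 + n%:R * (1 - q)) <= 1 by lra.
  move=> h; rewrite -[leRHS]mul1r ler_pdivlMr ?subr_gt0// (le_trans _ h)//.
  rewrite -mulrA mulrCA ler_wpM2l ?exprn_ge0 ?(ltW q0)//.
  by rewrite lerDr.
 apply: (@squeeze_cvgr _ _ _ _ (fun=> 0) (fun n => (1 - q)^-1 * q ^+ n)).
 - apply: nearW => n; rewrite mulr_ge0 ?exprn_ge0//= -qq -exprM mulnC mulnC exprM.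
  by rewrite exprMn mulrA ler_wpM2r// exprn_ge0// ltW.
 - exact: cvg_cst.
 - rewrite -[X in _ --> X](mulr0 (1 - q)^-1); apply: cvgMr.
  by apply: cvg_expr; rewrite ger0_norm ?(ltW q0).
apply: (@squeeze_cvgr _ _ _ _ (fun n => 1 - n%:R * r ^+ n) (fun=> 1)).
- apply: nearW => n.
 have s01 : 0 <= s <= 1 by lra.
 have /andP[_ ->] := step_poly_itv n s01; rewrite andbT.
 have u0 : 0 <= (1 - s) ^+ n by rewrite exprn_ge0; lra.
 have u1 : (1 - s) ^+ n <= 1 by rewrite exprn_ile1; lra.
 have := @bernoulli_ge ((1 - s) ^+ n) (n * 2 ^ n)%N; rewrite u0 u1 => /(_ isT).
 by rewrite natrM natrX -mulrA -exprMn.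
- rewrite -[X in _ --> X]subr0; apply: cvgB => //; exact: cvg_cst.
- exact: cvg_cst.
Qed.

(** An affine change of coordinate that takes values in [[0, 1]] and sends the threshold [c] to
    [1 / 2]. *)
Definition half_coord (i : 'I_3) (c : R) (x : S2 R) : R :=
 2^-1 + (s2coord i x - c) / (2 * (1 + `|c|)).

Lemma half_coord_itv i c x : 0 <= half_coord i c x <= 1.
have : `|(s2coord i x - c) / (2 * (1 + `|c|))| <= 2^-1.
 rewrite normrM (@gtr0_norm _ (_ ^-1)) // ler_pdivrMr// mulrA mulVf// mul1r.
 by apply: (le_trans (ler_normB _ _)); rewrite lerD2r s2coord_le1.
by rewrite ler_norml /half_coord => /andP[? ?]; lra.
Qed.

Lemma half_coord_gt i c x : (1 / 2 < half_coord i c x) = (c < s2coord i x).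
by rewrite div1r ltrDl pmulr_lgt0 // subr_gt0.
Qed.

Definition orthant (c : 'I_3 -> R) : set (S2 R) := [set x | forall i, c i < s2coord i x].

Definition orthant_poly (c : 'I_3 -> R) n : P := \prod_(i < 3)
 (1 - (1 - ((2 * (1 + `|c i|))^-1 *: px R i +
  (2^-1 - c i / (2 * (1 + `|c i|))) *: 1)) ^+ n) ^+ (n * 2 ^ n).

Lemma pev_orthant_poly c n x :
 pev (orthant_poly c n) x = \prod_(i < 3) step_poly n (half_coord i (c i) x).
rewrite (big_morph (fun p => pev p x) (fun p q => pevM p q x) (pev1 x)).
apply: eq_bigr => i _; rewrite pevX pevB pevX pevB pevD !pevZ pev1 pev_px mulr1.
by rewrite /half_coord [_^-1 * _]mulrC; congr ((1 - (1 - _) ^+ _) ^+ _); ring.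
Qed.

Lemma orthant_poly_itv c n x : 0 <= pev (orthant_poly c n) x <= 1.
rewrite pev_orthant_poly; apply/andP; split.
 by apply: prodr_ge0 => i; have /andP[] := step_poly_itv n (half_coord_itv i (c i) x).
by apply: prodr_ile1 => i _; exact: step_poly_itv (half_coord_itv i (c i) x).
Qed.

Lemma orthant_poly_cvg c x :
 pev (orthant_poly c n) x @[n --> \oo] --> (\1_(orthant c) x : R).
rewrite (_ : (fun n => _ x) =
 (fun n => \prod_(i < 3) step_poly n (half_coord i (c i) x))); last first.
 by apply/funext => n; exact: pev_orthant_poly.
have h i : step_poly n (half_coord i (c i) x) @[n --> \oo] -->
  (if c i < s2coord i x then 1 else 0 : R).
 rewrite -half_coord_gt; have /andP[h0 h1] := half_coord_itv i (c i) x.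
 case: ltP => h; first by apply: step_poly_high; rewrite h.
 by apply: step_poly_low; rewrite h0.
have -> : \1_(orthant c) x = \prod_(i < 3) (if c i < s2coord i x then 1 else 0 : R).
 rewrite indicE; have [xc|xc] := pselect (x \in orthant c).
  rewrite xc big1// => i; move: xc; rewrite inE => ->//.
 rewrite (negbTE (introN idP xc)).
 have : ~ orthant c x by move=> hx; apply: xc; rewrite inE.
 move=> /existsNP[i /negP hi]; by rewrite (bigD1 i)//= (negbTE hi) mul0r.
have -> : (fun n => \prod_(i < 3) step_poly n (half_coord i (c i) x)) =
 (fun n => step_poly n (half_coord ord0 (c ord0) x) *
   (step_poly n (half_coord (lift ord0 ord0) (c (lift ord0 ord0)) x) *
   step_poly n (half_coord (lift ord0 (lift ord0 ord0)) (c (lift ord0 (lift ord0 ord0))) x))).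
 by apply/funext => n; rewrite !big_ord_recl big_ord0 mulr1.
rewrite !big_ord_recl big_ord0 mulr1.
by apply: cvgM; [exact: h|apply: cvgM; exact: h].
Qed.

Lemma measurable_orthant c : measurable (orthant c).
have -> : orthant c = \bigcap_(i in [set: 'I_3]) (@s2coord R i @^-1` `]c i, +oo[).
 apply/seteqP; split=> x.
  by move=> h i /=; rewrite in_itv/= andbT.
 by move=> h i; have := h i Logic.I; rewrite /= in_itv/= andbT.
apply: fin_bigcap_measurable => // i _; rewrite -[X in measurable X]setTI.
by apply: measurable_s2coord => //.
Qed.

Lemma S2_generated : @measurable _ (S2 R) = <<s [set A | exists c, A = orthant c] >>.
apply/seteqP; split; last first.
 apply: smallest_sub; first exact: sigma_algebra_measurable.
 by move=> _ [c ->]; exact: measurable_orthant.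
rewrite [X in X `<=` _](_ : _ = g_sigma_preimage (@s2coord R))//.
set G := [set A | exists c, A = orthant c].
apply: smallest_sub => //.
rewrite -bigcup_mkord_ord => A [i _] [B mB <-]; rewrite setTI.
pose T := g_sigma_algebraType G.
have : measurable_fun [set: T] (@s2coord R (inord i) : T -> R).
 apply: (measurability _ (RGenOInfty.measurableE R)).
 move=> _ [_ [a ->] <-]; rewrite setTI.
 apply: sub_sigma_algebra.
 (* The threshold -2 imposes nothing, as coordinates are at least -1. *)
 exists (fun j => if j == inord i then a else - 2); apply/seteqP; split=> x /=.
  rewrite in_itv/= andbT => h j; case: eqP => [->//|_].
  by have := s2coord_le1 x j; rewrite ler_norml => /andP[h1]; lra.
 by move=> /(_ (inord i)); rewrite eqxx in_itv/= andbT.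
by move=> /(_ measurableT _ mB); rewrite setTI.
Qed.

(** Orthogonality to polynomials passes to the indicators of orthants by dominated convergence, and
    from these to all measurable sets by Dynkin's theorem. *)
Lemma polynomials_dense (f : S2 R -> R) : L2 f ->
 (forall p : P, l2ip f (pev p) = 0) -> f = 0 %[ae area].
move=> hf h0.
have intf : area.-integrable setT (EFin \o f).
 have := L2_mul hf (L2_bmeas (@bmeas_cst _ (S2 R) R 1)).
 by apply: integrable_eqf => x /=; rewrite mulr1.
have mf := L2_meas hf.
have orth c : (\int[area]_(x in orthant c) (f x)%:E = 0)%E.
 pose F n x := (f x * pev (orthant_poly c n) x)%:E.
 have mF n : measurable_fun setT (F n).
  by apply/measurable_EFinP; apply: measurable_funM => //; exact: (bmeas_pev _).1.
 have mG : measurable_fun setT (fun x => (f x * \1_(orthant c) x)%:E).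
  by apply/measurable_EFinP; apply: measurable_funM => //;
   exact: measurable_indic (measurable_orthant c).
 have [|||_ _ hc] := @dominated_convergence _ _ _ area setT measurableT F
   (fun x => (f x * \1_(orthant c) x)%:E) (fun x => `|f x|%:E) mF mG.
 - apply: aeW => x _ /=; apply: cvg_EFin; first exact: nearW.
  by apply: cvgMr; exact: orthant_poly_cvg.
 - by have := integrable_abse intf.
 - apply: aeW => x n /=; rewrite lee_fin normrM ler_piMr//.
  by have /andP[u0 u1] := orthant_poly_itv c n x; rewrite ger0_norm.
 rewrite integral_mkcond.
 have -> : ((EFin \o f) \_ (orthant c)) = (fun x => (f x * \1_(orthant c) x)%:E).
  apply/funext => x; rewrite patchE indicE; case: ifP => _; first by rewrite mulr1.
  by rewrite mulr0.
 rewrite -(cvg_lim _ hc)//; apply/cvg_lim => //.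
 rewrite (_ : [sequence _]_n = fun=> 0%E); first exact: cvg_cst.
 apply/funext => n /=.
 have := h0 (orthant_poly c n); rewrite /l2ip /Rintegral => h.
 rewrite -[LHS]fineK ?[fine _]h//.
 by apply: (integrable_fin_num measurableT); exact: (L2_mul hf (L2_pev _)).
have all A : measurable A -> (\int[area]_(x in A) (f x)%:E = 0)%E.
 rewrite S2_generated; move: A.
 apply: (@dynkin_induction _ _ [set A | exists c, A = orthant c]
  (fun A => (\int[area]_(x in A) (f x)%:E = 0)%E)).
 - exact: S2_generated.
 - move=> _ _ [c ->] [d ->]; exists (fun i => Num.max (c i) (d i)); apply/seteqP; split=> x /=.
   by move=> [h1 h2] i; rewrite gt_max h1 h2.
  by move=> h; split => i; have := h i; rewrite gt_max => /andP[].
 - rewrite -(orth (fun=> -2)); congr integral; apply/seteqP; split=> // x _ i.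
  have := s2coord_le1 x i; rewrite ler_norml => /andP[h1 _].
  by lra.
 - by move=> _ [c ->].
 - move=> A mA hA.
  have : (\int[area]_(x in A `|` ~` A) (f x)%:E =
    \int[area]_(x in A) (f x)%:E + \int[area]_(x in ~` A) (f x)%:E)%E.
   apply: integral_setU => //; first exact: measurableC.
    by rewrite setUv; exact/measurable_EFinP.
   by rewrite disj_set2E setICr.
  rewrite hA add0e setUv => <-.
  rewrite -(orth (fun=> -2)); congr integral; apply/seteqP; split=> // x _ i.
  have := s2coord_le1 x i; rewrite ler_norml => /andP[h1 _].
  by lra.
 - move=> F mF tF hF; rewrite integral_bigcup//.
   by apply: eseries0 => n.
  exact: integrableS (bigcupT_measurable _ mF) _ intf.
have := @integral_ae_eq _ _ _ area setT measurableT (cst 0%E) (EFin \o f) intf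
 (measurable_cst _) (fun E _ mE => eq_trans (all E mE) (esym (integral0 _ _))).
by apply: filterS => x /(_ Logic.I) [].
Qed.

End density.

(** * Completeness of L_2 along polynomials *)

Section riesz_fischer.
Context (R : realType).
Notation P := (pol R).
Notation area := (@area R).

Definition n0cauchy (p : nat -> P) := forall e : R, 0 < e -> exists n0, forall n m,
 (n0 <= n)%N -> (n0 <= m)%N -> N 0 (p n - p m) <= e.

Lemma integral_abs_pev (p : P) :
 (\int[area]_x `|(pev p x)%:E| <= (N 0 (1 : P) * N 0 p)%:E)%E.
have bp : bmeas (fun x => `|pev p x|).
 split; first by apply: measurableT_comp => //; exact: (bmeas_pev p).1.
 by have [M hM] := (bmeas_pev p).2; exists M => x; rewrite normr_id.
have hp := L2_bmeas bp.
have h1 : l2norm (fun x => `|pev p x|) = N 0 p.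
 rewrite -l2norm_pev /Defs.l2norm; congr Num.sqrt; apply: eq_Rintegral => x _.
 by rewrite -normrM ger0_norm// sqr_ge0.
have := l2ip_le (L2_pev (1 : P)) hp; rewrite h1 l2norm_pev.
move=> /(le_trans (ler_norm _)); rewrite -lee_fin; apply: le_trans.
rewrite le_eqVlt; apply/orP; left; apply/eqP.
have i1 := bmeas_integrable bp.
rewrite -[LHS]fineK; last exact: (integrable_fin_num measurableT i1).
by congr EFin; apply: eq_Rintegral => x; rewrite pev1 mul1r.
Qed.

Lemma limn_einf_le (u : nat -> \bar R) (M : \bar R) n0 :
 (forall n, (n0 <= n)%N -> (u n <= M)%E) -> (limn_einf u <= M)%E.
move=> h; rewrite limn_einf_lim; apply: lime_le; first exact: is_cvg_einfs.
apply: nearW => n; apply: (@le_trans _ _ (u (maxn n n0))).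
 by apply: ereal_inf_lbound; exists (maxn n n0) => //=; rewrite leq_maxl.
by apply: h; rewrite leq_maxr.
Qed.

(* A subsequence with summable increments converges almost everywhere, and
  Fatou's lemma identifies its limit as the L_2 limit. *)
Lemma riesz_fischer (p : nat -> P) : n0cauchy p -> exists f, l2lim p f.
move=> hc.
have sub k : exists n0, forall n m, (n0 <= n)%N -> (n0 <= m)%N ->
  N 0 (p n - p m) <= (2^-1) ^+ k.
 by apply: hc.
pose s k := sval (cid (sub k)).
have sP k n m : (s k <= n)%N -> (s k <= m)%N -> N 0 (p n - p m) <= (2^-1) ^+ k.
 exact: (svalP (cid (sub k))).
pose t k := (k + \sum_(j < k.+1) s j)%N.
have st j k : (j <= k)%N -> (s j <= t k)%N.
 move=> jk; have jk1 : (j < k.+1)%N by [].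
 by rewrite /t (bigD1 (Ordinal jk1))// addnCA leq_addr.
pose u k := p (t k).
have uS k : N 0 (u k.+1 - u k) <= (2^-1) ^+ k by apply: sP; apply: st.
have mu k : measurable_fun setT (pev (u k)) by exact: (bmeas_pev _).1.
pose G x : \bar R := (\sum_(0 <= k <oo) `|(pev (u k.+1 - u k) x)%:E|)%E.
have mabs k : measurable_fun setT (fun x => `|(pev (u k.+1 - u k) x)%:E|)%E.
 by apply: measurableT_comp => //; apply/measurable_EFinP; exact: (bmeas_pev _).1.
have iG : (\int[area]_x G x < +oo)%E.
 rewrite integral_nneseries//.
 apply: (@le_lt_trans _ _ (\sum_(0 <= k <oo) (N 0 (1 : P) * (2^-1) ^+ k)%:E)%E).
  apply: lee_nneseries => [k _ _|k _].
   by apply: integral_ge0.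
  by apply: (le_trans (integral_abs_pev _)); rewrite lee_fin ler_wpM2l.
 have : cvgn (series (geometric (N 0 (1 : P)) (2^-1 : R))).
  apply: is_cvg_geometric_series.
  by rewrite ger0_norm // invf_lt1// ltr1n.
 move=> /cvg_ex[l hl].
 have : (\sum_(0 <= k < n) (N 0 (1 : P) * (2^-1) ^+ k)%:E)%E @[n --> \oo] --> l%:E.
  rewrite (_ : (fun n => _) = EFin \o series (geometric (N 0 (1 : P)) (2^-1 : R))).
   by apply: cvg_EFin => //; exact: nearW.
  by apply/funext => n /=; rewrite sumEFin.
 by move=> /cvg_lim -> //; rewrite ltry.
have mG : measurable_fun setT G by apply: ge0_emeasurable_sum.
have G0 x : (0 <= G x)%E by apply: nneseries_ge0.
have iG' : area.-integrable setT G.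
 apply/integrableP; split => //.
 by under eq_integral do rewrite gee0_abs//.
have Gfin := integrable_ae measurableT iG'.
have ucv x : (G x \is a fin_num) -> cvgn (fun k => pev (u k) x).
 move=> hG.
 have hs : cvgn (series (fun k => `|pev (u k.+1 - u k) x|)).
  apply/cvg_ex; exists (fine (G x)).
  have hl : (\sum_(0 <= k < n) `|(pev (u k.+1 - u k) x)%:E|)%E @[n --> \oo] --> G x.
   by apply: is_cvg_nneseries.
  have -> : series (fun k => `|pev (u k.+1 - u k) x|) =
    fine \o (fun n => (\sum_(0 <= k < n) `|(pev (u k.+1 - u k) x)%:E|)%E).
   by apply/funext => n /=; rewrite sumEFin.
  by apply: fine_cvg; rewrite fineK.
 have := normed_cvg hs; move=> /cvg_ex[l hl].
 apply/cvg_ex; exists (pev (u 0) x + l).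
 rewrite (_ : (fun k => pev (u k) x) = (fun k => pev (u 0) x +
   series (fun k => pev (u k.+1 - u k) x) k)).
  by apply: cvgD => //; exact: cvg_cst.
 apply/funext => k; rewrite /series/=; elim: k => [|k IH].
  by rewrite big_geq// addr0.
 by rewrite big_nat_recr// addrA -IH pevB addrC subrK.
(* The upper limit is measurable everywhere, including where the sequence diverges. *)
pose f x : R := fine (limn_esup (fun k => (pev (u k) x)%:E)).
have mf : measurable_fun setT f.
 apply: measurableT_comp => //; apply: measurable_fun_limn_esup => k.
 exact/measurable_EFinP.
have fcv : {ae area, forall x, pev (u k) x @[k --> \oo] --> f x}.
 apply: filterS Gfin => x /(_ Logic.I) hG.
 have /cvg_ex[l hl] := ucv x hG.
 suff -> : f x = l by [].
 rewrite /f (_ : limn_esup _ = l%:E)//.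
 have hl' : (pev (u k) x)%:E @[k --> \oo] --> l%:E by apply: cvg_EFin => //; exact: nearW.
 by rewrite is_cvg_limn_esupE ?(cvg_lim _ hl').
have fatou_ q M n0 : (forall k, (n0 <= k)%N -> N 0 (u k - q) <= M) ->
  (\int[area]_x ((f x - pev q x) ^+ 2)%:E <= (M ^+ 2)%:E)%E.
 move=> hM.
 pose h k x := (((pev (u k) x - pev q x) ^+ 2)%:E).
 have mh k : measurable_fun setT (h k).
  apply/measurable_EFinP; apply: measurable_funX; apply: measurable_funB => //.
  exact: (bmeas_pev _).1.
 have h0 k x : setT x -> (0 <= h k x)%E by rewrite lee_fin sqr_ge0.
 have e : (\int[area]_x ((f x - pev q x) ^+ 2)%:E = \int[area]_x limn_einf (h^~ x))%E.
  apply: ae_eq_integral => //.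
  - apply/measurable_EFinP; apply: measurable_funX; apply: measurable_funB => //.
   exact: (bmeas_pev _).1.
  - rewrite (_ : (fun x => limn_einf (h^~ x)) = (fun x => - limn_esup (fun k => - h k x)))%E.
    apply: measurableT_comp => //; apply: measurable_fun_limn_esup => k.
    exact: measurableT_comp.
   apply/funext => x; rewrite -limn_einfN; congr limn_einf; apply/funext => k /=.
   by rewrite opprK.
  apply: filterS fcv => x hx _; apply/esym.
  have hl' : h k x @[k --> \oo] --> ((f x - pev q x) ^+ 2)%:E.
   rewrite /h expr2; apply: cvg_EFin; first exact: nearW.
   rewrite (_ : fine \o _ = (fun k => (pev (u k) x - pev q x) * (pev (u k) x - pev q x))).
    by apply: cvgM; apply: cvgB => //; exact: cvg_cst.
   by [].
  by rewrite is_cvg_limn_einfE ?(cvg_lim _ hl').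
 rewrite e; apply: (le_trans (fatou area measurableT mh h0)).
 apply: (@limn_einf_le _ _ n0) => k hk.
 have -> : (\int[area]_x h k x = (S 0 (u k - q))%:E)%E.
  rewrite -[LHS]fineK.
   congr EFin; rewrite -[RHS]/(ip _ _) -l2ip_pev; apply: eq_Rintegral => x _.
   by rewrite pevB.
  apply: (integrable_fin_num measurableT).
  have := L2_sqr (L2_pev (u k - q)); congr integrable; apply/funext => x /=.
  by rewrite pevB.
 rewrite lee_fin -N_sq lerXn2r ?nnegrE ?hM//.
 exact: le_trans (hM k hk).
have L2fq q M n0 : (forall k, (n0 <= k)%N -> N 0 (u k - q) <= M) -> 0 <= M ->
  L2 (f - pev q) /\ l2norm (f - pev q) <= M.
 move=> hM M0; have hF := fatou_ q M n0 hM.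
 have mfq : measurable_fun setT (f - pev q).
  by apply: measurable_funB => //; exact: (bmeas_pev _).1.
 have iF : area.-integrable setT (EFin \o (fun x => (f - pev q) x ^+ 2)).
  apply/integrableP; split; first by apply/measurable_EFinP; exact: measurable_funX.
  under eq_integral do rewrite /= ger0_norm ?sqr_ge0//.
  exact: le_lt_trans hF (ltry _).
 split; first exact: L2_intro.
 rewrite -ler_sqr ?nnegrE ?l2norm_ge0// l2norm_sq -lee_fin.
 apply: le_trans hF; rewrite le_eqVlt; apply/orP; left; apply/eqP.
 rewrite fineK.
  by [].
 have := integrable_fin_num measurableT iF.
 by [].
exists f; split.
 have [h _] := L2fq (p (s 0%N)) 1 0%N (fun k _ => le_trans (sP 0%N _ _ (st 0%N k (leq0n k))
  (leqnn _)) (lexx _)) ler01.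
 by have := L2D h (L2_pev (p (s 0%N))); rewrite subrK.
move=> e e0; have [n0 hn0] := hc e e0; exists n0 => n hn.
have [|_ //] := L2fq (p n) e n0 _ (ltW e0).
move=> k hk; apply: hn0 => //; apply: (leq_trans hk); exact: leq_addr.
Qed.

End riesz_fischer.

(** * Weak derivatives and H^2 limits of polynomials *)

Section weak_derivatives.
Context (R : realType).
Notation P := (pol R).
Notation area := (@area R).
Notation L2 := (@L2 R).
Implicit Types (f g h : S2 R -> R) (p q : nat -> P) (u v w : P) (phi : 'rV[R]_3 -> R).

Lemma pev_inj_ip u v : (forall w, ip u w = ip v w) -> pev u = pev v.
by move=> h; apply: cf_inj; apply/funext => k; rewrite !cfE.
Qed.

Lemma ip_tgr i u v : ip (tgr i u) v = ip u (2 *: (px R i * v) - tgr i v).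
have := Ip_tgr i (u * v); rewrite tgrM IpD ipBr ipZr !ipE.
rewrite (_ : u * (px R i * v) = px R i * (u * v)); last by ring.
by move: Ip => c; lra.
Qed.

Lemma sum_ip_tgr u v : ip (tgr e0 u) (tgr e0 v) + ip (tgr e1 u) (tgr e1 v) +
 ip (tgr e2 u) (tgr e2 v) = - ip (lapp u) v.
have key w : ip (tgr e0 w) (tgr e0 w) + ip (tgr e1 w) (tgr e1 w) + ip (tgr e2 w) (tgr e2 w) =
  ip (rot e0 w) (rot e0 w) + ip (rot e1 w) (rot e1 w) + ip (rot e2 w) (rot e2 w).
 have h : pev (tgr e0 w ^+ 2 + tgr e1 w ^+ 2 + tgr e2 w ^+ 2) =
   pev (rot e0 w ^+ 2 + rot e1 w ^+ 2 + rot e2 w ^+ 2).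
  apply/funext => x; have := congr1 (fun r => pev r x) (sum_tgr_sqr w).
  rewrite pevB pevM pev_r2 mul1r pevM pevB pev_r2 pev1 subrr mul0r.
  by move/eqP; rewrite subr_eq0 => /eqP.
 by rewrite -!IpD (eq_Ip h).
(* Polarization of the equality of quadratic forms [key]. *)
have := key (u + v); rewrite ip_lapp opprK.
have tD i : tgr i (u + v) = tgr i u + tgr i v by rewrite linearD.
rewrite !tD !rotD !(ipDl (tgr _ _)) !(ipDr (tgr _ _)) !(ipDl (rot _ _)) !(ipDr (rot _ _)).
rewrite (ipC (tgr e0 v) (tgr e0 u)) (ipC (tgr e1 v) (tgr e1 u)) (ipC (tgr e2 v) (tgr e2 u))
 (ipC (rot e0 v) (rot e0 u)) (ipC (rot e1 v) (rot e1 u)) (ipC (rot e2 v) (rot e2 u)).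
have := key u; have := key v; lra.
Qed.

Lemma sum_px_tgr u : pev (px R e0 * tgr e0 u + px R e1 * tgr e1 u + px R e2 * tgr e2 u) = (fun=> 0).
apply/funext => x.
have -> : px R e0 * tgr e0 u + px R e1 * tgr e1 u + px R e2 * tgr e2 u =
 (1 - r2 R) * eul u by rewrite /tgr /eul /r2; ring.
by rewrite pevM pevB pev1 pev_r2 subrr mul0r.
Qed.

(** The curvature terms produced by [ip_tgr] add up to zero because the tangential gradient is
    orthogonal to the position. This identifies [lapp] with the divergence form used in [lap]. *)
Lemma sum_tgr_tgr u : pev (tgr e0 (tgr e0 u) + tgr e1 (tgr e1 u) + tgr e2 (tgr e2 u)) =
 pev (lapp u).
apply: pev_inj_ip => w.
have A i : ip (tgr i (tgr i u)) w = 2 * ip (tgr i u) (px R i * w) - ip (tgr i u) (tgr i w).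
 by rewrite (ip_tgr i (tgr i u) w) (ipBr (2 *: _) (tgr i w)) ipZr.
rewrite (ipDl _ (tgr e2 _)) (ipDl (tgr e0 _) (tgr e1 _)) !A.
have hx := ip_0ext w (sum_px_tgr u).
rewrite (ipDl _ (px R e2 * _)) (ipDl (px R e0 * _) (px R e1 * _)) in hx.
move: hx; have := sum_ip_tgr u w.
have e i : ip (px R i * tgr i u) w = ip (tgr i u) (px R i * w).
 by congr Ip; ring.
rewrite !e.
move: (ip _ _) (ip _ _) (ip _ _) (ip (tgr _ _) _) (ip (tgr _ _) _) (ip (tgr _ _) _) (ip (lapp u) w).
by move=> a b c a' b' c' d; lra.
Qed.

(** The adjoint of [tgr i], curvature term included. *)
Definition tadj i u : P := 2 *: (px R i * u) - tgr i u.

Lemma sum_tadj_tadj u : pev (tadj e0 (tadj e0 u) + tadj e1 (tadj e1 u) + tadj e2 (tadj e2 u)) =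
 pev (lapp u).
apply: pev_inj_ip => w; rewrite [LHS]ipC [RHS]ipC 2!ipDr -!ip_tgr -2!ipDl.
by rewrite (ip_extl _ (sum_tgr_tgr w)) ip_lappC.
Qed.

Lemma N_tgr_le i u : N 0 (tgr i u) <= N 1 u.
apply: N_S_le; have := sum_ip_tgr u u.
have -> : - ip (lapp u) u = S 1 u by rewrite /S /sip ipNl.
have h j : ip (tgr j u) (tgr j u) = S 0 (tgr j u) by [].
rewrite !h => <-.
move: (S_ge0 0 (tgr e0 u)) (S_ge0 0 (tgr e1 u)) (S_ge0 0 (tgr e2 u)).
by elim/ord3: i; move: S => c; lra.
Qed.

Lemma bmeas_bound (b : S2 R -> R) : bmeas b -> exists M, 0 < M /\ forall x, `|b x| <= M.
move=> [_ [M hM]]; exists (`|M| + 1); split => //.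
by move=> x; apply: (le_trans (hM x)); apply: (le_trans (ler_norm M)); rewrite lerDl.
Qed.

Lemma l2norm_bM (b : S2 R -> R) M f : measurable_fun setT b -> (forall x, `|b x| <= M) -> L2 f ->
 l2norm (fun x => b x * f x) <= M * l2norm f.
move=> mb hM hf; have M0 : 0 <= M by apply: le_trans (hM point).
have hbf : L2 (fun x => b x * f x) by apply: L2_bM => //; split => //; exists M.
rewrite -ler_sqr ?nnegrE ?mulr_ge0 ?l2norm_ge0// exprMn !l2norm_sq /Defs.l2ip.
rewrite -RintegralZl//; last exact: L2_mul.
apply: le_Rintegral => //; [exact: L2_mul|by apply: integrableZR; exact: L2_mul|].
move=> x; rewrite mulrACA -!expr2 ler_wpM2r ?sqr_ge0//.
by rewrite -(real_normK (num_real (b x))) lerXn2r.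
Qed.

Lemma N_mul u : exists K, 0 <= K /\ forall v, N 0 (u * v) <= K * N 0 v.
have [M [M0 hM]] := bmeas_bound (bmeas_pev u); exists M; split; first nneg.
move=> v; rewrite -!l2norm_pev.
have := @l2norm_bM (pev u) M (pev v) (bmeas_pev u).1 hM (L2_pev v).
by congr (l2norm _ <= _); apply/funext => x; rewrite pevM.
Qed.

Lemma N_rot_mul i u : exists K, 0 <= K /\ forall v, N 0 (rot i (u * v)) <= K * (N 0 v + N 1 v).
have [K1 [K10 h1]] := N_mul (rot i u); have [K2 [K20 h2]] := N_mul u.
exists (K1 + K2); split; first nneg.
move=> v; rewrite rotM; apply: ND_le.
apply: (le_trans (lerD (h1 v) (h2 _))).
have := ler_wpM2l K20 (N_rot_le 0 i v).
have := mulr_ge0 K10 (N_ge0 1 v); have := mulr_ge0 K20 (N_ge0 0 v).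
by lra.
Qed.

Lemma N1_tgr i : exists K, 0 <= K /\ forall u, N 1 (tgr i u) <= K * (N 1 u + N 2 u).
have key a b c d : exists K, 0 <= K /\ forall u, N 0 (rot a (px R b * rot c u - px R c * rot d u))
  <= K * (N 1 u + N 2 u).
 have [K1 [K10 h1]] := N_rot_mul a (px R b); have [K2 [K20 h2]] := N_rot_mul a (px R c).
 exists (K1 + K2); split; first nneg.
 move=> u; rewrite rotB; apply: (le_trans (NB _ _ _)).
 apply: (le_trans (lerD (h1 _) (h2 _))); rewrite mulrDl.
 by apply: lerD; rewrite ler_wpM2l//; apply: lerD; exact: N_rot_le.
have key2 a : exists K, 0 <= K /\ forall u, N 0 (rot a (tgr i u)) <= K * (N 1 u + N 2 u).
 have hx u := pev_tgr u.
 have hr u v : pev u = pev v -> N 0 (rot a u) = N 0 (rot a v).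
  by move=> h; apply: N_ext; exact: pev_rot.
 elim/ord3: i.
 - have [K [K0 h]] := key a e2 e1 e2; exists K; split=> // u.
  by rewrite (hr _ _ (hx u).1.1).
 - have [K [K0 h]] := key a e0 e2 e0; exists K; split=> // u.
  by rewrite (hr _ _ (hx u).1.2).
 - have [K [K0 h]] := key a e1 e0 e1; exists K; split=> // u.
  by rewrite (hr _ _ (hx u).2).
have [K0 [K00 h0]] := key2 e0; have [K1 [K10 h1]] := key2 e1; have [K2 [K20 h2]] := key2 e2.
exists (K0 + K1 + K2); split; first by rewrite !addr_ge0.
move=> u.
apply: (@le_trans _ _ (N 0 (rot e0 (tgr i u)) + N 0 (rot e1 (tgr i u)) + N 0 (rot e2 (tgr i u)))).
 apply: sqr_le_norm; first by nneg.
 rewrite N_sq -S_rot -!N_sq.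
 move: (N_ge0 0 (rot e0 (tgr i u))) (N_ge0 0 (rot e1 (tgr i u))) (N_ge0 0 (rot e2 (tgr i u))).
 move: (N _ _) (N _ _) (N _ _) => a b c a0 b0 c0.
 have := mulr_ge0 a0 b0; have := mulr_ge0 a0 c0; have := mulr_ge0 b0 c0.
 rewrite -[_ <= _ ^+ 2]subr_ge0.
 have -> : (c + b + a) ^+ 2 - (c ^+ 2 + b ^+ 2 + a ^+ 2) = 2 * (b * a + c * a + c * b) by ring.
 by lra.
by apply: (le_trans (lerD (lerD (h0 u) (h1 u)) (h2 u))); rewrite !mulrDl.
Qed.

Lemma is_wder_pev i u : is_wder i (pev u) (pev (tgr i u)).
split; first exact: L2_pev.
move=> phi hphi.
(* Integration by parts is applied to the product of [u] with the test function. *)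
have C1u : C1 (@mev R P u * phi).
 have [du cu] := mev_C1 u; have [dp cp] := hphi; split.
  by move=> y; apply: differentiableM.
 move=> j.
 rewrite (_ : 'D_(delta_mx 0 j) (@mev R P u * phi) =
   (fun y => @mev R P u y * 'D_(delta_mx 0 j) phi y + @mev R P (mD j u) y * phi y)).
  have cphi : continuous phi by move=> y; exact: differentiable_continuous.
  have c1 : continuous (fun y => @mev R P u y * 'D_(delta_mx 0 j) phi y).
   by move=> y; apply: continuousM; [exact: mev_continuous|exact: cp].
  have c2 : continuous (fun y => @mev R P (mD j u) y * phi y).
   by move=> y; apply: continuousM; [exact: mev_continuous|exact: cphi].
  by move=> y; exact: (continuousD (c1 y) (c2 y)).
 apply/funext => y; rewrite deriveM; [|exact: diff_derivable|exact: diff_derivable].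
 by rewrite mev_D [_ *: @mev R P _ y]mulrC.
have bphi : bmeas (fun x : S2 R => phi x) := bmeas_continuous_S2 (C1_continuous hphi).
have btp := bmeas_tder i hphi.
have e x : tder i (@mev R P u * phi) x = pev u x * tder i phi x + pev (tgr i u) x * phi x.
 have [du cu] := mev_C1 u; have [dp cp] := hphi.
 have hd j : 'D_(delta_mx 0 j) (@mev R P u * phi) x = mev u x * 'D_(delta_mx 0 j) phi x
   + phi x * 'D_(delta_mx 0 j) (@mev R P u) x.
  by rewrite deriveM//; exact: diff_derivable.
 rewrite -tder_mev /tder !hd; under eq_bigr do rewrite hd.
 rewrite (_ : \sum_j _ = mev u x * (\sum_j s2coord j x * 'D_(delta_mx 0 j) phi x) +
  phi x * (\sum_j s2coord j x * 'D_(delta_mx 0 j) (@mev R P u) x)).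
  by rewrite -[pev u x]/(mev u x); ring.
 by rewrite !mulr_sumr -big_split/=; apply: eq_bigr => j _; ring.
have := integral_tder C1u i.
under eq_Rintegral do rewrite e.
have iM (b c : S2 R -> R) : bmeas b -> bmeas c ->
 area.-integrable setT (EFin \o (fun x => b x * c x)).
 by move=> hb hc; apply: bmeas_integrable; exact: bmeasM.
rewrite RintegralD//; [|exact: iM (bmeas_pev _) btp|exact: iM (bmeas_pev _) bphi].
rewrite (_ : \int[area]_x (s2coord i x * (mev u * phi) x) =
 \int[area]_x (s2coord i x * pev u x * phi x)); first by move=> <-; rewrite addrK.
by apply: eq_Rintegral => x; rewrite -mulrA.
Qed.

Lemma le_eps (a K : R) : 0 <= K -> (forall e : R, 0 < e -> a <= e * K) -> a <= 0.
move=> K0 h; apply/ler_addgt0Pr => e e0; rewrite add0r.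
have K1 : 0 < K + 1 by rewrite ltr_wpDl.
apply: (le_trans (h (e / (K + 1)) (divr_gt0 e0 K1))).
by rewrite mulrAC ler_pdivrMr// ler_wpM2l ?(ltW e0)// lerDl.
Qed.

Lemma l2lim_ip p f g : l2lim p f -> L2 g -> forall e : R, 0 < e -> exists n0, forall n,
 (n0 <= n)%N -> `|l2ip f g - l2ip (pev (p n)) g| <= e * l2norm g.
move=> [hf hp] hg e e0; have [n0 h] := hp e e0; exists n0 => n hn.
rewrite -l2ipBl//; last exact: L2_pev.
apply: (le_trans (l2ip_le (L2B hf (L2_pev _)) hg)).
by rewrite ler_wpM2r ?l2norm_ge0// h.
Qed.

Lemma is_wder_lim i p f g : l2lim p f -> l2lim (fun n => tgr i (p n)) g -> is_wder i f g.
move=> hf hg; split; first exact: hg.1.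
move=> phi hphi.
have bphi : bmeas (fun x : S2 R => phi x) := bmeas_continuous_S2 (C1_continuous hphi).
have Lt := L2_bmeas (bmeas_tder i hphi).
have Lp := L2_bmeas bphi.
have Lxp := L2_bmeas (bmeasM (bmeas_s2coord R i) bphi).
have e2 h : \int[area]_x (s2coord i x * h x * phi x) = l2ip h (fun x => s2coord i x * phi x).
 by apply: eq_Rintegral => x _; ring.
rewrite e2 -/(l2ip f (tder i phi)) -/(l2ip g (fun x => phi x)).
set A := l2ip f _; set B := l2ip f _; set C := l2ip g _.
apply/eqP; rewrite -subr_eq0 -normr_le0.
pose K := l2norm (tder i phi) + 2 * l2norm (fun x : S2 R => s2coord i x * phi x) +
  l2norm (fun x : S2 R => phi x).
apply: (@le_eps _ K); first by rewrite !addr_ge0 ?mulr_ge0 ?l2norm_ge0.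
move=> e e0.
have [n1 h1] := l2lim_ip hf Lt e0; have [n2 h2] := l2lim_ip hf Lxp e0.
have [n3 h3] := l2lim_ip hg Lp e0.
pose n := maxn n1 (maxn n2 n3).
have {}h1 := h1 n (leq_maxl _ _).
have {}h2 := h2 n (leq_trans (leq_maxl _ _) (leq_maxr _ _)).
have {}h3 := h3 n (leq_trans (leq_maxr _ _) (leq_maxr _ _)).
have [_ /(_ phi hphi)] := is_wder_pev i (p n).
rewrite e2 -/(l2ip (pev (p n)) (tder i phi)) -/(l2ip (pev (tgr i (p n))) (fun x => phi x)).
move: h1 h2 h3; rewrite -/A -/B -/C /K.
move: (l2ip (pev _) _) (l2ip (pev _) _) (l2ip (pev _) _) (l2norm _) (l2norm _) (l2norm _).
move=> a b c u v w; rewrite !ler_norml !mulrDr => /andP[? ?] /andP[? ?] /andP[? ?] ?.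
by lra.
Qed.

Lemma is_wder_uniq i f g h : is_wder i f g -> is_wder i f h -> g = h %[ae area].
move=> [hg Hg] [hh Hh].
have := @polynomials_dense R (g - h) (L2B hg hh).
have e u : l2ip (g - h) (pev u) = 0.
 rewrite l2ipBl//; last exact: L2_pev.
 have := Hg _ (mev_C1 u); have := Hh _ (mev_C1 u).
 rewrite -/(l2ip g (pev u)) -/(l2ip h (pev u)); lra.
move=> /(_ e); apply: filterS => x hx _.
by apply/eqP; rewrite -subr_eq0; apply/eqP; exact: (hx Logic.I).
Qed.

(** [wder] picks some weak derivative, so it agrees with a given one only almost everywhere. *)
Lemma wderP i f g : is_wder i f g -> is_wder i f (wder i f) /\ wder i f = g %[ae area].
move=> hg; rewrite /Defs.wder; case: xgetP => [h _ hh|/(_ g)//].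
by split => //; exact: is_wder_uniq hg.
Qed.

Lemma l2lim_ae p f g : l2lim p f -> L2 g -> f = g %[ae area] -> l2lim p g.
move=> [hf hp] hg fg; split => // e e0; have [n0 h] := hp e e0; exists n0 => n /h.
apply: le_trans.
have -> : g - pev (p n) = (g - f) + (f - pev (p n)) by rewrite addrA subrK.
apply: (le_trans (l2normD (L2B hg hf) (L2B hf (L2_pev _)))).
rewrite (ae_l2norm0 hg hf) ?add0r//.
by apply: filterS fg => x hx; rewrite hx.
Qed.

Lemma l2lim_uniq p f g : l2lim p f -> l2lim p g -> f = g %[ae area].
move=> [hf hp] [hg hq].
have hfg := L2B hf hg.
have : l2norm (f - g) <= 0.
 apply: (@le_eps _ 2) => // e e0.
 have [n1 h1] := hp e e0; have [n2 h2] := hq e e0.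
 have -> : f - g = (f - pev (p (maxn n1 n2))) - (g - pev (p (maxn n1 n2))).
  by rewrite opprB addrA subrK.
 apply: (le_trans (l2normB (L2B hf (L2_pev _)) (L2B hg (L2_pev _)))).
 have := h1 _ (leq_maxl n1 n2); have := h2 _ (leq_maxr n1 n2).
 by lra.
move=> h; have h0 : l2norm (f - g) = 0 by apply/eqP; rewrite eq_le h l2norm_ge0.
have := l2norm_eq0 hfg h0; apply: filterS => x hx _.
by apply/eqP; rewrite -subr_eq0; apply/eqP; exact: (hx Logic.I).
Qed.

Lemma l2lim_ext p q f : (forall n, pev (p n) = pev (q n)) -> l2lim p f -> l2lim q f.
by move=> h [hf hp]; split => // e e0; have [n0 k] := hp e e0; exists n0 => n; rewrite -h; exact: k. Qed.
Lemma l2limD p q f g : l2lim p f -> l2lim q g -> l2lim (fun n => p n + q n) (f + g).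
move=> [hf hp] [hg hq]; split; first exact: L2D.
move=> e e0; have e2 : 0 < e / 2 by rewrite divr_gt0.
have [n1 h1] := hp _ e2; have [n2 h2] := hq _ e2.
exists (maxn n1 n2) => n; rewrite geq_max => /andP[k1 k2].
have -> : f + g - pev (p n + q n) = (f - pev (p n)) + (g - pev (q n)).
 by rewrite -pevDf opprD addrACA.
apply: (le_trans (l2normD (L2B hf (L2_pev _)) (L2B hg (L2_pev _)))).
by have := h1 n k1; have := h2 n k2; lra.
Qed.

Lemma l2limZ a p f : l2lim p f -> l2lim (fun n => a *: p n) (a *: f).
move=> [hf hp]; split; first exact: L2Z.
move=> e e0; have a1 : 0 < `|a| + 1 by [].
have [n0 h] := hp (e / (`|a| + 1)) (divr_gt0 e0 a1).
exists n0 => n hn; rewrite -pevZf -scalerBr l2normZ; last exact: L2B (L2_pev _).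
apply: (le_trans (ler_wpM2l (normr_ge0 a) (h n hn))).
by rewrite mulrA [_ * e]mulrC -mulrA ler_piMr ?(ltW e0)// ler_pdivrMr// mul1r lerDl.
Qed.

Lemma l2limN p f : l2lim p f -> l2lim (fun n => - p n) (- f).
by move=> /(l2limZ (-1)); under eq_fun do rewrite scaleN1r; rewrite scaleN1r. Qed.
Lemma l2limB p q f g : l2lim p f -> l2lim q g -> l2lim (fun n => p n - q n) (f - g).
by move=> hf /l2limN; exact: l2limD. Qed.
Lemma l2lim_norm p f a n0 : l2lim p f -> (forall n, (n0 <= n)%N -> N 0 (p n) <= a) -> l2norm f <= a.
move=> [hf hp] ha; rewrite -subr_le0; apply: (@le_eps _ 1) => // e e0; rewrite mulr1.
have [n1 h1] := hp e e0; have := h1 _ (leq_maxl n1 n0); have := ha _ (leq_maxr n1 n0).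
have := l2normD (L2B hf (L2_pev (p (maxn n1 n0)))) (L2_pev (p (maxn n1 n0))).
rewrite subrK l2norm_pev; lra.
Qed.

(** Convergence in H^2 in terms of the polynomial norms. It is the bridge between the estimates on
    polynomials and the function spaces of the statement. *)
Definition H2lim p f := [/\ forall n, zm (p n), hcauchy p & l2lim p f].

Lemma n0cauchy_le (K : R) (p q : nat -> P) : 0 <= K -> hcauchy p ->
 (forall n m, N 0 (q n - q m) <= K * N 2 (p n - p m)) -> n0cauchy q.
move=> K0 hp h e e0; have K1 : 0 < K + 1 by rewrite ltr_wpDl.
have [n0 hn] := hp (e / (K + 1)) (divr_gt0 e0 K1); exists n0 => n m kn km.
apply: (le_trans (h n m)); apply: (le_trans (ler_wpM2l K0 (hn n m kn km))).
by rewrite mulrA [_ * e]mulrC -mulrA ler_piMr ?(ltW e0)// ler_pdivrMr// mul1r lerDl.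
Qed.

Lemma H2lim_exists p : (forall n, zm (p n)) -> hcauchy p -> exists f, H2lim p f.
move=> zp hp; have [|f hf] := @riesz_fischer R p.
 apply: (n0cauchy_le (@ler01 R) hp) => n m; rewrite mul1r.
 by apply: N_zm_le => //; exact: zmB.
by exists f.
Qed.

Lemma N_tgr_zm i u : zm u -> N 0 (tgr i u) <= N 2 u.
by move=> zu; apply: (le_trans (N_tgr_le i u)); exact: N_zm_le. Qed.
Lemma N_tgr2 : exists K, 0 <= K /\ forall i j u, zm u -> N 0 (tgr j (tgr i u)) <= K * N 2 u.
have key i : exists K, 0 <= K /\ forall j u, zm u -> N 0 (tgr j (tgr i u)) <= K * N 2 u.
 have [K [K0 h]] := N1_tgr i; exists (2 * K); split; first nneg.
 move=> j u zu; apply: (le_trans (N_tgr_le j _)); apply: (le_trans (h u)).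
 rewrite -mulrA mulrCA ler_wpM2l//; have := N_zm_le zu (isT : (1 <= 2)%N).
 by move: (N 2 u) => *; lra.
have [K0 [K00 h0]] := key e0; have [K1 [K10 h1]] := key e1; have [K2 [K20 h2]] := key e2.
exists (K0 + K1 + K2); split; first by rewrite !addr_ge0.
move=> i j u zu; have n2 := N_ge0 2 u.
have g0 := mulr_ge0 K00 n2; have g1 := mulr_ge0 K10 n2; have g2 := mulr_ge0 K20 n2.
have := h0 j u zu; have := h1 j u zu; have := h2 j u zu; rewrite !mulrDl.
by elim/ord3: i => *; lra.
Qed.

Lemma tgrB i u v : tgr i (u - v) = tgr i u - tgr i v.
by rewrite linearB. Qed.
Lemma H2lim_wder p f : H2lim p f -> forall i,
 [/\ is_wder i f (wder i f), l2lim (fun n => tgr i (p n)) (wder i f) &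
  forall j, is_wder j (wder i f) (wder j (wder i f)) /\
   l2lim (fun n => tgr j (tgr i (p n))) (wder j (wder i f))].
move=> [zp hp lf] i.
have [|g hg] := @riesz_fischer R (fun n => tgr i (p n)).
 apply: (n0cauchy_le (@ler01 R) hp) => n m; rewrite mul1r -tgrB.
 by apply: N_tgr_zm; exact: zmB.
have [h1 h2] := wderP (is_wder_lim lf hg).
have l1 : l2lim (fun n => tgr i (p n)) (wder i f).
 by apply: (l2lim_ae hg h1.1); apply: filterS h2 => x hx; rewrite hx.
split; [exact: h1|exact: l1|move=> j].
have [|g' hg'] := @riesz_fischer R (fun n => tgr j (tgr i (p n))).
 have [K [K0 hK]] := N_tgr2.
 apply: (n0cauchy_le K0 hp) => n m; rewrite -!tgrB.
 by apply: hK; exact: zmB.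
have [k1 k2] := wderP (is_wder_lim l1 hg'); split => //.
by apply: (l2lim_ae hg' k1.1); apply: filterS k2 => x hx; rewrite hx.
Qed.

Lemma H2lim_H2 p f : H2lim p f -> H2 f.
move=> hf; have hw := H2lim_wder hf; have [zp _ lf] := hf.
split; last first.
 rewrite /zero_mean.
 have L1 := L2_bmeas (@bmeas_cst _ (S2 R) R 1).
 have -> : \int[area]_x f x = l2ip f (fun=> 1) by apply: eq_Rintegral => x; rewrite mulr1.
 apply/eqP; rewrite -normr_le0; apply: (@le_eps _ (l2norm (fun=> 1))); first exact: l2norm_ge0.
 move=> e e0; have [n0 h] := l2lim_ip lf L1 e0.
 have := h n0 (leqnn _).
 have -> : l2ip (pev (p n0)) (fun=> 1) = 0.
  by rewrite -(zp n0); apply: eq_Rintegral => x; rewrite mulr1.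
 by rewrite subr0.
split.
 by split; [exact: lf.1|move=> i; have [h] := hw i; exists (wder i f)].
move=> i; have [h1 _ h2] := hw i; split; first exact: h1.1.
by move=> j; exists (wder j (wder i f)); exact: (h2 j).1.
Qed.

Lemma H2lim_lap p f : H2lim p f -> l2lim (fun n => lapp (p n)) (lap f).
move=> hf; have hw i : l2lim (fun n => tgr i (tgr i (p n))) (wder i (wder i f)).
 by have [_ _ /(_ i)[_]] := H2lim_wder hf i.
rewrite /lap sum3; apply: (@l2lim_ext (fun n => tgr e0 (tgr e0 (p n)) + tgr e1 (tgr e1 (p n))
 + tgr e2 (tgr e2 (p n)))); first by move=> n; exact: sum_tgr_tgr.
by apply: l2limD => //; exact: l2limD.
Qed.

Lemma H2norm_lim : exists K, 0 <= K /\ forall p f a n0, H2lim p f ->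
 (forall n, (n0 <= n)%N -> N 2 (p n) <= a) -> H2norm f <= K * a.
have [K [K0 hK]] := N_tgr2; pose C := 1 + K.
have C0 : 0 <= C by rewrite addr_ge0.
have C1 : 1 <= C by rewrite lerDl.
exists (4 * C); split; first by nneg.
move=> p f a n0 hf ha; have [zp _ lf] := hf; have hw := H2lim_wder hf.
have a0 : 0 <= a by apply: le_trans (ha n0 (leqnn _)).
have b0 : l2norm f ^+ 2 <= (C * a) ^+ 2.
 rewrite lerXn2r ?nnegrE ?l2norm_ge0 ?mulr_ge0//; apply: (l2lim_norm (n0 := n0) lf) => n hn.
 apply: (@le_trans _ _ (N 2 (p n))); first exact: N_zm_le.
 by apply: (le_trans (ha n hn)); rewrite ler_peMl.
have b1 i : l2norm (wder i f) ^+ 2 <= (C * a) ^+ 2.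
 rewrite lerXn2r ?nnegrE ?l2norm_ge0 ?mulr_ge0//; have [_ h _] := hw i.
 apply: (l2lim_norm (n0 := n0) h) => n hn; apply: (le_trans (N_tgr_zm i (zp n))).
 by apply: (le_trans (ha n hn)); rewrite ler_peMl.
have b2 i j : l2norm (wder j (wder i f)) ^+ 2 <= (C * a) ^+ 2.
 rewrite lerXn2r ?nnegrE ?l2norm_ge0 ?mulr_ge0//; have [_ _ /(_ j)[_ h]] := hw i.
 apply: (l2lim_norm (n0 := n0) h) => n hn; apply: (le_trans (hK i j _ (zp n))).
 by apply: ler_pM => //; [rewrite lerDr|exact: ha].
have -> : 4 * C * a = Num.sqrt ((4 * (C * a)) ^+ 2).
 by rewrite sqrtr_sqr ger0_norm ?mulrA// !mulr_ge0.
apply: ler_wsqrtr.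
have s1 : \sum_(i < 3) l2norm (wder i f) ^+ 2 <= \sum_(i < 3) (C * a) ^+ 2 by apply: ler_sum.
have s2 : \sum_(i < 3) \sum_(j < 3) l2norm (wder j (wder i f)) ^+ 2 <=
  \sum_(i < 3) \sum_(j < 3) (C * a) ^+ 2.
 by apply: ler_sum => i _; apply: ler_sum.
apply: (le_trans (lerD (lerD b0 s1) s2)).
rewrite !sumr_const !card_ord (_ : (4 * (C * a)) ^+ 2 = 16 * (C * a) ^+ 2); last by ring.
by have := sqr_ge0 (C * a); lra.
Qed.

Lemma hcauchyB p q : hcauchy p -> hcauchy q -> hcauchy (fun n => p n - q n).
move=> hp hq e e0; have e2 : 0 < e / 2 by rewrite divr_gt0.
have [n1 h1] := hp _ e2; have [n2 h2] := hq _ e2; exists (maxn n1 n2) => n m.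
rewrite !geq_max => /andP[k1 k2] /andP[l1 l2].
have -> : p n - q n - (p m - q m) = (p n - p m) - (q n - q m) by ring.
apply: (le_trans (NB _ _ _)); have := h1 n m k1 l1; have := h2 n m k2 l2.
by lra.
Qed.

Lemma H2limB p q f g : H2lim p f -> H2lim q g -> H2lim (fun n => p n - q n) (f - g).
move=> [zp hp lp] [zq hq lq]; split; first by move=> n; exact: zmB.
 exact: hcauchyB.
exact: l2limB.
Qed.

Lemma H2lim_cst u : zm u -> H2lim (fun=> u) (pev u).
move=> zu; split => //; last exact: l2lim_cst.
by exists 0%N => m; rewrite subrr N0 ltW.
Qed.

End weak_derivatives.

(** * Expansion of H^2 functions and the limit of the Euler term *)

Section sobolev_functions.
Context (R : realType).
Notation P := (pol R).
Notation area := (@area R).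
Notation Y := (@Y R).
Notation lam := (@lam R).
Implicit Types (f g h : S2 R -> R) (p q : nat -> P) (u v w : P).

Definition fcf f k : R := l2ip f (pev (Y k)).
Definition fproj f n : P := \sum_(k < n) fcf f k *: Y k.

Lemma fcf_nY f k : fcf f k * nY R k = fcf f k.
have [h|->] := nY01 R k; last by rewrite mulr1.
by rewrite h mulr0 /fcf l2ipC (ip_eq0 h); exact: (esym (l2ip0l f)).
Qed.

Lemma cf_fproj f n k : cf (fproj f n) k = if (k < n)%N then fcf f k else 0.
by rewrite (cf_sum n (fcf f)) fcf_nY. Qed.
Lemma l2ip_fproj f n u : L2 f -> inV n u -> l2ip f (pev u) = ip (fproj f n) u.
move=> hf hu; rewrite ipC (ip_parseval _ hu) hu /proj.
rewrite (_ : pev (\sum_(k < n) cf u k *: Y k) = \sum_(k < n) cf u k *: pev (Y k)); last first.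
 elim/big_rec2 : _ => [|k a b _ <-]; first by apply/funext => x; exact: pev0.
 by rewrite pevZf pevDf.
rewrite l2ipC l2ip_suml//; last by move=> k; rewrite pevZf; exact: L2_pev.
apply: eq_bigr => k _; rewrite l2ipZl//; last exact: L2_pev.
by rewrite cf_fproj ltn_ord l2ipC.
Qed.

Lemma inV_fproj f n : inV n (fproj f n).
by apply: (@inV_sum _ n n (fun k => fcf f k *: Y k)) => k kn; apply: inVZ; exact: inV_Y. Qed.
Lemma bessel f n : L2 f -> \sum_(k < n) fcf f k ^+ 2 <= l2norm f ^+ 2.
move=> hf; pose u := fproj f n.
have hu := inV_fproj f n.
have e1 : l2ip f (pev u) = \sum_(k < n) fcf f k ^+ 2.
 rewrite (l2ip_fproj hf hu) (ip_parseval _ hu); apply: eq_bigr => k _.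
 by rewrite cf_fproj ltn_ord.
have e2 : l2ip (pev u) (pev u) = \sum_(k < n) fcf f k ^+ 2.
 by rewrite -e1 l2ip_pev (l2ip_fproj hf hu).
have := l2ip_ge0 (f - pev u); have lu := L2_pev u; have lfu := L2B hf lu.
rewrite l2ipBl// !l2ipBr// (l2ipC (pev u) f) e1 e2 l2norm_sq.
by lra.
Qed.

Lemma N0_fprojB f n m : (n <= m)%N ->
 N 0 (fproj f m - fproj f n) ^+ 2 = \sum_(n <= k < m) fcf f k ^+ 2.
move=> nm; rewrite N_sq.
have h : inV m (fproj f m - fproj f n).
 rewrite -scaleN1r addrC; apply: inV_lin; [exact: inV_le (inV_fproj f n)|exact: inV_fproj].
rewrite (S_sum _ h) -(big_mkord xpredT (fun k => lam k ^+ 0 * _ k ^+ 2)).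
rewrite (big_cat_nat (n := n))//= big_nat big1 ?add0r.
 apply: eq_big_nat => k /andP[nk km]; rewrite mul1r cfB !cf_fproj km.
 by rewrite ltnNge nk subr0.
move=> k /andP[_ kn]; rewrite cfB !cf_fproj kn (leq_trans kn nm) subrr expr2 !mulr0.
by [].
Qed.

Lemma mono_bounded_cauchy (s : nat -> R) M : (forall n m, (n <= m)%N -> s n <= s m) ->
 (forall n, s n <= M) -> forall e : R, 0 < e -> exists n0, forall n m,
 (n0 <= n)%N -> (n <= m)%N -> s m - s n <= e.
move=> mono bound e e0.
have hs : has_sup (range s) by split; [exists (s 0%N), 0%N|exists M => _ [n _ <-]].
have [_ [n0 _ <-] h] := sup_adherent e0 hs.
exists n0 => n m hn nm.
have h1 : s m <= sup (range s) by apply: sup_upper_bound => //.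
have := mono _ _ hn; lra.
Qed.

Lemma fproj_cauchy f : L2 f -> n0cauchy (fproj f).
move=> hf e e0; have e2 : 0 < e ^+ 2 by nneg.
have mono n m : (n <= m)%N -> \sum_(0 <= k < n) fcf f k ^+ 2 <= \sum_(0 <= k < m) fcf f k ^+ 2.
 move=> nm; rewrite [leRHS](big_cat_nat (n := n))// lerDl sumr_ge0// => k _.
 exact: sqr_ge0.
have bound n : \sum_(0 <= k < n) fcf f k ^+ 2 <= l2norm f ^+ 2.
 by rewrite big_mkord; exact: bessel.
have [n0 h] := mono_bounded_cauchy mono bound e2.
suff key n m : (n0 <= n)%N -> (n <= m)%N -> N 0 (fproj f m - fproj f n) <= e.
 exists n0 => n m hn hm; have [nm|/ltnW nm] := leqP n m; last exact: key.
 by rewrite NBC; exact: key.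
move=> hn nm; apply: sqr_le_norm; first nneg.
rewrite N0_fprojB//; apply: le_trans (h n m hn nm).
by rewrite [X in _ <= X - _](big_cat_nat (n := n))//= addrC addrK.
Qed.

Lemma l2lim_fcf p f k : l2lim p f -> forall e : R, 0 < e -> exists n0, forall n, (n0 <= n)%N ->
 `|fcf f k - cf (p n) k| <= e.
move=> hf e e0; have l1 : 0 < l2norm (pev (Y k)) + 1 by rewrite ltr_wpDl// l2norm_ge0.
have [n0 h] := l2lim_ip hf (L2_pev (Y k)) (divr_gt0 e0 l1).
exists n0 => n /h; rewrite l2ip_pev => /le_trans; apply.
by rewrite mulrAC ler_pdivrMr// ler_wpM2l ?(ltW e0)// lerDl.
Qed.

Lemma fcf_eq_ae f g : L2 f -> L2 g -> (forall k, fcf f k = fcf g k) -> f = g %[ae area].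
move=> hf hg h.
have key u : l2ip (f - g) (pev u) = 0.
 have [n hu] := inV_exists u.
 rewrite l2ipBl//; last exact: L2_pev.
 rewrite (l2ip_fproj hf hu) (l2ip_fproj hg hu) (_ : fproj f n = fproj g n) ?subrr//.
 by apply: eq_bigr => k; rewrite h.
have := polynomials_dense (L2B hf hg) key; apply: filterS => x hx _.
by apply/eqP; rewrite -subr_eq0; apply/eqP; exact: (hx Logic.I).
Qed.

(** The partial sums are Cauchy by Bessel's inequality; their limit has the coefficients of [f],
    hence equals [f] by density of the polynomials. *)
Lemma fproj_lim f : L2 f -> l2lim (fproj f) f.
move=> hf; have [g hg] := riesz_fischer (fproj_cauchy hf).
apply: (l2lim_ae hg hf); apply: fcf_eq_ae => //; first exact: hg.1.
move=> k; apply/eqP; rewrite -subr_eq0 -normr_le0; apply: (@le_eps _ _ 1) => // e e0.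
rewrite mulr1; have [n0 h] := l2lim_fcf k hg e0.
have := h (maxn n0 k.+1) (leq_maxl _ _).
by rewrite cf_fproj leq_maxr.
Qed.

Lemma is_wder_pair i f g u : L2 f -> is_wder i f g ->
 l2ip g (pev u) = l2ip f (pev (tadj i u)).
move=> hf [hg /(_ _ (mev_C1 u)) h].
move: h; rewrite -/(l2ip g (pev u)).
have -> : \int[area]_x (f x * tder i (@mev R P u) x) = l2ip f (pev (tgr i u)).
 by apply: eq_Rintegral => x; rewrite tder_mev.
have -> : \int[area]_x (s2coord i x * f x * mev u x) = l2ip f (pev (px R i * u)).
 by apply: eq_Rintegral => x _; rewrite pevM pev_px -[mev u x]/(pev u x); ring.
move=> h; rewrite -pevBf -pevZf.
have La := L2_pev (px R i * u); have Lb := L2_pev (tgr i u).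
rewrite (l2ipBr (L2Z 2 La) Lb hf) (l2ipZr 2 La hf) h.
by move: l2ip l2ip => a b; lra.
Qed.

Lemma H2_lap_pair f u : H2 f -> L2 (lap f) /\ l2ip (lap f) (pev u) = l2ip f (pev (lapp u)).
move=> [[[hf h1] h2] _].
have w1 i : is_wder i f (wder i f) by have [g hg] := h1 i; exact: (wderP hg).1.
have w2 i : is_wder i (wder i f) (wder i (wder i f)).
 by have [_ /(_ i)[g hg]] := h2 i; exact: (wderP hg).1.
have L i : L2 (wder i (wder i f)) := (w2 i).1.
split; first exact: L2_sum.
rewrite l2ip_suml//; last exact: L2_pev.
have pr i : l2ip (wder i (wder i f)) (pev u) = l2ip f (pev (tadj i (tadj i u))).
 by rewrite (is_wder_pair _ (w1 i).1 (w2 i)) (is_wder_pair _ hf (w1 i)).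
rewrite (eq_bigr _ (fun i _ => pr i)) sum3 -(sum_tadj_tadj u).
have ip3 a b c : l2ip f (pev (a + b + c)) = l2ip f (pev a) + l2ip f (pev b) + l2ip f (pev c).
 have Lab := L2_pev (a + b).
 by rewrite -pevDf (l2ipDr Lab (L2_pev c) hf) -pevDf (l2ipDr (L2_pev a) (L2_pev b) hf).
by [].
Qed.

(** The coefficients of [lap f] are those of [f] times [- lam k], so Bessel's inequality for [lap f]
    makes the partial sums Cauchy in [N 2]. *)
Lemma H2_fproj f : H2 f -> H2lim (fproj f) f.
move=> hf; have hL2 : L2 f by case: hf => -[[]].
have fc k : fcf (lap f) k = - lam k * fcf f k.
 have [hl] := H2_lap_pair (Y k) hf; rewrite /fcf => ->.
 by rewrite lapp_Y -pevZf l2ipZr//; exact: L2_pev.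
have hl : L2 (lap f) by have [] := H2_lap_pair 0 hf.
split; last exact: fproj_lim.
- move=> n; apply: (zm_cf0 _).2; rewrite cf_fproj; case: ifP => // _.
 have [c hc] := @pev_Y0 R point; rewrite /fcf hc -pevZf l2ipZr//; last exact: L2_pev.
 have -> : l2ip f (pev (1 : P)) = 0.
  case: hf => _ <-; apply: eq_Rintegral => x; by rewrite pev1 mulr1.
 by rewrite mulr0.
- move=> e e0; have [n0 h] := fproj_cauchy hl e0; exists n0 => n m hn hm.
 apply: le_trans (h n m hn hm).
 rewrite le_eqVlt; apply/orP; left; apply/eqP; rewrite -(N_lapp 0); apply: N_ext.
 apply: cf_inj; apply/funext => k; rewrite cf_lapp !cfB !cf_fproj fc.
 by case: ifP => _; case: ifP => _; rewrite ?(subrr,subr0,sub0r,mulr0,oppr0,mulrN).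
Qed.

(** As [invlap] is a choice, uniqueness of the stream function is proved along with its existence: a
    zero-mean function of H^2 with null Laplacian vanishes. *)
Lemma invlap_lim p f : H2lim p f -> H2lim (fun n => invl (p n)) (invlap f).
move=> hf; have [zp hp lf] := hf.
have hi : hcauchy (fun n => invl (p n)).
 move=> e e0; have [n0 h] := hp e e0; exists n0 => n m hn hm; apply: le_trans (h n m hn hm).
 rewrite -(N_ext 2 (invlB (p n) (p m))) N_invl; last exact: zmB.
 by apply: N_zm_le => //; exact: zmB.
have [psi0 h0] := H2lim_exists (fun n => zm_invl (p n)) hi.
have lap0 : lap psi0 = f %[ae area].
 apply: (l2lim_uniq (H2lim_lap h0)); apply: l2lim_ext lf => n.
 by rewrite lapp_invl.
rewrite /invlap; case: xgetP => [psi _ [hpsi lpsi]|/(_ psi0)[]]; last first.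
 by split => //; exact: H2lim_H2 h0.
have h1 := H2_fproj hpsi; have h2 := H2limB h1 h0.
have Lpsi : L2 psi by case: h1 => _ _ [].
have Lpsi0 : L2 psi0 by case: h0 => _ _ [].
split=> //; first by move=> n; exact: zm_invl.
apply: (@l2lim_ae _ _ psi0) => //; first by case: h0.
have hl := H2lim_lap h2.
have z : lap (psi - psi0) = 0 %[ae area].
 have Ll := (H2lim_lap h1).1; have Ll0 := (H2lim_lap h0).1.
 have hB := l2limB (H2lim_lap h1) (H2lim_lap h0).
 have hB' : l2lim (fun n => lapp (fproj psi n - invl (p n))) (lap psi - lap psi0).
  apply: l2lim_ext hB => n; apply: cf_inj; apply/funext => k.
  by rewrite cfB !cf_lapp cfB; ring.
 have u := l2lim_uniq hl hB'.
 move: lpsi lap0 u; apply: filterS3 => x h3 h4 h5 _.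
 rewrite (h5 Logic.I) -[LHS]/(lap psi x - lap psi0 x) (h3 Logic.I) (h4 Logic.I).
 by rewrite subrr.
have n0 : l2norm (psi - psi0) <= 0.
 apply: (@le_eps _ _ 1) => // e e0; rewrite mulr1.
 have l0 : l2lim (fun n => lapp (fproj psi n - invl (p n))) 0.
  apply: (l2lim_ae hl); first exact: L2_0.
  by apply: filterS z => x hx _; rewrite hx.
 have [m hm] := l0.2 e e0; have [zz _ l2] := h2.
 apply: (l2lim_norm (n0 := m) l2) => n hn.
 apply: (le_trans (N_zm_le (zz n) (isT : (0 <= 2)%N))).
 have := hm n hn; rewrite -(N_lapp 0) -l2norm_pev l2normBC; last 2 first.
  exact: L2_0.
  exact: L2_pev.
 by rewrite subr0.
have e0 : l2norm (psi - psi0) = 0 by apply/eqP; rewrite eq_le n0 l2norm_ge0.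
have := l2norm_eq0 (L2B Lpsi Lpsi0) e0; apply: filterS => x hx _.
by apply/esym/eqP; rewrite -subr_eq0; apply/eqP; exact: (hx Logic.I).
Qed.

Lemma det3 (A : 'M[R]_3) : \det A =
 A e0 e0 * (A e1 e1 * A e2 e2 - A e1 e2 * A e2 e1)
 + A e0 e1 * (A e1 e2 * A e2 e0 - A e1 e0 * A e2 e2)
 + A e0 e2 * (A e1 e0 * A e2 e1 - A e1 e1 * A e2 e0).
rewrite (expand_det_row _ e0) sum3 /cofactor.
have d2 (B : 'M[R]_2) : \det B = B 0 0 * B 1 1 - B 0 1 * B 1 0.
 have l0 : lift (ord0 : 'I_2) ord0 = 1 by exact: val_inj.
 have l1 : lift (1 : 'I_2) ord0 = 0 by exact: val_inj.
 rewrite (expand_det_row _ ord0) 2!big_ord_recl big_ord0 addr0 /cofactor 2!det_mx11 !mxE l0 l1.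
 by rewrite mul1r mulN1r mulrN.
rewrite !d2 !mxE /=.
have l00 : lift e0 0 = e1 by exact: val_inj.
have l01 : lift e0 1 = e2 by exact: val_inj.
have l10 : lift e1 0 = e0 by exact: val_inj.
have l11 : lift e1 1 = e2 by exact: val_inj.
have l20 : lift e2 0 = e0 by exact: val_inj.
have l21 : lift e2 1 = e1 by exact: val_inj.
rewrite l00 l01 l10 l11 l20 l21 expr0 expr1 expr2.
by ring.
Qed.

Definition cross3 (x : S2 R) (a b : 'I_3 -> R) : R :=
 - (s2coord e0 x * (a e1 * b e2 - a e2 * b e1)
  + s2coord e1 x * (a e2 * b e0 - a e0 * b e2)
  + s2coord e2 x * (a e0 * b e1 - a e1 * b e0)).

Lemma poissonE f g x : poisson f g x = cross3 x (fun i => wder i f x) (fun i => wder i g x).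
rewrite /poisson det3 !mxE /s2coord; congr (- _).
Qed.

Lemma poissonC f g : poisson g f = - poisson f g.
apply/funext => x; rewrite -[RHS]/(- poisson f g x) !poissonE /cross3 opprK.
move: (wder e0 f x) (wder e1 f x) (wder e2 f x) (wder e0 g x) (wder e1 g x) (wder e2 g x).
by move: (s2coord e2 x) => *; ring.
Qed.

Lemma bk_tgr u v x : pev (bk u v) x = cross3 x (fun i => pev (tgr i u) x) (fun i => pev (tgr i v) x).
have tg i w : pev (tgr i w) x = pev (mD i w) x - s2coord i x * pev (eul w) x.
 by rewrite pevB pevM pev_px.
have gen (x0 x1 x2 a0 a1 a2 b0 b1 b2 : P) : pev (- (x0 * (a1 * b2 - a2 * b1) +
  x1 * (a2 * b0 - a0 * b2) + x2 * (a0 * b1 - a1 * b0))) x =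
  - (pev x0 x * (pev a1 x * pev b2 x - pev a2 x * pev b1 x) +
  pev x1 x * (pev a2 x * pev b0 x - pev a0 x * pev b2 x) +
  pev x2 x * (pev a0 x * pev b1 x - pev a1 x * pev b0 x)).
 by rewrite pevN !pevD !pevM !pevB !pevM.
rewrite /cross3 !tg bkE gen !pev_px.
by ring.
Qed.

Lemma l2lim_M (p q : nat -> P) (G f : S2 R -> R) : bmeas G ->
 (forall e : R, 0 < e -> exists n0, forall n x, (n0 <= n)%N -> `|G x - pev (p n) x| <= e) ->
 l2lim q f -> l2lim (fun n => p n * q n) (fun x => G x * f x).
move=> bG hp [hf hq]; split; first exact: L2_bM.
move=> e e0; have [M [M0 hM]] := bmeas_bound bG.
have d0 : 0 < l2norm f + M + 1 + 1 by rewrite ltr_wpDl// addr_ge0// addr_ge0 ?l2norm_ge0// ltW.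
pose d := Num.min 1 (e / (l2norm f + M + 1 + 1)).
have dp : 0 < d by rewrite lt_min ltr01 divr_gt0.
have [n1 h1] := hp d dp; have [n2 h2] := hq d dp.
exists (maxn n1 n2) => n; rewrite geq_max => /andP[k1 k2].
have bp := bmeas_pev (p n).
have mB : measurable_fun setT (fun x => G x - pev (p n) x).
 by apply: measurable_funB; [exact: bG.1|exact: bp.1].
have -> : (fun x => G x * f x) - pev (p n * q n) =
  (fun x => (G x - pev (p n) x) * f x) + (fun x => pev (p n) x * (f - pev (q n)) x).
 apply/funext => x; rewrite -[LHS]/(G x * f x - pev (p n * q n) x) pevM.
 rewrite -[RHS]/((G x - pev (p n) x) * f x + pev (p n) x * (f x - pev (q n) x)); ring.
have hfq := L2B hf (L2_pev (q n)).
have L1 : L2 (fun x => (G x - pev (p n) x) * f x).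
 by apply: L2_bM => //; split => //; exists d => x; exact: h1.
have L2' : L2 (fun x => pev (p n) x * (f - pev (q n)) x) by exact: L2_bM.
apply: (le_trans (l2normD L1 L2')).
have b1 := @l2norm_bM R (fun x => G x - pev (p n) x) d f mB (fun x => h1 n x k1) hf.
have hpM x : `|pev (p n) x| <= M + 1.
 have -> : pev (p n) x = G x - (G x - pev (p n) x) by rewrite opprB addrC subrK.
 apply: (le_trans (ler_normB _ _)); apply: lerD => //.
 by apply: (le_trans (h1 n x k1)); rewrite ge_min lexx.
have b2 := @l2norm_bM R (pev (p n)) (M + 1) _ bp.1 hpM hfq.
have b3 : (M + 1) * l2norm (f - pev (q n)) <= (M + 1) * d.
 by rewrite ler_wpM2l ?h2// addr_ge0// ltW.
have b4 : d * (l2norm f + M + 1 + 1) <= e.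
 by rewrite -ler_pdivlMr// ge_min lexx orbT.
move: b1 b2 b3 b4 dp; move: (l2norm _) (l2norm _) (l2norm _) (l2norm _) => a b c a'.
by lra.
Qed.

(** The gradients of [p n] converge uniformly, by the Sobolev embedding in [N 3], and those of [q n]
    converge in L_2, so the products converge in L_2. *)
Lemma poisson_lim p q f g : H2lim p f -> H2lim q g ->
 (forall e : R, 0 < e -> exists n0, forall n m, (n0 <= n)%N -> (n0 <= m)%N ->
  N 3 (p n - p m) <= e) ->
 l2lim (fun n => bk (p n) (q n)) (poisson f g).
move=> hf hg h3.
have c0 := csup_ge0 R.
have sup i u x : `|pev (tgr i u) x| <= csup R * N 3 u.
 rewrite -ler_sqr ?nnegrE ?mulr_ge0// real_normK ?num_real// exprMn N_sq.
 apply: le_trans (rot_sup u x).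
 have := congr1 (fun r => pev r x) (sum_tgr_sqr u).
 rewrite pevB pevM pev_r2 mul1r pevM pevB pev_r2 pev1 subrr mul0r => /eqP.
 rewrite subr_eq0 => /eqP.
 rewrite [X in X = _](pevD (tgr e0 u ^+ 2 + tgr e1 u ^+ 2) (tgr e2 u ^+ 2)).
 rewrite [X in X + _](pevD (tgr e0 u ^+ 2) (tgr e1 u ^+ 2)).
 rewrite [X in _ X](pevD (rot e0 u ^+ 2 + rot e1 u ^+ 2) (rot e2 u ^+ 2)).
 rewrite [X in _ = X + _](pevD (rot e0 u ^+ 2) (rot e1 u ^+ 2)) !pevX => <-.
 move: (sqr_ge0 (pev (tgr e0 u) x)) (sqr_ge0 (pev (tgr e1 u) x)) (sqr_ge0 (pev (tgr e2 u) x)).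
 elim/ord3: i; lra.
have uc (i : 'I_3) (e : R) : 0 < e -> exists n0, forall n m x, (n0 <= n)%N -> (n0 <= m)%N ->
  `|pev (tgr i (p n)) x - pev (tgr i (p m)) x| <= e.
 move=> e0; have c1 : 0 < csup R + 1 by rewrite ltr_wpDl.
 have [n0 h] := h3 _ (divr_gt0 e0 c1); exists n0 => n m x hn hm.
 rewrite -pevB -tgrB; apply: (le_trans (sup _ _ _)).
 apply: (le_trans (ler_wpM2l c0 (h n m hn hm))).
 by rewrite mulrA [_ * e]mulrC -mulrA ler_piMr ?(ltW e0)// ler_pdivrMr// mul1r lerDl.
pose G i x : R := lim (pev (tgr i (p n)) x @[n --> \oo]).
have Gcv i x : pev (tgr i (p n)) x @[n --> \oo] --> G i x.
 suff : cvg (pev (tgr i (p n)) x @[n --> \oo]) by [].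
 apply/cauchy_cvgP; apply/cauchy_exP => e e0 /=.
 have e2 : 0 < e / 2 by rewrite divr_gt0.
 have [n0 h] := uc i _ e2; exists (pev (tgr i (p n0)) x).
 exists n0 => // n /= hn; rewrite /ball/= (le_lt_trans (h n0 n x (leqnn _) hn))//.
 by lra.
have Gu (i : 'I_3) (e : R) : 0 < e -> exists n0, forall n x, (n0 <= n)%N -> `|G i x - pev (tgr i (p n)) x| <= e.
 move=> e0; have [n0 h] := uc i _ e0; exists n0 => n x hn.
 have hc : `|pev (tgr i (p m)) x - pev (tgr i (p n)) x| @[m --> \oo] -->
   `|G i x - pev (tgr i (p n)) x|.
  by apply: cvg_norm; apply: cvgB; [exact: Gcv|exact: cvg_cst].
 rewrite -(cvg_lim _ hc)//; apply: limr_le; first by apply/cvg_ex; eexists; exact: hc.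
 by exists n0 => // m hm; exact: h.
have bG i : bmeas (G i).
 split.
  apply: (@measurable_fun_cvg _ _ R setT (fun n => pev (tgr i (p n)))).
   by move=> n; exact: (bmeas_pev _).1.
  by [].
 have [n0 h] := Gu i 1 ltr01; have [M hM] := (bmeas_pev (tgr i (p n0))).2.
 exists (1 + M) => x; rewrite -(subrK (pev (tgr i (p n0)) x) (G i x)).
 by apply: (le_trans (ler_normD _ _)); apply: lerD; [exact: h|exact: hM].
have Gw i : G i = wder i f %[ae area].
 have [_ hw _] := H2lim_wder hf i.
 apply: (@l2lim_uniq _ (fun n => tgr i (p n))) => //; split; first exact: L2_bmeas.
 move=> e e0; pose A := l2norm (fun=> 1 : R).
 have A1 : 0 < A + 1 by rewrite ltr_wpDl// l2norm_ge0.
 have [n0 h] := Gu i _ (divr_gt0 e0 A1); exists n0 => n hn.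
 have mB : measurable_fun setT (fun x => G i x - pev (tgr i (p n)) x).
  by apply: measurable_funB; [exact: (bG i).1|exact: (bmeas_pev _).1].
 have := @l2norm_bM R _ _ (fun=> 1) mB (fun x => h n x hn)
   (L2_bmeas (@bmeas_cst _ (S2 R) R 1)).
 rewrite (_ : (fun x => _ 1) = G i - pev (tgr i (p n))); last first.
  by apply/funext => x; rewrite mulr1.
 move/le_trans; apply; rewrite -/A mulrAC ler_pdivrMr// ler_wpM2l ?(ltW e0)//.
 by rewrite lerDl.
have wl i j : l2lim (fun n => tgr i (p n) * tgr j (q n)) (fun x => G i x * wder j g x).
 apply: l2lim_M; [exact: bG|exact: Gu|].
 by have [_ h] := H2lim_wder hg j.
have wx k p' f' : l2lim p' f' -> l2lim (fun n => px R k * p' n) (fun x => s2coord k x * f' x).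
 move=> hp'; apply: (@l2lim_M (fun=> px R k)) => //; first exact: bmeas_s2coord.
 by exists 0%N => n x; rewrite pev_px subrr normr0 ltW.
have term k i j : l2lim (fun n => px R k * (tgr i (p n) * tgr j (q n) - tgr j (p n) * tgr i (q n)))
  (fun x => s2coord k x * (G i x * wder j g x - G j x * wder i g x)).
 exact: (wx k _ _ (l2limB (wl i j) (wl j i))).
have tot := l2limN (l2limD (l2limD (term e0 e1 e2) (term e1 e2 e0)) (term e2 e0 e1)).
have key : l2lim (fun n => bk (p n) (q n)) (fun x => cross3 x (fun i => G i x) (fun i => wder i g x)).
 apply: l2lim_ext tot => n; apply/funext => x; rewrite bk_tgr /cross3.
 by rewrite !(pevN,pevD,pevM,pevB) !pev_px.
have ae : (fun x => cross3 x (fun i => G i x) (fun i => wder i g x)) = poisson f g %[ae area].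
 move: (Gw e0) (Gw e1) (Gw e2); apply: filterS3 => x h0 h1 h2 _.
 by rewrite poissonE /cross3 (h0 Logic.I) (h1 Logic.I) (h2 Logic.I).
(* Equality almost everywhere does not make [poisson f g] measurable; this is checked on its
   formula. *)
apply: (l2lim_ae key _ ae); apply: (L2_ae key.1 _ ae).
have mf i : measurable_fun setT (wder i f).
 by have [[h _] _ _] := H2lim_wder hf i; exact: L2_meas.
have mg i : measurable_fun setT (wder i g).
 by have [[h _] _ _] := H2lim_wder hg i; exact: L2_meas.
rewrite (_ : poisson f g = (fun x => cross3 x (fun i => wder i f x) (fun i => wder i g x))).
 have mP (a b : S2 R -> R) := @measurable_funM _ _ R setT a b.
 have mB (a b : S2 R -> R) := @measurable_funB _ _ R setT a b.
 have mc k i j : measurable_fun setT (fun x : S2 R =>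
   s2coord k x * (wder i f x * wder j g x - wder j f x * wder i g x)).
  exact: (mP _ _ (bmeas_s2coord R k).1 (mB _ _ (mP _ _ (mf i) (mg j)) (mP _ _ (mf j) (mg i)))).
 apply: measurable_funN; apply: measurable_funD; first apply: measurable_funD; exact: mc.
by apply/funext => x; exact: poissonE.
Qed.

Lemma euler_lim p f : H2lim p f ->
 l2lim (fun n => euler (p n)) (poisson (invlap f) f).
move=> hf; apply: poisson_lim => //; first exact: invlap_lim.
have [zp hp _] := hf.
move=> e e0; have [n0 h] := hp e e0; exists n0 => n m hn hm; apply: le_trans (h n m hn hm).
rewrite -(N_ext 3 (invlB (p n) (p m))) N_invl; last exact: zmB.
by apply: N_zm_le => //; exact: zmB.
Qed.

End sobolev_functions.

(** * Integrated form of differential equations *)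

Section primitives.
Context (R : realType).
Notation leb := (@lebesgue_measure R).

Lemma integrable_setU h (A B : set R) : measurable A -> measurable B -> [disjoint A & B] ->
 leb.-integrable A (EFin \o h) -> leb.-integrable B (EFin \o h) ->
 leb.-integrable (A `|` B) (EFin \o h).
move=> mA mB dAB /integrable_mkcond -/(_ mA) iA /integrable_mkcond -/(_ mB) iB.
have mAB : measurable (A `|` B) by exact: measurableU.
have [_ +] := @integrable_mkcond _ _ _ leb _ (EFin \o h) mAB; apply.
have -> : (EFin \o h) \_ (A `|` B) = ((EFin \o h) \_ A \+ (EFin \o h) \_ B)%E.
 apply/funext => x; rewrite /patch in_setU.
 have [xA|xA] /= := boolP (x \in A); have [xB|xB] := boolP (x \in B); rewrite ?adde0 ?add0e//.
 exfalso; move: dAB; rewrite disj_set2E => /eqP/seteqP[+ _]; apply.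
 by split; [exact: set_mem xA|exact: set_mem xB].
exact: integrableD.
Qed.

(** Intervals are open on the left, so that those of consecutive pieces are disjoint. *)
Definition primitive h F a b := leb.-integrable `]a, b] (EFin \o h) /\
 forall t, a <= t <= b -> F t - F a = \int[leb]_(x in `]a, t]) h x.

Lemma primitive_cat h F a b c : a <= b -> b <= c ->
 primitive h F a b -> primitive h F b c -> primitive h F a c.
move=> ab bc [i1 h1] [i2 h2].
have d : [disjoint `]a, b]%classic & `]b, c]%classic].
 apply/eqP/seteqP; split => x [] /=.
 by rewrite !in_itv/= => /andP[bx]; lra.
have u : `]a, c]%classic = `]a, b]%classic `|` `]b, c]%classic.
 apply/seteqP; split => x /=; rewrite !in_itv/=.
  move=> /andP[ax xc]; have [xb|bx] := leP x b; [left|right]; rewrite ?ax //.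
 lra.
have i : leb.-integrable `]a, c] (EFin \o h) by rewrite u; exact: integrable_setU.
split=> // t /andP[at_ tc]; have [tb|bt] := leP t b; first by apply: h1; rewrite at_.
have it : leb.-integrable `]a, t] (EFin \o h).
 apply: integrableS i => //; apply: subset_itvl; by [].
have := @Rintegral_itvB R h (BRight a) (BRight t) b it.
rewrite !bnd_simp => /(_ ab (ltW bt)) E.
have e1 := h1 b; have e2 := h2 t; rewrite ab lexx (ltW bt) tc /= in e1 e2.
have := e1 isT; have := e2 isT; rewrite -E; lra.
Qed.

Lemma primitive_ext h h' F a b : (forall t, a < t <= b -> h t = h' t) ->
 primitive h F a b -> primitive h' F a b.
move=> e [i hF]; split.
 apply: eq_integrable i => // x; rewrite inE => hx; congr EFin; exact: e.
move=> t /andP[at_ tb]; rewrite hF ?at_//; apply: eq_Rintegral => x.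
rewrite inE /= in_itv/= => /andP[ax xt]; apply: e; rewrite ax/=; exact: le_trans tb.
Qed.

(** A uniform limit of differentiable functions whose derivatives converge uniformly. The
    approximants are only required at each accuracy, so one truncation index per accuracy
    suffices. *)
Lemma primitive_limit e F a b : a < b ->
 (forall t, a <= t <= b -> forall d : R, 0 < d -> exists2 r : R, 0 < r &
   forall s, a <= s <= b -> `|s - t| < r -> `|e s - e t| <= d) ->
 (forall d : R, 0 < d -> exists Fd Ed, forall t, a <= t <= b ->
   [/\ `|F t - Fd t| <= d, is_derive t (1 : R) Fd (Ed t) & `|e t - Ed t| <= d]) ->
 primitive e F a b.
move=> ab ce hF; pose cl x := Num.max a (Num.min b x); pose f x := e (cl x).
have clI x : a <= cl x <= b.
 by rewrite /cl; case: (leP b x) => h1; [case: (leP b)|case: (leP x)]; lra.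
have clE x : a <= x <= b -> cl x = x.
 by rewrite /cl => /andP[]; case: (leP b x) => h1; [case: (leP b)|case: (leP a x)]; lra.
have clm x y : x <= y -> 0 <= cl y - cl x <= y - x.
 rewrite /cl => xy; case: (leP b x) => h1; case: (leP b y) => h2;
 rewrite ?(max_r (ltW ab)); try (case: (leP a x) => h4); try (case: (leP a y) => h5);
 by apply/andP; split; lra.
have cl1 x y : `|cl y - cl x| <= `|y - x|.
 case/orP: (le_total x y) => xy.
  by have /andP[h1 h2] := clm x y xy; rewrite !ger0_norm// subr_ge0.
 by have /andP[h1 h2] := clm y x xy; rewrite (distrC (cl y)) (distrC y) !ger0_norm// subr_ge0.
have cf : continuous f.
 move=> x; apply/cvgrPdist_le => d d0; have [r r0 hr] := ce (cl x) (clI x) d d0.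
 near=> y; rewrite distrC; apply: hr => //; apply: (le_lt_trans (cl1 x y)).
 by near: y; exists r => // y; rewrite /= distrC.
pose H x := (\int[leb]_(t in `[a - 1, x]) f t).
have ih : leb.-integrable `[a - 1, b + 1] (EFin \o f).
 apply: continuous_compact_integrable; first exact: segment_compact.
 exact: continuous_subspaceT.
have Hd t : a <= t <= b -> is_derive t (1 : R) H (e t).
 move=> ht; have /andP[t0 tT] := ht.
 have [||h1 h2] := @continuous_FTC1_closed R f (a - 1) t (b + 1) _ ih _ (cf t).
 - by lra.
 - by lra.
 have <- : f t = e t by rewrite /f clE.
 by apply: DeriveDef; [exact: h1|rewrite -derive1E; exact: h2].
have key t : a <= t <= b -> F t - F a = H t - H a.
 move=> /andP[at_ tb]; apply/eqP; rewrite -subr_eq0 -normr_le0.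
 have ba : 0 <= b - a + 2 by lra.
 apply: (@le_eps _ _ (b - a + 2) ba) => d d0; have [Fd [Ed hd]] := hF d d0.
 have ta : forall s, a <= s <= t -> a <= s <= b by move=> s; lra.
 have dB s : a <= s <= t -> is_derive s (1 : R) (fun x => Fd x - H x) (Ed s - e s).
  by move=> /ta hs; have [_ h1 _] := hd s hs; have h2 := Hd s hs; exact: is_deriveB.
 have dl (k : R) s : a <= s <= t -> is_derive s (1 : R) (fun x => k * x) k.
  move=> _; have := @is_deriveZ R R R id k s 1 1 (is_derive_id _ _).
  by rewrite -[k *: 1]/(k * 1) mulr1.
 have b1 : forall s, a <= s <= t -> Ed s - e s <= d.
  by move=> s /ta hs; have [_ _] := hd s hs; rewrite ler_norml; lra.
 have b2 : forall s, a <= s <= t -> - d <= Ed s - e s.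
  by move=> s /ta hs; have [_ _] := hd s hs; rewrite ler_norml; lra.
 have u1 := is_derive_le at_ dB (dl d) b1.
 have u2 := is_derive_le at_ (dl (- d)) dB b2.
 have [v1 _ _] := hd a (andb_true_intro (conj (lexx a) (ltW ab))).
 have [v2 _ _] := hd t (andb_true_intro (conj at_ tb)).
 move: v1 v2 u1 u2; rewrite !ler_norml; move: (F t) (F a) (H t) (H a) (Fd t) (Fd a) => x1 x2 x3 x4 x5 x6.
 have : d * t <= d * b by rewrite ler_wpM2l// ltW.
 by clear -d0; rewrite mulrDr mulrBr mulNr => *; apply/andP; split; lra.
split.
 have : leb.-integrable `]a, b] (EFin \o f).
  by apply: integrableS ih => //; apply: subset_itv; rewrite bnd_simp; lra.
 apply: eq_integrable => // x; rewrite inE /= in_itv/= => /andP[ax xb].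
 by rewrite /f clE// (ltW ax) xb.
move=> t /andP[at_ tb]; rewrite key ?at_//.
have it : leb.-integrable `[(a - 1), t] (EFin \o f).
 by apply: integrableS ih => //; apply: subset_itv; rewrite bnd_simp; lra.
rewrite /H (@Rintegral_itvB R f (BLeft (a - 1)) (BRight t) a it) ?bnd_simp//; last by lra.
apply: eq_Rintegral => x; rewrite inE /= in_itv/= => /andP[ax xt].
by rewrite /f clE// (ltW ax) (le_trans xt tb).
Unshelve. all: by end_near.
Qed.

End primitives.

Opaque ip cf sip S N lapp bk rot invl proj pev Ip.

(** * The limit of truncated solutions solves the equation *)

Section galerkin_limit.
Context (R : realType).
Notation P := (pol R).
Notation lam := (@lam R).
Notation csup := (@csup R).
Local Hint Extern 0 (is_true (@Order.le _ _ _ (csup))) => solve [apply: csup_ge0] : core.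

Lemma norm_chain (x x' y y' d : R) : `|x - y| <= d / 3 -> `|x' - y'| <= d / 3 ->
 `|y - y'| <= d / 3 -> `|x - x'| <= d.
rewrite !ler_norml; lra. Qed.

(** One derivative on the Euler term makes its truncation error tend to zero, through [N_projC],
    uniformly on bounded sets of H^2. *)
Lemma N1_euler (p : P) : zm p -> N 1 (euler p) <= 6 * (csup * N 2 p ^+ 2).
move=> zp; have c0 := csup_ge0 R; have p0 := N_ge0 2 p.
have h3 : N 3 (invl p) <= N 2 p by rewrite N_invl//; exact: N_zm_le.
have h1 : N 1 p <= N 2 p by exact: N_zm_le.
have k i : N 0 (rot i (euler p)) <= 2 * (csup * N 2 p ^+ 2).
 rewrite rot_bk; apply: ND_le.
 have a1 : N 0 (bk (rot i (invl p)) p) <= csup * N 2 p * N 2 p.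
  apply: (le_trans (N_bk31 _ _)); apply: ler_pM => //; first nneg.
  by apply: (ler_wpM2l c0); apply: (le_trans (N_rot_le _ _ _)); rewrite N_invl.
 have a2 : N 0 (bk (invl p) (rot i p)) <= csup * N 2 p * N 2 p.
  apply: (le_trans (N_bk31 _ _)); apply: ler_pM => //; first nneg.
   by apply: (ler_wpM2l c0).
  exact: N_rot_le.
 by lra.
have b0 : 0 <= csup * N 2 p ^+ 2 by nneg.
apply: sqr_le_norm; first by nneg.
rewrite N_sq -S_rot; move: (k e0) (k e1) (k e2); move: b0; move: (csup * N 2 p ^+ 2) => b b0.
have G (x y : R) : 0 <= x -> x <= 2 * y -> x ^+ 2 <= 4 * y ^+ 2.
 by move=> x0 xy; rewrite (_ : 4 * y ^+ 2 = (2 * y) ^+ 2); [rewrite lerXn2r// ?nnegrE; lra|ring].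
move=> /(G _ _ (N_ge0 _ _)) g1 /(G _ _ (N_ge0 _ _)) g2 /(G _ _ (N_ge0 _ _)) g3.
move: g1 g2 g3; rewrite !N_sq exprMn; have := sqr_ge0 b.
lra.
Qed.

Lemma N_projC n (p : P) : (0 < n)%N -> N 0 (p - proj n p) <= N 1 p / Num.sqrt (lam n).
move=> n0; have l0 : 0 < lam n by apply: lt_le_trans (lam_gt0 R n0).
rewrite ler_pdivlMr ?sqrtr_gt0// -sqrtrM// ler_wsqrtr//.
by apply: (le_trans (S_tail 0 1 n p)); exact: S_subproj.
Qed.

Lemma lappB (p q : P) : lapp (p - q) = lapp p - lapp q.
by rewrite addrC -scaleN1r lapp_linear scaleN1r addrC. Qed.
Lemma inV_gfield n m mu v (p : P) : (n <= m)%N -> inV n v -> inV m p -> inV m (gfield m mu v p).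
move=> nm hv hp; rewrite /gfield addrC -[v]scale1r; apply: inV_lin; first exact: inV_le hv.
by rewrite addrC; apply: inV_lin; [exact: inV_lapp|exact: inV_proj].
Qed.

Lemma N_gfieldB n m mu v (p q : P) : 0 <= mu -> zm p -> zm q ->
 N 0 (gfield n mu v p - gfield m mu v q) <=
 N 0 (euler p - proj n (euler p)) + N 0 (euler q - proj m (euler q)) +
 (csup * (N 2 p + N 2 q) + mu) * N 2 (p - q).
move=> mu0 zp zq; have zpq := zmB zp zq; rewrite /gfield.
have e1 : pev (proj n (euler p) + mu *: lapp p + v - (proj m (euler q) + mu *: lapp q + v)) =
 pev ((euler q - proj m (euler q)) - (euler p - proj n (euler p)) +
    ((euler p - euler q) + mu *: lapp (p - q))).
 have G (a b c d e f g : P) : a + c + g - (b + d + g) = f - b - (e - a) + (e - f + (c - d)) by ring.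
 by rewrite lappB scalerBr; congr pev.
rewrite (N_ext 0 e1); apply: ND_le.
have h1 := NB 0 (euler q - proj m (euler q)) (euler p - proj n (euler p)).
have h2 := ND 0 (euler p - euler q) (mu *: lapp (p - q)).
have h3 : N 0 (mu *: lapp (p - q)) = mu * N 2 (p - q) by rewrite NZ ger0_norm// N_lapp.
have h4 : N 0 (euler p - euler q) <= csup * (N 2 p + N 2 q) * N 2 (p - q).
 apply: (le_trans (N_eulerB zp zq)); apply: ler_pM => //.
 - nneg.
 - by apply: (ler_wpM2l (csup_ge0 R)); apply: lerD; exact: N_zm_le.
 - exact: N_zm_le.
rewrite h3 in h2; rewrite mulrDl.
have G (a b c x e f k : R) : a <= b + c -> x <= e + f -> e <= k -> a + x <= c + b + (k + f) by lra.
exact: G h4.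
Qed.

Lemma dcurve_ip n X dX (T : R) u t : dcurve n X dX T -> inV n u -> 0 <= t <= T ->
 is_derive t (1 : R) (fun s => ip (X s) u) (ip (dX t) u).
move=> [hX hd] hu ht.
have E z : ip z u = \sum_(k < n) cf u k * cf z k by rewrite ipC (ip_parseval _ hu).
have -> : (fun s => ip (X s) u) = \sum_(k < n) (fun s => cf u k * cf (X s) k).
 by apply/funext => s; rewrite fct_sumE.
rewrite E; apply: is_derive_sum => k; have h := hd t ht k.
by have := @is_deriveZ _ _ _ _ (cf u k) t 1 _ h.
Qed.

Lemma dcurve_cont n X dX (T t : R) : dcurve n X dX T -> 0 <= t <= T -> forall d : R, 0 < d ->
 exists2 r : R, 0 < r & forall s, `|s - t| < r -> N 2 (X s - X t) <= d.
move=> [hX hd] ht d d0.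
have c k : {for t, continuous (fun s => cf (X s) k)} := is_derive_continuous (hd t ht k).
have hS : S 2 (X s - X t) @[s --> t] --> (0 : R).
 have -> : (fun s => S 2 (X s - X t)) = (fun s => \sum_(k < n) lam k ^+ 2 * (cf (X s) k - cf (X t) k) ^+ 2).
  apply/funext => s; have h : inV n (X s - X t).
   by rewrite addrC -scaleN1r; exact: inV_lin (hX t).1 (hX s).1.
  by rewrite (S_sum _ h); apply: eq_bigr => k; rewrite cfB.
 have E : \sum_(k < n) lam k ^+ 2 * (cf (X t) k - cf (X t) k) ^+ 2 = 0.
  by rewrite big1// => k; rewrite subrr expr0n/= mulr0.
 rewrite -[X in _ --> X]E; apply: cvg_big => [|k _]; first exact: add_continuous.
 by apply: cvgMr; apply: cvgM; apply: cvgB; try exact: cvg_cst; exact: c.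
have d2 : 0 < d ^+ 2 by nneg.
have /cvgrPdist_lt /(_ _ d2) [r /= r0 hr] := hS.
exists r => // s hs; apply: sqr_le_norm; first nneg.
rewrite N_sq; have := hr s; rewrite /= distrC => /(_ hs).
by rewrite sub0r normrN ger0_norm // => /ltW.
Qed.

Definition rhs_cst (nu : R) v w := poisson (invlap w) w + nu *: lap w + pev v.

(** The dimension is raised to at least [n1.+1], so that it is positive, as [N_projC] requires. *)
Lemma gfield_lim nu v (p : nat -> P) w n1 : 0 <= nu -> H2lim p w ->
 l2lim (fun n => gfield (maxn n n1.+1) nu v (p n)) (rhs_cst nu v w).
move=> nu0 hp; have [zp hc _] := hp.
have h := l2limD (l2limD (euler_lim hp) (l2limZ nu (H2lim_lap hp))) (l2lim_cst v).
split; first exact: h.1.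
move=> e e0; have e2 : 0 < e / 2 by rewrite divr_gt0.
have [n2 h2] := h.2 _ e2; have [a [n3 [a0 h3]]] := hcauchy_bounded hc.
have [n4 h4] := lam_unbounded ((6 * (csup * a ^+ 2) / (e / 2)) ^+ 2).
exists (maxn n2 (maxn n3 n4)) => n; rewrite !geq_max => /and3P[k2 k3 k4].
have Lr := h.1; pose m := maxn n n1.+1.
have m0 : (0 < m)%N by rewrite leq_max orbT.
have mn : (n4 <= m)%N by rewrite leq_max k4.
have hE : N 0 (euler (p n) - proj m (euler (p n))) <= e / 2.
 apply: (le_trans (N_projC _ m0)).
 have l0 : 0 < lam m by apply: lt_le_trans (lam_gt0 R m0).
 rewrite ler_pdivrMr ?sqrtr_gt0//; apply: (le_trans (N1_euler (zp n))).
 have hs : 6 * (csup * N 2 (p n) ^+ 2) <= 6 * (csup * a ^+ 2).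
  by rewrite ler_pM2l// ler_wpM2l// lerXn2r ?nnegrE// h3.
 apply: (le_trans hs); rewrite [leRHS]mulrC -ler_pdivrMr//.
 have := h4 m mn; rewrite -{1}(sqr_sqrtr (ltW l0)) => hh.
 exact: (sqr_le_norm (sqrtr_ge0 _) hh).
have Lq := L2_pev (euler (p n) + nu *: lapp (p n) + v).
have -> : rhs_cst nu v w - pev (gfield m nu v (p n)) =
 (rhs_cst nu v w - pev (euler (p n) + nu *: lapp (p n) + v)) +
 pev (euler (p n) - proj m (euler (p n))).
 apply/funext => x; rewrite -[LHS]/(rhs_cst nu v w x - pev (gfield m nu v (p n)) x).
 rewrite -[RHS]/((rhs_cst nu v w x - pev (euler (p n) + nu *: lapp (p n) + v) x) +
  pev (euler (p n) - proj m (euler (p n))) x).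
 have ge (a1 b1 c1 d1 : P) (y : R) : y - pev (d1 + b1 + c1) x = y - pev (a1 + b1 + c1) x + pev (a1 - d1) x.
  by rewrite !pevD pevN; ring.
 exact: ge.
apply: (le_trans (l2normD (L2B Lr Lq) (L2_pev _))).
rewrite l2norm_pev; have := h2 n k2; move: hE.
by lra.
Qed.

Section one_piece.
Variables (nu : R) (n1 : nat) (v : P) (tau a : R) (y : nat -> P).
Variables (X Z : nat -> R -> P) (w : R -> S2 R -> R).
Hypotheses (nu0 : 0 <= nu) (vv : inV n1 v).
Hypothesis hX : forall n, (n1 <= n)%N -> gsol n nu v tau (y n) (X n).
Hypothesis hy : hcauchy y.
Hypothesis uX : ucauchy X tau.
Hypothesis hZ : forall n t, (n1 <= n)%N -> a <= t <= a + tau -> pev (Z n t) = pev (X n (t - a)).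
Hypothesis hw : forall t, a <= t <= a + tau -> H2lim (fun n => Z n t) (w t).

Let shift t : a <= t <= a + tau -> 0 <= t - a <= tau.
lra. Qed.

Lemma piece_continuous t : a <= t <= a + tau -> forall d : R, 0 < d ->
 exists2 r : R, 0 < r & forall s, a <= s <= a + tau -> `|s - t| < r -> H2norm (w s - w t) <= d.
move=> ht d d0; have [K [K0 hK]] := H2norm_lim R.
have c0 : 0 < 3 * K + 1 by rewrite ltr_wpDl// mulr_ge0.
pose b := d / (3 * K + 1); have b0 : 0 < b by rewrite divr_gt0.
have [n0 hn] := uX b0; pose n := maxn n0 n1.
have nn0 : (n0 <= n)%N by rewrite leq_maxl.
have nn1 : (n1 <= n)%N by rewrite leq_maxr.
have [_ _ dX _ _] := hX nn1.
have [r r0 hr] := dcurve_cont dX (shift ht) b0.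
exists r => // s hs hst; have hB := H2limB (hw hs) (hw ht).
apply: (le_trans (hK _ _ (3 * b) n hB _)); last first.
 rewrite mulrCA mulrA mulrC -mulrA ler_piMr ?(ltW d0)//.
 by rewrite mulrC ler_pdivrMr// mul1r lerDl.
move=> m hm; have hm1 := leq_trans nn1 hm; have hm0 := leq_trans nn0 hm.
have e1 : pev (Z m s - Z m t) = pev (X m (s - a) - X n (s - a) + (X n (s - a) - X n (t - a))
  + (X n (t - a) - X m (t - a))).
 apply/funext => x; rewrite pevB !hZ//; rewrite !pevD !pevN.
 by ring.
rewrite (N_ext 2 e1); apply: ND_le.
have i1 := ND 2 (X m (s - a) - X n (s - a)) (X n (s - a) - X n (t - a)).
have i2 := hn m n (s - a) hm0 nn0 (shift hs).
have i3 := hn n m (t - a) nn0 hm0 (shift ht).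
have i4 := hr (s - a); rewrite (_ : s - a - (t - a) = s - t) in i4; last by ring.
have {}i4 := i4 hst; move: i1 i2 i3 i4.
by move: (N 2 _) => x1 x2 x3 x4; lra.
Qed.

Let bound : exists B n0, [/\ 0 <= B, (n1 <= n0)%N & forall n t, (n0 <= n)%N -> 0 <= t <= tau ->
 N 2 (X n t) <= B].
have [c [n0 [c0 hc]]] := hcauchy_bounded hy.
have [T0 _ _ _ _] := hX (leqnn n1).
exists (4 * (c + tau * N 2 v)), (maxn n0 n1); split; last 1 first.
- move=> n t; rewrite geq_max => /andP[h0 h1] ht; have [_ _ _ _ hN] := hX h1.
 apply: (le_trans (hN t ht)); rewrite ler_pM2l// lerD2r; exact: hc.
- nneg.
- exact: leq_maxr.
Qed.

(** A single truncation approximates both the limit and its field on the whole piece, which is what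
    [primitive_limit] asks for. *)
Let uniform (d : R) : 0 < d -> exists n, (n1 <= n)%N /\ forall t, a <= t <= a + tau ->
 l2norm (w t - pev (X n (t - a))) <= d /\
 l2norm (rhs_cst nu v (w t) - pev (gfield n nu v (X n (t - a)))) <= d.
move=> d0; have [B [n0 [B0 hn0 hB]]] := bound; have c0 := csup_ge0 R.
have d3 : 0 < d / 3 by rewrite divr_gt0.
have [n4 h4] := lam_unbounded ((6 * (csup * B ^+ 2) / (d / 3)) ^+ 2).
have k0 : 0 < csup * (B + B) + nu + 1 by nneg.
have [n2 h2] := uX (divr_gt0 d3 k0); have [n3 h3] := uX d0.
pose n := maxn (maxn n0 n4) (maxn (maxn n2 n3) 1).
have [h5 h6 h7 h8 h9] : [/\ (n0 <= n)%N, (n4 <= n)%N, (n2 <= n)%N, (n3 <= n)%N & (0 < n)%N].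
 by rewrite !leq_max !leqnn !orbT.
have nn1 : (n1 <= n)%N := leq_trans hn0 h5.
have hE m t : (n <= m)%N -> 0 <= t <= tau ->
  N 0 (euler (X m t) - proj m (euler (X m t))) <= d / 3.
 move=> nm ht; have m0 := leq_trans h9 nm.
 have [_ _ [zX _] _ _] := hX (leq_trans nn1 nm).
 apply: (le_trans (N_projC _ m0)).
 have l0 : 0 < lam m by apply: lt_le_trans (lam_gt0 R m0).
 rewrite ler_pdivrMr ?sqrtr_gt0//; apply: (le_trans (N1_euler (zX t).2)).
 have hs : 6 * (csup * N 2 (X m t) ^+ 2) <= 6 * (csup * B ^+ 2).
  by rewrite ler_pM2l// ler_wpM2l// lerXn2r ?nnegrE// hB// (leq_trans h5 nm).
 apply: (le_trans hs); rewrite [leRHS]mulrC -ler_pdivrMr//.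
 have := h4 m (leq_trans h6 nm); rewrite -{1}(sqr_sqrtr (ltW l0)) => hh.
 exact: (sqr_le_norm (sqrtr_ge0 _) hh).
exists n; split => // t ht; have hs := shift ht; split.
 have lw : l2lim (fun m => Z m t - X n (t - a)) (w t - pev (X n (t - a))).
  apply: l2limB; last exact: l2lim_cst.
  by have [] := hw ht.
 apply: (l2lim_norm (n0 := n) lw) => m nm.
 have n1m := leq_trans nn1 nm.
 have [_ _ [zX _] _ _] := hX nn1; have [_ _ [zX' _] _ _] := hX n1m.
 have e1 : pev (Z m t - X n (t - a)) = pev (X m (t - a) - X n (t - a)).
  by apply/funext => x; rewrite !pevB hZ.
 rewrite (N_ext 0 e1); apply: le_trans (h3 m n (t - a) (leq_trans h8 nm) h8 hs).
 by apply: N_zm_le => //; apply: zmB; [exact: (zX' _).2|exact: (zX _).2].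
have lw : l2lim (fun m => gfield (maxn m n1.+1) nu v (Z m t) - gfield n nu v (X n (t - a)))
  (rhs_cst nu v (w t) - pev (gfield n nu v (X n (t - a)))).
 apply: l2limB; last exact: l2lim_cst.
 exact: gfield_lim (hw ht).
apply: (l2lim_norm (n0 := maxn n n1.+1) lw) => m; rewrite geq_max => /andP[nm n1m].
rewrite (maxn_idPl n1m).
have n1m' := leq_trans nn1 nm.
have [_ _ [zX _] _ _] := hX nn1; have [_ _ [zX' _] _ _] := hX n1m'.
have zZ : zm (Z m t) by exact: zm_ext (esym (hZ n1m' ht)) (zX' _).2.
have e2 := N_gfieldB n m v nu0 (zX (t - a)).2 zZ.
have eZ : pev (euler (Z m t) - proj m (euler (Z m t))) =
 pev (euler (X m (t - a)) - proj m (euler (X m (t - a)))).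
 have ee : pev (euler (Z m t)) = pev (euler (X m (t - a))).
  rewrite (pev_bkr _ (hZ n1m' ht)); apply: pev_bkl; apply: invl_ext; exact: hZ.
 apply: cf_inj; apply/funext => k; rewrite !cfB !cf_proj !(cfE _ k).
 by rewrite !(ip_extl _ ee).
rewrite NBC; apply: (le_trans e2); rewrite (N_ext 0 eZ).
have e3 : pev (X n (t - a) - Z m t) = pev (X n (t - a) - X m (t - a)).
 by apply/funext => x; rewrite !pevB hZ.
rewrite (N_ext 2 e3) (N_ext 2 (hZ n1m' ht)).
have g1 := hE n (t - a) (leqnn n) hs; have g2 := hE m (t - a) nm hs.
have g3 := h2 n m (t - a) h7 (leq_trans h7 nm) hs.
have g4 : csup * (N 2 (X n (t - a)) + N 2 (X m (t - a))) + nu <= csup * (B + B) + nu + 1.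
 rewrite -addrA lerD ?lerDl// ler_wpM2l// lerD// hB//; exact: leq_trans nm.
have g5 : (csup * (N 2 (X n (t - a)) + N 2 (X m (t - a))) + nu) * N 2 (X n (t - a) - X m (t - a)) <= d / 3.
 have := ler_pM _ (N_ge0 _ _) g4 g3.
 rewrite (_ : (_ 1) * (d / 3 / _) = d / 3); last by rewrite mulrC divfK// gt_eqF.
 by apply; rewrite addr_ge0// mulr_ge0// addr_ge0.
by move: g1 g2 g5; move: (N 0 _) (N 0 _) (_ * N 2 _) => x1 x2 x3; lra.
Qed.

Lemma piece_primitive g : L2 g ->
 primitive (fun t => l2ip (rhs_cst nu v (w t)) g) (fun t => l2ip (w t) g) a (a + tau).
move=> hg; have [T0 _ _ _ _] := hX (leqnn n1).
have g0 : 0 < l2norm g + 1 by rewrite ltr_wpDl// l2norm_ge0.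
have Lw t : a <= t <= a + tau -> L2 (w t) by move=> ht; have [_ _ []] := hw ht.
have Lr t : a <= t <= a + tau -> L2 (rhs_cst nu v (w t)).
 by move=> ht; exact: (gfield_lim v 0%N nu0 (hw ht)).1.
have close (f : S2 R -> R) u (d : R) : L2 f -> l2norm (f - pev u) <= d / (l2norm g + 1) ->
  0 < d -> `|l2ip f g - l2ip (pev u) g| <= d.
 move=> Lf hd d0; have Lu := L2_pev u; rewrite -l2ipBl//.
 apply: (le_trans (l2ip_le (L2B Lf Lu) hg)).
 apply: (le_trans (ler_wpM2r (l2norm_ge0 _) hd)).
 by rewrite mulrAC ler_pdivrMr// ler_wpM2l ?(ltW d0)// lerDl.
apply: primitive_limit; first by rewrite ltrDl.
 move=> t ht d d0; have d3 : 0 < d / 3 by rewrite divr_gt0.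
 have [n [hn hu]] := uniform (divr_gt0 d3 g0).
 have [_ _ dX _ hN] := hX hn; have [zX _] := dX.
 pose B := 4 * (N 2 (y n) + tau * N 2 v).
 have B0 : 0 <= B by nneg.
 have k0 : 0 < csup * (B + B) + nu + 1 by rewrite ltr_wpDl// addr_ge0// mulr_ge0// addr_ge0.
 pose b := d / 3 / (l2norm g + 1) / (csup * (B + B) + nu + 1).
 have b0 : 0 < b by rewrite !divr_gt0.
 have c0 := dcurve_cont dX (shift ht) b0; have [r r0 hr] := c0; exists r => // s hs hst.
 have [_ h1] := hu s hs; have [_ h2] := hu t ht.
 have k1 := close _ _ _ (Lr s hs) h1 d3; have k2 := close _ _ _ (Lr t ht) h2 d3.
 have gs : gfield n nu v (X n (s - a)) - gfield n nu v (X n (t - a)) = 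
  proj n (euler (X n (s - a)) ) + nu *: lapp (X n (s - a)) + v - gfield n nu v (X n (t - a)) by [].
 have i4 := hr (s - a); rewrite (_ : s - a - (t - a) = s - t) in i4; last by ring.
 have {}i4 := i4 hst.
 have k3 : `|l2ip (pev (gfield n nu v (X n (s - a)))) g - l2ip (pev (gfield n nu v (X n (t - a)))) g| <= d / 3.
  apply: close => //; first exact: L2_pev.
  rewrite pevBf l2norm_pev.
  have zz := zmB (zX (s - a)).2 (zX (t - a)).2.
  have e5 : pev (gfield n nu v (X n (s - a)) - gfield n nu v (X n (t - a))) =
   pev (proj n (euler (X n (s - a)) - euler (X n (t - a))) + nu *: lapp (X n (s - a) - X n (t - a))).
   apply/funext => x; rewrite pevB !pevD lappB scalerBr pevB (projB n) pevB; ring.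
  rewrite (N_ext 0 e5); apply: ND_le.
  have j1 : N 0 (proj n (euler (X n (s - a)) - euler (X n (t - a)))) <= csup * (B + B) * b.
   apply: (le_trans (N_proj _ _ _)); apply: (le_trans (N_eulerB (zX _).2 (zX _).2)).
   apply: ler_pM => //.
   - nneg.
   - apply: (ler_wpM2l (csup_ge0 R)); apply: lerD;
     (apply: le_trans (hN _ _); [exact: N_zm_le (zX _).2 _|exact: shift]).
   - exact: (le_trans (N_zm_le zz (isT : (1 <= 2)%N)) i4).
  have j2 : N 0 (nu *: lapp (X n (s - a) - X n (t - a))) <= nu * b.
   by rewrite NZ ger0_norm// N_lapp ler_wpM2l.
  have j3 : (csup * (B + B) + nu + 1) * b = d / 3 / (l2norm g + 1).
   by rewrite mulrC divfK// gt_eqF.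
  move: j1 j2 b0; rewrite -j3; move: (N 0 _) (N 0 _) => x1 x2.
  by lra.
 exact: norm_chain k3.
move=> d d0; have [n [hn hu]] := uniform (divr_gt0 d0 g0).
have [_ _ dX _ hN] := hX hn; have [zX _] := dX.
exists (fun t => l2ip (pev (X n (t - a))) g), (fun t => l2ip (pev (gfield n nu v (X n (t - a)))) g).
move=> t ht; have [h1 h2] := hu t ht; split; [exact: close (Lw t ht) h1 d0| |exact: close (Lr t ht) h2 d0].
have e1 u : inV n u -> l2ip (pev u) g = ip u (fproj g n).
 by move=> Vu; rewrite l2ipC (l2ip_fproj hg Vu) ipC.
have gV x : inV n (gfield n nu v (X n x)) := inV_gfield nu hn vv (zX x).1.
rewrite (_ : (fun t0 => _) = (fun s => ip (X n s) (fproj g n)) \o (fun s => s - a)); last first.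
 by apply/funext => s; rewrite e1//; exact: (zX _).1.
rewrite (e1 _ (gV _)).
have ds : is_derive t (1 : R) (fun s : R => s - a) 1.
 have := @is_deriveB R R R id (fun=> a) t 1 1 0 (is_derive_id _ _) (is_derive_cst _ _ _).
 by rewrite subr0.
have dd := dcurve_ip dX (inV_fproj g n) (shift ht).
by have := @is_derive1_comp R (fun s => ip (X n s) (fproj g n)) (fun s => s - a) t _ _ dd ds; rewrite mulr1.
Qed.

End one_piece.
End galerkin_limit.

(** * Piecewise constant controls *)

Section programs.
Context (R : realType).
Notation P := (pol R).
Variables (nu : R) (r n1 : nat) (d : 'I_r -> P).
Hypotheses (nu0 : 0 <= nu) (hd : forall k, inV n1 (d k)) (zd : forall k, zm (d k)).

Definition ctl (a : 'I_r -> R) : P := \sum_k a k *: d k.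

Lemma inV_ctl n a : (n1 <= n)%N -> inV n (ctl a).
move=> hn; have V0 : inV n (0 : P) by rewrite -(scale0r 0); apply: cf_inj; apply/funext => k; rewrite cf_proj scale0r cf0 if_same.
rewrite /ctl; elim/big_ind : _ => // [p q hp hq|k _].
 by rewrite -[p]scale1r; exact: inV_lin.
exact/inVZ/(inV_le hn).
Qed.

Lemma zm_ctl a : zm (ctl a).
by rewrite /ctl; elim/big_ind : _ => [|p q|k _]; [exact: zm0|exact: zmD|exact/zmZ]. Qed.

Definition program := seq (('I_r -> R) * R).

Fixpoint dur (s : program) : R := if s is (_, tau) :: s' then tau + dur s' else 0.

(** A relation rather than a function, because truncated solutions are only known to exist. *)
Fixpoint run n (s : program) (y z : P) : Prop :=
 if s is (a, tau) :: s' then exists X, gsol n nu (ctl a) tau y X /\ run n s' (X tau) z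
 else z = y.

(* [Y] is a trajectory, starting at time [t0], of the program [s]; its values
  only matter modulo polynomials vanishing on the sphere. *)
Fixpoint trajectory n (s : program) t0 (y : P) (Y : R -> P) : Prop :=
 if s is (a, tau) :: s' then exists X, [/\ gsol n nu (ctl a) tau y X,
  forall t, t0 <= t <= t0 + tau -> pev (Y t) = pev (X (t - t0)) &
  trajectory n s' (t0 + tau) (X tau) Y]
 else pev (Y t0) = pev y.

Lemma run_dur n s y z : run n s y z -> 0 <= dur s.
elim: s y => [|[a tau] s IH] y //= [X [[T0 _ _ _ _] /IH h]].
nneg.
Qed.

Lemma trajectory_ext n s t0 y (Y Y' : R -> P) : 0 <= dur s -> (forall t, t0 <= t -> Y t = Y' t) ->
 trajectory n s t0 y Y -> trajectory n s t0 y Y'.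
move=> _; elim: s t0 y => [|[a tau] s IH] t0 y e /=; first by rewrite e.
move=> [X [h1 h2 h3]]; have [T0 _ _ _ _] := h1; exists X; split => //.
 by move=> t ht; rewrite -e ?h2//; case/andP: ht.
by apply: IH h3 => t ht; apply: e; lra.
Qed.

Lemma trajectory_start n s t0 y Y : trajectory n s t0 y Y -> pev (Y t0) = pev y.
case: s => [|[a tau] s]// [X [[T0 _ _ X0 _] h _]].
by rewrite h ?subrr//; lra.
Qed.

Lemma run_trajectory n s t0 y z : inV n y -> zm y -> run n s y z ->
 exists Y, [/\ trajectory n s t0 y Y, pev (Y (t0 + dur s)) = pev z & forall t, zm (Y t)].
elim: s t0 y => [|[a tau] s IH] t0 y hy zy /=.
 by move=> ->; exists (fun=> y).
move=> [X [hX hr]]; have [T0 _ [hV _] _ _] := hX.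
have [Y [h1 h2 h3]] := IH (t0 + tau) (X tau) (hV _).1 (hV _).2 hr.
pose Z t := if t < t0 + tau then X (t - t0) else Y t.
have hE t : t0 + tau <= t -> Y t = Z t by rewrite /Z leNgt => /negbTE ->.
have d0 := run_dur hr.
exists Z; split.
- exists X; split => //; last exact: trajectory_ext h1.
 move=> t /andP[t1 t2]; rewrite /Z; case: ltP => // t3.
 have -> : t = t0 + tau by lra.
 by rewrite (trajectory_start h1) (addrC t0) addrK.
- by rewrite addrA -hE// lerDl.
- by move=> t; rewrite /Z; case: ifP => _ //; exact: (hV _).2.
Qed.

(** At a junction the earlier piece prevails, in agreement with the right-closed intervals of
    [primitive]. *)
Fixpoint control (s : program) (t0 : R) (k : 'I_r) (t : R) : R :=
 if s is (a, tau) :: s' then if t <= t0 + tau then a k else control s' (t0 + tau) k t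
 else 0.

Lemma control_measurable s t0 k : measurable_fun setT (control s t0 k).
elim: s t0 => [|[a tau] s IH] t0 /=; first exact: measurable_cst.
apply: measurable_fun_ifT; [|exact: measurable_cst|exact: IH].
exact: measurable_fun_ler.
Qed.

Lemma control_bounded s t0 k : exists M, forall t, `|control s t0 k t| <= M.
elim: s t0 => [|[a tau] s IH] t0 /=; first by exists 0 => t; rewrite normr0.
have [M hM] := IH (t0 + tau); exists (Num.max `|a k| M) => t.
by case: ifP => _; rewrite le_max ?lexx ?hM ?orbT.
Qed.

Lemma cons_choice a tau s t0 (y : nat -> P) (Y : nat -> R -> P) :
 (forall n, (n1 <= n)%N -> trajectory n ((a, tau) :: s) t0 (y n) (Y n)) ->
 exists X : nat -> R -> P, forall n, (n1 <= n)%N ->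
 [/\ gsol n nu (ctl a) tau (y n) (X n),
   forall t, t0 <= t <= t0 + tau -> pev (Y n t) = pev (X n (t - t0)) &
   trajectory n s (t0 + tau) (X n tau) (Y n)].
move=> hY.
have h n : exists X, (n1 <= n)%N -> [/\ gsol n nu (ctl a) tau (y n) X,
   forall t, t0 <= t <= t0 + tau -> pev (Y n t) = pev (X (t - t0)) &
   trajectory n s (t0 + tau) (X tau) (Y n)].
 have [hn|hn] := boolP (n1 <= n)%N; last by exists (fun=> 0).
 by have [X hX] := hY n hn; exists X.
by have [X hX] := choice h; exists X.
Qed.

(** By induction on the program: [galerkin_cauchy] on one piece makes its endpoints a Cauchy
    sequence of data for the next. *)
Lemma trajectory_cauchy s t0 (y : nat -> P) (Y : nat -> R -> P) : hcauchy y ->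
 (forall n, (n1 <= n)%N -> inV n (y n) /\ zm (y n)) ->
 (forall n, (n1 <= n)%N -> trajectory n s t0 (y n) (Y n)) ->
 forall e : R, 0 < e -> exists n0, forall n m (t : R), (n0 <= n)%N -> (n0 <= m)%N ->
  t0 <= t <= t0 + dur s -> N 2 (Y n t - Y m t) <= e.
elim: s t0 y => [|[a tau] s IH] t0 y hy vy hY e e0 /=.
 have [n0 h] := hy e e0; exists (maxn n0 n1) => n m t.
 rewrite !geq_max => /andP[k1 k2] /andP[k3 k4]; rewrite addr0 => ht.
 have -> : t = t0 by lra.
 have ee : pev (Y n t0 - Y m t0) = pev (y n - y m).
  by apply/funext => x; rewrite !pevB (hY n k2) (hY m k4).
 by rewrite (N_ext 2 ee); exact: h.
have [X hX] := cons_choice hY.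
have uX : ucauchy X tau.
 apply: (@galerkin_cauchy _ nu (ctl a) tau y X n1) => //; first exact: zm_ctl.
  exact: inV_ctl.
 by move=> n hn; have [h1 h2] := vy n hn; have [h3] := hX n hn.
have [T0 _ _ _ _] : gsol n1 nu (ctl a) tau (y n1) (X n1) by have [] := hX n1.
have hc : hcauchy (fun n => X n tau).
 move=> e' e0'; have [n0 h] := uX e' e0'; exists n0 => n m hn hm; apply: h => //.
 by rewrite lexx ltW.
have [n2 h2] := IH (t0 + tau) _ hc (fun n hn => let: And3 (And5 _ _ (conj hV _) _ _) _ _ := hX n hn in hV _)
 (fun n hn => let: And3 _ _ h := hX n hn in h) e e0.
have [n3 h3] := uX e e0.
exists (maxn (maxn n2 n3) n1) => n m t.
rewrite !geq_max => /andP[/andP[a1 a2] a3] /andP[/andP[b1 b2] b3] /andP[t1 t2].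
have [tt|/ltW tt] := leP t (t0 + tau); last by apply: h2; rewrite ?tt -?addrA.
have [_ q1 _] := hX n a3; have [_ q2 _] := hX m b3.
have ht : t0 <= t <= t0 + tau by rewrite t1.
have ee : pev (Y n t - Y m t) = pev (X n (t - t0) - X m (t - t0)).
 by apply/funext => x; rewrite !pevB (q1 t ht) (q2 t ht).
by rewrite (N_ext 2 ee); apply: h3 => //; lra.
Qed.

Definition h2continuous (w : R -> S2 R -> R) (a b : R) := forall t, a <= t <= b ->
 forall d : R, 0 < d -> exists2 r : R, 0 < r &
  forall s, a <= s <= b -> `|s - t| < r -> H2norm (w s - w t) <= d.

Lemma h2continuous_cat w (a b c : R) : a <= b -> b <= c -> h2continuous w a b ->
 h2continuous w b c -> h2continuous w a c.
move=> ab bc h1 h2 t /andP[at_ tc] e e0.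
have [tb|bt|tb] := ltgtP t b.
- have [|b1 b10 hr] := h1 t _ e e0; first by rewrite at_ ltW.
 exists (Num.min b1 (b - t)); first by rewrite lt_min b10 subr_gt0.
 move=> s /andP[s1 s2]; rewrite lt_min => /andP[k1 k2]; apply: hr => //.
 by move: k2; rewrite ltr_norml; lra.
- have [|b1 b10 hr] := h2 t _ e e0; first by rewrite ltW.
 exists (Num.min b1 (t - b)); first by rewrite lt_min b10 subr_gt0.
 move=> s /andP[s1 s2]; rewrite lt_min => /andP[k1 k2]; apply: hr => //.
 by move: k2; rewrite ltr_norml; lra.
- have [|b1 b10 hr] := h1 t _ e e0; first by rewrite at_ tb lexx.
 have [|b2 b20 hr'] := h2 t _ e e0; first by rewrite tb lexx.
 exists (Num.min b1 b2); first by rewrite lt_min b10.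
 move=> s /andP[s1 s2]; rewrite lt_min => /andP[k1 k2].
 have [sb|/ltW sb] := leP s b; first by apply: hr => //; rewrite s1.
 by apply: hr' => //; rewrite sb.
Qed.

Let f k := pev (d k).

Lemma trajectory_solution s t0 (y : nat -> P) (Y : nat -> R -> P) (w : R -> S2 R -> R) :
 hcauchy y -> (forall n, (n1 <= n)%N -> inV n (y n) /\ zm (y n)) ->
 (forall n, (n1 <= n)%N -> trajectory n s t0 (y n) (Y n)) ->
 (forall t, t0 <= t <= t0 + dur s -> H2lim (fun n => Y n t) (w t)) ->
 [/\ 0 <= dur s, h2continuous w t0 (t0 + dur s) & forall g, L2 g ->
  primitive (fun t => l2ip (rhs nu f (control s t0) w t) g) (fun t => l2ip (w t) g)
   t0 (t0 + dur s)].
elim: s t0 y => [|[a tau] s IH] t0 y hy vy hY hw /=.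
 rewrite addr0; split => //.
  move=> t ht e e0; exists 1 => // s hs _.
  have -> : s = t by lra.
  have [K [K0 hK]] := H2norm_lim R.
  have ht' : t0 <= t <= t0 + dur [::] by rewrite addr0.
  have h := H2limB (hw t ht') (hw t ht').
  have := hK _ _ 0 0%N h; rewrite mulr0 => /(_ _)/le_trans; apply; last nneg.
  by move=> n; rewrite subrr N0.
 move=> g Lg; split.
  rewrite set_itvoc0; exact: integrable_set0.
 move=> t ht; have -> : t = t0 by lra.
 by rewrite subrr set_itvoc0 Rintegral_set0.
have [X hX] := cons_choice hY.
have uX : ucauchy X tau.
 apply: (@galerkin_cauchy _ nu (ctl a) tau y X n1) => //; first exact: zm_ctl.
  exact: inV_ctl.
 by move=> n hn; have [h1 h2] := vy n hn; have [h3] := hX n hn.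
have [T0 _ _ _ _] : gsol n1 nu (ctl a) tau (y n1) (X n1) by have [] := hX n1.
have hc : hcauchy (fun n => X n tau).
 move=> e' e0'; have [n0 h] := uX e' e0'; exists n0 => n m hn hm; apply: h => //.
 by rewrite lexx ltW.
have Tt : t0 + tau + dur s = t0 + dur ((a, tau) :: s) by rewrite addrA.
have T0' : t0 <= t0 + tau by rewrite lerDl ltW.
have [|||D0 c2 p2] := IH (t0 + tau) (fun n => X n tau) hc.
- by move=> n hn; have [[_ _ [hV]]] := hX n hn.
- by move=> n hn; have [] := hX n.
- move=> t /andP[t1 t2]; apply: hw; rewrite (le_trans T0' t1) -Tt; exact: t2.
have D0' : t0 + tau <= t0 + tau + dur s by rewrite lerDl.
have hw1 t : t0 <= t <= t0 + tau -> H2lim (fun n => Y n t) (w t).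
 by move=> /andP[t1 t2]; apply: hw; rewrite t1 -Tt; exact: le_trans t2 _.
have hX1 n hn := let: And3 h _ _ := hX n hn in h.
have hZ n t (hn : (n1 <= n)%N) : t0 <= t <= t0 + tau -> pev (Y n t) = pev (X n (t - t0)).
 by have [_ h _] := hX n hn; exact: h.
have c1 := piece_continuous hX1 uX hZ hw1.
have p1 := piece_primitive nu0 (inV_ctl a (leqnn n1)) hX1 hy uX hZ hw1.
rewrite -[tau + dur s]/(dur ((a, tau) :: s)) -Tt; split.
- nneg.
- exact: h2continuous_cat c2.
move=> g Lg; apply: (primitive_cat T0' D0').
 apply: primitive_ext (p1 g Lg) => t /andP[t1 t2]; congr l2ip.
 congr (_ + _); apply/funext => x; rewrite fct_sumE.
 rewrite pev_sum; apply: eq_bigr => k _.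
 by rewrite t2 pevZ.
apply: primitive_ext (p2 g Lg) => t /andP[t1 t2]; congr l2ip.
congr (_ + _); apply/funext => x; rewrite !fct_sumE; apply: eq_bigr => k _.
by rewrite leNgt t1.
Qed.

(** Transfers to the full equation whatever one program achieves in all large dimensions; the values
    of [z] below [n1] are fixed only to have a total sequence. *)
Theorem run_attainable s T (y z : nat -> P) phi : 0 < T -> dur s = T -> H2lim y phi ->
 (forall n, inV n (y n)) ->
 (forall n, (n1 <= n)%N -> run n s (y n) (z n)) -> (forall n, (n < n1)%N -> z n = 0) ->
 exists2 h, attainable nu T f phi h & H2lim z h.
move=> T0 dT hy vy hr hz; have [zy hc ly] := hy.
have [Y hY] : exists Y : nat -> R -> P, forall n, [/\ (n1 <= n)%N -> trajectory n s 0 (y n) (Y n),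
  pev (Y n T) = pev (z n) & forall t, zm (Y n t)].
 have h n : exists Y, [/\ (n1 <= n)%N -> trajectory n s 0 (y n) Y,
  pev (Y T) = pev (z n) & forall t, zm (Y t)]; last first.
  by have [Y hY] := choice h; exists Y.
 have [hn|hn] := leqP n1 n; last by exists (fun=> 0); rewrite hz//; split => // _; exact: zm0.
 have [Y [h1 h2 h3]] := run_trajectory 0 (vy n) (zy n) (hr n hn).
 by exists Y; move: h2; rewrite add0r dT.
have tY n (hn : (n1 <= n)%N) : trajectory n s 0 (y n) (Y n) by have [h _ _] := hY n; exact: h.
have uY := trajectory_cauchy hc (fun n _ => conj (vy n) (zy n)) tY.
have [w hw] : exists w : R -> S2 R -> R, forall t, 0 <= t <= 0 + dur s -> H2lim (fun n => Y n t) (w t).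
 have h t : exists w, 0 <= t <= 0 + dur s -> H2lim (fun n => Y n t) w; last first.
  by have [w hw] := choice h; exists w.
 have [ht|ht] := boolP (0 <= t <= 0 + dur s); last by exists 0.
 have [|h hh] := @H2lim_exists R (fun n => Y n t) (fun n => let: And3 _ _ h := hY n in h t).
  by move=> e e0; have [n0 h0] := uY e e0; exists n0 => n m hn hm; exact: h0.
 by exists h.
have [_ c p] := trajectory_solution hc (fun n _ => conj (vy n) (zy n)) tY hw.
rewrite dT add0r in hw c p.
have I t : t \in `[0, T] -> 0 <= t <= T by [].
have h0 : 0 <= (0 : R) <= T by rewrite lexx ltW.
have hT : 0 <= T <= T by rewrite lexx ltW.
have w0 : w 0 = phi %[ae (@area R)].
 have [_ _ l0] := hw 0 h0; apply: (l2lim_uniq l0).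
 have : l2lim (fun n => y n) phi by [].
 move=> [Lp lp]; split => // e e0; have [n0 h] := lp e e0; exists (maxn n0 n1) => n.
 by rewrite geq_max => /andP[/h k1 /tY/trajectory_start ->].
exists (w T); last first.
 have [zY cY lY] := hw T hT.
 have e n : pev (Y n T) = pev (z n) by have [] := hY n.
 split.
 - by move=> n; exact: zm_ext.
 - move=> b b0; have [n0 h] := cY b b0; exists n0 => n m hn hm.
  have ee : pev (z n - z m) = pev (Y n T - Y m T) by apply/funext => x; rewrite !pevB !e.
  by rewrite (N_ext 2 ee); exact: h.
 - exact: l2lim_ext lY.
exists (control s 0), w; split => //.
 split; first exact: measurable_funTS (control_measurable _ _ _).
 by have [M hM] := control_bounded s 0 k; exists M; apply: aeW => t.
split => //.
- by move=> t /I/hw/H2lim_H2.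
- move=> t /I ht; apply/cvgrPdist_le => e e0; have [b b0 hb] := c t ht e e0.
 exists b => //= u hu /I uT.
 rewrite sub0r normrN ger0_norm ?sqrtr_ge0//; apply: hb => //.
 by rewrite distrC.
- move=> t /I ht g Lg; have [i /(_ t ht) E] := p g Lg.
 have Lw0 : L2 (w 0) by have [_ _ []] := hw 0 h0.
 rewrite -(ae_l2ip Lw0 ly.1 Lg w0) -[LHS](subrK (l2ip (w 0) g)) E addrC; congr (_ _).
 apply: Rintegral_itv_obnd_cbnd.
 by apply: integrableS i => //; apply: subset_itvl; case/andP: ht.
Qed.

End programs.

(** * Residuals along large data *)

Section smooth_estimates.
Context (R : realType).
Notation P := (pol R).
Notation csup := (@csup R).
Implicit Types (p q h w u : P).

Lemma N0_bk_invl p q : zm p -> N 0 (bk (invl p) q) <= csup * (N 1 p * N 1 q).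
by move=> zp; apply: (le_trans (N_bk31 _ _)); rewrite N_invl// mulrA. Qed.
Lemma N2_bk_invl p q : zm p -> zm q -> N 2 (bk (invl p) q) <= 4 * (csup * (N 2 p * N 3 q)).
move=> zp zq; have c0 := csup_ge0 R; apply: (le_trans (lapp_bk_le _ _)).
have ei := lapp_invl zp.
have n0 : N 0 (bk (lapp (invl p)) q) = N 0 (bk p q) by apply: N_ext; exact: pev_bkl.
have a1 : N 0 (bk (lapp (invl p)) q) <= csup * (N 2 p * N 3 q).
 rewrite n0; apply: (le_trans (N_bk13 _ _)); rewrite -mulrA; apply: (ler_wpM2l c0).
 by apply: ler_wpM2r => //; exact: N_zm_le.
have a2 : N 0 (bk (invl p) (lapp q)) <= csup * (N 2 p * N 3 q).
 apply: (le_trans (N_bk31 _ _)); rewrite -mulrA; apply: (ler_wpM2l c0).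
 rewrite N_invl// (N_lapp 1); apply: ler_wpM2r => //; exact: N_zm_le.
have a3 : csup * (N 4 (invl p) * N 2 q) <= csup * (N 2 p * N 3 q).
 by apply: (ler_wpM2l c0); rewrite N_invl// ler_wpM2l//; exact: N_zm_le.
have G (x y z b : R) : x <= b -> y <= b -> z <= b -> x + y + 2 * z <= 4 * b by lra.
rewrite (_ : 2 * csup * N 4 (invl p) * N 2 q = 2 * (csup * (N 4 (invl p) * N 2 q))); last by ring.
exact: G.
Qed.

Lemma eulerD p q : pev (euler (p + q)) =
 pev (euler p + (bk (invl p) q + bk (invl q) p) + euler q).
have e : pev (euler (p + q)) = pev (bk (invl p + invl q) (p + q)).
 by apply: pev_bkl; exact: invlD.
apply/funext => x; rewrite e bkDl !bkDr /euler.
have G (a b c d : P) : a + b + (c + d) = a + (b + c) + d by ring.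
by rewrite G.
Qed.

Lemma eulerZ (a : R) p : pev (euler (a *: p)) = pev (a ^+ 2 *: euler p).
have e : pev (euler (a *: p)) = pev (bk (a *: invl p) (a *: p)).
 by apply: pev_bkl; exact: invlZ.
by rewrite e bkZl bkZr scalerA.
Qed.

Lemma zm_euler p : zm (euler p). exact: zm_bk. Qed.

(* The part of the field along [a *: h + w] that is not of top order in [a]. *)
Lemma residual_le (a mu : R) h w : 0 <= a -> 0 <= mu -> zm h -> zm w ->
 N 2 (euler (a *: h + w) + mu *: lapp (a *: h + w) - a ^+ 2 *: euler h) <=
 a * (8 * csup * N 4 h * N 4 w) + 4 * csup * N 4 w ^+ 2 + mu * (a * N 4 h + N 4 w).
move=> a0 mu0 zh zw; have c0 := csup_ge0 R.
set x := _ - _; pose x1 := bk (invl (a *: h)) w + bk (invl w) (a *: h).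
have e : pev x = pev (x1 + euler w + mu *: lapp (a *: h + w)).
 apply/funext => z; rewrite pevB pevD (eulerD (a *: h) w) !pevD (eulerZ a h).
 by ring.
have zah : zm (a *: h) by exact: zmZ.
have nah k : N k (a *: h) = a * N k h by rewrite NZ ger0_norm.
have hh : N 3 h <= N 4 h by exact: N_zm_le.
have hw : N 3 w <= N 4 w by exact: N_zm_le.
have hh2 : N 2 h <= N 4 h by exact: N_zm_le.
have hw2 : N 2 w <= N 4 w by exact: N_zm_le.
have b1 : N 2 (bk (invl (a *: h)) w) <= 4 * csup * (a * (N 4 h * N 4 w)).
 apply: (le_trans (N2_bk_invl zah zw)); rewrite nah -!mulrA.
 apply: ler_wpM2l => //; apply: (ler_wpM2l c0); apply: (ler_wpM2l a0).
 by apply: ler_pM.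
have b2 : N 2 (bk (invl w) (a *: h)) <= 4 * csup * (a * (N 4 h * N 4 w)).
 apply: (le_trans (N2_bk_invl zw zah)); rewrite nah -!mulrA.
 apply: ler_wpM2l => //; apply: (ler_wpM2l c0); rewrite mulrCA; apply: (ler_wpM2l a0).
 by rewrite [leRHS]mulrC; apply: ler_pM.
have b3 : N 2 (euler w) <= 4 * csup * (N 4 w ^+ 2).
 apply: (le_trans (N2_bk_invl zw zw)); rewrite -!mulrA expr2.
 by apply: ler_wpM2l => //; apply: (ler_wpM2l c0); apply: ler_pM.
have b4 : N 2 (mu *: lapp (a *: h + w)) <= mu * (a * N 4 h + N 4 w).
 rewrite NZ ger0_norm// (N_lapp 2); apply: (ler_wpM2l mu0).
 by rewrite -nah; exact: ND.
rewrite (N_ext 2 e); apply: ND_le; apply: lerD => //.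
apply: ND_le; apply: lerD => //.
apply: ND_le; apply: (le_trans (lerD b1 b2)).
have G (c k m n : R) : 4 * c * (k * (m * n)) + 4 * c * (k * (m * n)) = k * (8 * c * m * n) by ring.
by rewrite G.
Qed.

(** Expansion in powers of [a] of the linearized field of [residual_diff_le]; there [i], [i'], [j],
    [k] are the stream functions of [h], [h'], [w], [x']. *)
Lemma bk_expand (a : R) (i i' j k h h' x w : P) y :
 a * (pev (bk (i - i') x) y + pev (bk k (h - h')) y + pev (bk j h) y + pev (bk i' w) y)
  + pev (bk j x) y + pev (bk k w) y + a ^+ 2 * pev (bk i h - bk i' h') y =
 pev (bk (a *: (i - i') + j) (a *: h + x)) y + pev (bk (a *: i' + k) (a *: (h - h') + w)) y.
rewrite !bkDl !bkDr !bkZl !bkZr !bkDl !bkDr !bkNl !bkNr !(pevD,pevN,pevZ).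
move: (pev (bk i h) y) (pev (bk i' h) y) (pev (bk i' h') y) (pev (bk i x) y) (pev (bk i' x) y).
move: (pev (bk i' w) y) (pev (bk j h) y) (pev (bk j x) y) (pev (bk k h) y) (pev (bk k h') y) (pev (bk k w) y).
by move=> *; ring.
Qed.

(* Linearized counterpart of [residual_le], for the difference of two
  trajectories [a *: h + x] and [a *: h' + x'], tested in negative norm. *)
Lemma residual_diff_le (a mu : R) h h' x x' w g : 0 <= a -> 0 <= mu -> zm h -> zm h' -> zm x ->
 zm x' -> zm w ->
 `|ip (bk (invl (a *: (h - h') + w)) (a *: h + x) + bk (invl (a *: h' + x')) (a *: (h - h') + w)
   + mu *: lapp (a *: (h - h') + w) - a ^+ 2 *: (euler h - euler h')) g| <=
 (a * (csup * (N 2 (h - h') * (N 2 x + N 2 x') + N 2 w * (N 2 h + N 2 h')))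
  + csup * (N 2 w * (N 2 x + N 2 x')) + mu * (a * N 2 (h - h') + N 2 w)) * N 1 g.
move=> a0 mu0 zh zh' zx zx' zw; have c0 := csup_ge0 R.
set z := _ - _; set K := (X in _ <= X * _).
have zD := zmB zh zh'.
have zz : zm z.
 apply: zmB; last by apply: zmZ; apply: zmB; exact: zm_bk.
 apply: zmD; last by apply: zmZ; exact: zm_lapp.
 by apply: zmD; exact: zm_bk.
suff NK : N 0 z <= K.
 have := sip1_invl g zz; move=> /(congr1 -%R); rewrite opprK => <-; rewrite normrN.
 apply: (le_trans (sip_le _ _ _)); apply: ler_wpM2r => //; apply: le_trans NK.
 rewrite -(N_invl 0 zz); exact: (N_zm_le (zm_invl z) (isT : (1 <= 2)%N)).
pose z1 := bk (invl (h - h')) x + bk (invl x') (h - h') + bk (invl w) h + bk (invl h') w.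
pose z2 := bk (invl w) x + bk (invl x') w.
have e : pev z = pev (a *: z1 + z2 + mu *: lapp (a *: (h - h') + w)).
 have i1 : pev (invl (a *: (h - h') + w)) = pev (a *: (invl h - invl h') + invl w).
  apply/funext => y; rewrite invlD !pevD invlZ !pevZ; congr (_ * _ + _).
  by rewrite invlB.
 have i2 : pev (invl (a *: h' + x')) = pev (a *: invl h' + invl x').
  by apply/funext => y; rewrite invlD !pevD invlZ.
 have i3 : pev (invl (h - h')) = pev (invl h - invl h') by exact: invlB.
 apply/funext => y; rewrite /z1 /z2 (pevB _ (a ^+ 2 *: _)) (pevD _ (mu *: _)) (pevD (bk _ _)).
 rewrite (pev_bkl _ i1) (pev_bkl _ i2) (pevD _ (mu *: _)) -(bk_expand a _ _ _ _ _ _ _ _ y).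
 rewrite (pevD (a *: _)) (pevZ a) 3!(pevD _ (bk _ _)) (pev_bkl _ i3) (pevD (bk _ _)).
 rewrite (pevZ (a ^+ 2)) (pevD (bk (invl w) x)) /euler (pevD (bk (invl h) h)).
 by ring.
have b1 p q (m k : R) : zm p -> zm q -> N 2 p <= m -> N 2 q <= k ->
  N 0 (bk (invl p) q) <= csup * (m * k).
 move=> zp zq hm hk; apply: (le_trans (N0_bk_invl q zp)); apply: (ler_wpM2l c0).
 apply: ler_pM => //; first exact: (le_trans (N_zm_le zp (isT : (1 <= 2)%N)) hm).
 exact: (le_trans (N_zm_le zq (isT : (1 <= 2)%N)) hk).
have g1 : N 0 z1 <= csup * (N 2 (h - h') * (N 2 x + N 2 x') + N 2 w * (N 2 h + N 2 h')).
 have t1 := b1 _ _ _ _ zD zx (lexx _) (lexx _); have t2 := b1 _ _ _ _ zx' zD (lexx _) (lexx _).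
 have t3 := b1 _ _ _ _ zw zh (lexx _) (lexx _); have t4 := b1 _ _ _ _ zh' zw (lexx _) (lexx _).
 have u1 := ND 0 (bk (invl (h - h')) x + bk (invl x') (h - h') + bk (invl w) h) (bk (invl h') w).
 have u2 := ND 0 (bk (invl (h - h')) x + bk (invl x') (h - h')) (bk (invl w) h).
 have u3 := ND 0 (bk (invl (h - h')) x) (bk (invl x') (h - h')).
 have G (c k m n o q s1 s2 s3 s4 v1 v2 v3 : R) : s1 <= c * (k * m) -> s2 <= c * (n * k) -> 
  s3 <= c * (o * q) -> s4 <= c * (v3 * o) -> v1 <= v2 + s4 -> v2 <= s1 + s2 + s3 ->
  v1 <= c * (k * (m + n) + o * (q + v3)).
  rewrite (_ : c * (k * (m + n) + o * (q + v3)) =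
   c * (k * m) + c * (n * k) + c * (o * q) + c * (v3 * o)); last by ring.
  by move: (c * _) (c * _) (c * _) (c * _) => *; lra.
 by apply: G t1 t2 t3 t4 u1 _; apply: (le_trans u2); rewrite lerD2r.
have g2 : N 0 z2 <= csup * (N 2 w * (N 2 x + N 2 x')).
 have t1 := b1 _ _ _ _ zw zx (lexx _) (lexx _); have t2 := b1 _ _ _ _ zx' zw (lexx _) (lexx _).
 apply: ND_le; rewrite mulrDr mulrDr [N 2 w * N 2 x']mulrC; exact: lerD.
have g3 : N 0 (mu *: lapp (a *: (h - h') + w)) <= mu * (a * N 2 (h - h') + N 2 w).
 rewrite NZ ger0_norm// (N_lapp 0); apply: (ler_wpM2l mu0); apply: ND_le.
 by rewrite NZ ger0_norm.
rewrite (N_ext 0 e); apply: ND_le; apply: lerD => //.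
apply: ND_le; apply: lerD => //.
by rewrite NZ ger0_norm//; apply: (ler_wpM2l a0).
Qed.

End smooth_estimates.

(** Bounds the factor found in [residual_diff_le] by [a * (r2 * m)]; the condition [1 <= a] absorbs
    the terms of order zero in [a]. *)
Lemma kick_arith (R : realFieldType) (a nu c H Qx m del x x' w h h' : R) : 1 <= a -> 0 <= nu ->
 0 <= c -> 0 <= H -> 0 <= Qx -> 0 <= m -> 0 <= del -> 0 <= x -> 0 <= x' -> 0 <= w -> 0 <= h ->
 0 <= h' -> del <= H * m -> w <= (1 + 2 * H) * m -> x <= Qx -> x' <= Qx -> h <= H -> h' <= H ->
 a * (c * (del * (x + x') + w * (h + h'))) + c * (w * (x + x')) + nu * (a * del + w) <=
 a * ((c * (2 * (H * Qx) + 2 * (1 + 2 * H) * H + 2 * (1 + 2 * H) * Qx) + nu * (1 + 3 * H)) * m).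
move=> a1 nu0 c0 H0 Q0 m0 d0 x0 x0' w0 h0 h0' dm wm xQ xQ' hH hH'.
have a0 : 0 <= a := le_trans ler01 a1.
have s1 : x + x' <= 2 * Qx by lra.
have s2 : h + h' <= 2 * H by lra.
have t1 : del * (x + x') <= H * m * (2 * Qx) by apply: ler_pM => //; nneg.
have t2 : w * (h + h') <= (1 + 2 * H) * m * (2 * H) by apply: ler_pM => //; nneg.
have t3 : w * (x + x') <= (1 + 2 * H) * m * (2 * Qx) by apply: ler_pM => //; nneg.
have u1 := ler_wpM2l a0 (ler_wpM2l c0 (lerD t1 t2)).
have H2 : 0 <= (1 + 2 * H) * m by lra.
have u2 : c * (w * (x + x')) <= a * (c * ((1 + 2 * H) * m * (2 * Qx))).
 apply: (le_trans (ler_wpM2l c0 t3)); rewrite ler_peMl// mulr_ge0// mulr_ge0//.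
 nneg.
have u3 : nu * (a * del + w) <= a * (nu * (H * m + (1 + 2 * H) * m)).
 rewrite mulrCA; apply: (ler_wpM2l nu0); rewrite mulrDr; apply: lerD; first exact: ler_wpM2l.
 by apply: (le_trans wm); rewrite ler_peMl.
apply: (le_trans (lerD (lerD u1 u2) u3)); rewrite le_eqVlt; apply/orP; left; apply/eqP; ring.
Qed.

(** * Steering steps, their composition and the basic kick *)

Section shifts.
Context (R : realType).
Notation P := (pol R).
Notation csup := (@csup R).
Variables (nu : R) (r n1 : nat) (d : 'I_r -> P).
Hypotheses (nu0 : 0 <= nu) (hd : forall k, inV n1 (d k)) (zd : forall k, zm (d k)).
Notation program := (program R r).
Notation run := (run nu d).
Notation nrm_ := (fun x : P => N 1 (invl x)).

Lemma run_inV n s y z : inV n y -> zm y -> run n s y z -> inV n z /\ zm z.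
elim: s y => [|[a tau] s IH] y hy zy /=; first by move=> ->.
by move=> [X [[_ _ [hX _] _ _] /IH]]; apply; [exact: (hX tau).1|exact: (hX tau).2].
Qed.

Lemma run_cat n s s' y z : run n (s ++ s') y z <-> exists x, run n s y x /\ run n s' x z.
elim: s y => [|[a tau] s IH] y /=.
 by split => [h|[x [-> h]]]; [exists y|].
split => [[X [hX /IH[x [h1 h2]]]]|[x [[X [hX h1]] h2]]].
 by exists x; split => //; exists X.
by exists X; split => //; apply/IH; exists x.
Qed.

Lemma dur_cat (s s' : program) : dur (s ++ s') = dur s + dur s'.
by elim: s => [|[a tau] s IH] /=; rewrite ?add0r// IH addrA. Qed.
Lemma inVD n (p q : P) : inV n p -> inV n q -> inV n (p + q).
by move=> hq; rewrite -[p]scale1r; exact: inV_lin. Qed.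
Lemma inVB n (p q : P) : inV n p -> inV n q -> inV n (p - q).
by move=> hp hq; rewrite addrC -scaleN1r; exact: inV_lin. Qed.
Lemma neg_le (x : P) : zm x -> N 1 (invl x) <= N 2 x.
move=> zx; apply: (le_trans (N_zm_le (zm_invl x) (isT : (1 <= 2)%N))).
by rewrite N_invl//; exact: N_zm_le.
Qed.

Lemma negD (x y : P) : N 1 (invl (x + y)) <= N 1 (invl x) + N 1 (invl y).
by rewrite (N_ext 1 (invlD x y)); exact: ND. Qed.

Section families.
Variables (A : Type) (Pr : A -> Prop) (ds : A -> A -> R).
Hypothesis ds0 : forall p p', 0 <= ds p p'.

(* Steering by the program [pi p] takes a neighbourhood of [E0 p] to a
  neighbourhood of [E1 p], nearly as the translation by [E1 p - E0 p] would do
  on smooth perturbations [t], and nearly so in the variable [p] too. *)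
Definition shift C n0 K Rd e (pi : A -> program) (E0 E1 : A -> P) : Prop :=
 forall n, (n0 <= n)%N ->
 [/\ forall p y, Pr p -> inV n y -> zm y -> N 2 (y - E0 p) <= Rd -> exists z, run n (pi p) y z,
   forall p y z t, Pr p -> inV n y -> zm y -> N 2 (y - E0 p) <= Rd -> run n (pi p) y z ->
    inV K t -> zm t -> N 2 t <= Rd ->
    N 2 (z - E1 p - t) <= C * N 2 (y - E0 p - t) + e &
   forall p p' y y' z z' t, Pr p -> Pr p' -> inV n y -> zm y -> N 2 (y - E0 p) <= Rd ->
    inV n y' -> zm y' -> N 2 (y' - E0 p') <= Rd ->
    run n (pi p) y z -> run n (pi p') y' z' -> inV K t -> zm t ->
    N 1 (invl (z - z' - (E1 p - E1 p') - t)) <=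
    C * N 1 (invl (y - y' - (E0 p - E0 p') - t)) + e * (ds p p' + N 2 t)].

(** A family of smooth states, of bounded degree, that is bounded and Lipschitz in the parameter. *)
Definition regular K B (E : A -> P) : Prop := forall p, Pr p ->
 [/\ inV K (E p), zm (E p), N 2 (E p) <= B &
  forall p', Pr p' -> N 2 (E p - E p') <= B * ds p p'].

(** The same smooth perturbation [t] accompanies both legs. The radius [R2] holds the intermediate
    states, and the second factor multiplies the first error. *)
Lemma shift_comp C1 C2 m1 m2 K Rd R2 (e1 e2 : R) pi1 pi2 E0 E1 E2 : 0 <= C1 -> 0 <= C2 -> 0 < Rd ->
 Rd <= R2 -> C1 * Rd + e1 <= R2 -> shift C1 m1 K Rd e1 pi1 E0 E1 -> shift C2 m2 K R2 e2 pi2 E1 E2 ->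
 shift (C2 * C1) (maxn m1 m2) K Rd (C2 * e1 + e2) (fun p => pi1 p ++ pi2 p) E0 E2.
move=> c1 c2 rd r12 r2 s1 s2 n; rewrite geq_max => /andP[n1' n2'].
have [x1 x2 x3] := s1 n n1'; have [y1 y2 y3] := s2 n n2'.
have mid p y x : Pr p -> inV n y -> zm y -> N 2 (y - E0 p) <= Rd -> run n (pi1 p) y x ->
  [/\ inV n x, zm x & N 2 (x - E1 p) <= R2].
 move=> hp vy zy hy hr; have [vx zx] := run_inV vy zy hr; split => //.
 have := x2 p y x 0 hp vy zy hy hr (inV0 R K) (zm0 R); rewrite !subr0 N0 => /(_ (ltW rd)).
 move/le_trans; apply; apply: le_trans r2; rewrite lerD2r; exact: ler_wpM2l.
split.
- move=> p y hp vy zy hy; have [x hx] := x1 p y hp vy zy hy.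
 have [vx zx h] := mid p y x hp vy zy hy hx; have [z hz] := y1 p x hp vx zx h.
 by exists z; apply/run_cat; exists x.
- move=> p y z t hp vy zy hy /run_cat[x [hx hz]] vt zt ht.
 have [vx zx h] := mid p y x hp vy zy hy hx.
 have := x2 p y x t hp vy zy hy hx vt zt ht.
 have := y2 p x z t hp vx zx h hz vt zt (le_trans ht r12).
 move: (N 2 _) (N 2 _) (N 2 _) => a b b' h1 h2; apply: (le_trans h1).
 by rewrite addrA lerD2r -mulrA -mulrDr; exact: ler_wpM2l.
move=> p p' y y' z z' t hp hp' vy zy hy vy' zy' hy' /run_cat[x [hx hz]] /run_cat[x' [hx' hz']] vt zt.
have [vx zx h] := mid p y x hp vy zy hy hx; have [vx' zx' h'] := mid p' y' x' hp' vy' zy' hy' hx'.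
have := x3 p p' y y' x x' t hp hp' vy zy hy vy' zy' hy' hx hx' vt zt.
have := y3 p p' x x' z z' t hp hp' vx zx h vx' zx' h' hz hz' vt zt.
move: (N 1 _) (N 1 _) (N 1 _) (ds p p' + _) => a b b' k h1 h2; apply: (le_trans h1).
by rewrite mulrDl addrA lerD2r -!mulrA -mulrDr; exact: ler_wpM2l.
Qed.

(** A perturbation [t] around [E0 + F] is a perturbation [t + F] around [E0], which is what the
    freedom of [t] in [shift] is for. *)
Lemma shift_translate C m K K' Rd B (e : R) pi E0 E1 F : (K <= K')%N -> 0 <= e -> 0 <= B ->
 regular K' B F -> shift C m K' (Rd + B) e pi E0 E1 ->
 shift C m K Rd (e * (1 + B)) pi (fun p => E0 p + F p) (fun p => E1 p + F p).
move=> KK e0 B0 rF s n hn; have [x1 x2 x3] := s n hn.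
have near p y : Pr p -> N 2 (y - (E0 p + F p)) <= Rd -> N 2 (y - E0 p) <= Rd + B.
 move=> hp h; have [_ _ hF _] := rF p hp.
 rewrite (_ : y - E0 p = (y - (E0 p + F p)) + F p); last by rewrite opprD addrA subrK.
 by apply: ND_le; exact: lerD.
have sub (a b c t : P) : a - (b + c) - t = a - b - (t + c) by ring.
have sub2 (a a' b b' c c' t : P) : a - a' - (b + c - (b' + c')) - t = a - a' - (b - b') - (t + (c - c')) by ring.
split.
- by move=> p y hp vy zy hy; apply: x1 => //; exact: near.
- move=> p y z t hp vy zy hy hr vt zt ht; have [vF zF hF _] := rF p hp.
 rewrite !sub; apply: (le_trans (x2 p y z (t + F p) hp vy zy (near _ _ hp hy) hr _ _ _)).
 + by apply: inVD => //; exact: inV_le vt.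
 + exact: zmD.
 + by apply: ND_le; exact: lerD.
 + by rewrite lerD2l ler_peMr// lerDl.
move=> p p' y y' z z' t hp hp' vy zy hy vy' zy' hy' hr hr' vt zt.
have [vF zF hF hL] := rF p hp; have [vF' zF' hF' _] := rF p' hp'.
rewrite !sub2; apply: (le_trans (x3 p p' y y' z z' _ hp hp' vy zy (near _ _ hp hy) vy' zy' (near _ _ hp' hy') hr hr' _ _)).
- apply: inVD; first exact: inV_le vt.
 exact: inVB.
- by apply: zmD => //; exact: zmB.
rewrite lerD2l -mulrA; apply: ler_wpM2l => //.
have := ND 2 t (F p - F p'); have := hL p' hp'; have := N_ge0 2 t; have := ds0 p p'.
move: (N 2 _) (N 2 _) (N 2 _) (ds p p') => a b c k k0 b0 h1 h2.
have := mulr_ge0 B0 b0; rewrite mulrDl mul1r mulrDr; move: (B * k) (B * c) h1 h2 => f1 f2.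
by lra.
Qed.

Lemma shift_weaken C m K Rd (e eta : R) pi E0 E1 E1' : 0 <= eta ->
 (forall p, Pr p -> zm (E1 p) /\ zm (E1' p)) ->
 (forall p, Pr p -> N 2 (E1 p - E1' p) <= eta) ->
 (forall p p', Pr p -> Pr p' -> N 2 (E1 p - E1' p - (E1 p' - E1' p')) <= eta * ds p p') ->
 shift C m K Rd e pi E0 E1 -> shift C m K Rd (e + eta) pi E0 E1'.
move=> eta0 zE h1 h2 s n hn; have [x1 x2 x3] := s n hn; split => //.
- move=> p y z t hp vy zy hy hr vt zt ht.
 rewrite (_ : z - E1' p - t = (z - E1 p - t) + (E1 p - E1' p)); last by ring.
 apply: ND_le; rewrite addrA; apply: lerD; last exact: h1.
 exact: x2.
move=> p p' y y' z z' t hp hp' vy zy hy vy' zy' hy' hr hr' vt zt.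
have [z1 z1'] := zE p hp; have [z2 z2'] := zE p' hp'.
rewrite (_ : z - z' - (E1' p - E1' p') - t =
 (z - z' - (E1 p - E1 p') - t) + (E1 p - E1' p - (E1 p' - E1' p'))); last by ring.
apply: (le_trans (negD _ _)); rewrite mulrDl addrA; apply: lerD; first exact: x3.
apply: (le_trans (neg_le _)); first by apply: zmB; exact: zmB.
by apply: (le_trans (h2 p p' hp hp')); apply: ler_wpM2l => //; rewrite lerDl.
Qed.

Lemma N4_inV K (t : P) Rd : inV K t -> N 2 t <= Rd -> N 4 t <= lam R K * Rd.
move=> vt ht; apply: (@le_trans _ _ (lam R K * N 2 t)); last by rewrite ler_wpM2l.
apply: sqr_le_norm; first by nneg.
by rewrite exprMn !N_sq; exact: (S_head 2 2 vt).
Qed.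

(* With [a = T^-1/2], a free run of length [T] starting near the large datum
  [a *: h p] moves it by the bounded increment [euler (h p)]. *)
Section kick.
Variables (h : A -> P) (alpha : A -> 'I_r -> R) (M : nat) (H : R).
Let u p := ctl d (alpha p).
Hypotheses (H0 : 0 <= H) (M1 : (n1 <= M)%N).
Hypothesis hM : forall p, Pr p -> [/\ inV M (h p), inV M (euler (h p)) & zm (h p)].
Hypothesis hH : forall p, Pr p -> [/\ N 4 (h p) <= H, N 4 (euler (h p)) <= H & N 4 (u p) <= H].
Hypothesis hL : forall p p', Pr p -> Pr p' -> [/\ N 2 (h p - h p') <= H * ds p p',
 N 2 (euler (h p) - euler (h p')) <= H * ds p p' & N 2 (u p - u p') <= H * ds p p'].

Let uM n p : (M <= n)%N -> inV n (u p). by move=> hn; apply: inV_ctl => //; exact: leq_trans hn. Qed.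
Let zu p : zm (u p). exact: zm_ctl. Qed.

Variables (K : nat) (Rd del : R).
Hypotheses (Rd0 : 0 <= Rd) (del0 : 0 < del) (del1 : del <= 1).
(** As [a ^ 2 * T = 1], the quadratic term has an effect of order one, while terms linear in [a]
    contribute [a * T = del]. [Q] bounds the smooth part of the comparison path, [r1] its residual
    divided by [a], [Qx] the distance of a solution to [a *: h p], and [r2] the Lipschitz constant
    of the residual divided by [a]. *)
Variables T a Q r1 Qx r2 : R.
Hypotheses (TE : T = del ^+ 2) (aE : a = del^-1) (QE : Q = lam R K * Rd + 2 * H).
Hypothesis r1E : r1 = 8 * csup * H * Q + 4 * csup * Q ^+ 2 + nu * (H + Q).
Hypothesis QxE : Qx = 2 * Rd + 4 * r1 + 2 * H.
Hypothesis r2E : r2 =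
 csup * (2 * (H * Qx) + 2 * (1 + 2 * H) * H + 2 * (1 + 2 * H) * Qx) + nu * (1 + 3 * H).
Hypothesis small1 : 512 * csup * (del * (H + Rd + H + Q)) <= 1.

(** The control is scaled by [T^-1], so that it contributes [u p] in total. *)
Let pi p : program := [:: (fun k => T^-1 * alpha p k, T)].
Let v p := T^-1 *: u p.
Let D p := a ^+ 2 *: euler (h p) + v p.

Let T0 : 0 < T. by rewrite TE exprn_gt0. Qed.
Let a0 : 0 < a. by rewrite aE invr_gt0. Qed.
Let aT : a ^+ 2 * T = 1.
by rewrite aE TE -exprMn mulVf ?expr1n// gt_eqF. Qed.
Let a1 : 1 <= a. by rewrite aE -[1]invr1 lef_pV2 ?posrE. Qed.
Let Ta : T * a = del. by rewrite TE aE mulfK// gt_eqF. Qed.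
Let Tdel : T <= del. by rewrite TE ler_piMr// ltW. Qed.
Let DE p : D p = T^-1 *: (euler (h p) + u p).
by rewrite scalerDr; congr (_ *: _ + _); rewrite -[LHS](mulfK (lt0r_neq0 T0)) aT mul1r. Qed.
Let ctlE p : ctl d (fun k => T^-1 * alpha p k) = v p.
by rewrite /v scaler_sumr; apply: eq_bigr => k; rewrite scalerA. Qed.
Let runE n p y z : run n (pi p) y z <-> exists2 X, gsol n nu (v p) T y X & z = X T.
rewrite /= ctlE; split; first by move=> [X [hX ->]]; exists X.
by move=> [X hX ->]; exists X.
Qed.

Let c0 : 0 <= csup := csup_ge0 R.
Let Q0 : 0 <= Q. by rewrite QE addr_ge0// mulr_ge0. Qed.
Let r10 : 0 <= r1.
have e1 : 0 <= 8 * csup * H * Q by nneg.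
have e2 : 0 <= 4 * csup * Q ^+ 2 by nneg.
have e3 : 0 <= nu * (H + Q) by nneg.
by rewrite r1E; lra.
Qed.
Let Qx0 : 0 <= Qx. by rewrite QxE; move: r10 Rd0 H0; lra. Qed.

Let near_le p y : Pr p -> N 2 (y - a *: h p) <= Rd -> N 2 y <= a * H + Rd.
move=> hp hy; have [hh _ _] := hH hp; have [_ _ zh] := hM hp.
rewrite -[y](subrK (a *: h p)) addrC; apply: ND_le; apply: lerD => //.
rewrite NZ ger0_norm ?(ltW a0)//; apply: (ler_wpM2l (ltW a0)).
exact: (le_trans (N_zm_le zh (isT : (2 <= 4)%N)) hh).
Qed.

Let exist n p y : (M <= n)%N -> Pr p -> inV n y -> zm y -> N 2 (y - a *: h p) <= Rd ->
 exists X, gsol n nu (v p) T y X.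
move=> hn hp vy zy hy; apply: gsol_exists => //.
- by apply: inVZ; exact: uM.
- exact: zmZ.
have [_ _ hu] := hH hp.
rewrite /small; apply: le_trans small1; rewrite -(mulrA _ T).
have k512 : 0 <= 512 * csup by nneg.
apply: (ler_wpM2l k512).
rewrite NZ ger0_norm ?invr_ge0 ?(ltW T0)// (mulrA T) mulfV ?gt_eqF// mul1r.
have e1 := near_le hp hy.
have e2 : N 2 (u p) <= H := le_trans (N_zm_le (zu p) (isT : (2 <= 4)%N)) hu.
apply: (le_trans (ler_wpM2l (ltW T0) (lerD e1 e2))).
rewrite !mulrDr mulrA Ta -!mulrDr -!addrA !mulrDr lerD2l.
have := ler_wpM2r Rd0 Tdel; have := ler_wpM2r H0 Tdel; have := mulr_ge0 (ltW del0) Q0.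
by move: (T * Rd) (T * H) (del * _) (del * _) (del * _) => *; lra.
Qed.

Let affineE p t s : affine (t + a *: h p) (D p) s = a *: h p + (t + s *: D p).
by rewrite /affine; ring. Qed.
Let N4sD p s : Pr p -> 0 <= s <= T -> N 4 (s *: D p) <= 2 * H.
move=> hp /andP[s0 sT]; have [_ he hu] := hH hp.
rewrite DE scalerA NZ ger0_norm; last by nneg.
have k1 : s * T^-1 <= 1 by rewrite ler_pdivrMr// mul1r.
have k2 := ND 4 (euler (h p)) (u p).
apply: (@le_trans _ _ (1 * N 4 (euler (h p) + u p))); first exact: ler_wpM2r.
by rewrite mul1r; apply: (le_trans k2); lra.
Qed.

(** The comparison path starts at [a *: h p + t]; its slope [D p] is the top-order Euler term plus
    the control, so only terms of lower order in [a] remain as residual. *)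
Let closeA n p y X t s : (M <= n)%N -> (K <= n)%N -> Pr p -> inV n y -> zm y ->
 gsol n nu (v p) T y X -> inV K t -> zm t -> N 2 t <= Rd -> 0 <= s <= T ->
 N 2 (X s - (a *: h p + (t + s *: D p))) <= 2 * N 2 (y - (t + a *: h p)) + 4 * (del * r1).
move=> hn hK hp vy zy hX vt zt ht hs.
have [vh ve zh] := hM hp; have [nh ne nu_] := hH hp.
have vD : inV n (D p).
 by rewrite DE; apply: inVZ; apply: inVD; [exact: inV_le ve|exact: uM].
have zD : zm (D p) by rewrite DE; apply: zmZ; apply: zmD => //; exact: zm_euler.
have vA : inV n (t + a *: h p).
 by apply: inVD; [exact: inV_le vt|apply: inVZ; exact: inV_le vh].
have zA : zm (t + a *: h p) by apply: zmD => //; exact: zmZ.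
have nw s' : 0 <= s' <= T -> N 4 (t + s' *: D p) <= Q.
 move=> hs'; rewrite QE; apply: ND_le; apply: lerD; first exact: N4_inV.
 exact: N4sD.
have zw s' : zm (t + s' *: D p) by apply: zmD => //; exact: zmZ.
rewrite -affineE.
have -> : del * r1 = T * (a * r1) by rewrite mulrA Ta.
apply: (gsol_close nu0 hX vA vD zA zD (G := a * H + Q)) hs.
- move=> s' hs'; rewrite affineE.
 have zz : zm (a *: h p + (t + s' *: D p)) by apply: zmD => //; exact: zmZ.
 apply: (le_trans (N_zm_le zz (isT : (3 <= 4)%N))); apply: ND_le.
 apply: lerD; last exact: nw.
 by rewrite NZ ger0_norm ?(ltW a0)//; apply: (ler_wpM2l (ltW a0)).
- move=> s' hs'; rewrite affineE.
 rewrite (_ : _ - D p = euler (a *: h p + (t + s' *: D p)) + nu *: lapp (a *: h p + (t + s' *: D p))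
   - a ^+ 2 *: euler (h p)); last by rewrite /D; ring.
 apply: (le_trans (residual_le (ltW a0) nu0 zh (zw s'))).
 have q1 := nw s' hs'; move: (N 4 (t + s' *: D p)) (N 4 (h p)) (N_ge0 4 (t + s' *: D p)) (N_ge0 4 (h p)) q1 nh => x y' x0 y0 xQ yH.
 have b1 : 8 * csup * y' * x <= 8 * csup * H * Q.
  by rewrite -!mulrA ler_wpM2l// ler_wpM2l// ler_pM.
 have b2 : 4 * csup * x ^+ 2 <= 4 * csup * Q ^+ 2.
  by rewrite -!mulrA ler_wpM2l// ler_wpM2l// lerXn2r.
 have b3 : a * y' + x <= a * (H + Q).
  rewrite mulrDr; apply: lerD; first exact: (ler_wpM2l (ltW a0)).
  by apply: (le_trans xQ); rewrite ler_peMl.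
 have b4 : nu * (a * y' + x) <= a * (nu * (H + Q)) by rewrite mulrCA; exact: ler_wpM2l.
 have b5 : 4 * csup * Q ^+ 2 <= a * (4 * csup * Q ^+ 2).
  by rewrite ler_peMl ?mulr_ge0.
 have b6 := ler_wpM2l (ltW a0) b1.
 rewrite r1E (mulrDr a) (mulrDr a).
 by apply: lerD b4; apply: lerD (le_trans b2 b5).
move: small1; rewrite -!mulrA.
rewrite (_ : csup * ((a * H + Q) * T) = csup * (del * H + T * Q)); last by rewrite -Ta; ring.
have := ler_wpM2r Q0 Tdel => q1.
have q2 : csup * (del * H + T * Q) <= csup * (del * (H + Rd + H + Q)).
 apply: (ler_wpM2l c0); rewrite !mulrDr.
 have := mulr_ge0 (ltW del0) Rd0; have := mulr_ge0 (ltW del0) H0; move: q1.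
 by lra.
have q3 : 0 <= csup * (del * H + T * Q).
 nneg.
by lra.
Qed.

Lemma kick_shift (e : R) : 4 * (del * r1) <= e -> 4 * (del * r2) <= e ->
 shift 2 (maxn M K) K Rd e pi (fun p => a *: h p) (fun p => a *: h p + euler (h p) + u p).
move=> er1 er2 n; rewrite geq_max => /andP[hn hK].
have TT : 0 <= T <= T by rewrite lexx ltW.
have TD p : T *: D p = euler (h p) + u p.
 by rewrite DE scalerA mulfV ?scale1r// gt_eqF.
split.
- move=> p y hp vy zy hy; have [X hX] := exist hn hp vy zy hy.
 by exists (X T); apply/runE; exists X.
- move=> p y z t hp vy zy hy /runE[X hX ->] vt zt ht.
 have := closeA hn hK hp vy zy hX vt zt ht TT; rewrite TD.
 rewrite (_ : X T - _ - t = X T - (a *: h p + (t + (euler (h p) + u p)))); last by ring.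
 rewrite (_ : y - a *: h p - t = y - (t + a *: h p)); last by ring.
 by move/le_trans; apply; rewrite lerD2l.
move=> p p' y y' z z' t hp hp' vy zy hy vy' zy' hy' /runE[X hX ->] /runE[X' hX' ->] vt zt.
have [vh ve zh] := hM hp; have [nh ne nu_] := hH hp.
have [vh' ve' zh'] := hM hp'; have [nh' ne' nu_'] := hH hp'.
have [l1 l2 l3] := hL hp hp'.
have dist p1 y1 X1 s : Pr p1 -> inV n y1 -> zm y1 -> N 2 (y1 - a *: h p1) <= Rd ->
  gsol n nu (v p1) T y1 X1 -> 0 <= s <= T -> N 2 (X1 s - a *: h p1) <= Qx.
 move=> hp1 vy1 zy1 hy1 hX1 hs.
 have := closeA hn hK hp1 vy1 zy1 hX1 (inV0 R K) (zm0 R).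
 rewrite N0 => /(_ s Rd0 hs); rewrite !add0r => k.
 have k2 := N4sD hp1 hs.
 have zsD : zm (s *: D p1) by rewrite DE; do 2!apply: zmZ; apply: zmD => //; exact: zm_euler.
 have k3 := le_trans (N_zm_le zsD (isT : (2 <= 4)%N)) k2.
 rewrite (_ : X1 s - a *: h p1 = X1 s - (a *: h p1 + s *: D p1) + s *: D p1); last by ring.
 apply: ND_le; rewrite QxE; apply: lerD => //.
 apply: (le_trans k); apply: lerD; first by rewrite ler_pM2l.
 by apply: ler_wpM2l => //; rewrite ler_piMl.
have zDp q : zm (D q) by rewrite DE; apply: zmZ; apply: zmD => //; exact: zm_euler.
have vDp q : Pr q -> inV n (D q).
 by move=> /hM[_ vq _]; rewrite DE; apply: inVZ; apply: inVD; [exact: inV_le vq|exact: uM].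
pose B := t + a *: (h p - h p'); pose E := D p - D p'.
have vB : inV n B.
 apply: inVD; first exact: inV_le vt.
 by apply: inVZ; apply: inVB; [exact: inV_le vh|exact: inV_le vh'].
have zB : zm B by apply: zmD => //; apply: zmZ; exact: zmB.
have vE : inV n E by apply: inVB; exact: vDp.
have zE : zm E by exact: zmB.
have ns0 : 0 <= ds p p' + N 2 t by rewrite addr_ge0.
set m := ds p p' + N 2 t in ns0 *.
have r20 : 0 <= r2.
 have f1 : 0 <= H * Qx by nneg.
 have f2 : 0 <= 1 + 2 * H by move: H0; lra.
 have f3 := mulr_ge0 f2 H0; have f4 := mulr_ge0 f2 Qx0.
 have f5 : 0 <= nu * (1 + 3 * H) by rewrite mulr_ge0//; move: H0; lra.
 rewrite r2E addr_ge0// mulr_ge0//.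
 by rewrite -!mulrA; move: (H * Qx) (_ * H) (_ * Qx) f1 f3 f4 => *; lra.
have R0 : 0 <= a * (r2 * m) by nneg.
have ED : E = T^-1 *: ((euler (h p) - euler (h p')) + (u p - u p')).
 by rewrite /E !DE -scalerBr; congr (_ *: _); ring.
have hds : N 2 (h p - h p') <= H * m.
 by apply: (le_trans l1); apply: ler_wpM2l => //; rewrite lerDl.
have hw s : 0 <= s <= T -> N 2 (t + s *: E) <= (1 + 2 * H) * m.
 move=> /andP[s0 sT]; apply: ND_le.
 have k1 : s * T^-1 <= 1 by rewrite ler_pdivrMr// mul1r.
 have k0 : 0 <= s * T^-1 by nneg.
 have k2 : N 2 (s *: E) <= 2 * H * ds p p'.
  rewrite ED scalerA NZ ger0_norm//.
  apply: (@le_trans _ _ (1 * N 2 ((euler (h p) - euler (h p')) + (u p - u p')))).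
   exact: ler_wpM2r.
  rewrite mul1r; apply: ND_le; apply: (le_trans (lerD l2 l3)).
  have G (b1 b2 : R) : b1 * b2 + b1 * b2 = 2 * b1 * b2 by ring.
  by rewrite G lexx.
 apply: (le_trans (lerD (lexx _) k2)).
 have G (x q b : R) : 0 <= b * x -> 0 <= q -> x + 2 * b * q <= (1 + 2 * b) * (q + x) by move=> *; lra.
 exact: G (mulr_ge0 H0 (N_ge0 2 t)) (ds0 p p').
have main := gsol_diff nu0 (leqnn n) hX hX' (zmZ _ (zu p)) (zmZ _ (zu p')) vB vE zB zE R0 (lexx 0).
have {main} main := main _ _ T TT.
have aff s : affine B E s = a *: (h p - h p') + (t + s *: E) by rewrite /affine /B; ring.
rewrite (_ : X T - X' T - _ - t = X T - X' T - affine B E T); last first.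
 rewrite aff scalerBr /E scalerBr !TD; ring.
rewrite (_ : y - y' - _ - t = y - y' - B); last by rewrite /B scalerBr; ring.
apply: le_trans (main _ _) _.
(* Both solutions have dimension [n], so there is no truncation discrepancy. *)
- move=> s g hs vg; rewrite (ip_proj _ vg) subrr normr0 mulr_ge0//.
- move=> s g hs vg; pose x := X s - a *: h p; pose x' := X' s - a *: h p'.
 have [_ _ [zX _] _ _] := hX; have [_ _ [zX' _] _ _] := hX'.
 have zx : zm x by apply: zmB; [exact: (zX s).2|exact: zmZ].
 have zx' : zm x' by apply: zmB; [exact: (zX' s).2|exact: zmZ].
 have zw : zm (t + s *: E) by apply: zmD => //; exact: zmZ.
 have ex : a *: h p + x = X s by rewrite /x addrC subrK.
 have ex' : a *: h p' + x' = X' s by rewrite /x' addrC subrK.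
 have := residual_diff_le g (ltW a0) nu0 zh zh' zx zx' zw; rewrite ex ex' -aff.
 rewrite (_ : _ - a ^+ 2 *: (euler (h p) - euler (h p')) =
  bk (invl (affine B E s)) (X s) + bk (invl (X' s)) (affine B E s) +
  nu *: lapp (affine B E s) + v p - v p' - E); last first.
  by rewrite /E /D scalerBr; ring.
 move/le_trans; apply; apply: ler_wpM2r => //.
 have nx : N 2 x <= Qx := dist p y X s hp vy zy hy hX hs.
 have nx' : N 2 x' <= Qx := dist p' y' X' s hp' vy' zy' hy' hX' hs.
 have nhh : N 2 (h p) <= H := le_trans (N_zm_le zh (isT : (2 <= 4)%N)) nh.
 have nhh' : N 2 (h p') <= H := le_trans (N_zm_le zh' (isT : (2 <= 4)%N)) nh'.
 rewrite r2E; apply: kick_arith nhh nhh' => //; first exact: hw.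
rewrite (_ : 4 * (T * _) = 4 * (del * r2) * m); last by rewrite -Ta; ring.
by rewrite lerD2l; apply: ler_wpM2r.
Qed.
End kick.
End families.
End shifts.

(** * Directions in which the system can be steered *)

Section availability.
Context (R : realType).
Notation P := (pol R).
Notation csup := (@csup R).
Variables (nu : R) (r n1 : nat) (d : 'I_r -> P).
Hypotheses (nu0 : 0 <= nu) (hd : forall k, inV n1 (d k)) (zd : forall k, zm (d k)).
Notation shift := (@shift R nu r d).

Lemma pos_small (k e : R) : 0 <= k -> 0 < e -> exists2 del : R, 0 < del & del * k <= e.
move=> k0 e0; have k1 : 0 < k + 1 by rewrite ltr_wpDl.
exists (e / (k + 1)); first by rewrite divr_gt0.
by rewrite mulrAC ler_pdivrMr// ler_wpM2l ?(ltW e0)// lerDl.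
Qed.

Lemma kick_exists (A : Type) (Pr : A -> Prop) (ds : A -> A -> R) (h : A -> P) (alpha : A -> 'I_r -> R) M H :
 (forall p p' : A, 0 <= ds p p') -> 0 <= H -> (n1 <= M)%N ->
 (forall p, Pr p -> [/\ inV M (h p), inV M (euler (h p)) & zm (h p)]) ->
 (forall p, Pr p -> [/\ N 4 (h p) <= H, N 4 (euler (h p)) <= H & N 4 (ctl d (alpha p)) <= H]) ->
 (forall p p', Pr p -> Pr p' -> [/\ N 2 (h p - h p') <= H * ds p p',
  N 2 (euler (h p) - euler (h p')) <= H * ds p p' &
  N 2 (ctl d (alpha p) - ctl d (alpha p')) <= H * ds p p']) ->
 forall K (Rd e tau0 : R), 0 <= Rd -> 0 < e -> 0 < tau0 -> exists (a T : R) pi m,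
 [/\ 0 < T < tau0, 0 < a, forall p, dur (pi p) = T &
  shift Pr ds 2 m K Rd e pi (fun p => a *: h p)
   (fun p => a *: h p + euler (h p) + ctl d (alpha p))].
move=> ds0 H0 M1 hM hH hL K Rd e tau0 Rd0 e0 t0.
have c0 := csup_ge0 R; have l0 := lam_ge0 R K.
pose Q := lam R K * Rd + 2 * H.
pose r1 := 8 * csup * H * Q + 4 * csup * Q ^+ 2 + nu * (H + Q).
pose Qx := 2 * Rd + 4 * r1 + 2 * H.
pose r2 := csup * (2 * (H * Qx) + 2 * (1 + 2 * H) * H + 2 * (1 + 2 * H) * Qx) + nu * (1 + 3 * H).
have Q0 : 0 <= Q by nneg.
have r10 : 0 <= r1 by nneg.
have Qx0 : 0 <= Qx by nneg.
have r20 : 0 <= r2 by nneg.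
have k2 : 0 <= 512 * csup * (H + Rd + H + Q) by nneg.
(* [k] dominates the constants of all smallness conditions, so that a single choice of [del] meets
   them. *)
pose k := 512 * csup * (H + Rd + H + Q) + 4 * r1 + 4 * r2 + 1.
have q1 : 0 <= 4 * r1 by nneg.
have q2 : 0 <= 4 * r2 by nneg.
have kk : 0 <= k by nneg.
have m0 : 0 < Num.min (1 : R) (Num.min e (tau0 / 2)) by rewrite !lt_min ltr01 e0 divr_gt0.
have [del d0 hd'] := pos_small kk m0.
have b1 (x : R) : 0 <= x -> x <= k -> [/\ del * x <= 1, del * x <= e & del * x <= tau0 / 2].
 move=> x0 xk; have := ler_wpM2l (ltW d0) xk => /le_trans /(_ hd').
 by rewrite !le_min => /and3P.
have Gk (x b c : R) : 0 <= b -> 0 <= c -> x <= x + b + c + 1 by lra.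
have [s1 _ _] := b1 _ k2 (Gk _ _ _ q1 q2).
have G2 (x b c' : R) : 0 <= b -> 0 <= c' -> x <= b + x + c' + 1 by lra.
have G3 (x b c' : R) : 0 <= b -> 0 <= c' -> x <= b + c' + x + 1 by lra.
have [_ s2 _] := b1 _ q1 (G2 _ _ _ k2 q2); have [_ s3 _] := b1 _ q2 (G3 _ _ _ k2 q1).
have k3 : 1 <= k by rewrite lerDr; exact: (addr_ge0 (addr_ge0 k2 q1) q2).
have [s4 _ s5] := b1 _ ler01 k3.
rewrite mulr1 in s4 s5.
have sm : 512 * csup * (del * (H + Rd + H + Q)) <= 1 by rewrite mulrCA.
have r1s : 4 * (del * r1) <= e by rewrite mulrCA.
have r2s : 4 * (del * r2) <= e by rewrite mulrCA.
have := @kick_shift R nu r n1 d nu0 hd zd A Pr ds ds0 h alpha M H H0 M1 hM hH hL K Rd del Rd0 d0 s4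
 (del ^+ 2) del^-1 Q r1 Qx r2 erefl erefl erefl erefl erefl erefl sm e r1s r2s.
move=> sh; exists del^-1, (del ^+ 2); do 2!eexists; split; last exact: sh.
- rewrite exprn_gt0// expr2; apply: (@le_lt_trans _ _ del); first by rewrite ler_piMr// ltW.
 by apply: (le_lt_trans s5); rewrite ltr_pdivrMr// ltr_pMr// ltr1n.
- by rewrite invr_gt0.
- by rewrite /= addr0.
Qed.

(** The factor [C] comes before the accuracy [e] and the time [tau0], so its amplification can be
    compensated when steps are composed. *)
Definition avail (A : Type) (Pr : A -> Prop) (ds : A -> A -> R) C (E : A -> P) : Prop :=
 forall K (Rd e tau0 : R), 0 < Rd -> 0 < e -> 0 < tau0 -> exists (T : R) pi m,
 [/\ 0 < T < tau0, forall p, dur (pi p) = T & shift Pr ds C m K Rd e pi (fun=> 0) E].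

Lemma shift_le A Pr ds C (m K : nat) (Rd e e' : R) pi E0 E1 : (forall p p' : A, 0 <= ds p p') -> e <= e' ->
 shift Pr ds C m K Rd e pi E0 E1 -> shift Pr ds C m K Rd e' pi E0 E1.
move=> ds0 ee s n hn; have [x1 x2 x3] := s n hn; split => //.
 move=> p y z t *; apply: (le_trans (x2 p y z t _ _ _ _ _ _ _ _)) => //.
 by rewrite lerD2l.
move=> p p' y y' z z' t *; apply: (le_trans (x3 p p' y y' z z' t _ _ _ _ _ _ _ _ _ _ _ _)) => //.
by rewrite lerD2l ler_wpM2r// addr_ge0.
Qed.

Lemma avail_translate A Pr ds C E M B F : (forall p p' : A, 0 <= ds p p') -> 0 <= B ->
 regular Pr ds M B F -> avail Pr ds C E ->
 forall K (Rd e tau0 : R), 0 < Rd -> 0 < e -> 0 < tau0 -> exists (T : R) pi m,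
 [/\ 0 < T < tau0, forall p, dur (pi p) = T &
  shift Pr ds C m K Rd e pi F (fun p => E p + F p)].
move=> ds0 B0 rF aE K Rd e tau0 Rd0 e0 t0.
have B1 : 0 < 1 + B by rewrite ltr_wpDr.
have [T [pi [m [hT hdur hs]]]] := aE (maxn K M) (Rd + B) (e / (1 + B)) tau0 (ltr_wpDr B0 Rd0) (divr_gt0 e0 B1) t0.
exists T, pi, m; split => //.
have rF' : regular Pr ds (maxn K M) B F.
 move=> p hp; have [v l] := rF p hp; split => //; apply: inV_le v; exact: leq_maxr.
have := shift_translate ds0 (leq_maxl K M) (ltW (divr_gt0 e0 B1)) B0 rF' hs.
rewrite divfK ?gt_eqF//.
by rewrite (_ : (fun p => 0 + F p) = F)//; apply/funext => p; rewrite add0r.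
Qed.

Lemma avail_add A Pr ds C C' E E' M B : (forall p p' : A, 0 <= ds p p') -> 0 <= B ->
 0 <= C -> 0 <= C' -> regular Pr ds M B E -> avail Pr ds C E -> avail Pr ds C' E' ->
 avail Pr ds (C' * C) (fun p => E p + E' p).
move=> ds0 B0 C0 C0' rE aE aE' K Rd e tau0 Rd0 e0 t0.
have t2 : 0 < tau0 / 2 by rewrite divr_gt0.
have k2 : 0 < C' + 1 by rewrite ltr_wpDl.
have e2 : 0 < e / 2 by rewrite divr_gt0.
(* The second leg multiplies the error of the first by [C']. *)
have e1 := divr_gt0 e2 k2.
have R0 : 0 < Rd + (C * Rd + e / 2 / (C' + 1)).
 nneg.
have [T1 [pi1 [m1 [hT1 hd1 hs1]]]] := aE K Rd _ _ Rd0 e1 t2.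
have [T2 [pi2 [m2 [hT2 hd2 hs2]]]] := avail_translate ds0 B0 rE aE' K R0 e2 t2.
exists (T1 + T2), (fun p => pi1 p ++ pi2 p), (maxn m1 m2); split.
- by lra.
- by move=> p; rewrite dur_cat hd1 hd2.
have le1 : Rd <= Rd + (C * Rd + e / 2 / (C' + 1)).
 by rewrite lerDl addr_ge0 ?(ltW e1)// mulr_ge0// ltW.
have le2 : C * Rd + e / 2 / (C' + 1) <= Rd + (C * Rd + e / 2 / (C' + 1)) by rewrite lerDr ltW.
have := shift_comp C0 C0' Rd0 le1 le2 hs1 hs2.
rewrite (_ : (fun p => E' p + E p) = (fun p => E p + E' p)); last by apply/funext => p; rewrite addrC.
apply: shift_le => //.
have : C' * (e / 2 / (C' + 1)) <= e / 2.
 by rewrite mulrC mulrAC ler_pdivrMr// ler_wpM2l ?(ltW e2)// lerDl.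
have G (x y : R) : x <= y / 2 -> x + y / 2 <= y by lra.
exact: G.
Qed.

(** The parameter type and [ds] are arbitrary: a one-point type serves for a single target, and
    boxes of coordinates for exact control. The factor [C] does not depend on the bound [L] of the
    coefficients. *)
Definition available (eta : P) : Prop := zm eta /\ exists C : R, 0 <= C /\
 forall (A : Type) (Pr : A -> Prop) (ds : A -> A -> R) (c : A -> R) (L : R), 0 <= L -> (forall p p', 0 <= ds p p') ->
 (forall p, Pr p -> `|c p| <= L) -> (forall p p', Pr p -> Pr p' -> `|c p - c p'| <= L * ds p p') ->
 avail Pr ds C (fun p => c p *: eta).

Lemma regular_scale A (Pr : A -> Prop) (ds : A -> A -> R) (c : A -> R) (L : R) eta : 0 <= L -> zm eta ->
 (forall p p', 0 <= ds p p') ->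
 (forall p, Pr p -> `|c p| <= L) -> (forall p p', Pr p -> Pr p' -> `|c p - c p'| <= L * ds p p') ->
 exists M B, 0 <= B /\ regular Pr ds M B (fun p => c p *: eta).
move=> L0 ze ds0 cL cl; have [M hM] := inV_exists eta.
exists M, (L * N 2 eta); split; first nneg.
move=> p hp; split; [exact: inVZ|exact: zmZ| |].
 by rewrite NZ; apply: ler_wpM2r; [nneg|exact: cL].
move=> p' hp'; rewrite -scalerBl NZ mulrAC; apply: ler_wpM2r => //.
exact: cl.
Qed.

Lemma availableZ a eta : available eta -> available (a *: eta).
move=> [ze [C [C0 h]]]; split; first exact: zmZ.
exists C; split; first exact: C0.
move=> A Pr ds c L L0 ds0 cL cl.
rewrite (_ : (fun p => _) = (fun p => (c p * a) *: eta)); last first.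
 by apply/funext => p; rewrite scalerA.
apply: (h A Pr ds _ (L * `|a|)) => //; first nneg.
 by move=> p hp; rewrite normrM ler_wpM2r// cL.
by move=> p p' hp hp'; rewrite -mulrBl normrM mulrAC ler_wpM2r// cl.
Qed.

Lemma availableD eta eta' : available eta -> available eta' -> available (eta + eta').
move=> [ze [C [C0 h]]] [ze' [C' [C0' h']]]; split; first exact: zmD.
exists (C' * C); split; first nneg.
move=> A Pr ds c L L0 ds0 cL cl.
have [M [B [B0 rE]]] := regular_scale L0 ze ds0 cL cl.
rewrite (_ : (fun p => _) = (fun p => c p *: eta + c p *: eta')); last first.
 by apply/funext => p; rewrite scalerDr.
exact: avail_add C0' rE (h A Pr ds c L L0 ds0 cL cl) (h' A Pr ds c L L0 ds0 cL cl).
Qed.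

(** A kick with [h = 0], that is, a strong control during a short time. *)
Lemma available_dir i : available (d i).
split => //.
exists 2; split => //.
move=> A Pr ds c L L0 ds0 cL cl K Rd e tau0 Rd0 e0 t0.
pose alpha p k := c p * (k == i)%:R.
have aE p : ctl d (alpha p) = c p *: d i.
 rewrite /ctl (bigD1 i)//= /alpha eqxx mulr1 big1 ?addr0// => k /negbTE ->.
 by rewrite mulr0 scale0r.
have eu0 : euler (0 : P) = 0 by rewrite /euler bk0r.
pose H := L * (N 4 (d i) + N 2 (d i)).
have H0 : 0 <= H by nneg; apply: addr_ge0.
have z0 k : N k (0 : P) = 0 by exact: N0.
have [|||a [T [pi [m [hT a0 hdu hs]]]]] := @kick_exists A Pr ds (fun=> 0) alpha n1 H ds0 H0 (leqnn n1)
  _ _ _ K Rd e tau0 (ltW Rd0) e0 t0.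
- by rewrite eu0; split; [exact: inV0|exact: inV0|exact: zm0].
- move=> p hp; rewrite eu0 z0 aE NZ; split => //; apply: ler_pM => //; first exact: cL.
 by rewrite lerDl.
- move=> p p' hp hp'; have hh := mulr_ge0 H0 (ds0 p p').
 rewrite eu0 subrr z0 !aE -scalerBl NZ; split => //.
 rewrite mulrAC; apply: ler_pM => //; first exact: cl.
 by rewrite lerDr.
exists T, pi, m; split => //.
move: hs; rewrite (_ : (fun p : A => a *: 0) = (fun=> 0)); last by rewrite scaler0.
rewrite (_ : (fun p : A => a *: 0 + _ + _) = (fun p => c p *: d i))//.
by apply/funext => p; rewrite scaler0 eu0 !add0r.
Qed.

Lemma sum4_ge (b1 b2 b3 b4 : R) : 0 <= b1 -> 0 <= b2 -> 0 <= b3 -> 0 <= b4 ->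
 [/\ b1 <= b1 + b2 + b3 + b4, b2 <= b1 + b2 + b3 + b4, b3 <= b1 + b2 + b3 + b4,
   b4 <= b1 + b2 + b3 + b4 & 0 <= b1 + b2 + b3 + b4].
by split; lra. Qed.

Lemma half_quarter (x : R) : 2 * (x / 4) + x / 2 = x. by field. Qed.

Lemma third_sum (x y z t : R) : 0 < x < t / 3 -> 0 < y < t / 3 -> 0 < z < t / 3 ->
 0 < x + y + z < t.
lra. Qed.

Lemma three_quarters (x y : R) : x <= y / 4 -> 0 < y -> x + y / 4 + y / 4 <= y.
lra. Qed.

(** The polarization of [euler]; it is the opposite of [Bform]. *)
Definition Bpol (f g : P) : P := bk (invl f) g + bk (invl g) f.

(** The two jumps have a size of order [a], yet their factor [C0] does not depend on it, since
    [available] fixes its constant before the bound [L]. The radii and error budgets can thus be set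
    before [a] is known. *)
Lemma available_bracket f g : pev (euler f) = pev (0 : P) -> available f -> available g ->
 available (Bpol f g).
move=> ef [zf [Cf [Cf0 hf]]] [zg [Cg [Cg0 hg]]].
have zB : zm (Bpol f g) by apply: zmD; exact: zm_bk.
split => //.
pose C0 := Cg * Cf; have C00 : 0 <= C0 by nneg.
exists (C0 * (2 * C0)); split; first nneg.
move=> A Pr ds c L L0 ds0 cL cl K Rd e tau0 Rd0 e0 t0.
pose G2 := N 2 (euler g); have G20 : 0 <= G2 by nneg.
have e4 : 0 < e / 4 by rewrite divr_gt0.
(* The jump is [a *: h p]; by steadiness of [f], [euler (h p)] is
  [c p *: Bpol f g] up to an error of order [sg ^+ 2]. *)
have K0 : 0 <= 2 * L ^+ 2 * G2 by nneg.
have [del del0 hdel] := pos_small K0 e4.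
pose sg := Num.min 1 del.
have sg0 : 0 < sg by rewrite lt_min ltr01.
have sgs : sg ^+ 2 * (2 * L ^+ 2 * G2) <= e / 4.
 apply: le_trans hdel; apply: ler_wpM2r => //.
 have s1 : sg <= 1 by rewrite ge_min lexx.
 have s2 : sg <= del by rewrite ge_min lexx orbT.
 by apply: le_trans s2; rewrite ler_piMr// ltW.
have sV0 : 0 <= sg^-1 by nneg.
pose h p := sg^-1 *: f + (c p * sg) *: g.
pose k p := (c p * sg) ^+ 2.
have ehE p : pev (euler (h p)) = pev (c p *: Bpol f g + k p *: euler g).
 apply/funext => x; rewrite eulerD !pevD (eulerZ _ f) (eulerZ _ g) pevZ ef pev0 mulr0 add0r.
 congr (_ + _); rewrite (pev_bkl _ (invlZ _ f)) (pev_bkl _ (invlZ _ g)).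
 rewrite !bkZl !bkZr !pevZ pevD.
 have ss : sg * sg^-1 = 1 by rewrite mulfV// gt_eqF.
 have G (v b q x1 x2 : R) : v * (q * b * x1) + q * b * (v * x2) = b * v * (q * (x1 + x2)) by ring.
 by rewrite G ss mul1r.
have kL p : Pr p -> `|k p| <= (L * sg) ^+ 2.
 move=> hp; rewrite normrX lerXn2r ?nnegrE ?(mulr_ge0 L0 (ltW sg0))//.
 by rewrite normrM (ger0_norm (ltW sg0)) ler_wpM2r ?(ltW sg0)// cL.
have kl p p' : Pr p -> Pr p' -> `|k p - k p'| <= sg ^+ 2 * (2 * L ^+ 2) * ds p p'.
 move=> hp hp'; rewrite (_ : k p - k p' = sg ^+ 2 * ((c p + c p') * (c p - c p'))); last by rewrite /k; ring.
 rewrite normrM (ger0_norm (sqr_ge0 sg)) -mulrA; apply: (ler_wpM2l (sqr_ge0 sg)).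
 rewrite normrM (_ : 2 * L ^+ 2 * ds p p' = (L + L) * (L * ds p p')); last by ring.
 apply: ler_pM => //; last exact: cl.
 by apply: (le_trans (ler_normD _ _)); apply: lerD; exact: cL.
have [M [m1M fM gM BM eM]] : exists M, [/\ (n1 <= M)%N, inV M f, inV M g, inV M (Bpol f g) & inV M (euler g)].
 have [i1 v1] := inV_exists f; have [i2 v2] := inV_exists g.
 have [i3 v3] := inV_exists (Bpol f g); have [i4 v4] := inV_exists (euler g).
 exists (maxn n1 (maxn (maxn i1 i2) (maxn i3 i4))); split.
 - exact: leq_maxl.
 - by apply: inV_le v1; rewrite !leq_max leqnn ?orbT.
 - by apply: inV_le v2; rewrite !leq_max leqnn ?orbT.
 - by apply: inV_le v3; rewrite !leq_max leqnn ?orbT.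
 - by apply: inV_le v4; rewrite !leq_max leqnn ?orbT.
have zh p : zm (h p) by apply: zmD; exact: zmZ.
have hM p : Pr p -> [/\ inV M (h p), inV M (euler (h p)) & zm (h p)].
 move=> hp; split; [by apply: inVD; exact: inVZ| |exact: zh].
 by apply: inV_ext (esym (ehE p)) _; apply: inVD; exact: inVZ.
pose H := (sg^-1 * N 4 f + L * sg * N 4 g) + (L * N 4 (Bpol f g) + (L * sg) ^+ 2 * N 4 (euler g)) +
 (L * sg * N 2 g) + (L * N 2 (Bpol f g) + sg ^+ 2 * (2 * L ^+ 2) * N 2 (euler g)).
have Ls : 0 <= L * sg by nneg.
have H1 : 0 <= sg^-1 * N 4 f + L * sg * N 4 g by nneg.
have H2 : 0 <= L * N 4 (Bpol f g) + (L * sg) ^+ 2 * N 4 (euler g) :=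
 addr_ge0 (mulr_ge0 L0 (N_ge0 4 _)) (mulr_ge0 (sqr_ge0 _) (N_ge0 4 _)).
have H3 : 0 <= L * sg * N 2 g := mulr_ge0 Ls (N_ge0 2 g).
have H4 : 0 <= L * N 2 (Bpol f g) + sg ^+ 2 * (2 * L ^+ 2) * N 2 (euler g) :=
 addr_ge0 (mulr_ge0 L0 (N_ge0 2 _)) (mulr_ge0 (mulr_ge0 (sqr_ge0 _) (mulr_ge0 (ler0n R 2) (sqr_ge0 _))) (N_ge0 2 _)).
have [u1 u2 u3 u4 H0] := sum4_ge H1 H2 H3 H4.
have ctl0 : ctl d (fun=> 0 : R) = 0 by rewrite /ctl big1// => i; rewrite scale0r.
have z0 j : N j (0 : P) = 0 := N0 R j.
have hsg p : Pr p -> `|c p * sg| <= L * sg.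
 by move=> hp; rewrite normrM (ger0_norm (ltW sg0)) ler_wpM2r ?(ltW sg0)// cL.
have hH p : Pr p -> [/\ N 4 (h p) <= H, N 4 (euler (h p)) <= H & N 4 (ctl d (fun=> 0 : R)) <= H].
 move=> hp; rewrite ctl0 z0; split => //.
 - apply: le_trans u1; apply: ND_le; rewrite !NZ; apply: lerD; first by rewrite ger0_norm.
  by apply: ler_wpM2r => //; exact: hsg.
 - apply: le_trans u2; rewrite (N_ext 4 (ehE p)); apply: ND_le; rewrite !NZ.
  by apply: lerD; apply: ler_wpM2r => //; [exact: cL|exact: kL].
have hL p p' : Pr p -> Pr p' -> [/\ N 2 (h p - h p') <= H * ds p p',
  N 2 (euler (h p) - euler (h p')) <= H * ds p p' &
  N 2 (ctl d (fun=> 0 : R) - ctl d (fun=> 0 : R)) <= H * ds p p'].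
 move=> hp hp'; have dp := ds0 p p'; rewrite subrr z0; split; last nneg.
 - apply: (le_trans _ (ler_wpM2r dp u3)).
  rewrite (_ : h p - h p' = ((c p - c p') * sg) *: g); last by rewrite /h mulrBl scalerBl; ring.
  rewrite NZ normrM (ger0_norm (ltW sg0)) [leRHS]mulrAC; apply: ler_wpM2r => //.
  by rewrite mulrAC; apply: ler_wpM2r; [nneg|exact: cl].
 - apply: (le_trans _ (ler_wpM2r dp u4)).
  have E : pev (euler (h p) - euler (h p')) = pev ((c p - c p') *: Bpol f g + (k p - k p') *: euler g).
   apply/funext => x; rewrite pevB !ehE !pevD !pevZ; ring.
  rewrite (N_ext 2 E); apply: ND_le; rewrite !NZ mulrDl.
  by apply: lerD; rewrite [leRHS]mulrAC; apply: ler_wpM2r => //; [exact: cl|exact: kl].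
have k1 : 0 < C0 + 1 by rewrite ltr_wpDl.
pose eb := e / 4 / (C0 + 1); have eb0 : 0 < eb by rewrite divr_gt0.
have ebC : C0 * eb <= e / 4.
 by rewrite mulrC mulrAC ler_pdivrMr// ler_wpM2l ?(ltW e4)// lerDl.
have eb2 : 0 < eb / 2 by rewrite divr_gt0.
have eb4 : 0 < eb / 4 by rewrite divr_gt0.
have t3 : 0 < tau0 / 3 by rewrite divr_gt0.
(* [R2] and [R3] hold the states reached after the first jump and after the kick. *)
pose R2 := Rd + (C0 * Rd + eb / 4); pose R3 := Rd + (2 * C0 * Rd + eb).
have R20 : 0 < R2 by nneg.
have R30 : 0 < R3 by nneg.
have [a [T2 [pi2 [m2 [hT2 a0 hd2 hs2]]]]] := kick_exists ds0 H0 m1M hM hH hL K (ltW R20) eb2 t3.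
have jump (b : R) : avail Pr ds C0 (fun p => b *: h p).
 have l1 : 0 <= `|b * sg^-1| := normr_ge0 _; have l2 : 0 <= `|b| * (L * sg) by nneg.
 have cb1 p : Pr p -> `|b * sg^-1| <= `|b * sg^-1| by [].
 have cb2 p p' : Pr p -> Pr p' -> `|b * sg^-1 - b * sg^-1| <= `|b * sg^-1| * ds p p'.
  by rewrite subrr normr0 mulr_ge0.
 have cb3 p : Pr p -> `|b * (c p * sg)| <= `|b| * (L * sg).
  by move=> hp; rewrite normrM ler_wpM2l// hsg.
 have cb4 p p' : Pr p -> Pr p' -> `|b * (c p * sg) - b * (c p' * sg)| <= `|b| * (L * sg) * ds p p'.
  move=> hp hp'; rewrite -mulrBr -mulrBl normrM -mulrA ler_wpM2l// normrM (ger0_norm (ltW sg0)).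
  by rewrite mulrAC ler_wpM2r ?(ltW sg0)// cl.
 have [M' [B' [B0' rE]]] := regular_scale l1 zf ds0 cb1 cb2.
 rewrite (_ : (fun p => b *: h p) = (fun p => (b * sg^-1) *: f + (b * (c p * sg)) *: g)); last first.
  by apply/funext => p; rewrite scalerDr !scalerA.
 exact: avail_add rE (hf A Pr ds _ _ l1 ds0 cb1 cb2) (hg A Pr ds _ _ l2 ds0 cb3 cb4).
have [T1 [pi1 [m1 [hT1 hd1 hs1]]]] := jump a K Rd _ _ Rd0 eb4 t3.
pose F p := a *: h p + euler (h p) + ctl d (fun=> 0 : R).
have FE p : F p = a *: h p + euler (h p) by rewrite /F ctl0 addr0.
have rF : regular Pr ds M (a * H + H) F.
 move=> p hp; have [vh ve _] := hM p hp; have [q1 q2 _] := hH p hp; split.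
 - by rewrite FE; apply: inVD => //; exact: inVZ.
 - by rewrite FE; apply: zmD; [exact: zmZ|exact: zm_euler].
 - rewrite FE; apply: ND_le; rewrite NZ (ger0_norm (ltW a0)); apply: lerD.
   apply: ler_wpM2l; first nneg.
   exact: (le_trans (N_zm_le (zh p) (isT : (2 <= 4)%N)) q1).
  exact: (le_trans (N_zm_le (zm_euler _) (isT : (2 <= 4)%N)) q2).
 move=> p' hp'; have [w1 w2 _] := hL p p' hp hp'.
 rewrite !FE (_ : _ _ = a *: (h p - h p') + (euler (h p) - euler (h p'))); last by ring.
 apply: ND_le; rewrite NZ (ger0_norm (ltW a0)) mulrDl -mulrA; apply: lerD => //.
 by apply: ler_wpM2l => //; nneg.
have B0 : 0 <= a * H + H by nneg.
have [T3 [pi3 [m3 [hT3 hd3 hs3]]]] := avail_translate ds0 B0 rF (jump (- a)) K R30 e4 t3.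
have c20 : 0 <= 2 * C0 by nneg.
have C0R : 0 <= C0 * Rd by nneg.
have l1 : Rd <= R2 by rewrite lerDl addr_ge0// ltW.
have l2 : C0 * Rd + eb / 4 <= R2 by rewrite lerDr ltW.
have s12 := shift_comp C00 (ler0n R 2) Rd0 l1 l2 hs1 hs2.
have l3 : Rd <= R3 by rewrite lerDl addr_ge0 ?(ltW eb0)// mulr_ge0// ltW.
have l4 : 2 * C0 * Rd + (2 * (eb / 4) + eb / 2) <= R3.
 by rewrite half_quarter lerDr ltW.
have s123 := shift_comp c20 C00 Rd0 l3 l4 s12 hs3.
exists (T1 + T2 + T3), (fun p => (pi1 p ++ pi2 p) ++ pi3 p), (maxn (maxn m1 m2) m3); split.
- exact: third_sum.
- by move=> p; rewrite !dur_cat hd1 hd2 hd3.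
have := @shift_weaken R nu r d A Pr ds _ _ K Rd _ (e / 4) _ _ _ (fun p => c p *: Bpol f g) (ltW e4) _ _ _ s123.
have FE2 p : - a *: h p + F p = euler (h p) by rewrite FE scaleNr; ring.
have E p : pev (- a *: h p + F p - c p *: Bpol f g) = pev (k p *: euler g).
 by apply/funext => x; rewrite FE2 pevB ehE !pevD addrAC subrr add0r.
have fin : C0 * (2 * (eb / 4) + eb / 2) + e / 4 + e / 4 <= e.
 rewrite half_quarter.
 exact: three_quarters.
move=> sw; apply: (shift_le ds0 fin); apply: sw.
- by split; [rewrite FE2; exact: zm_euler|exact: zmZ].
- move=> p hp; rewrite (N_ext 2 (E p)) NZ; apply: le_trans sgs.
 rewrite mulrA; apply: ler_wpM2r => //; apply: (le_trans (kL p hp)).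
 rewrite exprMn mulrC; apply: (ler_wpM2l (sqr_ge0 sg)).
 by rewrite ler_peMl ?sqr_ge0// ler1n.
move=> p p' hp hp'.
have E' : pev (- a *: h p + F p - c p *: Bpol f g - (- a *: h p' + F p' - c p' *: Bpol f g)) =
  pev ((k p - k p') *: euler g).
 by apply/funext => x; rewrite pevB !E scalerBl pevB.
rewrite (N_ext 2 E') NZ.
apply: (@le_trans _ _ (sg ^+ 2 * (2 * L ^+ 2) * ds p p' * G2)).
 by apply: ler_wpM2r => //; exact: kl.
rewrite mulrAC -(mulrA (sg ^+ 2)); exact: ler_wpM2r.
Qed.

End availability.

(** * Irreducibility of harmonics of a given degree under rotations *)

Section harmonics.
Context (R : realType).
Local Transparent proj.
Notation P := (pol R).
Notation mono := (@mono R).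
Implicit Types (p q f g u v w : P) (s k : nat).

(** All modes of degree other than [s] vanish, [Nat.sqrt k] being the degree of mode [k]. *)
Definition harm s p := forall k, Nat.sqrt k <> s -> cf p k = 0.
Definition null p := pev p = pev (0 : P).

Definition hpart s p : P := proj (s.+1 ^ 2) p - proj (s ^ 2) p.

Lemma nullP p : ip p p = 0 -> null p.
by rewrite /null => /ip_eq0 ->; apply/funext => x; rewrite pev0. Qed.
Lemma null_rot i p : null p -> null (rot i p).
move=> h; rewrite /null (pev_rot i h) -[0 : P](scale0r 0) rotZ.
by apply/funext => x; rewrite !pevZ !mul0r.
Qed.

Lemma cf_hpart s p k : cf (hpart s p) k = if Nat.sqrt k == s then cf p k else 0.
rewrite cfB !cf_proj; have /andP[h1 h2] := sqrt_spec k.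
have [<-|/eqP h] := eqVneq (Nat.sqrt k) s; first by rewrite h2 ltnNge h1 subr0.
case: ifP => a; case: ifP => b; rewrite ?subrr ?sub0r//.
 by case: h; apply: sqrt_uniq; rewrite leqNgt b.
by rewrite (leq_trans b) in a => //; rewrite leq_exp2r.
Qed.

Lemma harm_hpart s p : harm s (hpart s p).
by move=> k /eqP/negbTE h; rewrite cf_hpart h. Qed.
Lemma hpart_id s p : harm s p -> pev (hpart s p) = pev p.
move=> h; apply: cf_inj; apply/funext => k; rewrite cf_hpart.
by case: eqP => // /h.
Qed.

Lemma harm_lin s a p q : harm s p -> harm s q -> harm s (a *: p + q).
by move=> hp hq k hk; rewrite cf_lin hp// hq// mulr0 addr0. Qed.
Lemma harm0 s : harm s 0.
by move=> k _; exact: cf0. Qed.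
Lemma lam_sqrt s k : lam R k = (s * s.+1)%:R -> Nat.sqrt k = s.
move=> /eqP; rewrite eqr_nat => /eqP; move: (Nat.sqrt k) => t h.
nia.
Qed.

Lemma harmP s p : harm s p <-> pev (lapp p) = pev (- (s * s.+1)%:R *: p).
split => [h|e].
 apply: cf_inj; apply/funext => k; rewrite cf_lapp cfZ.
 have [<-|/eqP hk] := eqVneq (Nat.sqrt k) s => //.
 by rewrite h// !mulr0.
move=> k hk; have := congr1 (fun F : nat -> R => F k) (cf_ext e); rewrite cf_lapp cfZ => /eqP.
rewrite -subr_eq0 -mulrBl mulf_eq0 opprK => /orP[|/eqP//].
by rewrite addrC subr_eq0 => /eqP/esym/lam_sqrt.
Qed.

Lemma harm_rot s i p : harm s p -> harm s (rot i p).
move=> /harmP e; apply/harmP; rewrite -rot_lapp (pev_rot i e) rotZ.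
by [].
Qed.

Lemma harm_inV s p : harm s p -> inV (s.+1 ^ 2) p.
move=> h; apply: cf_inj; apply/funext => k; rewrite cf_proj.
case: ifP => // /negbT; rewrite -leqNgt => hk; apply: h => e.
by have /andP[_] := sqrt_spec k; rewrite e ltnNge hk.
Qed.

Lemma harm_Sp s p : harm s p -> Sp s p.
move=> h; apply: (Sp_ext (esym (harm_inV h))); rewrite /proj.
apply: Sp_sum => k _; apply: SpZ.
have hk : (Nat.sqrt k <= s)%N.
 have /andP[h1 _] := sqrt_spec k.
 by rewrite -ltnS -(ltn_exp2r _ _ (isT : 0 < 2)%N); exact: leq_ltn_trans (ltn_ord k).
exact: (Sp_le hk (@Sp_Y R k)).
Qed.

Lemma harm_low s t g p : harm s g -> Sp t p -> (t < s)%N -> ip g p = 0.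
move=> hg /Sp_inV hp ts; rewrite ipC (ip_parseval _ hp) big1// => k _.
rewrite hg ?mulr0// => e; have /andP[h1 _] := sqrt_spec k.
have := leq_ltn_trans h1 (ltn_ord k).
by rewrite e ltn_exp2r// ltnS leqNgt ts.
Qed.

Lemma hpart_low s t p : Sp t p -> (t < s)%N -> null (hpart s p).
move=> /Sp_inV hp ts; apply: cf_inj; apply/funext => k; rewrite cf_hpart cf0.
case: eqP => // e; apply: (cf_eq0 hp); have /andP[h1 _] := sqrt_spec k.
by rewrite e in h1; apply: leq_trans h1; rewrite leq_exp2r.
Qed.

Lemma hpart_lin s a p q : pev (hpart s (a *: p + q)) = pev (a *: hpart s p + hpart s q).
apply: cf_inj; apply/funext => k; rewrite cf_lin !cf_hpart cf_lin.
by case: ifP => //; rewrite mulr0 addr0.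
Qed.

Lemma hpart_ext s p q : pev p = pev q -> pev (hpart s p) = pev (hpart s q).
by move=> e; apply: cf_inj; apply/funext => k; rewrite !cf_hpart (cf_ext e).
Qed.

Lemma hpart_rot s i p : pev (hpart s (rot i p)) = pev (rot i (hpart s p)).
apply: cf_inj; apply/funext => k; rewrite cf_hpart.
case: eqP => [e|ne]; last by rewrite (harm_rot i (@harm_hpart s p) ne).
rewrite !cfE !ip_rot; congr (- _).
have [n hn] := inV_exists (rot i (Y R k)).
rewrite !(ipC _ (rot i _)) !(ip_parseval _ hn); apply: eq_bigr => j _.
rewrite cf_hpart; case: eqP => // nj; rewrite cf_rot_block ?mul0r//.
by apply/eqP => ee; apply: nj; rewrite ee.
Qed.

Lemma rot_mono a b c :
 (rot e0 (mono a b c) = c%:R *: mono a b.+1 c.-1 - b%:R *: mono a b.-1 c.+1) *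
 (rot e1 (mono a b c) = a%:R *: mono a.-1 b c.+1 - c%:R *: mono a.+1 b c.-1) *
 (rot e2 (mono a b c) = b%:R *: mono a.+1 b.-1 c - a%:R *: mono a.-1 b.+1 c).
by rewrite !rotE !D_mono -!scalerAr !px_mono. Qed.

(** Rotations about the first two axes trade a power of [z] for a power of [y] or [x], up to
    monomials with smaller [a + b]; so [z ^ s] generates all monomials of degree [s]. *)
Lemma mono_cyclic s (Q : P -> Prop) : (forall a p q, Q p -> Q q -> Q (a *: p + q)) ->
 (forall i p, Q p -> Q (rot i p)) -> Q (mono 0 0 s) ->
 forall a b c, (a + b + c = s)%N -> Q (mono a b c).
move=> Ql Qr Q0 a b c; move: {2}(a + b)%N (erefl (a + b)%N) => n.
have Qz : Q 0 by have := Ql (-1) _ _ Q0 Q0; rewrite scaleN1r addNr.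
elim/ltn_ind: n a b c => -[|n] IH a b c abn abc.
 have -> : a = 0%N by lia.
 have -> : b = 0%N by lia.
 by have -> : c = s by lia.
have QZ x p : Q p -> Q (x *: p) by move=> hp; rewrite -[_ *: _]addr0; exact: Ql.
have QD p q : Q p -> Q q -> Q (p + q) by move=> hq; rewrite -[p]scale1r; exact: Ql.
case: b abn abc => [|b] abn abc; last first.
 have E : mono a b.+1 c = (c.+1%:R)^-1 *: (b%:R *: mono a b.-1 c.+2 + rot e0 (mono a b c.+1)).
  by rewrite rot_mono addrC subrK scalerA mulVf// scale1r.
 rewrite E; apply: (QZ); apply: (QD); last by apply: Qr; apply: (IH n); lia.
 case: b abn abc {E} => [|b] abn abc /=; first by rewrite scale0r.
 by apply: QZ; apply: (IH n.-1); lia.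
case: a abn abc => [|a] abn abc//.
have E : mono a.+1 0 c = - (c.+1%:R)^-1 *: (- a%:R *: mono a.-1 0 c.+2 + rot e1 (mono a 0 c.+1)).
 by rewrite rot_mono 2!scaleNr addKr scalerN scalerA mulVf// scale1r opprK.
rewrite E; apply: (QZ); apply: (QD); last by apply: Qr; apply: (IH n); lia.
case: a abn abc {E} => [|a] abn abc /=; first by rewrite oppr0 scale0r.
by apply: QZ; apply: (IH n.-1); lia.
Qed.

Inductive rot_orbit g : P -> Prop :=
| Orbit0 : rot_orbit g g
| OrbitS i v : rot_orbit g v -> rot_orbit g (rot i v).

Lemma ip_harm_mono s g : harm s g -> (forall a b c, (a + b + c = s)%N -> ip g (mono a b c) = 0) ->
 ip g g = 0.
move=> hg h; apply: (harm_Sp hg) (fun p => ip g p = 0) _ _ _.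
- by move=> a p q hp hq; rewrite ipDr ipZr hp hq mulr0 addr0.
- by move=> p q e <-; exact/esym/ip_extr.
move=> a b c; rewrite leq_eqVlt => /orP[/eqP|lt]; first exact: h.
exact: (harm_low hg (@Sp_mono R _ a b c (leqnn _)) lt).
Qed.

(** Otherwise, by skew-symmetry, [g] would be orthogonal to all that rotations make of [z ^ s],
    hence to every monomial of degree [s], hence to itself. *)
Lemma orbit_pairing s g : harm s g -> ip g g <> 0 ->
 exists2 v, rot_orbit g v & ip v (mono 0 0 s) <> 0.
move=> hg g0; apply: contrapT => no; apply: g0; apply: (ip_harm_mono hg) => a b c abc.
have Q0 v : rot_orbit g v -> ip v (mono 0 0 s) = 0.
 by move=> hv; apply: contrapT => h; apply: no; exists v.
apply: (mono_cyclic (Q := fun m => forall v, rot_orbit g v -> ip v m = 0)) Q0 _ _ _ abc _ (Orbit0 g).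
- by move=> x p q hp hq v hv; rewrite ipDr ipZr hp// hq// mulr0 addr0.
move=> i p hp v hv; apply: oppr_inj; rewrite -ip_rot oppr0; apply: hp; exact: OrbitS.
Qed.

Lemma orbit_closed g (W : P -> Prop) : W g -> (forall i v, W v -> W (rot i v)) ->
 forall v, rot_orbit g v -> W v.
by move=> Wg Wr v; elim=> // i u _; exact: Wr. Qed.

(** A skew-symmetric operator and its square have the same kernel; powers are brought down one at a
    time. *)
Lemma iter_rot_null m i u : null (iter m (rot i) (rot i u)) -> null (rot i u).
elim: m u => // m IH u; rewrite iterSr => /IH h; apply: nullP.
by rewrite ip_rot ipC (ip_extl _ h) ip0l oppr0.
Qed.

(* Any [v] satisfies a linear relation between the [rot2^i v]; dividing out its
  lowest power leaves an axisymmetric combination. *)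
Lemma zonal_exists s v (W : P -> Prop) : W v -> (forall a p q, W p -> W q -> W (a *: p + q)) ->
 (forall i p, W p -> W (rot i p)) -> harm s v -> ip v (mono 0 0 s) <> 0 ->
 exists u, [/\ W u, harm s u, null (rot e2 u) & ip u (mono 0 0 s) <> 0].
move=> Wv Wl Wr hv v0; pose M w := rot e2 (rot e2 w); pose x i := iter i M v.
have Mx i : W (x i) /\ harm s (x i).
 elim: i => [|i [h1 h2]]//.
 by split; [do 2!apply: (Wr)|do 2!apply: harm_rot].
(* [rot e2] annihilates [z ^ s], so only the term without rotations pairs with it. This keeps the
   pairing of [u] nonzero. *)
have xz i : ip (x i) (mono 0 0 s) = if i is 0%N then ip v (mono 0 0 s) else 0.
 case: i => // i; rewrite ip_rot rot_mono !scale0r subrr ip0r oppr0.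
 by [].
pose n := (s.+1 ^ 2)%N; pose A := \matrix_(i < n.+1, k < n) cf (x i) k.
(* There is one more iterate than the dimension of the space. *)
have : kermx A != 0.
 rewrite kermx_eq0 neq_ltn; apply/orP; left.
 by exact: rank_leq_col.
move=> /rowV0Pn[c /sub_kermxP cA c0].
have [j cj jmin] : exists2 j : 'I_n.+1, c 0 j != 0 & forall i : 'I_n.+1, (i < j)%N -> c 0 i = 0.
 have : exists i, c 0 i != 0.
  by apply: contrapT => no; case/eqP: c0; apply/rowP => i; rewrite mxE; apply: contrapT => h; apply: no; exists i; apply/eqP.
 move=> [i hi]; case: (@arg_minnP _ i (fun i => c 0 i != 0) val hi) => j cj jmin.
 by exists j => // k kj; apply/eqP; apply: contraTT kj => /jmin; rewrite -leqNgt.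
pose u := \sum_(i < n.+1 | (j <= i)%N) c 0 i *: x (i - j)%N.
have W0 : W 0 by have := Wl (-1) _ _ Wv Wv; rewrite scaleN1r addNr.
have hu : W u /\ harm s u.
 rewrite /u; elim/big_rec : _ => [|i w _ [h1 h2]]; first by split => //; exact: harm0.
 by have [h3 h4] := Mx (i - j)%N; split; [exact: Wl|exact: harm_lin].
exists u; split; [exact: hu.1|exact: hu.2| |]; last first.
 rewrite ip_suml (bigD1 j)//= subnn ipZl xz big1 ?addr0; last first.
  move=> i /andP[ji ij]; rewrite ipZl xz.
  have : (0 < i - j)%N by rewrite subn_gt0 ltn_neqAle ji andbT eq_sym.
  by case: (i - j)%N => // m; rewrite mulr0.
 by move/eqP; rewrite mulf_eq0 (negbTE cj) => /eqP.
have M0 : M 0 = 0 by rewrite /M -(scale0r (0 : P)) !rotZ !scale0r.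
have ML a p q : M (a *: p + q) = a *: M p + M q by rewrite /M !rotD !rotZ.
have iterE : iter j M u = \sum_(i < n.+1) c 0 i *: x i.
 have -> : iter j M u = \sum_(i < n.+1 | (j <= i)%N) c 0 i *: x i.
  rewrite /u; elim/big_rec2 : _ => [|i w w' ji <-].
   by elim: (j : nat) => // m IH; rewrite iterS IH.
  have IL m a p q : iter m M (a *: p + q) = a *: iter m M p + iter m M q.
   by elim: m => // m IH; rewrite !iterS IH.
  by rewrite IL -iterD subnKC.
 rewrite [RHS](bigID (fun i : 'I_n.+1 => (j <= i)%N))/= [X in _ + X]big1 ?addr0// => i.
 by rewrite -ltnNge => /jmin ->; rewrite scale0r.
have nu : null (iter j M u).
 rewrite iterE; apply: cf_inj; apply/funext => k; rewrite cf0 cfE ip_suml.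
 have [kn|kn] := ltnP k n.
  move/rowP : cA => /(_ (Ordinal kn)); rewrite !mxE => {2}<-; apply: eq_bigr => i _.
  by rewrite ipZl mxE.
 rewrite big1// => i _; rewrite ipZl -cfE (cf_eq0 (harm_inV (Mx i).2) kn) mulr0.
 by [].
have nr : null (iter j M (rot e2 u)).
 have -> : iter j M (rot e2 u) = rot e2 (iter j M u) by elim: (j : nat) => // m IH; rewrite !iterS IH.
 exact: null_rot.
apply: (@iter_rot_null (j + j)); move: nr.
suff -> : iter (j + j) (rot e2) (rot e2 u) = iter j M (rot e2 u) by [].
by elim: (j : nat) => // m IH; rewrite addnS !iterS IH.
Qed.

(** Axial symmetry relates the pairings with monomials of equal power of [z]; orthogonality to lower
    degrees, with [r2 = 1], relates different powers of [z]. All pairings thus follow from the one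
    with [z ^ s]. *)
Lemma zonal_unique s f : harm s f -> null (rot e2 f) -> ip f (mono 0 0 s) = 0 -> ip f f = 0.
move=> hf zf f0; apply: (ip_harm_mono hf).
have rel a b c : b%:R * ip f (mono a.+1 b.-1 c) = a%:R * ip f (mono a.-1 b.+1 c).
 have : ip f (rot e2 (mono a b c)) = 0.
  by apply: oppr_inj; rewrite -ip_rot (ip_extl _ zf) ip0l oppr0.
 by rewrite rot_mono ipBr !ipZr => /eqP; rewrite subr_eq0 => /eqP.
have c1 b c : (b + c = s)%N -> ip f (mono 0 b c) = 0.
 elim/ltn_ind: b c => -[|[|b]] IH c bc.
 - by rewrite -bc in f0.
 - by have := rel 1%N 0%N c; rewrite mul0r mul1r => <-.
 have low : ip f (mono 0 b c) = 0 by apply: (harm_low hf (@Sp_mono R _ 0 b c (leqnn _))); lia.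
 have e : pev (mono 0 b c) = pev (mono 2 b c + mono 0 b.+2 c + mono 0 b c.+2).
  have -> : mono 2 b c + mono 0 b.+2 c + mono 0 b c.+2 = r2 R * mono 0 b c.
   by rewrite !mulrDl -!mulrA !px_mono.
  by apply/funext => z; rewrite pevM pev_r2 mul1r.
 move: low; rewrite (ip_extr _ e) !ipDr (IH b _ c.+2); [|by []|by lia].
 have := rel 1%N b.+1 c; rewrite /= mul1r addr0 => <- /eqP.
 rewrite -{1}[ip f _]mul1r -mulrDl mulf_eq0 => /orP[|/eqP ->]; last by rewrite mulr0.
 by rewrite -[1]/(1%:R) -natrD pnatr_eq0.
move=> a; elim/ltn_ind: a => -[|[|a]] IH b c abc; first exact: c1.
 have := rel 0%N b.+1 c; rewrite mul0r => /eqP; rewrite mulf_eq0 pnatr_eq0/=.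
 by move=> /eqP.
have := rel a.+1 b.+1 c; rewrite /= (IH a _ b.+2); [|by []|by lia].
by rewrite mulr0 => /eqP; rewrite mulf_eq0 pnatr_eq0/= => /eqP.
Qed.

(** An invariant subspace contains an axisymmetric element not orthogonal to [z ^ s]. By
    [zonal_unique] the harmonic part of [z ^ s] is a multiple of it, and rotations of that part give
    the harmonic parts of all monomials. *)
Lemma harm_irreducible s g (W : P -> Prop) : (forall a p q, W p -> W q -> W (a *: p + q)) ->
 (forall p q, pev p = pev q -> W p -> W q) -> (forall i p, W p -> harm s p -> W (rot i p)) ->
 W g -> harm s g -> ip g g <> 0 -> forall f, harm s f -> W f.
move=> Wl We Wr' Wg hg g0 f hf.
pose W' p := W p /\ harm s p.
have Wl' a p q : W' p -> W' q -> W' (a *: p + q).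
 by move=> [? ?] [? ?]; split; [exact: Wl|exact: harm_lin].
have Wr i p : W' p -> W' (rot i p).
 by move=> [? ?]; split; [exact: Wr'|exact: harm_rot].
have [v ov vz] := orbit_pairing hg g0.
have [Wv hv] := orbit_closed (conj Wg hg) Wr ov.
have [u [[Wu _] hu zu uz]] := zonal_exists (conj Wv hv) Wl' Wr hv vz.
have W0 : W 0 by have := Wl (-1) _ _ Wg Wg; rewrite scaleN1r addNr.
pose z := hpart s (mono 0 0 s); have hz : harm s z := @harm_hpart s _.
have zz : null (rot e2 z).
 rewrite /null -hpart_rot rot_mono !scale0r subrr.
 by apply: cf_inj; apply/funext => k; rewrite cf_hpart cf0 if_same.
pose a := ip z (mono 0 0 s) / ip u (mono 0 0 s).
have Wz : W z.
 have nf : null (- a *: u + z).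
  apply: nullP; apply: (zonal_unique (s := s)); first exact: harm_lin.
   rewrite rotD rotZ; apply/funext => x; rewrite pevD pevZ zu zz pev0 mulr0 addr0.
   by [].
  by rewrite ipDl ipZl mulNr divfK ?addNr; exact/eqP.
 have e : pev (a *: u + 0) = pev z.
  apply/funext => x; have := congr1 (fun F => F x) nf; rewrite addr0 pevD !pevZ pev0 mulNr.
  by move/eqP; rewrite addrC subr_eq0 => /eqP.
 by apply: (We _ _ e); exact: Wl.
have WH p : Sp s p -> W (hpart s p).
 move=> hp; apply: (hp (fun p => W (hpart s p))).
 - by move=> b p' q h1 h2; apply: (We _ _ (esym (hpart_lin s b p' q))); exact: Wl.
 - by move=> p' q e; apply: We; exact: hpart_ext.
 move=> b c d; rewrite leq_eqVlt => /orP[/eqP|lt]; last first.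
  by apply: (We _ _ (esym (hpart_low (@Sp_mono R _ b c d (leqnn _)) lt))).
 apply: (mono_cyclic (Q := fun p => W (hpart s p))) Wz b c d.
 - by move=> x p' q h1 h2; apply: (We _ _ (esym (hpart_lin s x p' q))); exact: Wl.
 - move=> i p' h; apply: (We _ _ (esym (hpart_rot s i p'))); apply: (Wr') => //.
  exact: (@harm_hpart s p').
by apply: (We _ _ (hpart_id hf)); apply: WH; exact: harm_Sp.
Qed.

Lemma harm_poly s p : eul p = s%:R *: p -> mD e0 (mD e0 p) + mD e1 (mD e1 p) + mD e2 (mD e2 p) = 0 ->
 harm s p.
move=> he hl; apply/harmP; rewrite lapp_eul hl mulr0 sub0r he.
have -> : eul (s%:R *: p) = s%:R *: eul p by rewrite /eul !mDZ -!scalerAr !scalerDr.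
rewrite he scalerA -scalerDl -scaleNr; congr (pev (- _ *: p)).
by rewrite mulnS natrD natrM addrC.
Qed.

End harmonics.

(** * Generation of all harmonics by brackets *)

Section generation.
Context (R : realType).
Notation P := (pol R).
Notation x := (px R e0).
Notation y := (px R e1).
Notation z := (px R e2).

(* Real and imaginary parts of [(x + i y) ^ k]. *)
Fixpoint sectoral (k : nat) : P * P :=
 if k is k'.+1 then let: (a, b) := sectoral k' in (x * a - y * b, x * b + y * a) else (1, 0).
Notation A k := (sectoral k).1.
Notation B k := (sectoral k).2.

Lemma sectoralS k : (A k.+1 = x * A k - y * B k) * (B k.+1 = x * B k + y * A k).
by rewrite /=; case: (sectoral k). Qed.
Lemma mD_one i : mD i (1 : P) = 0.
apply: (@addrI _ (mD i (1 : P))); rewrite addr0.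
by have := mD_mul i (1 : P) 1; rewrite !mulr1 mul1r => {3}->.
Qed.

Lemma mD_sectoral k : [/\ mD e0 (A k.+1) = k.+1%:R *: A k, mD e1 (A k.+1) = - (k.+1%:R *: B k),
  mD e2 (A k.+1) = 0 & [/\ mD e0 (B k.+1) = k.+1%:R *: B k, mD e1 (B k.+1) = k.+1%:R *: A k &
  mD e2 (B k.+1) = 0]].
elim: k => [|k [a0 a1 a2 [b0 b1 b2]]].
 rewrite !mDB !mDD !mDM !pdx /= !mD_one !mD0 !scale1r; by split; [ring|ring|ring|split; ring].
have kS (u : P) : k.+2%:R *: u = k.+1%:R *: u + u by rewrite -addn1 natrD scalerDl scale1r.
have [sA sB] := sectoralS k.+1; have [tA tB] := sectoralS k.
rewrite sA sB !mDB !mDD !mDM !pdx a0 a1 a2 b0 b1 b2 !kS {sA sB a0 a1 a2 b0 b1 b2}.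
move: tA tB; move: (A k.+1) (B k.+1) (A k) (B k) => a' b' a b -> -> /=; rewrite !scaleE.
by split; [ring|ring|ring|split; ring].
Qed.

Lemma rot2_sectoral k : rot e2 (B k.+1) = k.+1%:R *: A k.+1.
have [_ _ _ [b0 b1 _]] := mD_sectoral k; rewrite rot2E b0 b1 (sectoralS k).1.
by rewrite !scaleE; ring.
Qed.

(** Brackets with the quadratic harmonics [x * z] and [y * z] combine into a sectoral harmonic of
    the next degree: this is how the degree goes up. *)
Lemma bk_sectoral k : bk (x * z) (A k.+1) - bk (y * z) (B k.+1) = - (k.+1%:R *: B k.+2).
have [a0 a1 a2 [b0 b1 b2]] := mD_sectoral k; rewrite !bkE a0 a1 a2 b0 b1 b2 !mDM !pdx.
rewrite (sectoralS k.+1).2 (sectoralS k).1 (sectoralS k).2 !scaleE.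
by move: (A k) (B k) => a b /=; ring.
Qed.

Lemma sectoral_eul k : eul (A k.+1) = k.+1%:R *: A k.+1 /\ eul (B k.+1) = k.+1%:R *: B k.+1.
have [a0 a1 a2 [b0 b1 b2]] := mD_sectoral k; rewrite /eul a0 a1 a2 b0 b1 b2 !(sectoralS k) !scaleE.
by split; ring.
Qed.

Lemma harm_sectoral k : harm k.+1 (A k.+1) /\ harm k.+1 (B k.+1).
have [a0 a1 a2 [b0 b1 b2]] := mD_sectoral k; have [ea eb] := sectoral_eul k.
split; apply: harm_poly => //; rewrite ?a0 ?a1 ?a2 ?b0 ?b1 ?b2 !(mDN, mDZ, mD0).
 case: k {a0 a1 a2 b0 b1 b2 ea eb} => [|k].
  by rewrite /= -(scale0r (1 : P)) !mDZ !scale0r -{1}(mul1r (1 : P)) !mDM !mD_one !mul0r; rewrite ?mulr0 ?addr0 ?scaler0 ?subr0.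
 by have [a0 a1 a2 [b0 b1 b2]] := mD_sectoral k; rewrite a0 b1 addr0 subrr.
case: k {a0 a1 a2 b0 b1 b2 ea eb} => [|k]; first by rewrite !mD_one mD0 !scaler0 !addr0.
by have [a0 a1 a2 [b0 b2]] := mD_sectoral k; rewrite b0 a1 addr0 scalerN subrr.
Qed.

(** If the imaginary part were null, so would be its rotation, a multiple of the real part, which is
    1 at the point (1, 0, 0). *)
Lemma sectoral_nonnull k : ip (B k.+1) (B k.+1) <> 0.
move=> /nullP h; have n1 := null_rot e2 h.
have n2 : pev (rot e2 (B k.+1)) (sph (pi / 2, 0)) = 0 by rewrite n1 pev0.
have : pev (A k.+1) (sph (pi / 2, 0)) = 1.
 have xE : pev x (sph (pi / 2, 0)) = 1 by rewrite pev_px /s2coord mxE sin_pihalf cos0 mulr1.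
 have yE : pev y (sph (pi / 2, 0)) = 0 by rewrite pev_px /s2coord mxE sin0 mulr0.
 elim: k.+1 => [|j IH]; first by rewrite pev1.
 by rewrite (sectoralS j).1 pevB !pevM xE yE mul1r mul0r subr0.
move: n2; rewrite rot2_sectoral pevZ => /eqP; rewrite mulf_eq0 pnatr_eq0 => /eqP -> /eqP.
by rewrite eq_sym oner_eq0.
Qed.

Lemma harm_eul s (p : P) : harm s p -> (0 < s)%N ->
 pev (invl p) = pev (- ((s * s.+1)%:R)^-1 *: p).
move=> h s0; apply: cf_inj; apply/funext => k; rewrite cf_invl cfZ.
have [e|e] := pselect (Nat.sqrt k = s); last by rewrite (h k e) !mulr0 ?oppr0.
by rewrite /lam e mulNr.
Qed.

Lemma harm_zm s (p : P) : harm s p -> (0 < s)%N -> zm p.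
by move=> h s0; apply: (zm_cf0 _).2; apply: h => e; rewrite -e in s0. Qed.
Lemma harm_steady s (p : P) : harm s p -> (0 < s)%N -> null (euler p).
by move=> h s0; rewrite /null (pev_bkl p (harm_eul h s0)) bkZl bkpp scaler0.
Qed.

(** The stream function of a harmonic is a multiple of it, so [Bpol] is a Poisson bracket up to a
    factor that vanishes only for equal degrees. *)
Lemma Bpol_harm s t (p f : P) : harm s p -> harm t f -> (0 < s)%N -> (0 < t)%N ->
 pev (Bpol p f) = pev ((((t * t.+1)%:R)^-1 - ((s * s.+1)%:R)^-1) *: bk p f).
move=> hp hf s0 t0; apply/funext => w; rewrite pevD (pev_bkl f (harm_eul hp s0)).
rewrite (pev_bkl p (harm_eul hf t0)) !bkZl (bkC p f) !pevZ pevN.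
by ring.
Qed.

Lemma harm_px i : harm 1 (px R i).
apply: harm_poly; last by rewrite !pdx; elim/ord3: i => /=; rewrite ?mD_one ?mD0 !addr0.
by rewrite /eul !pdx scale1r; elim/ord3: i => /=; ring.
Qed.

Section generators.
(** [U] stands both for the saturation and for the available directions. *)
Variables (U : P -> Prop) (q c : P).
Hypotheses (Ul : forall a p p', U p -> U p' -> U (a *: p + p'))
 (Ue : forall p p', pev p = pev p' -> U p -> U p')
 (Ub : forall f g, null (euler f) -> U f -> U g -> U (Bpol f g))
 (Ux : forall i, U (px R i)) (Uq : U q) (Uc : U c).
Hypotheses (hq : harm 2 q) (hc : harm 3 c) (q0 : ip q q <> 0) (c0 : ip c c <> 0).

Let U0 : U 0. by have := Ul (-1) Uq Uq; rewrite scaleN1r addNr. Qed.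
Let UZ a p : U p -> U (a *: p). by move=> h; rewrite -[_ *: _]addr0; exact: Ul. Qed.

Let gap s t : (0 < s)%N -> (s < t)%N -> ((t * t.+1)%:R)^-1 - ((s * s.+1)%:R)^-1 != 0 :> R.
move=> s0 st; rewrite subr_eq0; apply/eqP => /invr_inj/eqP; rewrite eqr_nat /eqP; nia.
Qed.

Let Ubk s t p f : (0 < s)%N -> (s < t)%N -> harm s p -> harm t f -> U p -> U f -> U (bk p f).
move=> s0 st hp hf Up Uf; have t0 := ltn_trans s0 st.
have /UZ := Ue (Bpol_harm hp hf s0 t0) (Ub (harm_steady hp s0) Up Uf).
move=> /(_ (((t * t.+1)%:R)^-1 - ((s * s.+1)%:R)^-1)^-1).
by rewrite scalerA mulVf ?scale1r//; exact: gap.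
Qed.

(** A rotation is the bracket with a linear harmonic, whose degree differs from [s] as soon as
    [1 < s]. *)
Let Urot s i p : (1 < s)%N -> U p -> harm s p -> U (rot i p).
by move=> s1 Up hp; rewrite rotF; apply: (Ubk _ s1 (harm_px i) hp (Ux i) Up). Qed.
Let irr s g : (1 < s)%N -> U g -> harm s g -> ip g g <> 0 -> forall f, harm s f -> U f.
move=> s1; apply: harm_irreducible => // p Up; exact: Urot.
Qed.

(** Degree 3 is supplied by [c]: brackets with linear harmonics preserve the degree, and [Bpol] of
    two quadratic harmonics is null. From degree 3 on, brackets with quadratic harmonics reach the
    next degree, and irreducibility fills it. *)
Lemma generated_harm s f : (0 < s)%N -> harm s f -> U f.
elim/ltn_ind: s f => -[|[|[|[|s]]]] IH f // _ hf.
- apply: (Ue (hpart_id hf)).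
 have sp : Sp 1 f := harm_Sp hf.
 apply: (sp (fun p => U (hpart 1 p))) => [a p p' h1 h2|p p' e|a b d abd].
 - by apply: (Ue (esym (hpart_lin 1 a p p'))); exact: Ul.
 - by apply: Ue; exact: hpart_ext.
 have low : (a + b + d < 1)%N -> U (hpart 1 (mono R a b d)).
  by move=> lt; apply: (Ue (esym (hpart_low (@Sp_mono R _ a b d (leqnn _)) lt))).
 have hp i m : m = px R i -> U (hpart 1 m).
  by move=> ->; apply: (Ue (esym (hpart_id (harm_px i)))).
 case: a abd low => [|[|a]] abd low//.
  case: b abd low => [|[|b]] abd low//.
   case: d abd low => [|[|d]] abd low; [exact: low| |by lia].
   by apply: (hp e2); rewrite /mono !mul1r.
  have -> : d = 0%N by lia.
  by apply: (hp e1); rewrite /mono mul1r mulr1.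
 have -> : b = 0%N by lia.
 have -> : d = 0%N by lia.
 by apply: (hp e0); rewrite /mono !mulr1.
- exact: irr q0 _ hf.
- exact: irr c0 _ hf.
have [hA hB] := harm_sectoral s.+2; have [_ hB'] := harm_sectoral s.+3.
have h2 i j : i != j -> harm 2 (px R i * px R j).
 move=> ij; apply: harm_poly.
  by rewrite /eul !mDM !pdx scaler_nat mulr2n; elim/ord3: i ij; elim/ord3: j => //= _; ring.
 by elim/ord3: i ij; elim/ord3: j => //= _; rewrite !(mDD, mDM, pdx, mD_one, mD0) /=; ring.
have hxz := h2 e0 e2 isT; have hyz := h2 e1 e2 isT.
have UA : U (A s.+3) by apply: (IH s.+3).
have UB : U (B s.+3) by apply: (IH s.+3).
have U1 : U (bk (x * z) (A s.+3)) by apply: (Ubk (s := 2) (t := s.+3)) => //; apply: (IH 2).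
have U2 : U (bk (y * z) (B s.+3)) by apply: (Ubk (s := 2) (t := s.+3)) => //; apply: (IH 2).
apply: (irr (g := B s.+4)) hf => //; last exact: sectoral_nonnull.
have -> : B s.+4 = - (s.+3%:R)^-1 *: (-1 *: bk (y * z) (B s.+3) + bk (x * z) (A s.+3)).
 by rewrite scaleN1r addrC bk_sectoral scalerN scaleNr opprK scalerA mulVf ?scale1r.
by apply: UZ; exact: Ul.
Qed.

Lemma generated_all p : zm p -> U p.
move=> zp; have [n hn] := inV_exists p; apply: (Ue (esym hn)).
rewrite projE; elim/big_rec : _ => // k v _ Uv.
have [k0|k0] := posnP k; first by rewrite k0 (zm_cf0 _).1// scale0r add0r.
apply: Ul => //; apply: (@generated_harm (Nat.sqrt k)).
 have := sqrt_spec k; case: (Nat.sqrt k) => //=; rewrite ltnS leqn0 => /eqP kk.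
 by rewrite kk in k0.
move=> j jk; rewrite cfE Y_orth//; apply/eqP => e; apply: jk; rewrite -e.
by [].
Qed.

End generators.
End generation.

(** * Saturation of the controlled directions *)

Section static.
Context (R : realType).
Notation P := (pol R).

(** Equality almost everywhere with a polynomial, stated through a constant sequence so that the
    lemmas on limits apply. *)
Definition rep (h : S2 R -> R) (p : P) := l2lim (fun=> p) h.

Lemma rep_pev p : rep (pev p) p. exact: l2lim_cst. Qed.

Lemma rep_lin a h h' p p' : rep h p -> rep h' p' -> rep (a *: h + h') (a *: p + p').
by move=> r2; apply: l2limD => //; exact: l2limZ. Qed.
Lemma rep0 : rep 0 0.
have := rep_pev 0; rewrite (_ : pev 0 = 0)//.
by apply/funext => x; rewrite pev0.
Qed.

Lemma rep_H2lim h p : zm p -> rep h p -> H2lim (fun=> p) h.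
by move=> zp r; have [z c _] := H2lim_cst zp. Qed.
Lemma rep_uniq h p q : rep h p -> rep h q -> pev p = pev q.
move=> [hL hp] [_ hq]; apply/pev_eqP; rewrite -l2ip_pev -l2norm_sq.
suff -> : l2norm (pev (p - q)) = 0 by rewrite expr0n.
apply/eqP; rewrite eq_le l2norm_ge0 andbT; apply: (@le_eps _ _ 2) => // e e0.
have [n1 h1] := hp e e0; have [n2 h2] := hq e e0.
have k1 := h1 n1 (leqnn _); have k2 := h2 n2 (leqnn _).
have -> : pev (p - q) = (h - pev q) - (h - pev p).
 by apply/funext => x; rewrite pevB -[RHS]/(h x - pev q x - (h x - pev p x)); ring.
have Lp := L2B hL (L2_pev p); have Lq := L2B hL (L2_pev q).
apply: (le_trans (l2normB Lq Lp)); move: k2; move: (l2norm _) => b; lra.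
Qed.

Lemma rep_poisson h h' p p' : zm p -> zm p' -> rep h p -> rep h' p' ->
 rep (poisson h (invlap h')) (bk p (invl p')).
move=> zp zp' r r'; have k := rep_H2lim zp r; have k' := invlap_lim (rep_H2lim zp' r').
rewrite poissonC.
have := poisson_lim k' k; rewrite /rep => /(_ _)/l2limN H.
apply: l2lim_ext (H _) => [n|e e0]; first by rewrite bkC opprK.
by exists 0%N => m; rewrite subrr N0 ltW.
Qed.

Lemma rep_Bform h h' p p' : zm p -> zm p' -> rep h p -> rep h' p' ->
 rep (Bform h h') (- Bpol p p').
move=> zp zp' r r'; have := l2limD (rep_poisson zp' zp r' r) (rep_poisson zp zp' r r').
by rewrite (bkC (invl p)) (bkC (invl p')) -opprD.
Qed.

Lemma rep_steady h p : zm p -> rep h p -> steady h <-> null (euler p).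
move=> zp r; have rr := rep_poisson zp zp r r; split.
 move=> st; have z : rep 0 (bk p (invl p)) by apply: (l2lim_ae rr (@L2_0 R) st).
 have e := rep_uniq z rep0; rewrite /euler bkC; apply/funext => x; rewrite pevN e.
 by rewrite !pev0 oppr0.
move=> n; apply: (l2lim_uniq rr); apply: l2lim_ext rep0 => m; rewrite bkC.
by apply/funext => x; rewrite pevN n !pev0 oppr0.
Qed.

Lemma lin_span_lin (A : set (S2 R -> R)) a f g : lin_span A f -> lin_span A g ->
 lin_span A (a *: f + g).
move=> [n [b [e [he ->]]]] [m [b' [e' [he' ->]]]].
exists (n + m)%N, (fun k => match fintype.split k with inl i => a * b i | inr j => b' j end),
 (fun k => match fintype.split k with inl i => e i | inr j => e' j end); split.
 by move=> k; case: (fintype.split k).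
rewrite big_split_ord /=; congr (_ + _).
 rewrite scaler_sumr; apply: eq_bigr => i _.
 by rewrite (unsplitK (inl i) : fintype.split (lshift m i) = inl i) scalerA.
by apply: eq_bigr => i; rewrite (unsplitK (inr i) : fintype.split (rshift n i) = inr i).
Qed.

Lemma lin_span0 (A : set (S2 R -> R)) : lin_span A 0.
by exists 0%N, (fun=> 0), (fun=> 0); split => [[]//|]; rewrite big_ord0. Qed.
Lemma lin_span_sub (A : set (S2 R -> R)) f : A f -> lin_span A f.
by exists 1%N, (fun=> 1), (fun=> f); rewrite big_ord1 scale1r. Qed.
Lemma lin_span_rep (A : set (S2 R -> R)) : (forall f, A f -> exists p, zm p /\ rep f p) ->
 forall f, lin_span A f -> exists p, zm p /\ rep f p.
move=> hA f [n [a [e [he ->]]]]; elim/big_rec : _ => [|k g _ [p [zp rp]]].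
 by exists 0; split; [exact: zm0|exact: rep0].
have [q [zq rq]] := hA _ (he k); exists (a k *: q + p); split; last exact: rep_lin.
by apply: zmD => //; exact: zmZ.
Qed.

Section saturation.
Variables (r : nat) (d : 'I_r -> P).
Hypothesis zd : forall k, zm (d k).
Let f k := pev (d k).

Lemma saturation_rep j h : saturation f j h -> exists p, zm p /\ rep h p.
elim: j h => [|j IH] h /=.
 by apply: lin_span_rep => _ [k _ <-]; exists (d k); split; [exact: zd|exact: rep_pev].
move=> [g Dg [h' hh' <-]]; have [p [zp rp]] := IH g Dg.
have [p' [zp' rp']] : exists p, zm p /\ rep h' p.
 apply: lin_span_rep hh' => _ [a + [b Db <-]] => sa.
 have [q [zq rq]] : exists p, zm p /\ rep a p.
  by apply: lin_span_rep sa => u [Du _]; exact: IH.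
 have [q' [zq' rq']] := IH b Db; exists (- Bpol q q'); split; last exact: rep_Bform.
 by apply: zmN; apply: zmD; exact: zm_bk.
exists (p + p'); split; first exact: zmD.
exact: l2limD.
Qed.

Lemma saturation_lin j a g h : saturation f j g -> saturation f j h -> saturation f j (a *: g + h).
elim: j g h => [|j IH] g h /=; first exact: lin_span_lin.
move=> [u Du [v hv <-]] [u' Du' [v' hv' <-]].
exists (a *: u + u'); first exact: IH.
exists (a *: v + v'); first exact: lin_span_lin.
by rewrite scalerDr addrACA.
Qed.

Lemma saturation_le i j h : (i <= j)%N -> saturation f i h -> saturation f j h.
move=> /subnK <-; elim: (j - i)%N => // m IH hi; rewrite /=.
exists h; first exact: IH.
by exists 0; [exact: lin_span0|rewrite addr0].
Qed.

Definition saturated (p : P) := exists j h, saturation f j h /\ rep h p.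

Lemma saturated_lin a p q : saturated p -> saturated q -> saturated (a *: p + q).
move=> [i [h [Dh rh]]] [j [g [Dg rg]]]; exists (maxn i j), (a *: h + g); split.
 by apply: saturation_lin; [apply: saturation_le Dh; exact: leq_maxl|
  apply: saturation_le Dg; exact: leq_maxr].
exact: rep_lin.
Qed.

Lemma saturated_ext p q : pev p = pev q -> saturated p -> saturated q.
by move=> e [j [h [Dh rh]]]; exists j, h; split => //; apply: l2lim_ext rh. Qed.
Lemma saturated_bracket p q : null (euler p) -> saturated p -> saturated q -> saturated (Bpol p q).
move=> st [i [h [Dh rh]]] [j [g [Dg rg]]].
have zp : zm p by have [p' [z' r']] := saturation_rep Dh; apply: zm_ext z'; exact: rep_uniq rh.
have zq : zm q by have [p' [z' r']] := saturation_rep Dg; apply: zm_ext z'; exact: rep_uniq rg.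
have D1 : saturation f (maxn i j) h by apply: saturation_le Dh; exact: leq_maxl.
have D2 : saturation f (maxn i j) g by apply: saturation_le Dg; exact: leq_maxr.
exists (maxn i j).+1, (0 + -1 *: Bform h g); split; last first.
 have := rep_lin (-1) (rep_Bform zp zq rh rg) rep0; rewrite addr0 add0r /rep.
 by rewrite addr0 scaleN1r opprK.
exists 0.
 have := saturation_lin (-1) D1 D1; rewrite scaleN1r addNr; exact.
exists (-1 *: Bform h g) => //; rewrite -[_ *: _]addr0; apply: lin_span_lin; last exact: lin_span0.
apply: lin_span_sub; exists h; last by exists g.
by apply: lin_span_sub; split => //; exact/(rep_steady zp rh).
Qed.

Lemma saturated_dir k : saturated (d k).
exists 0%N, (f k); split; last exact: rep_pev.
by apply: lin_span_sub.
Qed.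

Lemma all_saturated_saturating : (forall k, null (euler (d k))) ->
 (forall p, zm p -> saturated p) -> saturating f.
move=> st all; split.
- by move=> k; apply/(rep_steady (zd k) (rep_pev (d k))).
- by move=> j h /saturation_rep[p [zp rp]]; exact: H2lim_H2 (rep_H2lim zp rp).
move=> g hg e e0; have [K [K0 hK]] := H2norm_lim R.
have k1 : 0 < K + 1 by rewrite ltr_wpDl.
have lg := H2_fproj hg; have [zg cg _] := lg.
have [n0 h0] := cg (e / 2 / (K + 1)) (divr_gt0 (divr_gt0 e0 (ltr0Sn _ 1)) k1).
have [j [h [Dh rh]]] := all (fproj g n0) (zg n0).
exists j, h; split => //; have lB := H2limB lg (rep_H2lim (zg n0) rh).
apply: (@le_lt_trans _ _ (K * (e / 2 / (K + 1)))).
 by apply: (hK _ _ _ n0 lB) => n hn; exact: h0.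
apply: (@le_lt_trans _ _ (e / 2)); last by rewrite ltr_pdivrMr// ltr_pMr// ltr1n.
by rewrite mulrC mulrAC ler_pdivrMr// ler_wpM2l ?lerDl// divr_ge0// ltW.
Qed.

End saturation.

(** The three harmonics are combinations of the coordinates; their independence makes the matrix of
    coefficients invertible. *)
Lemma span_linear (lb : 'I_3 -> P) : (forall i, harm 1 (lb i)) ->
 (forall a : 'I_3 -> R, null (\sum_i a i *: lb i) -> forall i, a i = 0) ->
 forall U : P -> Prop, (forall a p q, U p -> U q -> U (a *: p + q)) ->
 (forall p q, pev p = pev q -> U p -> U q) -> (forall i, U (lb i)) -> forall i, U (px R i).
move=> hlb free U Ul Ue Ulb i.
have U0 : U 0 by have := Ul (-1) _ _ (Ulb i) (Ulb i); rewrite scaleN1r addNr.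
have coef k : exists m : 'I_3 -> R, pev (lb k) = pev (\sum_j m j *: px R j).
 have sp : Sp 1 (lb k) := harm_Sp (hlb k).
 suff [m hm] : exists m : 'I_3 -> R, pev (hpart 1 (lb k)) = pev (\sum_j m j *: px R j).
  by exists m; rewrite -hm hpart_id.
 apply: (sp (fun p => exists m : 'I_3 -> R, pev (hpart 1 p) = pev (\sum_j m j *: px R j))).
 - move=> a p q [m hm] [m' hm']; exists (fun j => a * m j + m' j).
  rewrite hpart_lin; apply/funext => x; rewrite pevD pevZ hm hm' -pevZ -pevD scaler_sumr -big_split.
  by congr (pev _ x); apply: eq_bigr => j; rewrite scalerDl scalerA.
 - by move=> p q e [m hm]; exists m; rewrite -hm; exact: hpart_ext.
 move=> a b c abc.
 have px1 j m0 : m0 = px R j -> exists m : 'I_3 -> R, pev (hpart 1 m0) = pev (\sum_j m j *: px R j).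
  move=> ->; exists (fun t => (t == j)%:R); rewrite (hpart_id (harm_px R j)).
  rewrite (bigD1 j)//= eqxx scale1r big1 ?addr0// => t /negbTE ->; exact: scale0r.
 have low : (a + b + c < 1)%N -> exists m : 'I_3 -> R, pev (hpart 1 (mono R a b c)) = pev (\sum_j m j *: px R j).
  move=> lt; exists (fun=> 0); rewrite (hpart_low (@Sp_mono R _ a b c (leqnn _)) lt).
  by rewrite big1// => j; rewrite scale0r.
 case: a abc low => [|[|a]] abc low//.
  case: b abc low => [|[|b]] abc low//.
   case: c abc low => [|[|c]] abc low; [exact: low| |by lia].
   by apply: (px1 e2); rewrite /mono !mul1r.
  have -> : c = 0%N by lia.
  by apply: (px1 e1); rewrite /mono mul1r mulr1.
 have -> : b = 0%N by lia.
 have -> : c = 0%N by lia.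
 by apply: (px1 e0); rewrite /mono !mulr1.
have [m hm] := choice coef.
pose M := \matrix_(k, j) m k j.
have fM : row_free M.
 rewrite -kermx_eq0; apply/eqP/row_matrixP => k; rewrite row0.
 have : row k (kermx M) *m M = 0 by apply/sub_kermxP; exact: row_sub.
 move: (row k _) => c hc; apply/rowP => j; rewrite mxE.
 apply: (free (fun t => c 0 t)); rewrite /null.
 apply/funext => x; rewrite pev_sum pev0.
 under eq_bigr => t do rewrite pevZ hm pev_sum mulr_sumr.
 rewrite exchange_big/= big1// => t _.
 under eq_bigr => t' do rewrite pevZ mulrA.
 rewrite -mulr_suml.
 move/rowP : hc => /(_ t); rewrite !mxE => e.
 rewrite (_ : \sum_(i0 < 3) _ = 0) ?mul0r// -[RHS]e.
 by apply: eq_bigr => t'; rewrite mxE.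
have uM : M \in unitmx by rewrite -row_free_unit.
have e : pev (\sum_k (invmx M) i k *: lb k) = pev (px R i).
 apply/funext => x; rewrite pev_sum.
 under eq_bigr => t do rewrite pevZ hm pev_sum mulr_sumr.
 rewrite exchange_big/= (bigD1 i)//= [X in _ + X]big1 ?addr0.
  under eq_bigr => t do rewrite pevZ mulrA.
  rewrite -mulr_suml (_ : \sum_(i0 < 3) _ = 1) ?mul1r//.
  have E := congr1 (fun B : 'M[R]_3 => B i i) (mulVmx uM); rewrite mxE [RHS]mxE eqxx in E.
  apply: (etrans _ E); apply: eq_bigr => t; by rewrite [in RHS]mxE.
 move=> j ji; under eq_bigr => t do rewrite pevZ mulrA.
 rewrite -mulr_suml (_ : \sum_(i0 < 3) _ = 0) ?mul0r//.
 have E := congr1 (fun B : 'M[R]_3 => B i j) (mulVmx uM).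
 rewrite mxE [RHS]mxE eq_sym (negbTE ji) in E.
 apply: (etrans _ E); apply: eq_bigr => t; by rewrite [in RHS]mxE.
apply: (Ue _ _ e); elim/big_rec : _ => // k v Uv; exact: Ul.
Qed.

End static.

Lemma quarters_sum (R : realFieldType) (x y c del : R) : 0 <= del -> x <= c + del / 4 ->
 y <= del / 4 -> c <= del / 4 -> x + y <= del.
lra. Qed.

Lemma two_quarters (R : realFieldType) (x y c : R) : x <= c / 4 -> y <= c / 4 -> y + x <= c / 2.
lra. Qed.

(** * Approximate steering in a prescribed time *)

Section control.
Context (R : realType).
Notation P := (pol R).
Notation csup := (@csup R).
Variables (nu : R) (r n1 : nat) (d : 'I_r -> P).
Hypotheses (nu0 : 0 <= nu) (hd : forall k, inV n1 (d k)) (zd : forall k, zm (d k)).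
Notation program := (program R r).
Notation avail := (@avail R nu r d).
Notation available := (@available R nu r d).
Notation run := (run nu d).

Lemma available_ext eta eta' : pev eta = pev eta' -> available eta -> available eta'.
move=> e [ze [C [C0 h]]]; have ze' := zm_ext e ze; split => //.
exists C; split; first exact: C0.
move=> A Pr ds c L L0 ds0 cL cl K Rd b tau0 Rd0 b0 t0.
have [T [pi [m [hT hdu hs]]]] := h A Pr ds c L L0 ds0 cL cl K Rd b tau0 Rd0 b0 t0.
exists T, pi, m; split; [exact: hT|exact: hdu|]; rewrite -[b]addr0.
have n0 p : N 2 (c p *: eta - c p *: eta') = 0.
 by rewrite -scalerBr NZ (N_ext 2 (_ : _ = pev (0 : P))) ?N0 ?mulr0//; apply/funext => x; rewrite pevB e subrr pev0.
apply: shift_weaken hs => //.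
- by split; exact: zmZ.
- by move=> p; rewrite n0.
move=> p p' _ _; rewrite mul0r; apply: (le_trans (NB _ _ _)); rewrite !n0 addr0.
by [].
Qed.

Hypothesis all_avail : forall eta, zm eta -> available eta.

(** The translation is by the smooth [- fproj phi m0], and the datum is seen as the smooth
    [fproj phi k] up to a small error. That error is multiplied by [C], which depends on [m0], so
    [k] is chosen afterwards. *)
Lemma steer_to_zero phi (del tau0 : R) : H2 phi -> 0 < del -> 0 < tau0 -> exists s m,
 0 < dur s < tau0 /\ forall n, (m <= n)%N -> exists z, run n s (fproj phi n) z /\ N 2 z <= del.
move=> hphi d0 t0; have [zp cp _] := H2_fproj hphi.
have d4 : 0 < del / 4 by rewrite divr_gt0.
have [m0 h0] := cp _ d4; pose eta := - fproj phi m0.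
have [_ [C [C0 hC]]] := all_avail (zmN (zp m0)).
have C1 : 0 < C + 1 by rewrite ltr_wpDl.
have [k1 hk] := cp _ (divr_gt0 d4 C1).
have [a [k2 [a0 ha]]] := hcauchy_bounded cp.
pose k := maxn (maxn m0 k1) k2.
have [q0 q1 q2] : [/\ (m0 <= k)%N, (k1 <= k)%N & (k2 <= k)%N] by rewrite !leq_max !leqnn !orbT.
have a1 : 0 < a + 1 by rewrite ltr_wpDl.
have Pr0 : forall p : unit, True -> `|1| <= (1 : R) by rewrite normr1.
have Pr1 : forall p p' : unit, True -> True -> `|1 - 1| <= 1 * (0 : R) by rewrite subrr normr0.
have [T [pi [m [hT hdu hs]]]] := hC unit (fun=> True) (fun _ _ => 0) (fun=> 1) 1 ler01
 (fun _ _ => lexx 0) Pr0 Pr1 k (a + 1) (del / 4) tau0 a1 d4 t0.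
exists (pi tt), (maxn m k); split; first by rewrite hdu.
move=> n; rewrite geq_max => /andP[mn kn]; have [x1 x2 _] := hs n mn.
have ny : N 2 (fproj phi n - 0) <= a + 1.
 by rewrite subr0; apply: (le_trans (ha n (leq_trans q2 kn))); rewrite lerDl.
have [z hz] := x1 tt (fproj phi n) Logic.I (inV_fproj phi n) (zp n) ny.
exists z; split => //.
have nk : N 2 (fproj phi k) <= a + 1 by apply: (le_trans (ha k q2)); rewrite lerDl.
have := x2 tt (fproj phi n) z (fproj phi k) Logic.I (inV_fproj phi n) (zp n) ny hz (inV_fproj phi k) (zp k) nk.
rewrite subr0 scale1r => b1.
have b2 := hk n k (leq_trans q1 kn) q1; have b3 := h0 k m0 q0 (leqnn m0).
have b4 : C * N 2 (fproj phi n - fproj phi k) <= del / 4.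
 apply: (le_trans (ler_wpM2l C0 b2)).
 by rewrite mulrC mulrAC ler_pdivrMr// ler_wpM2l ?(ltW d4)// lerDl.
have e : z = (z - - fproj phi m0 - fproj phi k) + (fproj phi k - fproj phi m0) by ring.
rewrite e; apply: ND_le; move: b1 b3 b4.
exact: quarters_sum (ltW d0).
Qed.

Lemma drift n (t del : R) y : 0 < t -> 0 < del -> 512 * csup * t * del <= 1 -> inV n y -> zm y ->
 N 2 y <= del -> exists z, run n [:: (fun=> 0, t)] y z /\ N 2 z <= 4 * del.
move=> t0 d0 sm vy zy ny.
have c0 : ctl d (fun=> 0) = 0 by rewrite /ctl big1// => k; rewrite scale0r.
have e0 : N 2 y + t * N 2 (0 : P) = N 2 y by rewrite N0 mulr0 addr0.
have c512 : 0 <= 512 * csup * t by nneg.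
have [|||X hX] := @gsol_exists R n nu 0 t y nu0 t0 _ _ vy zy.
- exact: inV0.
- exact: zm0.
- by rewrite e0 /small; apply: le_trans sm; exact: ler_wpM2l.
exists (X t); split; first by exists X; rewrite ?c0.
case: hX => _ _ _ _ h; apply: (le_trans (h t _)); first by rewrite lexx ltW.
by rewrite e0 ler_pM2l.
Qed.

Section family.
Variables (A : Type) (Pr : A -> Prop) (ds : A -> A -> R) (C : R) (E : A -> P).
Hypotheses (ds0 : forall p p', 0 <= ds p p') (C0 : 0 <= C) (aE : avail Pr ds C E).

(** Availability gives short durations only. The state is first brought near 0, waits there without
    control for the time in excess, then is steered to [E p] in a time below [T / 2]. The first two
    phases do not depend on [p]. *)
Lemma steer phi (T e : R) : H2 phi -> 0 < T -> 0 < e -> exists (pi : A -> program) m Z,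
 (forall p, dur (pi p) = T) /\ forall n, (m <= n)%N -> forall p, Pr p ->
  [/\ run n (pi p) (fproj phi n) (Z n p), N 2 (Z n p - E p) <= e &
   forall p', Pr p' -> N 1 (invl (Z n p - Z n p' - (E p - E p'))) <= e * ds p p'].
move=> hphi T0 e0; have T2 : 0 < T / 2 by rewrite divr_gt0.
have e2 : 0 < e / 2 by rewrite divr_gt0.
have [T3 [pi [m3 [hT3 hd3 hs3]]]] := aE 0%N ltr01 e2 T2.
(* [del] has to permit the wait, to keep the state in the unit ball, and to make [C * (4 * del)] at
   most [e / 2]. *)
pose kk := 512 * csup * T + 4 + C * 8 / e.
have c512 : 0 <= 512 * csup * T by nneg.
have c8 : 0 <= C * 8 / e := divr_ge0 (mulr_ge0 C0 (ler0n R 8)) (ltW e0).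
have kk0 : 0 <= kk by nneg.
have [del d0 hdel] := pos_small kk0 (ltr01 : 0 < (1 : R)).
have G (x y z : R) : 0 <= x -> 0 <= z -> [/\ x <= x + 4 + z, 4 <= x + 4 + z & z <= x + 4 + z].
 by move=> *; split; lra.
have [g1 g2 g3] := G _ 0 _ c512 c8.
have k1 := le_trans (ler_wpM2l (ltW d0) g1) hdel.
have k2 := le_trans (ler_wpM2l (ltW d0) g2) hdel.
have k3 := le_trans (ler_wpM2l (ltW d0) g3) hdel.
have [s1 [m1 [hs1 hz1]]] := steer_to_zero hphi d0 T2.
pose t := T - dur s1 - T3; have t0 : 0 < t by rewrite /t; move: hs1 hT3; lra.
have tT : t <= T by rewrite /t; move: hs1 hT3; lra.
have zp := let: And3 z _ _ := H2_fproj hphi in z.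
have mid n : exists y, (m1 <= n)%N -> [/\ run n (s1 ++ [:: (fun=> 0, t)]) (fproj phi n) y,
  inV n y, zm y & N 2 y <= 4 * del].
 have [hn|hn] := boolP (m1 <= n)%N; last by exists 0.
 have [y [hy ny]] := hz1 n hn; have [vy zy] := run_inV (inV_fproj phi n) (zp n) hy.
 have [|z [hz nz]] := @drift n t del y t0 d0 _ vy zy ny.
  apply: le_trans k1; rewrite [leRHS]mulrC; apply: (ler_wpM2r (ltW d0)).
  exact: (ler_wpM2l (mulr_ge0 (ler0n R 512) (csup_ge0 R)) tT).
 exists z => _; have [vz zz] := run_inV vy zy hz; split => //.
 by apply/run_cat; exists y.
have [y hy] := choice mid.
pose pp p := (s1 ++ [:: (fun=> 0 : R, t)]) ++ pi p.
have y1 n : (m1 <= n)%N -> N 2 (y n - 0) <= 1.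
 by move=> /hy[_ _ _ h]; rewrite subr0; apply: (le_trans h); rewrite mulrC.
have [Z hZ] : exists Z : nat -> A -> P, forall n p, (maxn m1 m3 <= n)%N -> Pr p -> run n (pi p) (y n) (Z n p).
 have ex n p : exists z, (maxn m1 m3 <= n)%N -> Pr p -> run n (pi p) (y n) z.
  have [hn|hn] := boolP (maxn m1 m3 <= n)%N; last by exists 0.
  have [hp|hp] := pselect (Pr p); last by exists 0.
  move: hn; rewrite geq_max => /andP[n1' n3]; have [_ vy zy _] := hy n n1'.
  have [x1 _ _] := hs3 n n3; have [z hz] := x1 p (y n) hp vy zy (y1 n n1').
  by exists z.
 have ex' n : exists Z : A -> P, forall p, (maxn m1 m3 <= n)%N -> Pr p -> run n (pi p) (y n) (Z p).
  by have [Z hZ] := choice (ex n); exists Z.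
 by have [Z hZ] := choice ex'; exists Z.
exists pp, (maxn m1 m3), Z; split.
 by move=> p; rewrite /pp !dur_cat hd3 /= /t; ring.
move=> n hn p hp; have rp := hZ n p hn hp; have := hn; rewrite geq_max => /andP[n1' n3].
have [ry vy zy ny] := hy n n1'; have [_ x2 x3] := hs3 n n3.
have ny4 : C * N 2 (y n) <= e / 2.
 apply: (le_trans (ler_wpM2l C0 ny)).
 have : del * (C * 8 / e) * e <= 1 * e by rewrite ler_pM2r.
 rewrite mul1r (_ : del * (C * 8 / e) * e = C * (4 * del) * 2); last first.
  by field; rewrite gt_eqF.
 by move: (C * _) => x; lra.
split.
- by apply/run_cat; exists (y n).
- have := x2 p (y n) (Z n p) 0 hp vy zy (y1 n n1') rp (inV0 R 0) (zm0 R).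
 rewrite N0 => /(_ ler01); rewrite !subr0 => /le_trans; apply.
 by move: ny4; move: (C * _) => x; lra.
move=> p' hp'; have rp' := hZ n p' hn hp'.
have := x3 p p' (y n) (y n) _ _ 0 hp hp' vy zy (y1 n n1') vy zy (y1 n n1') rp rp' (inV0 R 0) (zm0 R).
rewrite !subr0 subrr N0 addr0.
have -> : N 1 (invl (0 : P)) = 0 by rewrite (N_ext 1 (pev_invl0 R)) N0.
rewrite mulr0 add0r => /le_trans; apply; apply: ler_wpM2r => //.
by rewrite ler_pdivrMr// ler_peMr ?(ltW e0)// ler1n.
Qed.

Let f k := pev (d k).

Lemma steer_attainable phi (T e : R) : H2 phi -> 0 < T -> 0 < e -> exists (h : A -> S2 R -> R) Z m,
 forall p, Pr p -> [/\ attainable nu T f phi (h p), H2lim (fun n => Z n p) (h p) &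
  forall n, (m <= n)%N -> [/\ inV n (Z n p), N 2 (Z n p - E p) <= e &
   forall p', Pr p' -> N 1 (invl (Z n p - Z n p' - (E p - E p'))) <= e * ds p p']].
move=> hphi T0 e0; have [pi [m0 [Z [hdu hZ]]]] := steer hphi T0 e0.
pose m := maxn m0 n1; have m0m : (m0 <= m)%N := leq_maxl _ _; have n1m : (n1 <= m)%N := leq_maxr _ _.
have hphi' := H2_fproj hphi; have zp := let: And3 z _ _ := hphi' in z.
pose Z' n p := if (m <= n)%N then Z n p else 0.
have ex p : exists h, Pr p -> attainable nu T f phi h /\ H2lim (fun n => Z' n p) h.
 have [hp|hp] := pselect (Pr p); last by exists 0.
 have [||||h h1 h2] := @run_attainable R nu r m d nu0 _ zd (pi p) T (fproj phi) (fun n => Z' n p) phi T0 (hdu p) hphi'.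
 - by move=> k; exact: inV_le (hd k).
 - exact: inV_fproj.
 - by move=> n hn; rewrite /Z' hn; have [] := hZ n (leq_trans m0m hn) p.
 - by move=> n hn; rewrite /Z' leqNgt hn.
 by exists h.
have [h hh] := choice ex; exists h, Z', m => p hp; have [h1 h2] := hh p hp; split => // n hn.
have [r1 r2 r3] := hZ n (leq_trans m0m hn) p hp.
rewrite /Z' hn; split => //; exact: (run_inV (inV_fproj phi n) (zp n) r1).1.
Qed.

End family.

Let f k := pev (d k).

Lemma all_avail_approximately T : 0 < T -> approximately_controllable nu T f.
move=> T0 phi hphi g hg eps eps0.
have e4 : 0 < eps / 4 by rewrite divr_gt0.
have [zg cg lg] := H2_fproj hg; have [m0 h0] := cg _ e4.
have [_ [C [C0 hC]]] := all_avail (zg m0).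
have Pr0 : forall p : unit, True -> `|1| <= (1 : R) by rewrite normr1.
have Pr1 : forall p p' : unit, True -> True -> `|1 - 1| <= 1 * (0 : R) by rewrite subrr normr0.
have aE := hC unit (fun=> True) (fun _ _ => 0) (fun=> 1) 1 ler01 (fun _ _ => lexx 0) Pr0 Pr1.
have [h [Z [m hZ]]] := steer_attainable (fun _ _ => lexx 0) C0 aE hphi T0 e4.
have [ha hl hn] := hZ tt Logic.I; exists (h tt) => //.
have [zz _ lh] := hl; have lB := l2limB lg lh.
apply: (@le_lt_trans _ _ (eps / 2)); last by rewrite ltr_pdivrMr// ltr_pMr// ltr1n.
apply: (l2lim_norm (n0 := maxn m m0) lB) => n; rewrite geq_max => /andP[mn m0n].
have [_ b1 _] := hn n mn; have b2 := h0 n m0 m0n (leqnn m0).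
have zB := zmB (zg n) (zz n).
apply: (le_trans (N_zm_le zB (isT : (0 <= 2)%N))).
rewrite (_ : fproj g n - Z n tt = (fproj g n - fproj g m0) - (Z n tt - 1 *: fproj g m0)); last first.
 by rewrite scale1r; ring.
apply: (le_trans (NB _ _ _)); exact: two_quarters.
Qed.

End control.

(** * Orthonormal families and a contraction principle *)

Section projection.
Context (R : realType).
Notation P := (pol R).
Notation area := (@area R).
Notation H2 := (@H2 R).

Lemma H2lim_lin (a : R) (p q : nat -> P) (f g : S2 R -> R) : H2lim p f -> H2lim q g ->
 H2lim (fun n => a *: p n + q n) (a *: f + g).
move=> [zp cp lp] [zq cq lq]; split.
- by move=> n; apply: zmD => //; exact: zmZ.
- move=> e e0; have a1 : 0 < `|a| + 1 by [].
 have e2 : 0 < e / 2 by rewrite divr_gt0.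
 have [n1 h1] := cp _ (divr_gt0 e2 a1); have [n2 h2] := cq _ e2.
 exists (maxn n1 n2) => n m; rewrite !geq_max => /andP[k1 k2] /andP[k3 k4].
 rewrite (_ : _ _ = a *: (p n - p m) + (q n - q m)); last by ring.
 apply: ND_le; rewrite NZ; have b1 := h1 n m k1 k3; have b2 := h2 n m k2 k4.
 have b3 : `|a| * N 2 (p n - p m) <= e / 2.
  apply: (le_trans (ler_wpM2l (normr_ge0 a) b1)).
  by rewrite mulrC mulrAC ler_pdivrMr// ler_wpM2l ?(ltW e2)// lerDl.
 by apply: (le_trans (lerD b3 b2)); rewrite -splitr.
- by apply: l2limD => //; exact: l2limZ.
Qed.

Lemma H2_lin (a : R) (f g : S2 R -> R) : H2 f -> H2 g -> H2 (a *: f + g).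
by move=> /H2_fproj hf /H2_fproj hg; apply: H2lim_H2 (H2lim_lin a hf hg). Qed.
Lemma H2_0 : H2 0.
apply: (@H2lim_H2 _ (fun=> 0)); have := H2lim_cst (zm0 R).
by rewrite (_ : pev 0 = 0)//; apply/funext => x; rewrite pev0.
Qed.

Lemma H2_L2 f : H2 f -> L2 f.
by move=> [[[]]]. Qed.

Definition comb k (a : nat -> R) (b : nat -> S2 R -> R) : S2 R -> R := \sum_(j < k) a j *: b j.

Lemma H2_comb k a b : (forall i, (i < k)%N -> H2 (b i)) -> H2 (comb k a b).
move=> hb; rewrite /comb; elim/big_rec : _ => [|j g _ hg]; first exact: H2_0.
by apply: H2_lin => //; exact: hb.
Qed.

Lemma l2ip_comb k a b f : L2 f -> (forall i, (i < k)%N -> L2 (b i)) ->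
 l2ip (comb k a b) f = \sum_(j < k) a j * l2ip (b j) f.
move=> hf hb; rewrite /comb; pose b' (j : 'I_k) := a j *: b j.
have hb' j : L2 (b' j) by apply: L2Z; exact: hb.
rewrite (l2ip_suml _ hb' hf); apply: eq_bigr => j; rewrite l2ipZl//; exact: hb.
Qed.

Definition orthonormal k (b : nat -> S2 R -> R) := (forall i, (i < k)%N -> H2 (b i)) /\
 forall i j, (i < k)%N -> (j < k)%N -> l2ip (b i) (b j) = (i == j)%:R.

Lemma gram_schmidt_fun (s : seq (S2 R -> R)) : (forall f, List.In f s -> H2 f) -> exists k b,
 orthonormal k b /\ forall f, List.In f s -> f = comb k (fun j => l2ip f (b j)) b %[ae area].
elim: s => [|f s IH] hs; first by exists 0%N, (fun=> 0).
have [k [b [[hb ob] hE]]] := IH (fun g hg => hs g (or_intror hg)).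
have hf : H2 f := hs f (or_introl erefl).
have Lf := H2_L2 hf; have Lb i (ik : (i < k)%N) : L2 (b i) := H2_L2 (hb i ik).
pose g := comb k (fun j => l2ip f (b j)) b; have hg : H2 g by exact: H2_comb.
pose u := f - g; have hu : H2 u by rewrite /u addrC -scaleN1r; exact: H2_lin.
have Lg := H2_L2 hg; have Lu := H2_L2 hu.
have ub i : (i < k)%N -> l2ip u (b i) = 0.
 move=> ik; rewrite (l2ipBl Lf Lg (Lb i ik)) (l2ip_comb _ (Lb i ik) Lb).
 rewrite (bigD1 (Ordinal ik))//= ob// eqxx mulr1 big1 ?addr0 ?subrr// => j ji.
 rewrite ob//; case: eqP => [e|_]; last by rewrite mulr0.
 by move/eqP : ji; case; exact: val_inj.
(* A function already in the span adds no vector. *)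
have [u0|u0] := eqVneq (l2norm u) 0.
 exists k, b; split => // h [<-|]; last exact: hE.
 have := l2norm_eq0 Lu u0; apply: filterS => x hx _.
 by apply/eqP; rewrite -subr_eq0; apply/eqP; exact: (hx Logic.I).
pose b' j := if (j < k)%N then b j else (l2norm u)^-1 *: u.
have bl j : (j < k)%N -> b' j = b j by move=> jk; rewrite /b' jk.
have bk' : b' k = (l2norm u)^-1 *: u by rewrite /b' ltnn.
have hb' i : (i < k.+1)%N -> H2 (b' i).
 rewrite ltnS leq_eqVlt => /orP[/eqP ->|ik]; last by rewrite bl//; exact: hb.
 by rewrite bk' -[_ *: _]addr0; apply: H2_lin => //; exact: H2_0.
have uu : l2ip ((l2norm u)^-1 *: u) ((l2norm u)^-1 *: u) = 1.
 rewrite l2ipZl ?l2ipZr//; last exact: L2Z.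
 rewrite -(l2norm_sq u); by field.
have uo i : (i < k)%N -> l2ip ((l2norm u)^-1 *: u) (b i) = 0.
 by move=> ik; rewrite l2ipZl ?ub ?mulr0//; exact: Lb.
have ck h : L2 h -> comb k.+1 (fun j => l2ip h (b' j)) b' =
  comb k (fun j => l2ip h (b j)) b + l2ip h (b' k) *: b' k.
 move=> Lh; rewrite /comb big_ord_recr /=; congr (_ + _).
 by apply: eq_bigr => j; rewrite bl.
exists k.+1, b'; split; first split => //.
 have cases i : (i < k.+1)%N -> i = k \/ (i < k)%N.
  by rewrite ltnS leq_eqVlt => /orP[/eqP ->|]; [left|right].
 move=> i j /cases[->|ik] /cases[->|jk].
 - by rewrite bk' eqxx.
 - by rewrite bk' bl// uo// gtn_eqF.
 - by rewrite bk' bl// (l2ipC (b i)) uo// ltn_eqF.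
 - by rewrite !bl//; exact: ob.
move=> h [<-|hin]; rewrite ck//; last first.
- exact: H2_L2 (hs h (or_intror hin)).
- have Lh := H2_L2 (hs h (or_intror hin)); have eh := hE h hin.
 have hk : l2ip h (b' k) = 0.
  have Lc : L2 (comb k (fun j => l2ip h (b j)) b) by apply: H2_L2; exact: H2_comb.
  have Lk : L2 (b' k) by apply: H2_L2; exact: hb'.
  rewrite (ae_l2ip Lh Lc Lk eh) (l2ip_comb _ Lk Lb) big1// => j _.
  by rewrite bk' (l2ipC (b j)) uo// mulr0.
 by rewrite hk scale0r addr0.
have fk : l2ip f (b' k) = l2norm u.
 have -> : f = u + g by rewrite subrK.
 have Lk : L2 (b' k) by apply: H2_L2; exact: hb'.
 rewrite (l2ipDl Lu Lg Lk) bk' (l2ipZr _ Lu Lu) -l2norm_sq mulKf//.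
 rewrite (l2ip_comb _ _ Lb); last by rewrite -bk'.
 by rewrite big1 ?addr0// => j; rewrite (l2ipC (b j)) uo// mulr0.
rewrite fk bk' scalerA mulfV// scale1r; apply: aeW => x _.
by rewrite addrC subrK.
Qed.

(* Picard iteration on [R^k] with the l^1 distance. *)
Lemma fixed_point k (L : R) (G : ('I_k -> R) -> 'I_k -> R) :
 let Pr (p : 'I_k -> R) := forall i, `|p i| <= L in
 let ds (p p' : 'I_k -> R) := \sum_i `|p i - p' i| in 0 <= L ->
 (forall p, Pr p -> Pr (G p)) -> (forall p p', Pr p -> Pr p' -> ds (G p) (G p') <= ds p p' / 2) ->
 exists p, Pr p /\ forall i, G p i = p i.
move=> Pr ds L0 GP Gc; pose x m := iter m G (fun=> 0).
have Px m : Pr (x m) by elim: m => i; [rewrite normr0|exact: GP].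
have ds_ge0 p p' : 0 <= ds p p' by rewrite sumr_ge0.
pose C := ds (x 1%N) (x 0%N).
have dx m : ds (x m.+1) (x m) <= C / 2 ^+ m.
 elim: m => [|m IH]; first by rewrite divr1.
 apply: (le_trans (Gc _ _ (Px m.+1) (Px m))).
 by rewrite exprSr invfM mulrA; apply: ler_wpM2r => //.
have co p p' i : `|p i - p' i| <= ds p p'.
 by rewrite /ds (bigD1 i)// lerDl sumr_ge0.
have lim i : exists l, forall m, `|l - x m i| <= 2 * C / 2 ^+ m.
 apply: (geometric_limit (ds_ge0 _ _)) => m; exact: le_trans.
have [p hp] := choice lim.
have small (c e : R) : 0 <= c -> 0 < e -> exists m, c / 2 ^+ m <= e by exact: half_exp_small.
have C2 : 0 <= 2 * C := mulr_ge0 (ler0n R 2) (ds_ge0 _ _).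
have Pp : Pr p.
 move=> i; rewrite -subr_le0; apply: (@le_eps _ _ 1) => // e e0; rewrite mulr1.
 have [m hm] := small _ e C2 e0; have := hp i m; have := Px m i.
 have := ler_normD (p i - x m i) (x m i); rewrite subrK.
 by lra.
have dp m : ds p (x m) <= k%:R * (2 * C / 2 ^+ m).
 apply: (le_trans (ler_sum _ (fun i _ => hp i m))).
 by rewrite sumr_const card_ord -[_ *+ _]mulr_natl.
have k0 : 0 <= k%:R * (2 * C) by nneg.
exists p; split => // i; apply/eqP; rewrite -subr_eq0 -normr_le0.
apply: (@le_eps _ _ 2) => // e e0; have [m hm] := small _ e k0 e0.
have h1 := le_trans (co (G p) (x m.+1) i) (Gc p (x m) Pp (Px m)).
have h2 := le_trans (co p (x m.+1) i) (dp m.+1).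
have h3 : k%:R * (2 * C / 2 ^+ m) <= e by rewrite mulrA.
have h4 : k%:R * (2 * C / 2 ^+ m.+1) <= e.
 apply: le_trans h3; apply: ler_wpM2l => //; apply: ler_wpM2l => //.
 by rewrite exprS invfM ler_piMl ?invf_le1 ?ler1n.
have := ler_distD (x m.+1 i) (G p i) (p i); rewrite (distrC (x m.+1 i)).
have := dp m; move: h1 h2 h3 h4.
by lra.
Qed.

End projection.

Lemma In_map_seq (I : eqType) (T : Type) (e : I -> T) (s : seq I) (x : T) :
 List.In x [seq e i | i <- s] -> exists i, e i = x.
by elim: s => [//|i s IH] [<-|/IH]; first exists i. Qed.

Lemma map_seq_In (I : eqType) (T : Type) (e : I -> T) (s : seq I) i :
 i \in s -> List.In (e i) [seq e i | i <- s].
by elim: s => [//|j s IH]; rewrite inE => /orP[/eqP ->|/IH]; [left|right]. Qed.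

Lemma norm3_le (R : realFieldType) (x a b L : R) : `|x - (a - b)| <= 4^-1 -> `|a| <= 4^-1 * L ->
 `|b| <= 4^-1 -> `|x| <= L / 2 + 1 / 2.
move=> h1 h2 h3; have L0 : 0 <= L by have := le_trans (normr_ge0 _) h2; lra.
have := ler_normD (x - (a - b)) (a - b); rewrite subrK; have := ler_normB a b; lra.
Qed.

Lemma norm_diff_le (R : realFieldType) (x x' a a' b c t A B : R) : `|x - a| <= t / 2 ->
 `|x' - a'| <= t / 2 -> `|b| <= A -> `|c| <= B -> a - a' = b - c -> `|x - x'| <= A + B + t.
move=> h1 h2 h3 h4 e; have -> : x - x' = (x - a) - (x' - a') + (b - c) by rewrite -e; ring.
have := ler_normD ((x - a) - (x' - a')) (b - c); have := ler_normB b c.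
have := ler_normB (x - a) (x' - a'); lra.
Qed.

(** * Exact controllability in projection *)

Section exact_control.
Context (R : realType).
Notation P := (pol R).
Variables (nu : R) (r n1 : nat) (d : 'I_r -> P).
Hypotheses (nu0 : 0 <= nu) (hd : forall k, inV n1 (d k)) (zd : forall k, zm (d k)).
Notation avail := (@avail R nu r d).
Notation available := (@available R nu r d).
Hypothesis all_avail : forall eta, zm eta -> available eta.

(** The negative norm is enough to control pairings with functions bounded in H^2. *)
Lemma ip_invl_le (x y : P) : zm x -> zm y -> `|ip x y| <= N 1 (invl x) * N 2 y.
move=> zx zy; have := sip1_invl y zx; move=> /(congr1 -%R); rewrite opprK => <-; rewrite normrN.
apply: (le_trans (sip_le _ _ _)); apply: ler_wpM2l; first nneg.
exact: N_zm_le.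
Qed.

Lemma ip_zm_le (x y : P) : zm x -> zm y -> `|ip x y| <= N 2 x * N 2 y.
move=> zx zy; apply: (le_trans (ip_le _ _)).
by apply: ler_pM; [nneg|nneg|exact: N_zm_le|exact: N_zm_le].
Qed.

Lemma fproj_bounded k (b : nat -> S2 R -> R) : (forall i, (i < k)%N -> H2 (b i)) ->
 exists (K : R) n0, 0 <= K /\ forall i n, (i < k)%N -> (n0 <= n)%N -> N 2 (fproj (b i) n) <= K.
elim: k => [|k IH] hb; first by exists 0, 0%N.
have [|K [n0 [K0 hK]]] := IH; first by move=> i ik; apply: hb; exact: ltnW.
have [_ ck _] := H2_fproj (hb k (ltnSn k)); have [a [n2 [a0 ha]]] := hcauchy_bounded ck.
exists (K + a), (maxn n0 n2); split; first nneg.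
move=> i n; rewrite ltnS leq_eqVlt geq_max => ik /andP[m1 m2].
case/orP : ik => [/eqP ->|ik]; first by apply: (le_trans (ha n m2)); rewrite lerDr.
by apply: (le_trans (hK i n ik m1)); rewrite lerDl.
Qed.

Lemma fproj_approx k (b : nat -> S2 R -> R) (e : R) : 0 < e -> (forall i, (i < k)%N -> H2 (b i)) ->
 exists M, forall i n, (i < k)%N -> (M <= n)%N -> l2norm (b i - pev (fproj (b i) n)) <= e.
move=> e0; elim: k => [|k IH] hb; first by exists 0%N.
have [|M hM] := IH; first by move=> i ik; apply: hb; exact: ltnW.
have [_ _ lk] := H2_fproj (hb k (ltnSn k)); have [n2 h2] := lk.2 e e0.
exists (maxn M n2) => i n; rewrite ltnS leq_eqVlt geq_max => ik /andP[m1 m2].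
case/orP : ik => [/eqP ->|ik]; [exact: h2|exact: hM].
Qed.

Lemma l2ip_lim_fproj m (p : nat -> P) h g : H2lim p h -> L2 g -> (forall n, (m <= n)%N -> inV n (p n)) ->
 forall e : R, 0 < e -> exists n0, forall n, (n0 <= n)%N ->
 `|l2ip h g - ip (p n) (fproj g n)| <= e * l2norm g.
move=> [_ _ lp] Lg vp e e0; have [n0 hn] := l2lim_ip lp Lg e0.
exists (maxn m n0) => n; rewrite geq_max => /andP[mn n0n].
by rewrite [ip _ _]ipC -(l2ip_fproj Lg (vp n mn)) (l2ipC g); exact: hn.
Qed.

Lemma regularD A (Pr : A -> Prop) (ds : A -> A -> R) M M' B B' (E E' : A -> P) :
 regular Pr ds M B E -> regular Pr ds M' B' E' ->
 regular Pr ds (maxn M M') (B + B') (fun p => E p + E' p).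
move=> h h' p hp; have [a1 a2 a3 a4] := h p hp; have [b1 b2 b3 b4] := h' p hp; split.
- by apply: inVD; [exact: inV_le (leq_maxl _ _) a1|exact: inV_le (leq_maxr _ _) b1].
- exact: zmD.
- by apply: ND_le; exact: lerD.
- move=> p' hp'; rewrite opprD addrACA mulrDl.
 by apply: ND_le; apply: lerD; [exact: a4|exact: b4].
Qed.

Lemma avail_comb (I : Type) (s : seq I) A (Pr : A -> Prop) (ds : A -> A -> R) (L : R) (c : I -> A -> R)
  (eta : I -> P) : 0 <= L -> (forall p p', 0 <= ds p p') ->
 (forall i p, Pr p -> `|c i p| <= L) ->
 (forall i p p', Pr p -> Pr p' -> `|c i p - c i p'| <= L * ds p p') -> (forall i, zm (eta i)) ->
 exists C, 0 <= C /\ avail Pr ds C (fun p => \sum_(i <- s) c i p *: eta i).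
move=> L0 ds0 cL cl ze.
suff [C [M [B [C0 h]]]] : exists C M B, [/\ 0 <= C, 0 <= B,
  regular Pr ds M B (fun p => \sum_(i <- s) c i p *: eta i) &
  avail Pr ds C (fun p => \sum_(i <- s) c i p *: eta i)] by exists C.
elim: s => [|i s [C [M [B [C0 B0 hr ha]]]]].
 have [_ [C [C0 hC]]] := all_avail (zm0 R).
 have c0 p : Pr p -> `|0 : R| <= L by rewrite normr0.
 have c1 p p' : Pr p -> Pr p' -> `|0 - 0 : R| <= L * ds p p'.
  by rewrite subrr normr0 mulr_ge0.
 have [M [B [B0 rE]]] := regular_scale L0 (zm0 R) ds0 c0 c1.
 exists C, M, B; have e : (fun p : A => \sum_(i <- [::]) c i p *: eta i) = (fun=> 0 *: 0).
  by apply/funext => p; rewrite big_nil scale0r.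
 by rewrite e; split; [exact: C0|exact: B0|exact: rE|exact: (hC _ _ _ _ L)].
have [_ [C' [C0' hC']]] := all_avail (ze i).
have [M' [B' [B0' rE]]] := regular_scale L0 (ze i) ds0 (cL i) (cl i).
have aE := hC' _ _ _ _ L L0 ds0 (cL i) (cl i).
have e : (fun p : A => \sum_(j <- i :: s) c j p *: eta j) =
  (fun p => c i p *: eta i + \sum_(j <- s) c j p *: eta j).
 by apply/funext => p; rewrite big_cons.
exists (C * C'), (maxn M' M), (B' + B); rewrite e; split.
- nneg.
- nneg.
- exact: regularD.
- exact: avail_add rE aE ha.
Qed.

Lemma coord_bounds (eps K e s kk : R) : 0 <= K -> 0 < kk ->
 eps = (4 * kk)^-1 -> e = (4 * kk * (K + 1))^-1 -> 0 <= s -> (eps * s + e * s * K) * kk <= s / 2.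
move=> K0 kk0 -> -> s0; have K1 : 0 < K + 1 by rewrite ltr_wpDl.
have -> : ((4 * kk)^-1 * s + (4 * kk * (K + 1))^-1 * s * K) * kk = s / 4 * (1 + K / (K + 1)).
 by field; rewrite !gt_eqF.
have : K / (K + 1) <= 1 by rewrite ler_pdivrMr// mul1r lerDl.
by nra.
Qed.

Lemma coord_small (eps K e kk : R) : 0 <= K -> 1 <= kk ->
 eps = (4 * kk)^-1 -> e = (4 * kk * (K + 1))^-1 -> kk * eps = 4^-1 /\ e * K <= 4^-1.
move=> K0 k1 -> ->; have kk0 : 0 < kk := lt_le_trans ltr01 k1.
have K1 : 0 < K + 1 by rewrite ltr_wpDl.
split; first by field; rewrite gt_eqF.
have -> : (4 * kk * (K + 1))^-1 * K = 4^-1 * (kk^-1 * (K / (K + 1))) by field; rewrite !gt_eqF.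
rewrite ger_pMr // mulr_ile1 ?invr_ge0 ?(ltW kk0)//.
- nneg.
- by rewrite invf_le1.
- by rewrite ler_pdivrMr// mul1r lerDl.
Qed.

Let f k := pev (d k).

(** With [h p] the endpoint obtained when aiming at the coordinates [p], and [dv p] the defect of
    its coordinates, a fixed point of [c + dv p] has an endpoint with coordinates [c]. The map
    contracts because the defect is Lipschitz with a small constant. *)
Lemma steer_coords k b phi T (c : 'I_k -> R) : orthonormal k b -> H2 phi -> 0 < T ->
 exists h, [/\ attainable nu T f phi h, H2 h & forall i : 'I_k, l2ip h (b i) = c i].
move=> [hb ob] hphi T0.
have Lb i (ik : (i < k)%N) : L2 (b i) := H2_L2 (hb i ik).
have [K [n0 [K0 hK]]] := fproj_bounded hb.
pose kk : R := k%:R + 1; have kk0 : 0 < kk by rewrite ltr_wpDl.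
(* [eps] is the error of replacing the [b i] by polynomials and [e] that of the steering; summed
   over the coordinates, each gives a Lipschitz constant of at most a quarter. *)
have [eps eE] : exists eps, eps = (4 * kk)^-1 by eexists.
have [e ee] : exists e, e = (4 * kk * (K + 1))^-1 by eexists.
have K1 : 0 < K + 1 by rewrite ltr_wpDl.
have eps0 : 0 < eps by rewrite eE invr_gt0 mulr_gt0.
have e0 : 0 < e by rewrite ee invr_gt0 mulr_gt0// mulr_gt0.
have [M hM] := fproj_approx eps0 hb.
pose eta (j : 'I_k) := fproj (b j) M.
have zeta j : zm (eta j) by have [z _ _] := H2_fproj (hb j (ltn_ord j)); exact: z.
(* The defect is at most [L / 2 + 1 / 2], so this [L] makes the box invariant. *)
pose L : R := 2 * \sum_i `|c i| + 2.
have c0 : 0 <= \sum_i `|c i| by rewrite sumr_ge0.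
have L1 : 1 <= L by rewrite /L; lra.
have L0 : 0 <= L := le_trans ler01 L1.
pose Pr (p : 'I_k -> R) := forall i, `|p i| <= L.
pose ds (p p' : 'I_k -> R) := \sum_i `|p i - p' i|.
have ds0 p p' : 0 <= ds p p' by rewrite sumr_ge0.
have co p p' i : `|p i - p' i| <= ds p p' by rewrite /ds (bigD1 i)// lerDl sumr_ge0.
have cl (i : 'I_k) p p' : Pr p -> Pr p' -> `|p i - p' i| <= L * ds p p'.
 by move=> _ _; apply: (le_trans (co p p' i)); rewrite ler_peMl.
pose E p := \sum_(i : 'I_k) p i *: eta i.
have [C [C0 aE]] := @avail_comb _ (index_enum 'I_k) _ Pr ds L (fun i p => p i) eta L0 ds0
 (fun i p hp => hp i) cl zeta.
have [h [Z [m hZ]]] := steer_attainable nu0 hd zd all_avail ds0 C0 aE hphi T0 e0.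
(* The departure of the truncated targets [eta] from orthonormality with [b]. *)
pose D (i j : 'I_k) := l2ip (b i) (b j - pev (eta j)).
have Db (i : 'I_k) : l2norm (b i) = 1.
 by rewrite /Defs.l2norm ob // eqxx sqrtr1.
have hD i j : `|D i j| <= eps.
 apply: (le_trans (l2ip_le (Lb i (ltn_ord i)) (L2B (Lb j (ltn_ord j)) (L2_pev _)))).
 by rewrite Db mul1r; exact: hM.
have zE p : zm (E p).
 rewrite /E; elim/big_rec : _ => [|j u _ zu]; first exact: zm0.
 by apply: zmD => //; exact: zmZ.
have zb (i : 'I_k) n : zm (fproj (b i) n) by have [z] := H2_fproj (hb i (ltn_ord i)).
have ipE n (i : 'I_k) p : (M <= n)%N -> ip (E p) (fproj (b i) n) = p i - \sum_j p j * D i j.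
 move=> Mn; rewrite ip_suml (eq_bigr (fun j : 'I_k => p j * (i == j)%:R - p j * D i j)).
  rewrite sumrB (bigD1 i)//= eqxx mulr1 big1 ?addr0// => j ji.
  by rewrite eq_sym (negbTE ji) mulr0.
 move=> j _; rewrite ipZl ipC -(l2ip_fproj (Lb i (ltn_ord i)) (inV_le Mn (inV_fproj (b j) M))) -mulrBr.
 rewrite /D l2ipBr ?ob ?subKr//; [exact: Lb|exact: L2_pev|exact: Lb].
pose dv p (i : 'I_k) := p i - l2ip (h p) (b i).
(* The defect is read on a large truncation, where the steering estimates hold, up to an arbitrary
   [t]. *)
have near p (i : 'I_k) t : Pr p -> 0 < t -> exists n2, forall n, (n2 <= n)%N ->
  `|dv p i - (\sum_j p j * D i j - ip (Z n p - E p) (fproj (b i) n))| <= t.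
 move=> hp t0; have [_ hl hn] := hZ p hp.
 have [n2 h2] := l2ip_lim_fproj hl (Lb i (ltn_ord i)) (fun n mn => let: And3 v _ _ := hn n mn in v) t0.
 exists (maxn M n2) => n; rewrite geq_max => /andP[Mn n2n]; have := h2 n n2n.
 rewrite Db mulr1 ipBl ipE// => q; rewrite distrC /dv.
 by rewrite (_ : _ - _ = l2ip (h p) (b i) - ip (Z n p) (fproj (b i) n))//; ring.
have k1 : 1 <= kk by rewrite lerDr.
have [ke eK] := coord_small K0 k1 eE ee.
have sumD (x : 'I_k -> R) i : `|\sum_j x j * D i j| <= eps * \sum_j `|x j|.
 apply: (le_trans (ler_norm_sum _ _ _)); rewrite mulr_sumr; apply: ler_sum => j _.
 by rewrite normrM mulrC; apply: ler_wpM2r => //.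
have dvL p i : Pr p -> `|dv p i| <= L / 2 + 1 / 2.
 move=> hp; have t0 : 0 < 4^-1 :> R by [].
 have [n2 h2] := near p i _ hp t0; pose n := maxn n2 (maxn n0 m).
 have [m1 m2 m3] : [/\ (n2 <= n)%N, (n0 <= n)%N & (m <= n)%N] by rewrite !leq_max !leqnn !orbT.
 have q1 := h2 n m1; have [_ hl hn] := hZ p hp; have [_ q2 _] := hn n m3.
 have zZ : zm (Z n p - E p) by have [z _ _] := hl; apply: zmB => //.
 have q3 : `|ip (Z n p - E p) (fproj (b i) n)| <= e * K.
  apply: (le_trans (ip_zm_le zZ (zb i n))).
  by apply: ler_pM; [nneg|nneg|exact: q2|exact: hK].
 have q4 : `|\sum_j p j * D i j| <= 4^-1 * L.
  apply: (le_trans (sumD p i)); rewrite -ke (mulrC kk) -mulrA; apply: ler_wpM2l; first nneg.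
  apply: (@le_trans _ _ (k%:R * L)); last by apply: ler_wpM2r => //; rewrite lerDl.
  by rewrite -[X in _ <= X%:R * _]card_ord mulr_natl -sumr_const; apply: ler_sum => j.
 exact: (norm3_le q1 q4 (le_trans q3 eK)).
have dvl p p' i : Pr p -> Pr p' -> `|dv p i - dv p' i| <= eps * ds p p' + e * ds p p' * K.
 move=> hp hp'; apply/ler_addgt0Pr => t t0; have t2 : 0 < t / 2 by rewrite divr_gt0.
 have [n2 h2] := near p i _ hp t2; have [n3 h3] := near p' i _ hp' t2.
 pose n := maxn (maxn n2 n3) (maxn n0 m).
 have [m1 m2 m3 m4] : [/\ (n2 <= n)%N, (n3 <= n)%N, (n0 <= n)%N & (m <= n)%N].
  by rewrite !leq_max !leqnn !orbT.
 have [_ hl hn] := hZ p hp; have [_ _ q2] := hn n m4; have q5 := q2 p' hp'.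
 have [_ hl' _] := hZ p' hp'.
 have zZ : zm (Z n p - Z n p' - (E p - E p')).
  have [z _ _] := hl; have [z' _ _] := hl'.
  by apply: zmB; apply: zmB.
 have q3 : `|ip (Z n p - Z n p' - (E p - E p')) (fproj (b i) n)| <= e * ds p p' * K.
  apply: (le_trans (ip_invl_le zZ (zb i n))).
  by apply: ler_pM; [nneg|nneg|exact: q5|exact: hK].
 have q4 := sumD (fun j => p j - p' j) i.
 have q6 := h2 n m1; have q7 := h3 n m2.
 apply: (norm_diff_le q6 q7 q4 q3).
 have -> : \sum_j (p j - p' j) * D i j = \sum_j p j * D i j - \sum_j p' j * D i j.
  by rewrite -sumrB; apply: eq_bigr => j; rewrite mulrBl.
 by rewrite !ipBl; ring.
have [||p [hp fp]] := @fixed_point R k L (fun p i => c i + dv p i) L0.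
- move=> p hp i; apply: (le_trans (ler_normD _ _)).
 have : `|c i| <= \sum_i `|c i| by rewrite (bigD1 i)// lerDl sumr_ge0.
 have := dvL p i hp; rewrite /L; move: `|c i| `|dv p i| (\sum_i _) => x y z; lra.
- move=> p p' hp hp'; rewrite -/(ds p p').
 apply: (@le_trans _ _ ((eps * ds p p' + e * ds p p' * K) * kk)); last first.
  exact: (coord_bounds K0 kk0 eE ee (ds0 p p')).
 have b0 : 0 <= eps * ds p p' + e * ds p p' * K.
  nneg.
 apply: (@le_trans _ _ ((eps * ds p p' + e * ds p p' * K) * k%:R)); last first.
  by apply: ler_wpM2l => //; rewrite lerDl.
 rewrite -[X in X%:R]card_ord mulr_natr -sumr_const; apply: ler_sum => i _.
 by rewrite [X in `|X|](_ : _ = dv p i - dv p' i); [exact: dvl|ring].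
exists (h p); have [ha hl _] := hZ p hp; split; [exact: ha|exact: H2lim_H2 hl|].
by move=> i; have := fp i; rewrite /dv; lra.
Qed.

(** The endpoint with the same coordinates as [g] differs from it by a function orthogonal to the
    orthonormal family, hence to the generators of [L]. *)
Lemma all_avail_projection T (L : set (S2 R -> R)) : 0 < T -> finite_dim_subspace L ->
 controllable_in_projection nu T f L.
move=> T0 [[n [e LE]] LH] phi hphi; apply/seteqP; split; first by move=> g [h _ []].
have Le i : L (e i).
 rewrite LE; exists 1%N, (fun=> 1), (fun=> e i); split => //.
 by rewrite big_ord1 scale1r.
have [f0 /(@In_map_seq _ _ e)[i <-]|k [b [ob hb]]] := @gram_schmidt_fun R [seq e i | i <- enum 'I_n].
 exact: LH.
move=> g Lg; have [h [ha hH hc]] := steer_coords (fun i => l2ip g (b i)) ob hphi T0.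
exists h => //; split => //.
have Lh := H2_L2 hH; have Lg2 : L2 g by apply: H2_L2; exact: LH.
have Lhg := L2B Lh Lg2; have Lb i (ik : (i < k)%N) : L2 (b i) := H2_L2 (ob.1 i ik).
have Ee i : l2ip (e i) (h - g) = 0.
 have Lei : L2 (e i) by apply: H2_L2; exact: LH.
 have Lc : L2 (comb k (fun j => l2ip (e i) (b j)) b).
  by apply: H2_L2; apply: H2_comb; exact: ob.1.
 rewrite (ae_l2ip Lei Lc Lhg); last by apply: hb; apply: map_seq_In; exact: mem_enum.
 rewrite (l2ip_comb _ Lhg Lb) big1// => j _.
 by rewrite (l2ipC (b j)) l2ipBl ?hc ?subrr ?mulr0//; exact: Lb.
move=> e'; rewrite LE => -[m [a [u [hu ->]]]]; rewrite l2ipC.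
have Lu j : L2 (a j *: u j) by apply: L2Z; have [i _ <-] := hu j; apply: H2_L2; exact: LH.
rewrite (l2ip_suml _ Lu Lhg) big1// => j _; have [i _ <-] := hu j.
by rewrite l2ipZl ?Ee ?mulr0//; apply: H2_L2; exact: LH.
Qed.

End exact_control.

(** * The theorem *)

Section main.
Context (R : realType).
Notation P := (pol R).

Lemma harmonic_pol s (f : S2 R -> R) : spherical_harmonic s f -> exists p : P, f = pev p /\ harm s p.
move=> /(m_harm P)[p [fE pe pl]]; exists p; split; last first.
 apply: harm_poly; first by rewrite -pe sum3.
 by rewrite -pl sum3.
by apply/funext => x; exact: fE.
Qed.

Lemma pev_sumZ n (a : 'I_n -> R) (p : 'I_n -> P) : pev (\sum_i a i *: p i) = \sum_i a i *: pev (p i).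
elim/big_rec2 : _ => [|i u v _ <-]; first by apply/funext => x; exact: pev0.
by rewrite pevZf; apply/funext => x; exact: pevD.
Qed.

Lemma codom3 (T : Type) (l : 'I_3 -> T) : codom l = [:: l e0; l e1; l e2].
rewrite /codom /image_mem !enum_ordSl enum_ord0 /=.
by congr [:: l _; l _; l _]; exact: val_inj.
Qed.

Lemma directions_pev (lp : 'I_3 -> P) (qp cp : P) k :
 directions (fun i => pev (lp i)) (pev qp) (pev cp) k = pev (nth 0 (codom lp ++ [:: qp; cp]) k).
by rewrite /directions !codom3; case: k => -[|[|[|[|[|//]]]]] /=. Qed.

End main.

Theorem theorem11p4 (R : realType) (nu : R) (hnu : 0 <= nu)
  (l : 'I_3 -> S2 R -> R) (q c : S2 R -> R)
  (hl : forall i, spherical_harmonic 1 (l i))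
  (hl_free : forall a : 'I_3 -> R,
   \sum_i a i *: l i = 0 -> forall i, a i = 0)
  (hq : spherical_harmonic 2 q) (hq0 : q <> 0)
  (hc : spherical_harmonic 3 c) (hc0 : c <> 0) :
 saturating (directions l q c) /\
 forall T : R, 0 < T ->
  (forall L : set (S2 R -> R), finite_dim_subspace L ->
   controllable_in_projection nu T (directions l q c) L) /\
  approximately_controllable nu T (directions l q c).
have [lp /all_and2[lE lh]] := choice (fun i => harmonic_pol (hl i)).
have [qp [qE qh]] := harmonic_pol hq; have [cp [cE ch]] := harmonic_pol hc.
have pev00 : pev (0 : pol R) = 0 by apply/funext => x; exact: pev0.
have q0 : ip qp qp <> 0 by move=> /nullP; rewrite /null -qE pev00.
have c0 : ip cp cp <> 0 by move=> /nullP; rewrite /null -cE pev00.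
have free (a : 'I_3 -> R) : null (\sum_i a i *: lp i) -> forall i, a i = 0.
 rewrite /null pev_sumZ pev00 => h; apply: hl_free; rewrite -[RHS]h.
 by apply: eq_bigr => i _; rewrite lE.
pose d (k : 'I_5) := nth 0 (codom lp ++ [:: qp; cp]) k.
have -> : directions l q c = fun k => pev (d k).
 apply/funext => k; rewrite -directions_pev qE cE; congr (directions _ _ _ k).
 by apply/funext => i; exact: lE.
have dP (Q : pol R -> Prop) : (forall i, Q (lp i)) -> Q qp -> Q cp -> forall k, Q (d k).
 by move=> ? ? ?; rewrite /d codom3; case=> -[|[|[|[|[|//]]]]] /=.
have dQ (Q : pol R -> Prop) : (forall k, Q (d k)) -> [/\ forall i, Q (lp i), Q qp & Q cp].
 rewrite /d codom3 => h; split; last 2 first.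
 - exact: (h (@Ordinal 5 3 isT)).
 - exact: (h (@Ordinal 5 4 isT)).
 by apply: ord3; [exact: (h (@Ordinal 5 0 isT))|exact: (h (@Ordinal 5 1 isT))|exact: (h (@Ordinal 5 2 isT))].
have zd k : zm (d k).
 by apply: dP => [i||]; [exact: harm_zm (lh i) _|exact: harm_zm qh _|exact: harm_zm ch _].
have sd k : null (euler (d k)).
 by apply: (dP (fun p => null (euler p))) => [i||]; [exact: harm_steady (lh i) _|exact: harm_steady qh _|exact: harm_steady ch _].
(* Saturation and availability are two instances of this generation principle. *)
have gen (U : pol R -> Prop) : (forall a p p', U p -> U p' -> U (a *: p + p')) ->
  (forall p p', pev p = pev p' -> U p -> U p') ->
  (forall f g, null (euler f) -> U f -> U g -> U (Bpol f g)) ->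
  (forall k, U (d k)) -> forall p, zm p -> U p.
 move=> Ul Ue Ub /dQ[Ulp Uq Uc] p zp.
 exact: (generated_all Ul Ue Ub (span_linear lh free Ul Ue Ulp) Uq Uc qh ch q0 c0 zp).
split.
 apply: (all_saturated_saturating zd sd); apply: gen.
 - by move=> *; exact: saturated_lin.
 - by move=> *; apply: saturated_ext; eassumption.
 - by move=> *; exact: saturated_bracket.
 - exact: saturated_dir.
have [n hn] := choice (fun k => inV_exists (d k)).
have hd k : inV (\max_k n k) (d k) by apply: inV_le (hn k); exact: leq_bigmax.
have av : forall p, zm p -> available nu d p.
 apply: gen.
 - by move=> a p p' ap ap'; apply: availableD; [exact: availableZ|].
 - by move=> p p'; exact: available_ext.
 - by move=> f g; exact: (available_bracket hnu hd zd).
 - exact: (available_dir hnu hd zd).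
move=> T T0; split; last exact: (all_avail_approximately hnu hd zd av T0).
by move=> L hL; exact: (all_avail_projection hnu hd zd av T0 hL).
Qed.
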